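(* Let $(A(n))_{n\ge1}$ be an i.i.d. sequence of random topical operators on $\mathbb R^d$ with the memory loss property, and let $\phi:\mathbb R^d\to\mathbb R$ be topical. Assume one of the following: (i) $\sup_{x}|\phi(A(1)x)-\phi(x)|$ has a finite $l$-th moment for some $l\ge3$; (ii) $\|A(1)0\|_\infty$ has a finite $l$-th moment for some $l>6$. Let $\sigma^2\ge0$ be the constant such that for every initial condition $X^0$ (independent of the sequence and with finite $l$-th moment), $\frac{x(n,X^0)-n\gamma\mathbf 1}{\sqrt n}$ converges weakly to a random vector with all coordinates equal and of law $\mathcal N(0,\sigma^2)$. If $\sigma^2>0$, then there exists $C\ge0$ such that for every $\mathbb R^d$-valued random variable $X^0$ independent of $(A(n))$ with $\mathbb E\|X^0\|_\infty^l<\infty$ and every $n\ge1$: $$\sup_{u\in\mathbb R}\Big|\mathbb P\big[\phi(x(n,X^0))-n\gamma-\phi(X^0)\le\sigma u\sqrt n\big]-\mathcal N(0,1)(]-\infty,u])\Big|\le\frac{C(1+\mathbb E[\|X^0\|_\infty^l])}{\sqrt n},$$ $$\sup_{u\in\mathbb R^d}\Big|\mathbb P\big[x(n,X^0)-n\gamma\mathbf 1\le\sigma u\sqrt n\big]-\mathcal N(0,1)(]-\infty,\min_iu_i])\Big|\le\frac{C(1+\mathbb E[\|X^0\|_\infty^l]+\mathbb E[\|A(1)0\|_\infty^l])}{n^{\frac{l}{2(l+1)}}},$$ where the inequality between vectors is coordinatewise.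
   Context: A map $A:\mathbb R^d\to\mathbb R^d$ is topical if it is isotone ($x\le y$ coordinatewise implies $Ax\le Ay$) and additively homogeneous ($A(x+a\mathbf 1)=Ax+a\mathbf 1$ for all $a\in\mathbb R$, $\mathbf 1=(1,\dots,1)'$). A map $\phi:\mathbb R^d\to\mathbb R$ is topical if it is isotone and $\phi(x+a\mathbf 1)=\phi(x)+a$. $\mathbb{PR}^d_{\max}$ is the quotient of $\mathbb R^d$ by $x\sim y\iff x-y\in\mathbb R\mathbf 1$, $\bar x$ the class of $x$. A topical operator $A$ has rank 1 if $\overline{Ax}$ does not depend on $x$. A sequence $(A(n))$ of random topical operators has the memory loss property if there is $N$ such that $A(N)\cdots A(1)$ has rank 1 with positive probability. Define $x(0,X^0)=X^0$, $x(n,X^0)=A(n)x(n-1,X^0)$. $A(1)0$ is the image of the vector $0$. $\gamma$ is the Lyapunov exponent: the constant with $x(n,X^0)/n\to\gamma\mathbf 1$ almost surely. *)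

(* Defs.v *)
From HB Require Import structures.
From mathcomp Require Import all_boot all_order all_algebra.
From mathcomp Require Import all_classical all_reals all_analysis.
From mathcomp Require Import measurable_realfun.
Set Implicit Arguments. Unset Strict Implicit. Unset Printing Implicit Defensive.
Import Order.TTheory GRing.Theory Num.Theory.
Import numFieldNormedType.Exports.
Local Open Scope classical_set_scope.
Local Open Scope ring_scope.

Section Defs.
Context {R : realType} {d : nat}.
Local Notation vec := 'rV[R]_d.
Local Notation op := (vec -> vec).

Definition vle (x y : vec) : Prop := forall i, x ord0 i <= y ord0 i.

Definition cst (a : R) : vec := const_mx a.

Definition supnorm (v : vec) : R := \big[Num.max/0]_i `|v ord0 i|.

Definition topical_op (A : op) : Prop :=
  (forall x y, vle x y -> vle (A x) (A y)) /\
  (forall x a, A (x + cst a) = A x + cst a).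

Definition topical_fun (phi : vec -> R) : Prop :=
  (forall x y, vle x y -> phi x <= phi y) /\
  (forall x a, phi (x + cst a) = phi x + a).

(** rank 1: the class of A x in PR^d_max does not depend on x *)
Definition rank_one (A : op) : Prop :=
  forall x y, exists a : R, A x = A y + cst a.

(** product A(n-1) ... A(0) applied to x (indices shifted: paper's A(k) is A (k-1)) *)
Fixpoint prodop {T : Type} (A : nat -> T -> op) (n : nat) (w : T) (x : vec) : vec :=
  match n with
  | 0 => x
  | m.+1 => A m w (prodop A m w x)
  end.

Definition op_gen : set (set op) :=
  [set E | exists (x : vec) (i : 'I_d) (B : set R),
      measurable B /\ E = [set f : op | B (f x ord0 i)]].
Definition op_meas (E : set op) : Prop := <<s op_gen >> E.

Definition vec_gen : set (set vec) :=
  [set E | exists (i : 'I_d) (B : set R),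
      measurable B /\ E = [set v : vec | B (v ord0 i)]].
Definition vec_meas (E : set vec) : Prop := <<s vec_gen >> E.

Definition vmin (u : vec) : R := fine (\big[Order.min/+oo%E]_i ((u ord0 i)%:E)).

Section Prob.
Context {dT : measure_display} {T : measurableType dT} (P : probability T R).

Definition moment (f : T -> R) (l : R) : \bar R := (\int[P]_w ((f w) `^ l)%:E)%E.

(** i.i.d. sequence of random operators (paper's A(k+1) is A k here);
    measurability of each coordinate of each A n x, identical distribution of the
    laws on the cylinder sigma-algebra, and mutual independence. *)
Definition iid_ops (A : nat -> T -> op) : Prop :=
  (forall n x i, measurable_fun setT (fun w => A n w x ord0 i)) /\
  (forall n F, op_meas F -> P (A n @^-1` F) = P (A 0 @^-1` F)) /\
  (forall (s : seq nat) (F : nat -> set op), uniq s -> (forall k, op_meas (F k)) ->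
     P (\bigcap_(k in [set` s]) (A k @^-1` F k)) = (\prod_(k <- s) P (A k @^-1` F k))%E).

Definition memory_loss (A : nat -> T -> op) : Prop :=
  exists N : nat, (0 < P [set w | rank_one (prodop A N w)])%E.

Definition indep_init (A : nat -> T -> op) (X0 : T -> vec) : Prop :=
  forall (E : set vec) (s : seq nat) (F : nat -> set op),
    vec_meas E -> (forall k, op_meas (F k)) ->
    P (X0 @^-1` E `&` \bigcap_(k in [set` s]) (A k @^-1` F k)) =
    (P (X0 @^-1` E) * P (\bigcap_(k in [set` s]) (A k @^-1` F k)))%E.

Definition good_init (A : nat -> T -> op) (l : R) (X0 : T -> vec) : Prop :=
  (forall i, measurable_fun setT (fun w => X0 w ord0 i)) /\
  indep_init A X0 /\ (moment (fun w => supnorm (X0 w)) l < +oo)%E.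

Definition lyapunov (A : nat -> T -> op) (gamma : R) : Prop :=
  {ae P, forall w, forall i : 'I_d,
     (fun n : nat => (prodop A n w 0) ord0 i / n%:R) @ \oo --> gamma}.

Definition clt (A : nat -> T -> op) (gamma l sigma : R) : Prop :=
  forall X0 : T -> vec, good_init A l X0 ->
  forall f : vec -> R, continuous f -> (exists M : R, forall v, `|f v| <= M) ->
    (fun n : nat => (\int[P]_w
        (f ((Num.sqrt n%:R)^-1 *: (prodop A n w (X0 w) - cst (n%:R * gamma))))%:E)%E)
      @ \oo --> (\int[normal_prob 0 sigma]_z (f (cst z))%:E)%E.

Definition supdiff (phi : vec -> R) (A : nat -> T -> op) (w : T) : \bar R :=
  ereal_sup (range (fun x : vec => (`|phi (A 0 w x) - phi x|)%:E)).

Definition supdiff_moment_finite (phi : vec -> R) (A : nat -> T -> op) (l : R) : Prop :=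
  measurable_fun [set: T] (supdiff phi A : T -> \bar R) /\
  (\int[P]_w ((supdiff phi A w) `^ l) < +oo)%E.
End Prob.
End Defs.

(* Main.v *)
(* Some product of N operators has rank one with positive probability, and such a
   block forgets its argument modulo constants. Since phi commutes with the addition
   of constants, phi (x_n) is an additive functional of the chain of blocks, up to
   the drift; solving two Poisson equations for functions on the classes replaces
   phi by phi* whose increments have mean exactly g and whose squared increments have
   conditional mean s^2 up to a coboundary. The rate comes from Lindeberg's replacement
   of the increments by Gaussian ones, run as an induction on the number of blocks
   in the manner of Bergstrom: the error of each replacement is a smooth functional
   of the past, which is reset at the last rank one block, so that the bound already
   known for shorter products controls it, and the sum of these errors against the
   derivatives of the normal law is of order 1 / sqrt n. The central limit theorem
   assumed for the process is only used to identify g and s with gamma and sigma.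
   For the second estimate, the orthant {x | x <= c + r} is the sublevel set of a
   topical function at bounded distance from phi modulo the oscillation of x. *)
Require Import Defs.
From HB Require Import structures.
From mathcomp Require Import all_boot all_order all_algebra.
From mathcomp Require Import all_classical all_reals all_analysis.
From mathcomp Require Import measurable_realfun.
From mathcomp Require Import ring lra zify.
Set Implicit Arguments. Unset Strict Implicit. Unset Printing Implicit Defensive.
Import Order.TTheory GRing.Theory Num.Theory.
Import numFieldNormedType.Exports.
Local Open Scope classical_set_scope.
Local Open Scope ring_scope.

(** Two features shape the induction. At a regeneration in a block [w] the future sees the past
    through [phi (B w x)] instead of [phi x], so the bound has to be proved at once for all
    equivariant observables within [M] times a weight of [phi]. It has to be linear in [M], which
    then becomes a random factor integrated over the block. Moreover, the absence of regeneration
    during [j] blocks is only of order [rho ^+ j], so the rate known for shorter products must vary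
    slowly: it is [1 / sqrt (k + i + 1)] with [i] large in terms of [rho]. The induction closes
    because the smoothing starts at a bandwidth of order [sqrt b]: the errors inherited from shorter
    products add up to a multiple of [1 / (sqrt b * sqrt n)], a small part of the rate for large
    [b], while removing the smoothing costs [sqrt (b / n)], which only enlarges the final constant.
    The two moment assumptions differ in how the increments of [phi] are dominated: independently of
    the state in one case, by its oscillation in the other. Both estimates are obtained at the rate
    [1 / sqrt n]. *)

Notation intg P f := (integrable P [set: _] (fun x => (f x)%:E)).

(** * Expectations of real functions, Fubini and dependence on parameters *)

Section RealExpectation.
Context {R : realType} {dT : measure_display} {T : measurableType dT}.
Variable P : probability T R.
Implicit Types f g : T -> R.

Lemma intg_measurable f : intg P f -> measurable_fun [set: T] f.
Proof. by move=> /measurable_int /measurable_EFinP. Qed.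

Lemma intg_le f g : measurable_fun [set: T] f -> intg P g ->
  (forall x, `|f x| <= g x) -> intg P f.
Proof.
move=> mf ig fg; apply: (le_integrable measurableT _ _ ig).
  exact/measurable_EFinP.
by move=> x _; rewrite lee_fin (le_trans (fg x))// ler_norm.
Qed.

Lemma intg_cst (c : R) : intg P (fun=> c).
Proof. exact: finite_measure_integrable_cst. Qed.

Lemma intg_bnd f (c : R) : measurable_fun [set: T] f ->
  (forall x, `|f x| <= c) -> intg P f.
Proof. by move=> mf; apply: intg_le => //; exact: intg_cst. Qed.

Lemma intgD f g : intg P f -> intg P g -> intg P (fun x => f x + g x).
Proof.
by move=> hf hg; under eq_fun do rewrite EFinD; exact: integrableD.
Qed.

Lemma intgB f g : intg P f -> intg P g -> intg P (fun x => f x - g x).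
Proof.
by move=> hf hg; under eq_fun do rewrite EFinB; exact: integrableB.
Qed.

Lemma intgZ (c : R) f : intg P f -> intg P (fun x => c * f x).
Proof.
by move=> hf; under eq_fun do rewrite EFinM; exact: integrableZl.
Qed.

Lemma intg_abs f : intg P f -> intg P (fun x => `|f x|).
Proof. exact: integrable_norm. Qed.

Lemma intgMb f g (c : R) : measurable_fun [set: T] f ->
  (forall x, `|f x| <= c) -> intg P g -> intg P (fun x => f x * g x).
Proof.
move=> mf fc ig; apply: (@intg_le _ (fun x => c * `|g x|)).
- by apply: measurable_funM => //; exact: intg_measurable.
- exact/intgZ/intg_abs.
- by move=> x; rewrite normrM ler_wpM2r.
Qed.

Lemma ExD f g : intg P f -> intg P g ->
  \int[P]_x (f x + g x) = \int[P]_x f x + \int[P]_x g x.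
Proof. by move=> hf hg; rewrite RintegralD. Qed.

Lemma ExB f g : intg P f -> intg P g ->
  \int[P]_x (f x - g x) = \int[P]_x f x - \int[P]_x g x.
Proof. by move=> hf hg; rewrite RintegralB. Qed.

Lemma ExZ (c : R) f : intg P f -> \int[P]_x (c * f x) = c * \int[P]_x f x.
Proof. by move=> hf; rewrite RintegralZl. Qed.

Lemma Ex_cst (c : R) : \int[P]_x c = c.
Proof. by rewrite Rintegral_cst//= [P _]probability_setT mulr1. Qed.

Lemma Ex_ge0 f : (forall x, 0 <= f x) -> 0 <= \int[P]_x f x.
Proof. by move=> f0; apply: Rintegral_ge0. Qed.

Lemma Ex_le f g : intg P f -> intg P g -> (forall x, f x <= g x) ->
  \int[P]_x f x <= \int[P]_x g x.
Proof. by move=> hf hg fg; apply: le_Rintegral. Qed.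

Lemma Ex_norm_le f g : measurable_fun [set: T] f -> intg P g ->
  (forall x, `|f x| <= g x) -> `|\int[P]_x f x| <= \int[P]_x g x.
Proof.
move=> mf ig fg; have hf := intg_le mf ig fg.
apply: (le_trans (le_normr_Rintegral measurableT hf)).
by apply: Ex_le => //; exact: intg_abs.
Qed.

Lemma Ex_bnd f (c : R) : measurable_fun [set: T] f ->
  (forall x, `|f x| <= c) -> `|\int[P]_x f x| <= c.
Proof.
move=> mf fc; rewrite -[leRHS]Ex_cst; apply: Ex_norm_le => //; exact: intg_cst.
Qed.

Lemma Ex_EFin f : intg P f -> (\int[P]_x (f x)%:E)%E = (\int[P]_x f x)%:E.
Proof. by move=> hf; rewrite /Rintegral fineK//; exact: integrable_fin_num. Qed.

Lemma Ex_indic A : measurable A -> \int[P]_x (\1_A x) = fine (P A).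
Proof. by move=> mA; rewrite /Rintegral integral_indic// setIT. Qed.

Lemma Ex_finP (A : set T) : measurable A -> P A = (fine (P A))%:E.
Proof. by move=> mA; rewrite fineK//; exact: fin_num_measure. Qed.

Lemma intg_ge0_lty f : measurable_fun [set: T] f -> (forall x, 0 <= f x) ->
  (\int[P]_x (f x)%:E < +oo)%E -> intg P f.
Proof.
move=> mf f0 fo; apply/integrableP; split; first exact/measurable_EFinP.
by under eq_integral do rewrite /= ger0_norm//.
Qed.

End RealExpectation.

Section Fubini.
Context {R : realType} {d1 d2 : measure_display} {T1 : measurableType d1}
  {T2 : measurableType d2}.
Variables (P1 : probability T1 R) (P2 : probability T2 R).

(** Domination by a product of integrable functions reduces integrability on the product space to
    Tonelli; in later uses one of the two factors is a constant. *)
Lemma Ex_fubini (F : T1 * T2 -> R) (a : T1 -> R) (b : T2 -> R) :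
  measurable_fun [set: T1 * T2] F -> intg P1 a -> intg P2 b ->
  (forall x y, `|F (x, y)| <= a x * b y) ->
  \int[P1]_x \int[P2]_y F (x, y) = \int[P2]_y \int[P1]_x F (x, y).
Proof.
move=> mF ia ib Fab.
have iF : (P1 \x P2)%E.-integrable [set: _] (EFin \o F).
  apply/integrable12ltyP; first exact/measurable_EFinP.
  apply: (@le_lt_trans _ _ (\int[P1]_x (\int[P2]_y (`|a x| * `|b y|)%:E)))%E.
    apply: ge0_le_integral => //=.
    - by move=> x _; apply: integral_ge0.
    - apply: (@measurable_fun_fubini_tonelli_F _ _ _ _ _ P2 (fun z => `|F z|%:E)) => //.
      by apply/measurable_EFinP; exact: measurableT_comp.
    - apply: (@measurable_fun_fubini_tonelli_F _ _ _ _ _ P2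
        (fun z => (`|a z.1| * `|b z.2|)%:E)).
        apply/measurable_EFinP/measurable_funM.
          apply: measurableT_comp => //.
          by apply: measurableT_comp => //; exact: intg_measurable ia.
        apply: measurableT_comp => //.
        by apply: measurableT_comp => //; exact: intg_measurable ib.
      by move=> z; rewrite lee_fin mulr_ge0.
    - move=> x _; apply: ge0_le_integral => //=.
      + apply/measurable_EFinP; apply: measurableT_comp => //.
        exact: measurableT_comp mF (pair1_measurable _).
      + apply/measurable_EFinP; apply: measurable_funM => //.
        by apply: measurableT_comp => //; exact: intg_measurable ib.
      + by move=> y _; rewrite lee_fin -normrM (le_trans (Fab x y))// ler_norm.
  have mb : measurable_fun [set: T2] (fun y => `|b y|%:E).
    by apply/measurable_EFinP; apply: measurableT_comp => //; exact: intg_measurable ib.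
  have ma : measurable_fun [set: T1] (fun y => `|a y|%:E).
    by apply/measurable_EFinP; apply: measurableT_comp => //; exact: intg_measurable ia.
  have bfin : (\int[P2]_y `|b y|%:E)%E \is a fin_num.
    by apply: integrable_fin_num => //; exact: intg_abs.
  have afin : (\int[P1]_y `|a y|%:E)%E \is a fin_num.
    by apply: integrable_fin_num => //; exact: intg_abs.
  rewrite (eq_integral (fun x => `|a x|%:E * \int[P2]_y `|b y|%:E)%E); last first.
    move=> x _; rewrite -[RHS]ge0_integralZl//.
  rewrite -(fineK bfin) ge0_integralZr//; first by rewrite -(fineK afin) -EFinM ltry.
  by rewrite lee_fin fine_ge0//; apply: integral_ge0 => y _; rewrite lee_fin.
have Fx x : intg P2 (fun y => F (x, y)).
  apply: (@intg_le _ _ _ _ _ (fun y => a x * b y)) => //; last exact: intgZ.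
  exact: measurableT_comp mF (pair1_measurable _).
have Fy y : intg P1 (fun x => F (x, y)).
  apply: (@intg_le _ _ _ _ _ (fun x => b y * a x)) => //; last 2 first.
  - exact: intgZ.
  - by move=> x; rewrite mulrC.
  exact: measurableT_comp mF (pair2_measurable _).
have := Fubini iF; rewrite /=.
under eq_integral => x _ do rewrite (Ex_EFin (Fx x)).
under [in X in _ = X -> _]eq_integral => y _ do rewrite (Ex_EFin (Fy y)).
by rewrite /Rintegral => ->.
Qed.

End Fubini.

Section ParametricExpectation.
Context {R : realType} {d1 d2 : measure_display} {V : measurableType d1}
  {T : measurableType d2}.
Variable P : probability T R.

(** Tonelli gives measurability in the parameter for nonnegative integrands, hence the passage
    through positive and negative parts. *)
Lemma measurable_Ex (F : V * T -> R) : measurable_fun [set: V * T] F ->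
  (forall v, intg P (fun w => F (v, w))) ->
  measurable_fun [set: V] (fun v => \int[P]_w F (v, w)).
Proof.
move=> mF iF.
have mF' : measurable_fun [set: V * T] (fun z => (F z)%:E) by exact/measurable_EFinP.
have -> : (fun v => \int[P]_w F (v, w)) = (fun v =>
    fine (\int[P]_w ((fun z => (F z)%:E)^\+ (v, w))
        - \int[P]_w ((fun z => (F z)%:E)^\- (v, w)))%E).
  apply/funext => v; rewrite /Rintegral; congr fine; rewrite [LHS]integralE.
  by congr (_ - _)%E; apply: eq_integral => w _; rewrite ?funeposE ?funenegE.
apply: measurableT_comp => //; apply: emeasurable_funB.
  apply: (@measurable_fun_fubini_tonelli_F _ _ _ _ _ P ((fun z => (F z)%:E)^\+)%E) => //.
  exact: measurable_funepos.
apply: (@measurable_fun_fubini_tonelli_F _ _ _ _ _ P ((fun z => (F z)%:E)^\-)%E) => //.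
exact: measurable_funeneg.
Qed.

End ParametricExpectation.

(** * Integration against a normal density *)

Section NormalDensity.
Context {R : realType}.
Variables m s : R.
Local Notation mu := (@lebesgue_measure R).
Local Notation N := (normal_prob m s).

(** The Radon-Nikodym derivative and the normal density have the same integral over every measurable
    set, so they agree almost everywhere and the change of variables formula can be read with the
    density. *)
Lemma ge0_integral_normal (f : R -> \bar R) :
  (forall x, 0 <= f x)%E -> measurable_fun [set: R] f ->
  (\int[N]_x f x = \int[mu]_x (f x * (normal_pdf m s x)%:E))%E.
Proof.
move=> f0 mf; have dom := @normal_prob_dominates R m s.
rewrite -(Radon_Nikodym_SigmaFinite.change_of_variables dom f0 measurableT mf).
have mpdf : measurable_fun [set: R] (fun x => (normal_pdf m s x)%:E).
  by apply/measurable_EFinP; exact: measurable_normal_pdf.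
have iRN := Radon_Nikodym_SigmaFinite.f_integrable dom.
apply: ge0_ae_eq_integral => //.
- exact: emeasurable_funM mf (measurable_int mu iRN).
- exact: emeasurable_funM.
- by move=> x _; rewrite mule_ge0// Radon_Nikodym_SigmaFinite.f_ge0.
- by move=> x _; rewrite mule_ge0// lee_fin normal_pdf_ge0.
- apply: ae_eqe_mul2l; apply: integral_ae_eq => // E _ mE.
  by rewrite -Radon_Nikodym_SigmaFinite.f_integral.
Qed.

Lemma intg_normal (f : R -> R) : measurable_fun [set: R] f ->
  mu.-integrable [set: R] (fun x => (f x * normal_pdf m s x)%:E) -> intg N f.
Proof.
move=> mf /integrableP[_ h]; apply/integrableP; split; first exact/measurable_EFinP.
rewrite ge0_integral_normal//; last first.
  by apply: measurableT_comp => //; exact/measurable_EFinP.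
apply: le_lt_trans h; apply: ge0_le_integral => //.
- by move=> x _; rewrite mule_ge0// lee_fin normal_pdf_ge0.
- apply: emeasurable_funM; last by apply/measurable_EFinP; exact: measurable_normal_pdf.
  by apply: measurableT_comp => //; exact/measurable_EFinP.
- apply: measurableT_comp => //; apply/measurable_EFinP; apply: measurable_funM => //.
  exact: measurable_normal_pdf.
- by move=> x _; rewrite EFinM abseM [(`|(normal_pdf _ _ _)%:E|)%E]gee0_abs// lee_fin normal_pdf_ge0.
Qed.

Lemma intg_normalP (f : R -> R) : intg N f ->
  mu.-integrable [set: R] (fun x => (f x * normal_pdf m s x)%:E).
Proof.
move=> /integrableP[/measurable_EFinP mf h]; apply/integrableP; split.
  apply/measurable_EFinP; apply: measurable_funM => //; exact: measurable_normal_pdf.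
rewrite ge0_integral_normal// in h; last first.
  by apply: measurableT_comp => //; exact/measurable_EFinP.
apply: le_lt_trans h; apply: ge0_le_integral => //.
- apply: measurableT_comp => //; apply/measurable_EFinP; apply: measurable_funM => //.
  exact: measurable_normal_pdf.
- apply: emeasurable_funM; last by apply/measurable_EFinP; exact: measurable_normal_pdf.
  by apply: measurableT_comp => //; exact/measurable_EFinP.
- by move=> x _; rewrite EFinM abseM [(`|(normal_pdf _ _ _)%:E|)%E]gee0_abs// lee_fin normal_pdf_ge0.
Qed.

Lemma Ex_normal (f : R -> R) : intg N f ->
  \int[N]_x f x = \int[mu]_x (f x * normal_pdf m s x).
Proof.
move=> hf; have [mf _] := integrableP _ _ _ hf.
rewrite /Rintegral; congr fine; rewrite [LHS]integralE [RHS]integralE.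
have pE x : ((fun x => (f x * normal_pdf m s x)%:E)^\+ x =
    (fun x => (f x)%:E)^\+ x * (normal_pdf m s x)%:E)%E.
  by rewrite !funeposE -!EFin_max -EFinM maxr_pMl ?mul0r ?normal_pdf_ge0.
have nE x : ((fun x => (f x * normal_pdf m s x)%:E)^\- x =
    (fun x => (f x)%:E)^\- x * (normal_pdf m s x)%:E)%E.
  by rewrite !funenegE -!EFinN -!EFin_max -EFinM maxr_pMl ?mul0r ?normal_pdf_ge0// mulNr.
congr (_ - _)%E.
  rewrite ge0_integral_normal//; last exact: measurable_funepos.
  by apply: eq_integral => x _; rewrite pE.
rewrite ge0_integral_normal//; last exact: measurable_funeneg.
by apply: eq_integral => x _; rewrite nE.
Qed.

End NormalDensity.

(** * The normal distribution function and Gaussian mollification *)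

Section GaussianFunctions.
Context {R : realType}.
Local Notation mu := (@lebesgue_measure R).
Local Notation N := (normal_prob (0 : R) 1).
Implicit Types x y u : R.

Definition gpdf : R -> R := normal_pdf 0 1.

Lemma gpdfE x : gpdf x = normal_peak 1 * expR (- (x ^+ 2 / 2)).
Proof.
rewrite /gpdf normal_pdfE ?oner_eq0// /normal_fun subr0 expr1n mulNr.
by rewrite -mulr_natr mul1r.
Qed.

Lemma gpdf_gt0 x : 0 < gpdf x.
Proof. by rewrite gpdfE mulr_gt0 ?expR_gt0// normal_peak_gt0 ?oner_eq0. Qed.

Lemma gpdf_ge0 x : 0 <= gpdf x.
Proof. exact/ltW/gpdf_gt0. Qed.

Lemma normal_peak_le1 : normal_peak (1 : R) <= 1.
Proof.
rewrite /normal_peak expr1n mul1r invf_le1; last by rewrite sqrtr_gt0 mulrn_wgt0 ?pi_gt0.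
rewrite -[leLHS]sqrtr1 ler_wsqrtr// (le_trans _ (ler_wMn2r _ (pi_ge2 R)))//.
by rewrite mulr2n; lra.
Qed.

Lemma measurable_gpdf : measurable_fun [set: R] gpdf.
Proof. exact: measurable_normal_pdf. Qed.

Lemma is_derive_gpdf x : is_derive x 1 gpdf (- x * gpdf x).
Proof.
rewrite (_ : gpdf = fun y => normal_peak 1 * expR (- (y ^+ 2 / 2))); last first.
  by apply/funext => y; rewrite gpdfE.
have h : is_derive x 1 (fun y : R => - (y ^+ 2 / 2)) (- x).
  by apply: is_derive_eq; rewrite /GRing.scale/=; lra.
have h2 : is_derive x 1 (fun y : R => expR (- (y ^+ 2 / 2))) (- x * expR (- (x ^+ 2 / 2))).
  by rewrite mulrC; exact: (is_derive1_comp (is_derive_expR _) h).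
by apply: is_derive_eq; rewrite /GRing.scale/=; ring.
Qed.

Definition Phi x : R := fine (N `]-oo, x]).

Lemma Phi_EFin x : N `]-oo, x] = (Phi x)%:E.
Proof. by rewrite /Phi -Ex_finP. Qed.

Lemma Phi_ge0 x : 0 <= Phi x.
Proof. by rewrite fine_ge0. Qed.

Lemma Phi_le1 x : Phi x <= 1.
Proof. by rewrite -lee_fin -Phi_EFin probability_le1. Qed.

Lemma Phi_dist_le1 p x : 0 <= p <= 1 -> `|p - Phi x| <= 1.
Proof.
move=> /andP[p0 p1]; have := Phi_ge0 x; have := Phi_le1 x.
by rewrite ler_norml => ? ?; apply/andP; split; lra.
Qed.

Lemma Phi_mono : {homo Phi : x y / x <= y}.
Proof.
move=> x y xy; rewrite -lee_fin -!Phi_EFin le_measure ?inE//; exact: subitvPr.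
Qed.

Lemma is_derive_Phi x : is_derive x 1 Phi (gpdf x).
Proof.
have ix : mu.-integrable `]-oo, x + 1] (EFin \o normal_pdf 0 1).
  by apply: integrableS (integrable_normal_pdf _ _).
have xx : x < x + 1 by rewrite ltrDl.
have cx : {for x, continuous (normal_pdf (0 : R) 1)}.
  by apply: continuous_normal_pdf; exact: oner_neq0.
have /(_ _ cx)[|] := @continuous_FTC1 R (normal_pdf 0 1) -oo%O x (x + 1) xx ix.
  by rewrite ltNyr.
move=> d1 d2; apply: DeriveDef; first exact: d1.
by rewrite -derive1E; exact: d2.
Qed.

(* [hermG r] is the r-th derivative of the normal distribution function. *)
Definition hermG (r : nat) x : R :=
  match r with
  | 0 => Phi x
  | 1 => gpdf x
  | 2 => - x * gpdf x
  | 3 => (x ^+ 2 - 1) * gpdf x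
  | _ => (3 * x - x ^+ 3) * gpdf x
  end.

Lemma is_derive_hermG r x : (r < 4)%N -> is_derive x 1 (hermG r) (hermG r.+1 x).
Proof.
have hg := is_derive_gpdf x.
case: r => [|[|[|[|//]]]] _ /=.
- exact: is_derive_Phi.
- exact: hg.
- apply: is_derive_eq; rewrite /GRing.scale/=; ring.
- apply: is_derive_eq; rewrite /GRing.scale/=; ring.
Qed.

(** Cube of [(1 + x ^+ 2) / 6 <= expR (x ^+ 2 / 6)], whence [216]. Of the three powers, two absorb
    the cubic polynomial of the fourth derivative of [Phi] and the last leaves the integrable bound
    [1 / (1 + x ^+ 2)]. *)
Lemma gpdf_decay x : gpdf x <= 216 / (1 + x ^+ 2) ^+ 3.
Proof.
rewrite ler_pdivlMr; last by rewrite exprn_gt0// ltr_pwDl// sqr_ge0.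
rewrite gpdfE; have e3 : expR (- (x ^+ 2 / 2)) = (expR (x ^+ 2 / 6) ^+ 3)^-1.
  by rewrite -expRM_natl -expRN; congr expR; field.
have h : (1 + x ^+ 2) / 6 <= expR (x ^+ 2 / 6).
  by apply: le_trans (expR_ge1Dx _); have := sqr_ge0 x; lra.
have h3 : (1 + x ^+ 2) ^+ 3 / 216 <= expR (x ^+ 2 / 6) ^+ 3.
  apply: le_trans (lerXn2r 3 _ _ h); rewrite ?nnegrE ?expR_ge0//.
    by rewrite expr_div_n; lra.
  by rewrite divr_ge0// addr_ge0// sqr_ge0.
rewrite e3 -mulrA; apply: le_trans (_ : 1 * 216 <= _); last by rewrite mul1r.
apply: ler_pM => //; first exact: normal_peak_ge0.
- rewrite mulr_ge0// ?invr_ge0 ?exprn_ge0 ?expR_ge0//.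
  by rewrite addr_ge0// sqr_ge0.
- exact: normal_peak_le1.
- rewrite mulrC ler_pdivrMr; last by rewrite exprn_gt0 ?expR_gt0.
  by move: h3; lra.
Qed.

(** A single constant for the size of all [hermG r] and for their decay: [216] from the density
    times [4] for the polynomial factors. It is locked so as to remain a symbol in later
    computations. *)
Fact hermB_key : unit. Proof. exact: tt. Qed.
Definition hermB : R := locked_with hermB_key 864.

Lemma hermB_gt0 : 0 < hermB.
Proof. by rewrite /hermB unlock; lra. Qed.

Lemma hermG_decay r x : (0 < r)%N -> `|hermG r x| <= hermB / (1 + x ^+ 2).
Proof.
rewrite /hermB unlock.
have x2 := sqr_ge0 x.
have k0 : 0 < 1 + x ^+ 2 by lra.
have poly_bound p : `|p| <= 4 * (1 + x ^+ 2) ^+ 2 -> `|p * gpdf x| <= 864 / (1 + x ^+ 2).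
  move=> hp; rewrite normrM (ger0_norm (gpdf_ge0 x)).
  apply: (@le_trans _ _ (4 * (1 + x ^+ 2) ^+ 2 * (216 / (1 + x ^+ 2) ^+ 3))).
    by apply: ler_pM => //; [exact: gpdf_ge0|exact: gpdf_decay].
  rewrite (_ : 4 * _ * _ = 864 / (1 + x ^+ 2))//.
  by field; rewrite gt_eqF.
case: r => [//|[|[|[|r]]]] _ /=.
- rewrite -[gpdf x]mul1r; apply: poly_bound; rewrite normr1; nra.
- apply: poly_bound; rewrite ler_norml; apply/andP; split; nra.
- apply: poly_bound; rewrite ler_norml; apply/andP; split; nra.
- have h1 : `|x| <= 1 + x ^+ 2 by rewrite ler_norml; apply/andP; split; nra.
  apply: poly_bound; rewrite (_ : 3 * x - x ^+ 3 = x * (3 - x ^+ 2)); last by ring.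
  have h2 : `|3 - x ^+ 2| <= 3 * (1 + x ^+ 2).
    by rewrite ler_norml; apply/andP; split; nra.
  rewrite normrM (le_trans (ler_pM _ _ h1 h2))//; nra.
Qed.

Lemma hermG_bounded r x : `|hermG r x| <= hermB.
Proof.
case: r => [|r].
  by rewrite /= ger0_norm ?Phi_ge0// /hermB unlock; have := Phi_le1 x; lra.
apply: (le_trans (hermG_decay x _)) => //.
have := sqr_ge0 x => x2; rewrite ler_pdivrMr; last by lra.
by have := hermB_gt0; nra.
Qed.

Lemma measurable_hermG r : measurable_fun [set: R] (hermG r).
Proof.
have mg := measurable_gpdf.
have mX n : measurable_fun [set: R] (fun x : R => x ^+ n).
  by apply: (@measurable_funX _ _ R _ id); exact: measurable_id.
case: r => [|[|[|[|r]]]].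
- by apply: nondecreasing_measurable => //; exact: Phi_mono.
- exact: mg.
- rewrite (_ : hermG 2 = fun x => - x * gpdf x)//.
  by apply: measurable_funM => //; apply: measurable_funN.
- rewrite (_ : hermG 3 = fun x => (x ^+ 2 - 1) * gpdf x)//.
  by apply: measurable_funM => //; exact: measurable_funB.
- rewrite (_ : hermG _ = fun x => (3 * x - x ^+ 3) * gpdf x)//.
  apply: measurable_funM => //; apply: measurable_funB => //.
Qed.

End GaussianFunctions.

Section GaussianMollification.
Context {R : realType} {dT : measure_display} {T : measurableType dT}.
Variables (P : probability T R) (Y : T -> R).
Hypothesis mY : measurable_fun [set: T] Y.
Implicit Types (u v : R) (r : nat).

(* The r-th derivative in [u] of E Phi((u - Y) / v), the mollified distribution
   function of [Y]. *)
Definition hexp r v u : R := \int[P]_w ((v ^+ r)^-1 * hermG r ((u - Y w) / v)).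

Lemma measurable_hexp_fun r v u :
  measurable_fun [set: T] (fun w => (v ^+ r)^-1 * hermG r ((u - Y w) / v)).
Proof.
apply: measurable_funM => //; apply: measurableT_comp; first exact: measurable_hermG.
by apply: measurable_funM => //; exact: measurable_funB.
Qed.

Lemma hexp_fun_bound r v u w : 0 < v ->
  `|(v ^+ r)^-1 * hermG r ((u - Y w) / v)| <= hermB / v ^+ r.
Proof.
move=> v0; have vr : 0 <= (v ^+ r)^-1 by rewrite invr_ge0 exprn_ge0// ltW.
by rewrite normrM (ger0_norm vr) mulrC ler_wpM2r// hermG_bounded.
Qed.

Lemma intg_hexp r v u : 0 < v ->
  intg P (fun w => (v ^+ r)^-1 * hermG r ((u - Y w) / v)).
Proof.
move=> v0; apply: (@intg_bnd _ _ _ _ _ (hermB / v ^+ r)).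
  exact: measurable_hexp_fun.
by move=> w; exact: hexp_fun_bound.
Qed.

Lemma hexp_bound r v u : 0 < v -> `|hexp r v u| <= hermB / v ^+ r.
Proof.
move=> v0; apply: Ex_bnd; first exact: measurable_hexp_fun.
by move=> w; exact: hexp_fun_bound.
Qed.

Lemma is_derive_hermG_scaled r v a u : (r < 4)%N -> 0 < v ->
  is_derive u 1 (fun u => (v ^+ r)^-1 * hermG r ((u - a) / v))
    ((v ^+ r.+1)^-1 * hermG r.+1 ((u - a) / v)).
Proof.
move=> r4 v0.
have h : is_derive u 1 (fun u => (u - a) / v) v^-1.
  by apply: is_derive_eq; rewrite /GRing.scale/=; lra.
have h2 : is_derive u 1 (fun u => hermG r ((u - a) / v)) (hermG r.+1 ((u - a) / v) * v^-1).
  exact: (@is_derive1_comp R (hermG r) (fun u => (u - a) / v) u _ _ (is_derive_hermG _ r4) h).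
have h3 := is_deriveZ (v ^- r) h2.
rewrite (_ : v ^- r.+1 * _ = v ^- r *: (hermG r.+1 ((u - a) / v) / v)); first exact: h3.
by rewrite /GRing.scale/= exprSr invfM; ring.
Qed.

(** The next derivative of the kernel is bounded by a constant, so differentiation under the
    integral holds for every law of [Y], without any moment. *)
Lemma is_derive_hexp r v u : (r < 4)%N -> 0 < v ->
  is_derive u 1 (hexp r v) (hexp r.+1 v u).
Proof.
move=> r4 v0.
pose f (u : R) (w : T) := (v ^+ r)^-1 * hermG r ((u - Y w) / v).
have df (x : R) (y : T) : is_derive x 1 (f ^~ y) ((v ^+ r.+1)^-1 * hermG r.+1 ((x - Y y) / v)).
  exact: is_derive_hermG_scaled.
have uI : `]u - 1, u + 1[%classic u by rewrite /= in_itv/= ltrBlDr ltrDl ltr01.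
have int_f (x : R) : `]u - 1, u + 1[%classic x -> P.-integrable setT (EFin \o f x).
  by move=> _; exact: intg_hexp.
have der_f (x : R) (y : T) : `]u - 1, u + 1[%classic x -> [set: T] y -> derivable (f ^~ y) x 1.
  by move=> _ _; have := df x y; case.
have dfE (x : R) (y : T) : partial1of2 f x y = (v ^+ r.+1)^-1 * hermG r.+1 ((x - Y y) / v).
  by rewrite partial1of2E; have [_ ->] := df x y.
have G0 (y : T) : 0 <= (cst : R -> T -> R) (hermB / v ^+ r.+1) y.
  by apply: divr_ge0; [exact/ltW/hermB_gt0 | exact/exprn_ge0/ltW].
have intG : P.-integrable setT (EFin \o cst (hermB / v ^+ r.+1)).
  exact: (@intg_cst _ _ _ P (hermB / v ^+ r.+1)).
have Gub (x : R) (y : T) : `]u - 1, u + 1[%classic x -> [set: T] y ->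
    `|partial1of2 f x y| <= (cst : R -> T -> R) (hermB / v ^+ r.+1) y.
  by move=> _ _; rewrite dfE; exact: hexp_fun_bound.
apply: DeriveDef; first exact: (derivable_under_integral measurableT uI int_f der_f G0 intG Gub).
have := differentiation_under_integral measurableT uI int_f der_f G0 intG Gub.
rewrite derive1E => ->; rewrite /hexp.
by apply: eq_Rintegral => w _; rewrite dfE.
Qed.

End GaussianMollification.

Section RealDominatedConvergence.
Context {R : realType} {dT : measure_display} {T : measurableType dT}.
Variable P : {measure set T -> \bar R}.

Lemma Ex_dct (f_ : nat -> T -> R) (f g : T -> R) :
  (forall n, measurable_fun [set: T] (f_ n)) -> measurable_fun [set: T] f ->
  intg P g -> (forall n x, `|f_ n x| <= g x) ->
  (forall x, f_ n x @[n --> \oo] --> f x) ->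
  \int[P]_x f_ n x @[n --> \oo] --> \int[P]_x f x.
Proof.
move=> mf_ mf ig fg ff.
have [] := @dominated_convergence _ T R P setT measurableT (fun n x => (f_ n x)%:E)
  (fun x => (f x)%:E) (fun x => (g x)%:E).
- by move=> n; exact/measurable_EFinP.
- exact/measurable_EFinP.
- by apply: aeW => x _; apply/fine_cvgP; split; [exact: nearW|exact: ff].
- exact: ig.
- by apply: aeW => x n _; rewrite lee_fin.
move=> i1 _ h; apply: fine_cvg.
by rewrite /Rintegral fineK//; exact: integrable_fin_num.
Qed.

End RealDominatedConvergence.

Section GaussianIntegrals.
Context {R : realType}.
Local Notation mu := (@lebesgue_measure R).
Local Notation N := (normal_prob (0 : R) 1).
Implicit Types (u v s x z : R) (r : nat).

Lemma normal_peak_scale s : 0 < s -> normal_peak s = normal_peak 1 / s :> R.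
Proof.
move=> s0; rewrite /normal_peak expr1n mul1r -invfM -mulrnAr.
by rewrite (sqrtrM _ (sqr_ge0 s)) sqrtr_sqr gtr0_norm// mulrC.
Qed.

Lemma normal_pdf_gpdf s z : 0 < s -> normal_pdf 0 s z = gpdf (z / s) / s.
Proof.
move=> s0; rewrite normal_pdfE ?gt_eqF// gpdfE (normal_peak_scale s0) /normal_fun subr0.
rewrite mulrAC; congr (_ * expR _ / _).
by rewrite -mulr_natr expr_div_n; field; rewrite gt_eqF.
Qed.

(* Completing the square: the product of two Gaussian densities is a Gaussian
   density in [z] times a Gaussian density in [u]. *)
Lemma gpdf_mul v s u z : 0 < v -> let t := Num.sqrt (v ^+ 2 + s ^+ 2) in
  v^-1 * gpdf ((u - s * z) / v) * gpdf z =
  t^-1 * gpdf (u / t) * normal_pdf (s * u / t ^+ 2) (v / t) z.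
Proof.
move=> v0 t; have t2 : t ^+ 2 = v ^+ 2 + s ^+ 2.
  by rewrite sqr_sqrtr// addr_ge0// sqr_ge0.
have t0 : 0 < t by rewrite sqrtr_gt0 ltr_pwDl ?exprn_gt0// sqr_ge0.
have vt0 : 0 < v / t by rewrite divr_gt0.
rewrite normal_pdfE ?gt_eqF// (normal_peak_scale vt0) !gpdfE /normal_fun.
rewrite (_ : v^-1 * _ * _ = v^-1 * normal_peak 1 * normal_peak 1 *
  (expR (- (((u - s * z) / v) ^+ 2 / 2)) * expR (- (z ^+ 2 / 2)))); last by ring.
rewrite (_ : t^-1 * _ * _ = v^-1 * normal_peak 1 * normal_peak 1 *
  (expR (- ((u / t) ^+ 2 / 2)) *
   expR (- (z - s * u / t ^+ 2) ^+ 2 / ((v / t) ^+ 2 *+ 2)))); last first.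
  by field; rewrite !gt_eqF.
rewrite -!expRD; congr (_ * expR _); rewrite -[(v / t) ^+ 2 *+ 2]mulr_natr.
have -> : z - s * u / t ^+ 2 = (z * t ^+ 2 - s * u) / t ^+ 2 by field; rewrite gt_eqF.
rewrite !expr_div_n.
have -> : - (u ^+ 2 / t ^+ 2 / 2) +
  - ((z * t ^+ 2 - s * u) ^+ 2 / (t ^+ 2) ^+ 2) / (v ^+ 2 / t ^+ 2 * 2) =
  - ((u ^+ 2 * v ^+ 2 + (z * t ^+ 2 - s * u) ^+ 2) / (t ^+ 2 * v ^+ 2 * 2)).
  by field; rewrite !gt_eqF.
rewrite t2; field.
by rewrite -t2 !gt_eqF// exprn_gt0.
Qed.

Lemma measurable_scale s : measurable_fun [set: R] (fun z => s * z).
Proof. exact: measurable_funM. Qed.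

Lemma hexp1_normal v s u : 0 < v -> let t := Num.sqrt (v ^+ 2 + s ^+ 2) in
  hexp N (fun z => s * z) 1 v u = (t ^+ 1)^-1 * hermG 1 (u / t).
Proof.
move=> v0 t; rewrite /hexp Ex_normal; last first.
  by apply: intg_hexp => //; exact: measurable_scale.
transitivity (\int[mu]_z (t^-1 * gpdf (u / t) *
    normal_pdf (s * u / t ^+ 2) (v / t) z)).
  by apply: eq_Rintegral => z _; rewrite -gpdf_mul// expr1.
rewrite RintegralZl//; last exact: integrable_normal_pdf.
by rewrite /Rintegral integral_normal_pdf/= mulr1 expr1.
Qed.

Lemma Phi_cvgNy : Phi (- n%:R : R) @[n --> \oo] --> (0 : R).
Proof.
have F0 : \bigcap_n `]-oo, (- n%:R : R)]%classic = set0.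
  rewrite -subset0 => x /(_ (Num.truncn (- x)).+1 I)/=; rewrite in_itv/= => h.
  by have := truncnS_gt (- x); rewrite ltNge lerNr h.
have : N (`]-oo, (- n%:R : R)]%classic) @[n --> \oo] --> N (\bigcap_n `]-oo, (- n%:R : R)]%classic).
  apply: nonincreasing_cvg_mu => //.
  - by rewrite (le_lt_trans (probability_le1 _ _))// ltry.
  - by rewrite F0.
  - move=> m n mn; apply/subsetPset => x /=; rewrite !in_itv/= => /le_trans; apply.
    by rewrite lerN2 ler_nat.
rewrite F0 measure0 => /fine_cvgP[_].
by apply: cvg_trans; apply: near_eq_cvg; apply: nearW => n.
Qed.

Lemma Phi_Ny (e : R) : 0 < e -> exists M : R, forall x, x <= M -> Phi x < e.
Proof.
move=> e0; have /cvgrPdist_lt/(_ _ e0)[n _ /(_ n (leqnn n))] := Phi_cvgNy.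
rewrite sub0r normrN ger0_norm ?Phi_ge0// => h.
by exists (- n%:R) => x xn; apply: le_lt_trans h; exact: Phi_mono.
Qed.

Lemma Phi_cvgNy_affine (a v : R) : 0 < v ->
  Phi ((- n%:R - a) / v) @[n --> \oo] --> (0 : R).
Proof.
move=> v0; apply/cvgrPdist_lt => e e0; have [M hM] := Phi_Ny e0.
near=> n; rewrite sub0r normrN ger0_norm ?Phi_ge0//; apply: hM.
rewrite ler_pdivrMr// lerBlDr lerNl.
by near: n; exact: nbhs_infty_ger.
Unshelve. all: by end_near. Qed.

End GaussianIntegrals.

Section NormalMixture.
Context {R : realType} {dT : measure_display} {T : measurableType dT}.
Variables (Q : probability T R) (Y : T -> R) (v t : R).
Hypotheses (mY : measurable_fun [set: T] Y) (v0 : 0 < v) (t0 : 0 < t).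

(** Equal derivatives leave a constant difference, and both sides tend to [0] along [- n]. The law
    [Q] is kept abstract because the lemma serves both for [s * z] under the standard normal law and
    for the identity under [normal_prob 0 sigma]. *)
Lemma hexp0_of_hexp1 u : (forall u, hexp Q Y 1 v u = t^-1 * gpdf (u / t)) ->
  hexp Q Y 0 v u = Phi (u / t).
Proof.
move=> hexp1; pose D (u : R) := hexp Q Y 0 v u - Phi (u / t).
have D0 (x : R) : is_derive x 1 D 0.
  have h1 := @is_derive_hexp _ _ _ Q _ mY 0 v x isT v0.
  have h2 : is_derive x 1 (fun x => Phi (x / t)) (gpdf (x / t) / t).
    have := @is_derive_hermG_scaled R 0 t 0 x isT t0.
    rewrite /= expr0 invr1; under eq_fun do rewrite mul1r subr0.
    by rewrite subr0 expr1 mulrC.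
  by have := is_deriveB h1 h2; rewrite hexp1 mulrC subrr.
have Dn n : D u = D (- n%:R) by exact: is_derive_0_is_cst.
have Dlim : D (- n%:R) @[n --> \oo] --> 0 - (0 : R).
  apply: cvgB; last first.
    by have := Phi_cvgNy_affine 0 t0; under eq_fun do rewrite subr0.
  rewrite -[X in _ --> X](@Ex_cst _ _ _ Q 0) /hexp.
  apply: (@Ex_dct _ _ _ Q _ _ (fun=> hermB)) => //.
  - by move=> n; exact: measurable_hexp_fun.
  - exact: intg_cst.
  - by move=> n x; have := @hexp_fun_bound _ _ _ Y 0 v (- n%:R) x v0; rewrite expr0 divr1.
  - move=> x; rewrite expr0 invr1; under eq_fun do rewrite mul1r.
    exact: Phi_cvgNy_affine.
have : D u = 0.
  rewrite subrr in Dlim; apply: (@cvg_unique _ _ _ _ _ _ _ Dlim) => //.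
  by rewrite /=; under eq_fun do rewrite -Dn; exact: cvg_cst.
by move/eqP; rewrite subr_eq0 => /eqP.
Qed.

End NormalMixture.

Section NormalMollification.
Context {R : realType}.
Local Notation N := (normal_prob (0 : R) 1).

Lemma hexp0_normal v s u : 0 < v ->
  hexp N (fun z => s * z) 0 v u = Phi (u / Num.sqrt (v ^+ 2 + s ^+ 2)).
Proof.
move=> v0; set t := Num.sqrt _.
have t0 : 0 < t by rewrite sqrtr_gt0 ltr_pwDl ?exprn_gt0// sqr_ge0.
apply: (@hexp0_of_hexp1 _ _ _ N _ v t (measurable_scale s) v0 t0) => x; exact: hexp1_normal.
Qed.

Lemma hexp_normal r v s u : (r <= 4)%N -> 0 < v ->
  let t := Num.sqrt (v ^+ 2 + s ^+ 2) in
  hexp N (fun z => s * z) r v u = (t ^+ r)^-1 * hermG r (u / t).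
Proof.
move=> r4 v0 t.
have t0 : 0 < t by rewrite sqrtr_gt0 ltr_pwDl ?exprn_gt0// sqr_ge0.
elim: r r4 u => [_ u|r IH r4 u]; first by rewrite hexp0_normal// expr0 invr1 mul1r.
have h1 := @is_derive_hexp _ _ _ N _ (measurable_scale s) r v u r4 v0.
have := @is_derive_hermG_scaled R r t 0 u r4 t0.
rewrite (_ : (fun u => _) = hexp N (fun z => s * z) r v); last first.
  by apply/funext => x; rewrite IH 1?ltnW// subr0.
by rewrite subr0 => h2; rewrite -(@derive_val _ _ _ _ _ _ _ h1) -(@derive_val _ _ _ _ _ _ _ h2).
Qed.

End NormalMollification.

Section GaussianConvolution.
Context {R : realType} {dT : measure_display} {T : measurableType dT}.
Variables (P : probability T R) (Y : T -> R).
Hypothesis mY : measurable_fun [set: T] Y.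
Local Notation N := (normal_prob (0 : R) 1).
Implicit Types (u v s : R) (r : nat).

(** Adding to [Y] an independent centred normal variable of standard deviation [s] merely enlarges
    the bandwidth. This is how a Gaussian increment is traded for a change of [v]. *)
Lemma hexp_convolution r v s u : (r <= 4)%N -> 0 < v ->
  hexp P Y r (Num.sqrt (v ^+ 2 + s ^+ 2)) u = \int[N]_z hexp P Y r v (u - s * z).
Proof.
move=> r4 v0; rewrite {1}/hexp.
transitivity (\int[P]_w \int[N]_z ((v ^+ r)^-1 * hermG r ((u - Y w - s * z) / v))).
  by apply: eq_Rintegral => w _; rewrite -hexp_normal.
pose F (wz : T * measurableTypeR R) := (v ^+ r)^-1 * hermG r ((u - Y wz.1 - s * wz.2) / v).
have mF : measurable_fun [set: T * measurableTypeR R] F.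
  apply: measurable_funM => //; apply: measurableT_comp; first exact: measurable_hermG.
  apply: measurable_funM => //; apply: measurable_funB.
    by apply: measurable_funB => //; exact: measurableT_comp.
  by apply: measurable_funM.
have Fb w z : `|F (w, z)| <= hermB / v ^+ r * 1.
  by rewrite mulr1; exact: (hexp_fun_bound (fun _ : unit => s * z) r (u - Y w) tt v0).
transitivity (\int[N]_z \int[P]_w F (w, z)).
  have E := Ex_fubini mF (intg_cst P (hermB / v ^+ r)) (intg_cst N 1) Fb.
  rewrite -E.
  by [].
apply: eq_Rintegral => z _; apply: eq_Rintegral => w _ /=.
by rewrite addrAC.
Qed.

End GaussianConvolution.

Section GaussianMoments.
Context {R : realType}.
Local Notation mu := (@lebesgue_measure R).
Local Notation N := (normal_prob (0 : R) 1).

(** The fundamental theorem of calculus on growing symmetric intervals, then dominated convergence.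
    Mean and variance of the normal law follow because [hermG 2] and [hermG 3] are derivatives of
    functions that vanish at infinity. *)
Lemma integral_derive_eq0 (F f : R -> R) :
  (forall x : R, is_derive x 1 F (f x)) -> continuous f ->
  mu.-integrable [set: R] (fun x => (f x)%:E) ->
  F n%:R @[n --> \oo] --> (0 : R) -> F (- n%:R) @[n --> \oo] --> (0 : R) ->
  \int[mu]_x f x = 0.
Proof.
move=> dF cf fint Fy FNy.
have mf : measurable_fun [set: R] f by exact: continuous_measurable_fun.
pose I n : set R := `[- (n.+1%:R), n.+1%:R]%classic.
have In n : \int[mu]_x (f \_ (I n)) x = F n.+1%:R - F (- n.+1%:R).
  rewrite -Rintegral_mkcond /Rintegral (@continuous_FTC2 R f F)//.
  - by rewrite gtrN.
  - exact: continuous_subspaceT.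
  - split.
    + by move=> x _; have := dF x; case.
    + apply: cvg_at_right_filter; apply: differentiable_continuous.
      by apply/derivable1_diffP; have := dF (- n.+1%:R); case.
    + apply: cvg_at_left_filter; apply: differentiable_continuous.
      by apply/derivable1_diffP; have := dF (n.+1%:R); case.
  - by move=> x _; rewrite derive1E; have := dF x; case.
have h1 : \int[mu]_x (f \_ (I n)) x @[n --> \oo] --> \int[mu]_x f x.
  apply: (@Ex_dct _ _ _ mu (fun n => f \_ (I n)) f (fun x => `|f x|)) => //.
  - move=> n; apply/(measurable_restrictT f) => //; first exact: measurable_itv.
    exact: measurable_funTS.
  - exact: integrable_norm.
  - by move=> n x; rewrite patchE; case: ifP => // _; rewrite normr0.
  - move=> x; apply: cvg_near_cst; near=> n.
    rewrite patchE mem_set// /I /= in_itv/= -ler_norml.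
    rewrite (le_trans (ltW (truncnS_gt `|x|)))// ler_nat ltnS.
    by near: n; exact: nbhs_infty_ge.
have h2 : \int[mu]_x (f \_ (I n)) x @[n --> \oo] --> (0 - 0 : R).
  under eq_fun do rewrite In.
  apply: cvgB; first by rewrite (cvg_shiftS (fun n => F n%:R)).
  by rewrite (cvg_shiftS (fun n => F (- n%:R))).
rewrite subr0 in h2; exact: cvg_unique h1 h2.
Unshelve. all: by end_near. Qed.

Lemma hermG_cvg0 r (x_ : nat -> R) : (0 < r)%N -> (forall n, `|x_ n| = n%:R) ->
  hermG r (x_ n) @[n --> \oo] --> (0 : R).
Proof.
move=> r0 xn; apply/cvgrPdist_lt => e e0; near=> n.
rewrite sub0r normrN (le_lt_trans (hermG_decay _ r0))//.
have B0 := @hermB_gt0 R.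
have nB : hermB / e < n%:R by near: n; exact: nbhs_infty_gtr.
have n1 : (1 : R) <= n%:R by rewrite ler1n; near: n; exact: nbhs_infty_ge.
rewrite -real_normK ?num_real// xn ltr_pdivrMr; last by nra.
rewrite ltr_pdivrMr// in nB; nra.
Unshelve. all: by end_near. Qed.

Lemma hermG_continuous r : (r < 4)%N -> continuous (@hermG R r).
Proof.
move=> r4 x; apply: differentiable_continuous; apply/derivable1_diffP.
by have := is_derive_hermG x r4; case.
Qed.

Lemma integral_hermG_eq0 r : (0 < r < 3)%N ->
  mu.-integrable [set: R] (fun x => (hermG r.+1 x)%:E) ->
  \int[mu]_x hermG r.+1 x = 0.
Proof.
move=> /andP[r0 r3] ir; apply: (@integral_derive_eq0 (hermG r)) => //.
- by move=> x; apply: is_derive_hermG; rewrite (ltn_trans r3).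
- exact: hermG_continuous.
- by apply: (hermG_cvg0 r0 (x_ := fun n => n%:R)) => n; rewrite normr_nat.
- by apply: (hermG_cvg0 r0 (x_ := fun n => - n%:R)) => n; rewrite normrN normr_nat.
Qed.

(** The fourth power is absorbed by doubling the standard deviation: the ratio of the two densities
    is half of [expR (3 * x ^+ 2 / 8)], and this exponential is at least the square of
    [3 * x ^+ 2 / 16]. *)
Lemma intg_normal_pow4 : intg N (fun z : R => z ^+ 4).
Proof.
have mX : measurable_fun [set: R] (fun x : R => x ^+ 4).
  by apply: (@measurable_funX _ _ R _ id); exact: measurable_id.
apply: intg_normal => //.
apply: (@le_integrable _ _ _ mu _ measurableT _ (fun x => (64 * normal_pdf 0 2 x)%:E)).
- apply/measurable_EFinP; apply: measurable_funM => //; exact: measurable_normal_pdf.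
- move=> x _; rewrite lee_fin ger0_norm; last first.
    by rewrite mulr_ge0 ?normal_pdf_ge0// exprn_even_ge0.
  rewrite ger0_norm ?mulr_ge0 ?normal_pdf_ge0//.
  have s2 : 0 < 2 :> R by [].
  rewrite (normal_pdf_gpdf x s2) (_ : normal_pdf 0 1 x = gpdf x)// !gpdfE.
  have h : 9 * x ^+ 4 / 256 <= expR (3 * x ^+ 2 / 8).
    have e1 : 1 + 3 * x ^+ 2 / 16 <= expR (3 * x ^+ 2 / 16) by exact: expR_ge1Dx.
    have -> : 3 * x ^+ 2 / 8 = 3 * x ^+ 2 / 16 + 3 * x ^+ 2 / 16 by lra.
    rewrite expRD; have x2 := sqr_ge0 x.
    have -> : x ^+ 4 = (x ^+ 2) ^+ 2 by rewrite -exprM.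
    by nra.
  have E : expR (- ((x / 2) ^+ 2 / 2)) = expR (- (x ^+ 2 / 2)) * expR (3 * x ^+ 2 / 8).
    by rewrite -expRD; congr expR; field.
  rewrite E; have p0 := normal_peak_ge0 (1 : R).
  have e0 := expR_ge0 (- (x ^+ 2 / 2)).
  rewrite (_ : 64 * _ = (normal_peak 1 * expR (- (x ^+ 2 / 2))) * (32 * expR (3 * x ^+ 2 / 8))); last by lra.
  rewrite mulrC ler_wpM2l ?mulr_ge0//.
  have : 0 <= x ^+ 4 by rewrite exprn_even_ge0.
  by lra.
- under eq_fun do rewrite EFinM.
  by apply: integrableZl => //; exact: integrable_normal_pdf.
Qed.

Lemma intg_normal_pow k : (k <= 4)%N -> intg N (fun z : R => `|z| ^+ k).
Proof.
move=> k4; apply: (@intg_le _ _ _ N _ (fun z => 1 + z ^+ 4)).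
- by apply: measurable_funX; exact: normr_measurable.
- by apply: intgD; [exact: intg_cst|exact: intg_normal_pow4].
- move=> z; rewrite ger0_norm ?exprn_ge0//.
  have -> : z ^+ 4 = `|z| ^+ 4 by rewrite -normrX ger0_norm// exprn_even_ge0.
  have z0 := normr_ge0 z; set y := `|z| in z0 *.
  have [y1|/ltW y1] := leP y 1.
    by rewrite (@le_trans _ _ 1)// ?exprn_ile1// lerDl exprn_ge0.
  by rewrite (@le_trans _ _ (y ^+ 4))// ?lerDr// ler_weXn2l.
Qed.

Lemma intg_normal_id : intg N (fun z : R => z).
Proof.
apply: (@intg_le _ _ _ N (fun z => z) (fun z => `|z| ^+ 1)) => //.
exact: intg_normal_pow.
Qed.

Lemma intg_normal_sqr : intg N (fun z : R => z ^+ 2).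
Proof.
have mX : measurable_fun [set: R] (fun x : R => x ^+ 2).
  by apply: (@measurable_funX _ _ R _ id); exact: measurable_id.
apply: (@intg_le _ _ _ N (fun z => z ^+ 2) (fun z => `|z| ^+ 2)) => //.
- exact: intg_normal_pow.
- by move=> z; rewrite normrX.
Qed.

Lemma normal_mean : \int[N]_z z = 0 :> R.
Proof.
rewrite Ex_normal; last exact: intg_normal_id.
have i2 : mu.-integrable [set: R] (fun x => (hermG 2 x)%:E).
  have := intg_normalP (intgZ (-1) intg_normal_id).
  by under eq_fun do rewrite mulN1r.
have := integral_hermG_eq0 (isT : (0 < 1 < 3)%N) i2 => e0.
transitivity (-1 * \int[mu]_x (hermG 2 x)); last by rewrite e0 mulr0.
rewrite -RintegralZl//.
by apply: eq_Rintegral => x _ /=; rewrite mulN1r mulNr opprK.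
Qed.

Lemma normal_variance : \int[N]_z (z ^+ 2) = 1 :> R.
Proof.
have i1 := intgB intg_normal_sqr (intg_cst N 1).
have i3 : mu.-integrable [set: R] (fun x => (hermG 3 x)%:E).
  exact: (intg_normalP i1).
apply/eqP; rewrite -subr_eq0 -{1}[X in _ - X](Ex_cst N) -ExB//; last 2 first.
- exact: intg_normal_sqr.
- exact: intg_cst.
by rewrite Ex_normal//; apply/eqP; exact: (integral_hermG_eq0 (isT : (0 < 2 < 3)%N) i3).
Qed.

End GaussianMoments.

(** * Comparison of laws and desmoothing *)

Section Calculus.
Context {R : realType}.
Implicit Types (f : R -> R) (a b t h D : R).

Lemma is_derive_translate t (x : R) : is_derive x 1 (fun x : R => t + x) 1.
Proof.
have := is_deriveD (is_derive_cst t x 1) (is_derive_id x 1).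
by rewrite add0r.
Qed.

Lemma MVT_any f (df : R -> R) a b : (forall x : R, is_derive x 1 f (df x)) ->
  exists2 c, `|c - a| <= `|b - a| & f b - f a = df c * (b - a).
Proof.
move=> fd; have cf x y : {within `[x, y], continuous f}.
  by apply: derivable_within_continuous => z _; have := fd z; case.
have [ab|ba|->] := ltgtP a b.
- have [c] := MVT ab (fun x _ => fd x) (cf a b).
  rewrite in_itv/= => /andP[ac cb] ->; exists c => //.
  by rewrite !ger0_norm ?subr_ge0 ?lerD2r// ltW.
- have [c] := MVT ba (fun x _ => fd x) (cf b a).
  rewrite in_itv/= => /andP[bc ca] E; exists c.
    by rewrite !ler0_norm ?subr_le0 ?lerN2 ?lerD2r// ltW.
  by rewrite -opprB E -mulrN opprB.
- by exists b; rewrite !subrr ?mulr0.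
Qed.

Lemma nondecreasing_derive f (df : R -> R) : (forall x : R, is_derive x 1 f (df x)) ->
  (forall x, 0 <= df x) -> {homo f : x y / x <= y}.
Proof.
move=> fd df0 x y xy; have [c _ E] := MVT_any x y fd.
by rewrite -subr_ge0 E mulr_ge0// subr_ge0.
Qed.

Lemma lipschitz_derive f (df : R -> R) D : (forall x : R, is_derive x 1 f (df x)) ->
  (forall x, `|df x| <= D) -> forall a b, `|f b - f a| <= D * `|b - a|.
Proof.
move=> fd dfD a b; have [c _ ->] := MVT_any a b fd.
by rewrite normrM ler_wpM2r.
Qed.

Variables (e0 e1 e2 e3 : R -> R) (D : R).
Hypotheses (d0 : forall x : R, is_derive x 1 e0 (e1 x))
  (d1 : forall x : R, is_derive x 1 e1 (e2 x))
  (d2 : forall x : R, is_derive x 1 e2 (e3 x)) (e3D : forall x, `|e3 x| <= D).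

Lemma taylor1 t h : `|e1 (t + h) - e1 t - h * e2 t| <= D * `|h| ^+ 2.
Proof.
pose f x := e1 (t + x) - x * e2 t.
have fd (x : R) : is_derive x 1 f (e2 (t + x) - e2 t).
  have ht := is_derive_translate t x.
  have h1 : is_derive x 1 (fun x => e1 (t + x)) (e2 (t + x)).
    rewrite -[e2 _]mulr1.
    exact: (@is_derive1_comp R e1 (fun x => t + x) x _ _ (d1 _) ht).
  by apply: is_derive_eq; rewrite /GRing.scale/=; ring.
have [c cx] := MVT_any 0 h fd; rewrite /f addr0 mul0r subr0 => E.
rewrite addrAC E subr0 normrM expr2 mulrA ler_wpM2r//.
apply: (le_trans (lipschitz_derive d2 e3D t (t + c))).
rewrite addrAC subrr add0r ler_wpM2l//; last by rewrite !subr0 in cx.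
exact: le_trans (e3D 0).
Qed.

Lemma taylor2 t h :
  `|e0 (t + h) - e0 t - h * e1 t - h ^+ 2 / 2 * e2 t| <= D * `|h| ^+ 3.
Proof.
pose f x := e0 (t + x) - x * e1 t - x ^+ 2 / 2 * e2 t.
have fd (x : R) : is_derive x 1 f (e1 (t + x) - e1 t - x * e2 t).
  have ht := is_derive_translate t x.
  have h1 : is_derive x 1 (fun x => e0 (t + x)) (e1 (t + x)).
    rewrite -[e1 _]mulr1.
    exact: (@is_derive1_comp R e0 (fun x => t + x) x _ _ (d0 _) ht).
  by apply: is_derive_eq; rewrite /GRing.scale/=; field.
have [c cx] := MVT_any 0 h fd; rewrite /f addr0 !mul0r expr0n/= !mul0r !subr0 => E.
rewrite (_ : e0 (t + h) - _ - _ - _ =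
  e0 (t + h) - h * e1 t - h ^+ 2 / 2 * e2 t - e0 t); last by ring.
rewrite E normrM exprSr mulrA ler_wpM2r// (le_trans (taylor1 t c))//.
rewrite ler_wpM2l//; first exact: le_trans (e3D 0).
by rewrite !subr0 in cx; exact: lerXn2r.
Qed.

End Calculus.

Section CdfComparison.
Context {R : realType} {d1 d2 : measure_display} {T1 : measurableType d1}
  {T2 : measurableType d2}.
Variables (P1 : probability T1 R) (P2 : probability T2 R).
Variables (Y1 : T1 -> R) (Y2 : T2 -> R) (delta : R).
Hypotheses (mY1 : measurable_fun [set: T1] Y1) (mY2 : measurable_fun [set: T2] Y2).
Hypothesis delta0 : 0 <= delta.
Hypothesis cdf_close : forall u,
  `|fine (P1 [set w | Y1 w <= u]) - fine (P2 [set w | Y2 w <= u])| <= delta.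

Lemma measurable_le_set (dT : measure_display) (T : measurableType dT) (Y : T -> R) u :
  measurable_fun [set: T] Y -> measurable [set w | Y w <= u].
Proof.
move=> mY; have := mY measurableT `]-oo, u]%classic (measurable_itv _).
by rewrite setTI; congr measurable; apply/seteqP; split => x /=; rewrite in_itv.
Qed.

(** A sublevel set of a continuous nondecreasing function is empty, the whole line, or a half line
    that contains its supremum; the hypothesis on distribution functions handles the last case. *)
Lemma sublevel_close (g : R -> R) c : {homo g : x y / x <= y} -> continuous g ->
  `|fine (P1 [set w | g (Y1 w) <= c]) - fine (P2 [set w | g (Y2 w) <= c])| <= delta.
Proof.
move=> ndg cg; pose A := [set y | g y <= c].
have [/eqP A0|A0] := boolP (A == set0).
  have AE (y : R) : ~ g y <= c by move=> gy; have : A y by []; rewrite A0.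
  have -> : [set w | g (Y1 w) <= c] = set0 by rewrite -subset0 => w /AE.
  have -> : [set w | g (Y2 w) <= c] = set0 by rewrite -subset0 => w /AE.
  by rewrite !measure0 subrr normr0.
have {}A0 : A !=set0 by exact/set0P.
have [ubA|nub] := pselect (has_ubound A); last first.
  have AE (y : R) : g y <= c.
    apply: contrapT => gy; apply: nub; exists y => z Az.
    rewrite leNgt; apply/negP => yz; apply: gy; exact: le_trans (ndg _ _ (ltW yz)) Az.
  have -> : [set w | g (Y1 w) <= c] = setT by apply/seteqP; split => w //= _.
  have -> : [set w | g (Y2 w) <= c] = setT by apply/seteqP; split => w //= _.
  by rewrite [P1 _]probability_setT [P2 _]probability_setT subrr normr0.
have AE (y : R) : (g y <= c) = (y <= sup A).
  apply/idP/idP => [gy|ys]; first exact: ub_le_sup.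
  apply: le_trans (ndg _ _ ys) _.
  have clA : closed A by exact: closed_comp (fun x _ => cg x) (@closed_le R c).
  exact: (clA _ (closure_sup A0 ubA)).
have -> : [set w | g (Y1 w) <= c] = [set w | Y1 w <= sup A].
  by apply/seteqP; split => w /=; rewrite AE.
have -> : [set w | g (Y2 w) <= c] = [set w | Y2 w <= sup A].
  by apply/seteqP; split => w /=; rewrite AE.
exact: cdf_close.
Qed.

(** Layer cake formula for [g - lo]: the tail functions differ by at most [delta] on [[0, hi - lo]],
    and the first one vanishes beyond. *)
Lemma monotone_close_le (g : R -> R) (lo hi : R) : {homo g : x y / x <= y} ->
  continuous g -> (forall y, lo <= g y <= hi) ->
  \int[P1]_w g (Y1 w) <= \int[P2]_w g (Y2 w) + delta * (hi - lo).
Proof.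
move=> ndg cg gb.
have mg : measurable_fun [set: R] g by exact: continuous_measurable_fun.
have mX1 : measurable_fun [set: T1] (fun w => g (Y1 w) - lo).
  by apply: measurable_funB => //; exact: measurableT_comp.
have mX2 : measurable_fun [set: T2] (fun w => g (Y2 w) - lo).
  by apply: measurable_funB => //; exact: measurableT_comp.
pose m1 := isMeasurableFun.Build _ _ _ _ _ mX1.
pose m2 := isMeasurableFun.Build _ _ _ _ _ mX2.
pose X1 : {RV P1 >-> R} := HB.pack (fun w => g (Y1 w) - lo) m1.
pose X2 : {RV P2 >-> R} := HB.pack (fun w => g (Y2 w) - lo) m2.
have X10 w : 0 <= X1 w by rewrite /= subr_ge0; have /andP[] := gb (Y1 w).
have X20 w : 0 <= X2 w by rewrite /= subr_ge0; have /andP[] := gb (Y2 w).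
have ig1 : intg P1 (fun w => g (Y1 w) - lo).
  apply: (@intg_bnd _ _ _ _ _ (hi - lo)) => // w.
  by rewrite ger0_norm ?(X10 w)// lerD2r; have /andP[] := gb (Y1 w).
have ig2 : intg P2 (fun w => g (Y2 w) - lo).
  apply: (@intg_bnd _ _ _ _ _ (hi - lo)) => // w.
  by rewrite ger0_norm ?(X20 w)// lerD2r; have /andP[] := gb (Y2 w).
have hilo : 0 <= hi - lo by have /andP[h1 h2] := gb 0; rewrite subr_ge0 (le_trans h1).
have E1 := ge0_expectation_ccdf X10.
have E2 := ge0_expectation_ccdf X20.
rewrite expectation_def Ex_EFin// in E1.
rewrite expectation_def Ex_EFin// in E2.
have key r : (ccdf X1 r <= ccdf X2 r + (delta * \1_(`[0%R, hi - lo]%classic) r)%:E)%E \/ r < 0.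
  have [r0|r0] := leP 0 r; [left|by right].
  have [rH|rH] := leP r (hi - lo); last first.
    rewrite (_ : ccdf X1 r = 0%E) ?adde_ge0//.
      by rewrite lee_fin mulr_ge0.
    rewrite /ccdf /distribution /pushforward (_ : _ @^-1` _ = set0) ?measure0//.
    rewrite -subset0 => w /=; rewrite in_itv/= andbT => h.
    have := lt_trans rH h; rewrite ltNge lerD2r.
    by have /andP[_ ->] := gb (Y1 w).
  have cE (dT : measure_display) (T : measurableType dT) (P : probability T R) (Y : T -> R) :
      measurable_fun [set: T] Y ->
      P ((fun w => g (Y w) - lo) @^-1` `]r, +oo[%classic) =
      (1 - fine (P [set w | (g (Y w) <= r + lo)%R]))%:E.
    move=> mY; have mS : measurable [set w | g (Y w) <= r + lo].
      by apply: (measurable_le_set (Y := g \o Y)); exact: measurableT_comp.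
    rewrite EFinB -Ex_finP// -probability_setC//; congr (P _).
    apply/seteqP; split => w /=; rewrite in_itv/= andbT ltrBrDr.
      by move=> h; apply/negP; rewrite -ltNge.
    by move/negP; rewrite -ltNge.
  rewrite /ccdf /distribution /pushforward !cE// -EFinD lee_fin.
  rewrite indicE mem_set/=; last by rewrite in_itv/= r0 rH.
  by have := sublevel_close (r + lo) ndg cg; rewrite ler_norml mulr1; lra.
have mI : measurable_fun [set: R] (fun r => (delta * \1_(`[0%R, hi - lo]%classic) r)%:E).
  apply/measurable_EFinP; apply: measurable_funM => //; exact: measurable_indic.
have : (\int[lebesgue_measure]_(r in `[0%R, +oo[) ccdf X1 r <=
    \int[lebesgue_measure]_(r in `[0%R, +oo[) (ccdf X2 r) + (delta * (hi - lo))%:E)%E.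
  have -> : (delta * (hi - lo))%:E = (\int[lebesgue_measure]_(r in `[0%R, +oo[)
      (delta * \1_(`[0%R, hi - lo]%classic) r)%:E)%E.
    under eq_integral do rewrite EFinM.
    rewrite ge0_integralZl//.
    - rewrite integral_indic//= (_ : _ `&` _ = `[0%R, hi - lo]%classic); last first.
        by apply: setIidl => x /=; rewrite !in_itv/= => /andP[->].
      rewrite lebesgue_measure_itv/= lte_fin.
      case: ifPn => [_|]; first by rewrite oppr0 adde0 EFinM.
      by rewrite -leNgt => h; rewrite mule0 (_ : hi - lo = 0) ?mulr0//; apply/eqP; rewrite eq_le h hilo.
    - by apply: measurable_funTS; apply/measurable_EFinP; exact: measurable_indic.
  rewrite -ge0_integralD//; first last.
  - exact: measurable_funTS.
  - by move=> r _; rewrite lee_fin mulr_ge0.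
  - by apply: measurable_funTS; exact: ccdf_measurable.
  apply: ge0_le_integral => //.
  - by apply: measurable_funTS; exact: ccdf_measurable.
  - by apply: emeasurable_funD; apply: measurable_funTS => //; exact: ccdf_measurable.
  - move=> r /=; rewrite in_itv/= andbT => r0; have [//|] := key r.
    by rewrite ltNge r0.
rewrite -E1 -E2 -EFinD lee_fin /= !ExB ?Ex_cst ?intg_cst//; first lra.
  by have := intgD ig2 (intg_cst P2 lo); under eq_fun do rewrite subrK.
by have := intgD ig1 (intg_cst P1 lo); under eq_fun do rewrite subrK.
Qed.

End CdfComparison.

Section SmoothComparison.
Context {R : realType} {d1 d2 : measure_display} {T1 : measurableType d1}
  {T2 : measurableType d2}.
Variables (P1 : probability T1 R) (P2 : probability T2 R).
Variables (Y1 : T1 -> R) (Y2 : T2 -> R) (delta : R).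
Hypotheses (mY1 : measurable_fun [set: T1] Y1) (mY2 : measurable_fun [set: T2] Y2).
Hypothesis delta0 : 0 <= delta.
Hypothesis cdf_close : forall u,
  `|fine (P1 [set w | Y1 w <= u]) - fine (P2 [set w | Y2 w <= u])| <= delta.

Lemma monotone_close (g : R -> R) (lo hi : R) : {homo g : x y / x <= y} ->
  continuous g -> (forall y, lo <= g y <= hi) ->
  `|\int[P1]_w g (Y1 w) - \int[P2]_w g (Y2 w)| <= delta * (hi - lo).
Proof.
move=> ndg cg gb.
have h1 := monotone_close_le mY1 mY2 delta0 cdf_close ndg cg gb.
have cdf_close' u :
    `|fine (P2 [set w | Y2 w <= u]) - fine (P1 [set w | Y1 w <= u])| <= delta.
  by rewrite distrC.
have h2 := monotone_close_le mY2 mY1 delta0 cdf_close' ndg cg gb.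
by rewrite ler_norml; apply/andP; split; lra.
Qed.

(* A function whose derivative is dominated by that of an arctangent is a
   difference of two bounded nondecreasing functions. *)
Lemma smooth_close (h dh : R -> R) (b c u v : R) : 0 < v -> 0 <= c ->
  (forall y : R, is_derive y 1 h (dh y)) -> (forall y, `|h y| <= b) ->
  (forall y, `|dh y| <= c * (v^-1 * (1 + ((y - u) / v) ^+ 2)^-1)) ->
  `|\int[P1]_w h (Y1 w) - \int[P2]_w h (Y2 w)| <= delta * (2 * b + 8 * c).
Proof.
move=> v0 c0 hd hb dhb.
pose at_ y := c * atan ((y - u) / v).
have dat (y : R) : is_derive y 1 at_ (c * (v^-1 * (1 + ((y - u) / v) ^+ 2)^-1)).
  have i1 : is_derive y 1 (fun y => (y - u) / v) v^-1.
    by apply: is_derive_eq; rewrite /GRing.scale/=; lra.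
  have i2 : is_derive y 1 (fun y => atan ((y - u) / v)) ((1 + ((y - u) / v) ^+ 2)^-1 * v^-1).
    exact: (@is_derive1_comp R atan (fun y => (y - u) / v) y _ _ (is_derive1_atan _) i1).
  by have := is_deriveZ c i2; rewrite mulrC.
have k0 y : 0 <= c * (v^-1 * (1 + ((y - u) / v) ^+ 2)^-1).
  apply: mulr_ge0 => //; apply: divr_ge0; first by rewrite invr_ge0 ltW.
  by rewrite addr_ge0// sqr_ge0.
have atb y : - (2 * c) <= at_ y <= 2 * c.
  have p2 := pihalf_lt2 R.
  have a1 := atan_ltpi2 ((y - u) / v); have a2 := atan_gtNpi2 ((y - u) / v).
  by rewrite /at_; apply/andP; split; nra.
have cat : continuous at_.
  move=> y; apply: differentiable_continuous; apply/derivable1_diffP.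
  by have := dat y; case.
have dsum (y : R) : is_derive y 1 (fun y => h y + at_ y)
    (dh y + c * (v^-1 * (1 + ((y - u) / v) ^+ 2)^-1)).
  exact: (is_deriveD (hd y) (dat y)).
have csum : continuous (fun y => h y + at_ y).
  move=> y; apply: differentiable_continuous; apply/derivable1_diffP.
  by have := dsum y; case.
(* As [pi / 2 < 2], the range of [at_] has length at most [4 * c] and that of [h + at_] at most
   [2 * b + 4 * c]; the two comparisons together cost [2 * b + 8 * c]. *)
have m1 := monotone_close (lo := - (2 * c)) (hi := 2 * c) (nondecreasing_derive dat k0) cat atb.
have sum0 y : 0 <= dh y + c * (v^-1 * (1 + ((y - u) / v) ^+ 2)^-1).
  by have := dhb y; rewrite ler_norml => /andP[+ _]; lra.
have sumb y : - b - 2 * c <= h y + at_ y <= b + 2 * c.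
  have := hb y; rewrite ler_norml => /andP[h1 h2].
  by have /andP[a1 a2] := atb y; apply/andP; split; lra.
have m2 := monotone_close (nondecreasing_derive dsum sum0) csum sumb.
have ch : continuous h.
  move=> y; apply: differentiable_continuous; apply/derivable1_diffP.
  by have := hd y; case.
have mh := continuous_measurable_fun ch.
have mat := continuous_measurable_fun cat.
have i1 d (T : measurableType d) (P : probability T R) (Y : T -> R) :
    measurable_fun [set: T] Y -> \int[P]_w (h (Y w) + at_ (Y w)) =
    \int[P]_w h (Y w) + \int[P]_w at_ (Y w).
  move=> mY; apply: ExD.
    apply: (@intg_bnd _ _ _ _ _ b) => //; exact: measurableT_comp mh mY.
  apply: (@intg_bnd _ _ _ _ _ (2 * c)).
    exact: measurableT_comp mat mY.
  by move=> w; rewrite ler_norml.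
rewrite !i1// in m2.
move: m1 m2; rewrite !ler_norml => /andP[? ?] /andP[? ?].
by apply/andP; split; nra.
Qed.

End SmoothComparison.

Section MollifiedBounds.
Context {R : realType} {dT : measure_display} {T : measurableType dT}.
Variables (P : probability T R) (Y : T -> R) (delta s : R).
Hypothesis mY : measurable_fun [set: T] Y.
Local Notation N := (normal_prob (0 : R) 1).
Hypotheses (s0 : 0 < s) (delta0 : 0 <= delta).
Hypothesis cdfY : forall u, `|fine (P [set w | Y w <= u]) - Phi (u / s)| <= delta.

Lemma normal_scale_cdf u : fine (N [set z | s * z <= u]) = Phi (u / s).
Proof.
congr (fine (N _)); apply/seteqP; split => z /=; rewrite in_itv/=.
  by rewrite ler_pdivlMr// mulrC.
by rewrite ler_pdivlMr// mulrC.
Qed.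

(** Converts a rate for the distribution function into bounds on the derivatives of the mollified
    law: they have the size [t ^- r] of the normal case, up to [delta / v ^+ r]. The factor [10] is
    [2 + 8] from [smooth_close] with [b = c]. *)
Lemma hexp_close r v u : (r < 4)%N -> 0 < v ->
  `|hexp P Y r v u| <= 10 * hermB * (delta / v ^+ r + (Num.sqrt (v ^+ 2 + s ^+ 2) ^+ r)^-1).
Proof.
move=> r4 v0; set t := Num.sqrt _.
have t0 : 0 < t by rewrite sqrtr_gt0 ltr_pwDl ?exprn_gt0// sqr_ge0.
have B0 := @hermB_gt0 R.
have vr0 : 0 < (v ^+ r)^-1 by rewrite invr_gt0 exprn_gt0.
have tr0 : 0 < (t ^+ r)^-1 by rewrite invr_gt0 exprn_gt0.
have hN : `|hexp N (fun z => s * z) r v u| <= hermB * (t ^+ r)^-1.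
  rewrite (hexp_normal s u (ltnW r4) v0) -/t normrM gtr0_norm// mulrC ler_wpM2r//.
    exact: ltW.
  exact: hermG_bounded.
pose h y := (v ^+ r)^-1 * hermG r ((u - y) / v).
have hd (y : R) : is_derive y 1 h (- ((v ^+ r.+1)^-1 * hermG r.+1 ((u - y) / v))).
  have i1 : is_derive y 1 (fun y => (u - y) / v) (- v^-1).
    by apply: is_derive_eq; rewrite /GRing.scale/=; lra.
  have i2 : is_derive y 1 (fun y => hermG r ((u - y) / v)) (hermG r.+1 ((u - y) / v) * - v^-1).
    exact: (@is_derive1_comp R (hermG r) (fun y => (u - y) / v) y _ _ (is_derive_hermG _ r4) i1).
  rewrite (_ : - (_ * _) = (v ^+ r)^-1 *: (hermG r.+1 ((u - y) / v) * - v^-1)).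
    exact: is_deriveZ.
  by rewrite /GRing.scale/= exprSr invfM; ring.
have hb y : `|h y| <= hermB / v ^+ r by exact: (hexp_fun_bound (fun _ : unit => y) r u tt v0).
have dhb y : `|- ((v ^+ r.+1)^-1 * hermG r.+1 ((u - y) / v))| <=
    (hermB / v ^+ r) * (v^-1 * (1 + ((y - u) / v) ^+ 2)^-1).
  rewrite normrN normrM ger0_norm; last by rewrite invr_ge0 exprn_ge0// ltW.
  rewrite exprSr invfM (_ : ((y - u) / v) ^+ 2 = ((u - y) / v) ^+ 2); last by field; rewrite gt_eqF.
  have := @hermG_decay R r.+1 ((u - y) / v) isT.
  set k := (1 + _)^-1 => hk.
  rewrite (_ : hermB / v ^+ r * (v^-1 * k) = (v ^+ r)^-1 * v^-1 * (hermB * k)); last by ring.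
  by rewrite ler_wpM2l//; apply: mulr_ge0; rewrite ltW// invr_gt0.
have cdfN w : `|fine (P [set w0 | Y w0 <= w]) - fine (N [set z | s * z <= w])| <= delta.
  by rewrite normal_scale_cdf.
have ms := measurable_scale s.
have c0 : 0 <= hermB / v ^+ r by rewrite ltW// divr_gt0// exprn_gt0.
have := smooth_close (P1 := P) (P2 := N) mY ms delta0 cdfN v0 c0 hd hb dhb.
rewrite -/(hexp P Y r v u) -/(hexp N (fun z => s * z) r v u) => h1.
rewrite -[hexp P Y r v u](subrK (hexp N (fun z => s * z) r v u)).
apply: (le_trans (ler_normD _ _)); move: h1 hN.
set A := `|_ - _|; set B := `|_|; set q := (v ^+ r)^-1 in vr0 *.
have bt : 0 <= hermB * (t ^+ r)^-1 by apply: mulr_ge0; exact: ltW.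
have E : delta * (2 * (hermB * q) + 8 * (hermB * q)) = 10 * hermB * (delta * q) by ring.
by rewrite E mulrDr => h1 h2; lra.
Qed.

End MollifiedBounds.

Lemma ExN {R : realType} {dT : measure_display} {T : measurableType dT}
  (P : probability T R) (f : T -> R) : intg P f ->
  \int[P]_x (- f x) = - \int[P]_x f x.
Proof.
move=> fi; rewrite -[RHS]mulN1r -ExZ//.
by apply: eq_Rintegral => x _; rewrite mulN1r.
Qed.

Section Desmoothing.
Context {R : realType} {dT : measure_display} {T : measurableType dT}.
Variables (P : probability T R) (Y : T -> R).
Hypothesis mY : measurable_fun [set: T] Y.
Local Notation N := (normal_prob (0 : R) 1).
Implicit Types (a s u v : R).

Lemma gpdf_le1 (x : R) : gpdf x <= 1.
Proof.
rewrite gpdfE; apply: mulr_ile1; [exact: normal_peak_ge0|exact: expR_ge0|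
  exact: normal_peak_le1|].
by rewrite -[leRHS]expR0 ler_expR oppr_le0 divr_ge0// sqr_ge0.
Qed.

Lemma Phi_lipschitz (x y : R) : `|Phi y - Phi x| <= `|y - x|.
Proof.
rewrite -[leRHS]mul1r; apply: (lipschitz_derive (@is_derive_Phi R)) => z.
by rewrite ger0_norm ?gpdf_ge0// gpdf_le1.
Qed.

Lemma fine_prob01 (A : set T) : measurable A -> 0 <= fine (P A) <= 1.
Proof.
move=> mA; rewrite fine_ge0//=.
by rewrite -lee_fin -Ex_finP// probability_le1.
Qed.

Lemma hexp0_cdf a u : 0 < a ->
  hexp P Y 0 a u = \int[N]_z fine (P [set w | Y w <= u - a * z]).
Proof.
move=> a0; pose A : set (T * measurableTypeR R) := [set wz | Y wz.1 + a * wz.2 <= u].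
have mA : measurable A.
  apply: (measurable_le_set (Y := fun wz : T * measurableTypeR R => Y wz.1 + a * wz.2)).
  by apply: measurable_funD; [exact: measurableT_comp|exact: measurable_funM].
have mF : measurable_fun [set: T * measurableTypeR R] (\1_A : _ -> R).
  exact: measurable_indic.
have Fb w z : `|\1_A (w, z) : R| <= 1 * 1.
  by rewrite mulr1 indicE; case: (_ \in _); rewrite ?normr1 ?normr0.
have := Ex_fubini mF (intg_cst P 1) (intg_cst N 1) Fb.
rewrite /hexp => E; transitivity (\int[P]_w \int[N]_z \1_A (w, z)).
  apply: eq_Rintegral => w _; rewrite expr0 invr1 mul1r /= -normal_scale_cdf//.
  rewrite -Ex_indic; last first.
    by apply: (measurable_le_set (Y := fun z : R => a * z)); exact: measurable_scale.
  apply: eq_Rintegral => z _; rewrite !indicE /A; congr ((_ : bool)%:R).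
  by apply/idP/idP; rewrite !inE/= lerBrDl.
rewrite E; apply: eq_Rintegral => z _.
rewrite -Ex_indic; last exact: measurable_le_set.
apply: eq_Rintegral => w _; rewrite !indicE /A; congr ((_ : bool)%:R).
by apply/idP/idP; rewrite !inE/= lerBrDr.
Qed.

(** A smoothing inequality with a Gaussian kernel. Monotonicity of the distribution function keeps
    the discrepancy [D] close to its value at [u] on a window of length [4 * a] on one side of [u].
    Outside the window only [- sup S] is known, but the recentred kernel gives it mass at most
    [1 / 4], so [sup S] is bounded in terms of a third of itself. *)
Lemma desmoothing (a s eps : R) : 0 < a -> 0 < s ->
  (forall u, `|hexp P Y 0 a u - Phi (u / Num.sqrt (a ^+ 2 + s ^+ 2))| <= eps) ->
  forall u, `|fine (P [set w | Y w <= u]) - Phi (u / s)| <= 2 * eps + 6 * (a / s).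
Proof.
move=> a0 s0 hyp.
pose F u := fine (P [set w | Y w <= u]).
pose D u := F u - Phi (u / s).
have mS u : measurable [set w | Y w <= u] by exact: measurable_le_set.
have F01 u : 0 <= F u <= 1 by exact: fine_prob01.
have Fmono u v : u <= v -> F u <= F v.
  move=> uv; rewrite /F -lee_fin -!Ex_finP// le_measure ?inE// => w /=.
  by move=> h; exact: le_trans uv.
have mF : measurable_fun [set: R] F by exact: nondecreasing_measurable.
have mP : measurable_fun [set: R] (fun u => Phi (u / s)).
  by apply: measurableT_comp; [exact: (@measurable_hermG R 0)|exact: measurable_funM].
have mD : measurable_fun [set: R] D by exact: measurable_funB.
have Db1 u : `|D u| <= 1.
  have /andP[h1 h2] := F01 u; have h3 := Phi_ge0 (u / s); have h4 := Phi_le1 (u / s).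
  by rewrite /D ler_norml; apply/andP; split; lra.
have Dint u : \int[N]_z D (u - a * z) =
    hexp P Y 0 a u - Phi (u / Num.sqrt (a ^+ 2 + s ^+ 2)).
  have maz : measurable_fun [set: R] (fun z => u - a * z).
    by apply: measurable_funB => //; exact: measurable_funM.
  rewrite hexp0_cdf// addrC [a ^+ 2 + _]addrC -hexp0_normal// addrC /hexp.
  rewrite -ExB; last 2 first.
  - apply: (@intg_bnd _ _ _ N _ 1); first exact: measurableT_comp mF maz.
    by move=> z; have /andP[h1 h2] := F01 (u - a * z); rewrite ger0_norm.
  - by apply: (intg_hexp N) => //; exact: measurable_scale.
  by apply: eq_Rintegral => z _; rewrite expr0 invr1 mul1r.
pose S := [set x | exists u, x = `|D u|].
have S0 : S !=set0 by exists `|D 0|, 0.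
have Sb : has_ubound S by exists 1 => x [u ->].
have Dle u : `|D u| <= sup S by apply: ub_le_sup => //; exists u.
have S0' : 0 <= sup S by exact: le_trans (Dle 0).
have k0 : 0 <= a / s by rewrite ltW// divr_gt0.
have eps0 : 0 <= eps by exact: le_trans (hyp 0).
have gd u v : `|v - u| <= 4 * a -> `|Phi (v / s) - Phi (u / s)| <= 4 * (a / s).
  move=> h; apply: (le_trans (Phi_lipschitz _ _)).
  by rewrite -mulrBl normrM [`|s^-1|]ger0_norm ?invr_ge0 ?(ltW s0)// mulrA ler_wpM2r ?invr_ge0 ?(ltW s0).
(* Chebyshev's inequality in integrated form: such an [f] dominates the parabola
   [c - (c + sup S) / 4 * z ^+ 2], whose mean follows from the unit variance of [z]. *)
have ineq (c : R) (f : R -> R) : measurable_fun [set: R] f -> (forall z, `|f z| <= 1) ->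
    0 <= c + sup S -> (forall z, `|z| <= 2 -> c <= f z) -> (forall z, - sup S <= f z) ->
    c - (c + sup S) / 4 <= \int[N]_z f z.
  move=> mf f1 cS fc fS.
  have -> : c - (c + sup S) / 4 = \int[N]_z (c - (c + sup S) / 4 * z ^+ 2).
    rewrite ExB ?Ex_cst; last 2 first.
    - exact: intg_cst.
    - by apply: intgZ; exact: intg_normal_sqr.
    by rewrite ExZ ?normal_variance ?mulr1//; exact: intg_normal_sqr.
  apply: Ex_le; last 1 first.
  - move=> z; have [z2|z2] := leP `|z| 2.
      apply: le_trans (fc z z2); rewrite gerBl mulr_ge0 ?sqr_ge0//.
      by rewrite divr_ge0.
    apply: le_trans (fS z).
    have : 4 <= z ^+ 2 by rewrite -real_normK ?num_real//; nra.
    by nra.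
  - apply: intgB; first exact: intg_cst.
    by apply: intgZ; exact: intg_normal_sqr.
  - exact: (@intg_bnd _ _ _ N _ 1).
have maz u : measurable_fun [set: R] (fun z => D (u - a * z)).
  apply: measurableT_comp mD _; apply: measurable_funB => //; exact: measurable_funM.
have main u : `|D u| <= 4 * (a / s) + 4 / 3 * eps + sup S / 3.
  have [cS|cS] := leP 0 (`|D u| - 4 * (a / s) + sup S); last by lra.
  have [Du|Du] := leP 0 (D u).
    have h := @ineq (`|D u| - 4 * (a / s)) (fun z => D (u + 2 * a - a * z)) (maz _)
      (fun z => Db1 _) cS.
    have h1 : forall z, `|z| <= 2 -> `|D u| - 4 * (a / s) <= D (u + 2 * a - a * z).
      move=> z; rewrite ler_norml => /andP[z1 z2]; rewrite ger0_norm// /D.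
      have := Fmono u (u + 2 * a - a * z); have := gd u (u + 2 * a - a * z).
      rewrite !ler_norml => /(_ _)/andP[]; first by apply/andP; split; nra.
      move=> _ h2 /(_ _); move: h2; nra.
    have h2 : forall z, - sup S <= D (u + 2 * a - a * z).
      by move=> z; have := Dle (u + 2 * a - a * z); rewrite ler_norml => /andP[].
    move: (h h1 h2); rewrite Dint; have := hyp (u + 2 * a).
    by rewrite ler_norml => /andP[_]; lra.
  have h := @ineq (`|D u| - 4 * (a / s)) (fun z => - D (u - 2 * a - a * z)).
  have h1 : forall z, `|z| <= 2 -> `|D u| - 4 * (a / s) <= - D (u - 2 * a - a * z).
    move=> z; rewrite ler_norml => /andP[z1 z2]; rewrite ltr0_norm// /D.
    have := Fmono (u - 2 * a - a * z) u; have := gd u (u - 2 * a - a * z).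
    rewrite !ler_norml => /(_ _)/andP[]; first by apply/andP; split; nra.
    move=> h2 _ /(_ _); move: h2; nra.
  have h2 : forall z, - sup S <= - D (u - 2 * a - a * z).
    by move=> z; rewrite lerN2; have := Dle (u - 2 * a - a * z); rewrite ler_norml => /andP[].
  have h3 : forall z, `|- D (u - 2 * a - a * z)| <= 1 by move=> z; rewrite normrN.
  have mN : measurable_fun [set: R] (fun z => - D (u - 2 * a - a * z)).
    by apply: measurable_funN; exact: maz.
  move: (h mN h3 cS h1 h2).
  have -> : \int[N]_z (- D (u - 2 * a - a * z)) = - \int[N]_z D (u - 2 * a - a * z).
    apply: (ExN (P := N)).
    by apply: (@intg_bnd _ _ _ N _ 1); [exact: maz|move=> z; exact: Db1].
  rewrite Dint; have := hyp (u - 2 * a).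
  by rewrite ler_norml => /andP[+ _]; lra.
(* Two thirds of the supremum remain on the left, which produces the constants [2] and [6]. *)
have supS : sup S <= 4 * (a / s) + 4 / 3 * eps + sup S / 3.
  by apply: ge_sup => // x [u ->].
by move=> u; apply: (le_trans (Dle u)); lra.
Qed.

End Desmoothing.

(** * Regenerative chains *)

Section GeometricSequences.
Context {R : realType}.
Implicit Types (rho c a : R) (u : nat -> R).

Lemma geometric_le_eq0 rho c a : 0 <= rho < 1 ->
  (forall n, `|a| <= c * rho ^+ n) -> a = 0.
Proof.
move=> /andP[r0 r1] h; apply/eqP; rewrite -normr_le0.
have : (fun n => c * rho ^+ n) @ \oo --> (c * 0 : R).
  by apply: cvgM; [exact: cvg_cst|apply: cvg_expr; rewrite ger0_norm].
rewrite mulr0 => hc; rewrite -(cvg_lim (@Rhausdorff R) hc).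
by apply: limr_ge; [apply/cvg_ex; exists 0|exact: nearW].
Qed.

(** With [e n] the tail of the geometric series, [u n - e n] increases and [u n + e n] decreases;
    the supremum of the former lies below every term of the latter, which yields the limit and the
    rate together. *)
Lemma geometric_limit rho c u : 0 <= rho < 1 ->
  (forall n, `|u n.+1 - u n| <= c * rho ^+ n) ->
  exists l, forall n, `|u n - l| <= c * rho ^+ n / (1 - rho).
Proof.
move=> /andP[r0 r1] hu; pose e n := c * rho ^+ n / (1 - rho).
have r10 : 0 < 1 - rho by rewrite subr_gt0.
have e_rec n : e n - e n.+1 = c * rho ^+ n.
  by rewrite /e exprS; field; rewrite gt_eqF.
have c0 : 0 <= c by have := hu 0%N; rewrite expr0 mulr1; apply: le_trans.
have e0 n : 0 <= e n by rewrite /e divr_ge0 ?mulr_ge0 ?exprn_ge0// ltW.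
pose a n := u n - e n; pose b n := u n + e n.
have a_nd : {homo a : m n / (m <= n)%N >-> m <= n}.
  apply: homo_leq => [//|x y z|n]; first exact: le_trans.
  have := hu n; have := e_rec n; rewrite /a ler_norml => ? /andP[? ?]; lra.
have b_ni : {homo b : m n / (m <= n)%N >-> n <= m}.
  apply: homo_leq => [//|x y z xy yz|n]; first exact: le_trans yz xy.
  have := hu n; have := e_rec n; rewrite /b ler_norml => ? /andP[? ?]; lra.
have ab m n : a m <= b n.
  have h1 := a_nd _ _ (leq_maxl m n); have h2 := b_ni _ _ (leq_maxr m n).
  have := e0 (maxn m n); move: h1 h2; rewrite /a /b; lra.
have uba : has_ubound (range a) by exists (b 0%N) => _ [m _ <-].
exists (sup (range a)) => n; rewrite -/(e n) ler_norml.
have h1 : a n <= sup (range a) by apply: ub_le_sup => //; exists n.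
have h2 : sup (range a) <= b n.
  by apply: ge_sup; [exists (a 0%N), 0%N|move=> _ [m _ <-]].
by move: h1 h2; rewrite /a /b => ? ?; apply/andP; split; lra.
Qed.

End GeometricSequences.

(** * The Poisson equation for a random map that forgets its argument with positive probability *)

Section PoissonEquation.
Context {R : realType} {dT dV : measure_display} {T : measurableType dT}
  {V : measurableType dV}.
Variables (P : probability T R) (tr : V -> R -> V) (x0 : V) (B : T -> V -> V)
  (Rk : set T).
Hypotheses (mB : measurable_fun [set: V * T] (fun p => B p.2 p.1))
  (B_tr : forall w x s, B w (tr x s) = tr (B w x) s) (mRk : measurable Rk)
  (B_rank1 : forall w, Rk w -> forall x, exists s, B w x = tr (B w x0) s).

(** Functions on the quotient of the state space by the translations [tr]. *)
Definition class_fun (f : V -> R) := forall x s, f (tr x s) = f x.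

Definition transfer (f : V -> R) (x : V) : R := \int[P]_w f (B w x).

(** A Lyapunov function for the dynamics killed on [Rk]. The contraction concerns only the
    complement of [Rk], where nothing is forgotten; the growth bound, with an arbitrary [cQ], keeps
    the iterates under control. *)
Record weight (rho cQ : R) (Q : V -> R) : Prop := Weight {
  weight_measurable : measurable_fun [set: V] Q;
  weight_class : class_fun Q;
  weight_ge0 : forall x, 0 <= Q x;
  weight_intg : forall x, intg P (fun w => Q (B w x));
  weight_growth : forall x, \int[P]_w Q (B w x) <= cQ * Q x;
  weight_contract : forall x, \int[P]_w (\1_(~` Rk) w * Q (B w x)) <= rho * Q x }.

Lemma measurable_B_comp (f : V -> R) x : measurable_fun [set: V] f ->
  measurable_fun [set: T] (fun w => f (B w x)).
Proof.
move=> mf; apply: measurableT_comp => //.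
exact: (measurableT_comp mB (pair1_measurable x)).
Qed.

Variables (rho cQ : R) (Q : V -> R).
Hypotheses (rho01 : 0 <= rho < 1) (wQ : weight rho cQ Q).

Lemma transfer_intg (f : V -> R) (C : R) x : measurable_fun [set: V] f ->
  (forall x, `|f x| <= C * Q x) -> intg P (fun w => f (B w x)).
Proof.
move=> mf fC; apply: (@intg_le _ _ _ _ _ (fun w => C * Q (B w x))) => //.
- exact: measurable_B_comp.
- exact/intgZ/(weight_intg wQ).
Qed.

Lemma transfer_measurable (f : V -> R) (C : R) : measurable_fun [set: V] f ->
  (forall x, `|f x| <= C * Q x) -> measurable_fun [set: V] (transfer f).
Proof.
move=> mf fC.
have mF : measurable_fun [set: V * T] (fun p => f (B p.2 p.1)).
  exact: measurableT_comp mf mB.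
by apply: (measurable_Ex mF) => x; exact: transfer_intg mf fC.
Qed.

Lemma transfer_bound (f : V -> R) (C : R) x : 0 <= C -> measurable_fun [set: V] f ->
  (forall x, `|f x| <= C * Q x) -> `|transfer f x| <= C * cQ * Q x.
Proof.
move=> C0 mf fC; rewrite /transfer.
have h := @Ex_norm_le _ _ _ P (fun w => f (B w x)) (fun w => C * Q (B w x))
  (measurable_B_comp x mf) (intgZ C (weight_intg wQ x)) (fun w => fC _).
apply: (le_trans h); rewrite ExZ; last exact: (weight_intg wQ).
by rewrite -mulrA ler_wpM2l// (weight_growth wQ).
Qed.

Lemma transfer_class (f : V -> R) : class_fun f -> class_fun (transfer f).
Proof. by move=> cf x s; apply: eq_Rintegral => w _; rewrite B_tr cf. Qed.

Lemma intg_indicM A (g : T -> R) : measurable A -> intg P g ->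
  intg P (fun w => \1_A w * g w).
Proof.
move=> mA; apply: (@intgMb _ _ _ _ _ _ 1); first exact: measurable_indic.
by move=> w; rewrite indicE; case: (_ \in _); rewrite ?normr1 ?normr0.
Qed.

(* On the rank one event the class of [B w x] does not depend on [x]. *)
Lemma transfer_contract (f : V -> R) (C D : R) : measurable_fun [set: V] f ->
  class_fun f -> (forall x, `|f x| <= C * Q x) -> 0 <= D ->
  (forall x y, `|f x - f y| <= D * (Q x + Q y)) ->
  forall x y, `|transfer f x - transfer f y| <= rho * D * (Q x + Q y).
Proof.
move=> mf cf fC D0 fD x y; have iQ := weight_intg wQ.
rewrite /transfer -ExB; last 2 first.
- exact: transfer_intg mf fC.
- exact: transfer_intg mf fC.
have mN : measurable (~` Rk) by exact: measurableC.
have b w : `|f (B w x) - f (B w y)| <=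
    D * (\1_(~` Rk) w * Q (B w x) + \1_(~` Rk) w * Q (B w y)).
  rewrite indicE; have [wR|wR] := pselect (Rk w).
    rewrite memNset//=.
    have [s ->] := B_rank1 wR x; have [t ->] := B_rank1 wR y.
    by rewrite !cf subrr normr0 !mul0r addr0 mulr0.
  by rewrite mem_set//= !mul1r.
have ii z : intg P (fun w => \1_(~` Rk) w * Q (B w z)) by exact: intg_indicM.
have h := @Ex_norm_le _ _ _ P (fun w => f (B w x) - f (B w y)) _ _ _ b.
apply: le_trans (h _ _) _.
- by apply: measurable_funB; exact: measurable_B_comp.
- by apply: intgZ; apply: intgD; exact: ii.
rewrite ExZ ?ExD//; last exact: intgD.
have := weight_contract wQ x; have := weight_contract wQ y => h1 h2.
rewrite (mulrC rho) -mulrA ler_wpM2l// mulrDr lerD//.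
Qed.

(** Relative to [Q], the oscillation of the iterates of [transfer] contracts by [rho] at each step,
    so the iterates converge geometrically to a constant [p], and [q] is the sum of their
    differences with [p]. The sign clause is what makes the limiting variance nonnegative. *)
Lemma poisson_equation (f : V -> R) (C : R) : 0 <= C -> measurable_fun [set: V] f ->
  class_fun f -> (forall x, `|f x| <= C * Q x) ->
  exists (p : R) (q : V -> R) (C' : R),
  [/\ 0 <= C', measurable_fun [set: V] q, class_fun q,
      forall x, `|q x| <= C' * Q x &
      (forall x, transfer q x = q x - f x + p) /\
      ((forall x, 0 <= f x) -> 0 <= p)].
Proof.
move=> C0 mf cf fC; have Q0 := weight_ge0 wQ; have iQ := weight_intg wQ.
have /andP[r0 r1] := rho01.
pose F k := iter k transfer f.
pose cB := `|cQ| + 1.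
have cB0 : 0 <= cB by rewrite addr_ge0.
have growth x : \int[P]_w Q (B w x) <= cB * Q x.
  apply: (le_trans (weight_growth wQ x)); rewrite ler_wpM2r//.
  by rewrite (le_trans (ler_norm _))// lerDl.
have HF k : [/\ measurable_fun [set: V] (F k), class_fun (F k),
    (exists2 Ck, 0 <= Ck & forall x, `|F k x| <= Ck * Q x) &
    forall x y, `|F k x - F k y| <= C * rho ^+ k * (Q x + Q y)].
  elim: k => [|k [mk ck [Ck Ck0 bk] ok]].
    split=> //; first by exists C.
    move=> x y; rewrite expr0 mulr1 mulrDr (le_trans (ler_normB _ _))//.
    by rewrite lerD.
  have fk : forall x, `|F k x| <= Ck * Q x by [].
  split.
  - exact: transfer_measurable mk fk.
  - exact: transfer_class.
  - exists (Ck * `|cQ|); first by rewrite mulr_ge0.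
    move=> x; apply: (le_trans (transfer_bound x Ck0 mk fk)).
    by rewrite -!mulrA ler_wpM2l// ler_wpM2r// ler_norm.
  - move=> x y; rewrite exprS mulrCA; apply: (transfer_contract mk ck fk) => //.
    by rewrite mulr_ge0 ?exprn_ge0.
have iF k x : intg P (fun w => F k (B w x)).
  by have [mk _ [Ck _ bk] _] := HF k; exact: transfer_intg mk bk.
have stepF k x : `|F k.+1 x - F k x| <= C * (cB + 1) * Q x * rho ^+ k.
  have [mk ck _ ok] := HF k.
  rewrite -[X in _ - X](Ex_cst P (F k x)) -ExB//; last exact: intg_cst.
  have h := @Ex_norm_le _ _ _ P (fun w => F k (B w x) - F k x)
    (fun w => C * rho ^+ k * (Q (B w x) + Q x)) _ _ (fun w => ok _ _).
  apply: (le_trans (h _ _)).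
  - by apply: measurable_funB => //; exact: measurable_B_comp.
  - by apply: intgZ; apply: intgD => //; exact: intg_cst.
  rewrite ExZ ?ExD ?Ex_cst//; last 2 first.
  - exact: intg_cst.
  - by apply: intgD => //; exact: intg_cst.
  rewrite (_ : C * (cB + 1) * Q x * rho ^+ k = C * rho ^+ k * (cB * Q x + Q x)); last by ring.
  by rewrite ler_wpM2l ?mulr_ge0 ?exprn_ge0// lerD2r.
pose C1 := C * (cB + 1) / (1 - rho).
have r10 : 0 < 1 - rho by rewrite subr_gt0.
have C10 : 0 <= C1 by rewrite /C1 divr_ge0 ?mulr_ge0 ?(ltW r10)// addr_ge0.
have limF x : exists l, forall n, `|F n x - l| <= C1 * Q x * rho ^+ n.
  have [l hl] := geometric_limit rho01 (stepF ^~ x).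
  exists l => n; apply: (le_trans (hl n)).
  by rewrite /C1 le_eqVlt; apply/orP; left; apply/eqP; field; rewrite gt_eqF.
have [p0 hp0] := limF x0.
(* The limit is the same from every starting point, since the oscillation of [F k] tends to zero. *)
have limFp x n : `|F n x - p0| <= C1 * Q x * rho ^+ n.
  have [l hl] := limF x; suff -> : p0 = l by [].
  apply/eqP; rewrite -subr_eq0; apply/eqP.
  apply: (@geometric_le_eq0 R rho (C1 * Q x0 + C * (Q x0 + Q x) + C1 * Q x)) => // k.
  have [_ _ _ ok] := HF k.
  rewrite (_ : p0 - l = - (F k x0 - p0) + (F k x0 - F k x) + (F k x - l)); last by ring.
  rewrite !mulrDl; apply: (le_trans (ler_normD _ _)); rewrite lerD//.
  apply: (le_trans (ler_normD _ _)); rewrite normrN lerD//.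
  by rewrite mulrAC; exact: ok.
pose S n x := \sum_(k < n) (F k x - p0).
have SS n x : S n.+1 x - S n x = F n x - p0 by rewrite /S big_ord_recr/= [X in X - _]addrC addrK.
have limS x : exists l, forall n, `|S n x - l| <= C1 * Q x * rho ^+ n / (1 - rho).
  by apply: geometric_limit => // n; rewrite SS.
have [q qP] := choice limS.
have mS n : measurable_fun [set: V] (S n).
  apply: measurable_sum => k; apply: measurable_funB => //; by have [] := HF k.
have cvgS x : S n x @[n --> \oo] --> q x.
  apply/cvgrPdist_le => e e0; near=> n; rewrite distrC.
  apply: (le_trans (qP x n)); rewrite -mulrA mulrC.
  near: n; have : (fun n => rho ^+ n / (1 - rho) * (C1 * Q x)) @ \oo --> (0 / (1 - rho) * (C1 * Q x)).
    apply: cvgM; last exact: cvg_cst.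
    by apply: cvgM; [apply: cvg_expr; rewrite ger0_norm|exact: cvg_cst].
  rewrite !mul0r => /cvgrPdist_le/(_ e e0); apply: filterS => n.
  by rewrite sub0r normrN; apply: le_trans; rewrite ler_norm.
have mq : measurable_fun [set: V] q.
  exact: (measurable_fun_cvg mS (fun x _ => cvgS x)).
have Sc n : class_fun (S n).
  move=> x s; apply: eq_bigr => k _; by have [_ -> _ _] := HF k.
have cq : class_fun q.
  move=> x s; apply: (cvg_unique _ (cvgS (tr x s))) => //.
  rewrite (_ : (fun n => S n (tr x s)) = (fun n => S n x)); first exact: cvgS.
  by apply/funext => n; rewrite Sc.
pose C2 := C1 / (1 - rho).
have C20 : 0 <= C2 by rewrite /C2 divr_ge0// ltW.
have qb x : `|q x| <= C2 * Q x.
  have := qP x 0%N; rewrite {1}/S big_ord0 sub0r normrN expr0 mulr1.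
  by rewrite /C2 mulrAC.
have iS n x : intg P (fun w => S n (B w x)).
  rewrite /S; elim: n => [|n IH].
    by under eq_fun do rewrite big_ord0; exact: intg_cst.
  under eq_fun do rewrite big_ord_recr/=.
  by apply: intgD => //; apply: intgB => //; exact: intg_cst.
have iq x : intg P (fun w => q (B w x)) by exact: transfer_intg mq qb.
have LS n x : transfer (S n) x = S n.+1 x - (f x - p0).
  elim: n => [|n IH].
    rewrite /transfer /S big_ord_recl big_ord0 /= addr0 subrr.
    by under eq_Rintegral do rewrite big_ord0; exact: Ex_cst.
  have -> : transfer (S n.+1) x = transfer (S n) x + (F n.+1 x - p0).
    rewrite /transfer -[X in _ + (_ - X)](Ex_cst P p0) -ExB//; last exact: intg_cst.
    rewrite -ExD//; last by apply: intgB => //; exact: intg_cst.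
    by apply: eq_Rintegral => w _; rewrite /S big_ord_recr.
  rewrite IH; have := SS n.+1 x; lra.
exists p0, q, C2; split=> //; split=> [x|f0].
- apply/eqP; rewrite -subr_eq0; apply/eqP.
  apply: (@geometric_le_eq0 R rho (C2 * cB * Q x + C2 * Q x)) => // n.
  have h1 : `|transfer q x - transfer (S n) x| <= C2 * cB * Q x * rho ^+ n.
    rewrite /transfer -ExB//.
    have b w : `|q (B w x) - S n (B w x)| <= C2 * rho ^+ n * Q (B w x).
      rewrite distrC; apply: (le_trans (qP _ n)).
      by rewrite /C2 le_eqVlt; apply/orP; left; apply/eqP; field; rewrite gt_eqF.
    have h := @Ex_norm_le _ _ _ P _ _ _ _ b.
    apply: (le_trans (h _ _)).
    + by apply: measurable_funB; exact: measurable_B_comp.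
    + exact: intgZ.
    rewrite ExZ//.
    rewrite (_ : C2 * cB * Q x * rho ^+ n = C2 * rho ^+ n * (cB * Q x)); last by ring.
    by rewrite ler_wpM2l// mulr_ge0 ?exprn_ge0.
  have h2 : `|S n.+1 x - q x| <= C2 * Q x * rho ^+ n.
    apply: (le_trans (qP x n.+1)); rewrite exprS /C2.
    rewrite (_ : C1 * Q x * (rho * rho ^+ n) / (1 - rho) = rho * (C1 / (1 - rho) * Q x * rho ^+ n)); last by field; rewrite gt_eqF.
    rewrite -/C2; apply: ler_piMl; last exact: ltW.
    by apply: mulr_ge0; [exact: mulr_ge0|exact: exprn_ge0].
  rewrite (_ : _ - _ = (transfer q x - transfer (S n) x) + (S n.+1 x - q x)).
    by rewrite mulrDl; apply: (le_trans (ler_normD _ _)); rewrite lerD.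
  by rewrite LS; ring.
- have F0 n x : 0 <= F n x.
    by elim: n x => [|n IH] x; [exact: f0|apply: Ex_ge0 => w; exact: IH].
  rewrite leNgt; apply/negP => p00.
  have : - p0 = 0.
    apply: (@geometric_le_eq0 R rho (C1 * Q x0)) => // n.
    apply: le_trans (limFp x0 n); have := F0 n x0.
    by move=> h; rewrite !ger0_norm; lra.
  lra.
Unshelve. all: by end_near. Qed.

End PoissonEquation.

Section Corrector.
Context {R : realType} {dT dV : measure_display} {T : measurableType dT}
  {V : measurableType dV}.
Variables (P : probability T R) (tr : V -> R -> V) (x0 : V).

(* [B] is a random equivariant map of rank one on [Rk]; [m] controls the growth of
   the weights [U <= W] along [B]. *)
Record regenerative (B : T -> V -> V) (Rk : set T) (rho K : R) (m : T -> R)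
    (U W : V -> R) : Prop := Regenerative {
  rg_mB : measurable_fun [set: V * T] (fun p => B p.2 p.1);
  rg_tr : forall w x s, B w (tr x s) = tr (B w x) s;
  rg_mRk : measurable Rk;
  rg_rank1 : forall w, Rk w -> forall x, exists s, B w x = tr (B w x0) s;
  rg_mm : measurable_fun [set: T] m;
  rg_m1 : forall w, 1 <= m w;
  rg_m3 : intg P (fun w => m w ^+ 3);
  rg_rho : 0 <= rho < 1;
  rg_mN : \int[P]_w (\1_(~` Rk) w * m w ^+ 3) <= rho;
  rg_K : 0 <= K;
  rg_mU : measurable_fun [set: V] U;
  rg_mW : measurable_fun [set: V] W;
  rg_cU : class_fun tr U;
  rg_cW : class_fun tr W;
  rg_U1 : forall x, 1 <= U x;
  rg_UW : forall x, U x <= W x;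
  rg_BU : forall w x, U (B w x) <= m w * U x;
  rg_BW : forall w x, W (B w x) <= m w * W x;
  rg_RU : forall w x, Rk w -> U (B w x) <= K * m w;
  rg_RW : forall w x, Rk w -> W (B w x) <= K * m w;
  rg_int : intg P (fun w => \1_Rk w * (U (B w x0) ^+ 3 * m w)) }.

Definition equivariant (f : V -> R) := forall x s, f (tr x s) = f x + s.

Variables (B : T -> V -> V) (Rk : set T) (rho K : R) (m : T -> R) (U W : V -> R).
Hypothesis rgB : regenerative B Rk rho K m U W.

Lemma rg_m_ge0 w : 0 <= m w.
Proof. exact: le_trans ler01 (rg_m1 rgB w). Qed.

Lemma rg_m_le i w : (i <= 3)%N -> m w ^+ i <= m w ^+ 3.
Proof. by move=> i3; apply: ler_weXn2l => //; exact: (rg_m1 rgB). Qed.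

Lemma rg_intg_m i : (i <= 3)%N -> intg P (fun w => m w ^+ i).
Proof.
move=> i3; apply: (@intg_le _ _ _ _ _ (fun w => m w ^+ 3)).
- by apply: measurable_funX; exact: (rg_mm rgB).
- exact: (rg_m3 rgB).
- by move=> w; rewrite ger0_norm ?exprn_ge0 ?rg_m_ge0// rg_m_le.
Qed.

Lemma rg_W1 x : 1 <= W x.
Proof. exact: le_trans (rg_U1 rgB x) (rg_UW rgB x). Qed.

(** Because [1 <= m], the bound on the third moment of [m] off [Rk] serves for all lower powers,
    with the same [rho]. *)
Lemma weight_pow (Q : V -> R) i : (i <= 3)%N -> measurable_fun [set: V] Q ->
  class_fun tr Q -> (forall x, 1 <= Q x) -> (forall w x, Q (B w x) <= m w * Q x) ->
  weight P tr B Rk rho (\int[P]_w m w ^+ 3) (fun x => Q x ^+ i).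
Proof.
move=> i3 mQ cQ Q1 BQ; have Q0 x : 0 <= Q x by exact: le_trans (Q1 x).
have mQi : measurable_fun [set: V] (fun x => Q x ^+ i) by exact: measurable_funX.
have b w x : Q (B w x) ^+ i <= Q x ^+ i * m w ^+ 3.
  apply: (@le_trans _ _ (m w ^+ i * Q x ^+ i)).
    rewrite -exprMn; apply: lerXn2r; rewrite ?nnegrE//.
    by rewrite mulr_ge0 ?rg_m_ge0.
  by rewrite mulrC ler_wpM2l ?exprn_ge0// rg_m_le.
have iQ x : intg P (fun w => Q (B w x) ^+ i).
  apply: (@intg_le _ _ _ _ _ (fun w => Q x ^+ i * m w ^+ 3)).
  - exact: (measurable_B_comp (rg_mB rgB) x mQi).
  - exact/intgZ/rg_intg_m.
  - by move=> w; rewrite ger0_norm ?exprn_ge0.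
split=> //.
- by move=> x s; rewrite cQ.
- by move=> x; rewrite exprn_ge0.
- move=> x; rewrite mulrC -ExZ; last exact: rg_intg_m.
  by apply: Ex_le => //; exact/intgZ/rg_intg_m.
- move=> x; have mN : measurable (~` Rk) by exact/measurableC/(rg_mRk rgB).
  have i1 := intg_indicM mN (rg_m3 rgB).
  apply: (@le_trans _ _ (\int[P]_w (Q x ^+ i * (\1_(~` Rk) w * m w ^+ 3)))).
    apply: Ex_le; [exact: intg_indicM|exact: intgZ|].
    by move=> w; rewrite mulrCA ler_wpM2l// indicE.
  by rewrite ExZ// mulrC ler_wpM2r ?exprn_ge0// (rg_mN rgB).
Qed.

Lemma weight_U i : (i <= 3)%N ->
  weight P tr B Rk rho (\int[P]_w m w ^+ 3) (fun x => U x ^+ i).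
Proof.
by move=> i3; apply: weight_pow => //; [exact: rg_mU rgB|exact: rg_cU rgB|exact: rg_U1 rgB|exact: rg_BU rgB].
Qed.

Lemma weight_W i : (i <= 3)%N ->
  weight P tr B Rk rho (\int[P]_w m w ^+ 3) (fun x => W x ^+ i).
Proof.
by move=> i3; apply: weight_pow => //; [exact: rg_mW rgB|exact: rg_cW rgB|exact: rg_W1|exact: rg_BW rgB].
Qed.

(** The mean increment of [phi] is of order [U] and the conditional variance of order [U ^+ 2]; the
    solutions of the two Poisson equations inherit these weights. The variance must be taken after
    the first correction, since it is that of the increments of [phis]. *)
Lemma corrector (phi : V -> R) (Cphi : R) : 0 <= Cphi ->
  measurable_fun [set: V] phi -> equivariant phi ->
  (forall w x, `|phi (B w x) - phi x| <= Cphi * (m w * U x)) ->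
  exists (g s2 : R) (phis q : V -> R) (C : R),
  [/\ 0 <= C, 0 <= s2, measurable_fun [set: V] phis, equivariant phis &
      forall x, `|phis x - phi x| <= C * U x] /\
  [/\ forall w x, `|phis (B w x) - phis x - g| <= C * (m w * U x),
      forall x, \int[P]_w (phis (B w x) - phis x - g) = 0,
      measurable_fun [set: V] q /\ class_fun tr q,
      forall x, `|q x| <= C * U x ^+ 2 &
      forall x, \int[P]_w q (B w x) =
        q x - \int[P]_w (phis (B w x) - phis x - g) ^+ 2 + s2].
Proof.
move=> Cp0 mphi ephi phiB.
have mB := rg_mB rgB; have Btr := rg_tr rgB.
have U0 x : 0 <= U x by exact: le_trans (rg_U1 rgB x).
have m0 := rg_m_ge0.
have w1 := weight_U (isT : (1 <= 3)%N); have w2 := weight_U (isT : (2 <= 3)%N).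
have rho01 := rg_rho rgB.
have mBF (f : V -> R) : measurable_fun [set: V] f ->
    measurable_fun [set: V * T] (fun p => f (B p.2 p.1)).
  by move=> mf; exact: measurableT_comp mf mB.
have mB1 (f : V -> R) x : measurable_fun [set: V] f ->
    measurable_fun [set: T] (fun w => f (B w x)).
  by move=> mf; exact: (measurable_B_comp mB x mf).
have im1 : intg P m by have := rg_intg_m (isT : (1 <= 3)%N).
have im2 := rg_intg_m (isT : (2 <= 3)%N).
pose Em := \int[P]_w m w.
have Em0 : 0 <= Em by exact: Ex_ge0.
pose f0 x := \int[P]_w (phi (B w x) - phi x).
have i0 x : intg P (fun w => phi (B w x) - phi x).
  apply: (@intg_le _ _ _ _ _ (fun w => Cphi * U x * m w)).
  - by apply: measurable_funB => //; exact: mB1.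
  - exact: intgZ.
  - by move=> w; rewrite -mulrA [U x * _]mulrC.
have mf0 : measurable_fun [set: V] f0.
  apply: (@measurable_Ex _ _ _ V T P (fun p => phi (B p.2 p.1) - phi p.1)) => //.
  by apply: measurable_funB; [exact: mBF|exact: measurableT_comp].
have cf0 : class_fun tr f0.
  by move=> x s; apply: eq_Rintegral => w _; rewrite Btr !ephi; ring.
have f0b x : `|f0 x| <= Cphi * Em * U x ^+ 1.
  have h := @Ex_norm_le _ _ _ P (fun w => phi (B w x) - phi x) (fun w => Cphi * U x * m w).
  apply: (le_trans (h _ _ _)).
  - by apply: measurable_funB => //; exact: mB1.
  - exact: intgZ.
  - by move=> w; rewrite -mulrA [U x * _]mulrC.
  - by rewrite ExZ// expr1 mulrAC.
have C00 : 0 <= Cphi * Em by exact: mulr_ge0.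
have [g [q0 [C1 [C10 mq0 cq0 q0b [Lq0 _]]]]] :=
  poisson_equation mB Btr (rg_mRk rgB) (rg_rank1 rgB) rho01 w1 C00 mf0 cf0 f0b.
have {}q0b x : `|q0 x| <= C1 * U x by have := q0b x; rewrite expr1.
pose phis x := phi x + q0 x.
have mphis : measurable_fun [set: V] phis by exact: measurable_funD.
have ephis : equivariant phis by move=> x s; rewrite /phis ephi cq0; ring.
pose C2 := Cphi + C1 + C1 + `|g|.
pose xi w x := phis (B w x) - phis x - g.
have xib w x : `|xi w x| <= C2 * (m w * U x).
  have mU1 : 1 <= m w * U x.
    by rewrite mulr_ege1// ?(rg_m1 rgB)// (rg_U1 rgB).
  have Um : U x <= m w * U x by rewrite ler_peMl// (rg_m1 rgB).
  rewrite (_ : xi w x = (phi (B w x) - phi x) + q0 (B w x) - q0 x - g); last first.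
    by rewrite /xi /phis; ring.
  rewrite /C2 !mulrDl; apply: (le_trans (ler_normB _ _)); apply: lerD; last first.
    by rewrite ler_peMr.
  apply: (le_trans (ler_normB _ _)); apply: lerD; last first.
    by apply: (le_trans (q0b x)); rewrite ler_wpM2l.
  apply: (le_trans (ler_normD _ _)); apply: lerD => //.
  by apply: (le_trans (q0b _)); rewrite ler_wpM2l// (rg_BU rgB).
have mxi : measurable_fun [set: V * T] (fun p => xi p.2 p.1).
  apply: measurable_funB => //; apply: measurable_funB; first exact: mBF.
  exact: measurableT_comp.
have mxi1 x : measurable_fun [set: T] (fun w => xi w x).
  by apply: measurable_funB => //; apply: measurable_funB => //; exact: mB1.
have C20 : 0 <= C2 by rewrite /C2 !addr_ge0.
have iq0 x : intg P (fun w => q0 (B w x)).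
  apply: (@intg_le _ _ _ _ _ (fun w => C1 * U x * m w)).
  - exact: mB1.
  - exact: intgZ.
  - move=> w; apply: (le_trans (q0b _)); rewrite -mulrA ler_wpM2l// mulrC.
    exact: (rg_BU rgB).
have xi0 x : \int[P]_w xi w x = 0.
  transitivity (\int[P]_w ((phi (B w x) - phi x) + (q0 (B w x) - (q0 x + g)))).
    by apply: eq_Rintegral => w _; rewrite /xi /phis; ring.
  rewrite ExD//; last by apply: intgB => //; exact: intg_cst.
  rewrite [X in _ + X]ExB ?Ex_cst//; last exact: intg_cst.
  by have := Lq0 x; rewrite /transfer /f0 => ->; ring.
pose v x := \int[P]_w (xi w x) ^+ 2.
have xi2b w x : `|xi w x ^+ 2| <= C2 ^+ 2 * U x ^+ 2 * m w ^+ 2.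
  rewrite normrX -!exprMn; apply: lerXn2r; rewrite ?nnegrE//.
    by rewrite !mulr_ge0.
  by rewrite -mulrA [U x * _]mulrC.
have ixi2 x : intg P (fun w => xi w x ^+ 2).
  apply: (@intg_le _ _ _ _ _ (fun w => C2 ^+ 2 * U x ^+ 2 * m w ^+ 2)) => //.
  - exact: measurable_funX.
  - exact: intgZ.
have mv : measurable_fun [set: V] v.
  apply: (@measurable_Ex _ _ _ V T P (fun p => xi p.2 p.1 ^+ 2)) => //.
  exact: measurable_funX.
have cv : class_fun tr v.
  by move=> x s; apply: eq_Rintegral => w _; rewrite /xi Btr !ephis; congr (_ ^+ 2); ring.
have vb x : `|v x| <= C2 ^+ 2 * (\int[P]_w m w ^+ 2) * U x ^+ 2.
  have h := @Ex_norm_le _ _ _ P (fun w => xi w x ^+ 2) (fun w => C2 ^+ 2 * U x ^+ 2 * m w ^+ 2).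
  apply: (le_trans (h _ _ _)) => //.
  - exact: measurable_funX.
  - exact: intgZ.
  - by rewrite ExZ// mulrAC.
have Cv0 : 0 <= C2 ^+ 2 * (\int[P]_w m w ^+ 2).
  by rewrite mulr_ge0 ?sqr_ge0//; apply: Ex_ge0 => w; rewrite sqr_ge0.
have [s2 [q [C3 [C30 mq cq qb [Lq s20]]]]] :=
  poisson_equation mB Btr (rg_mRk rgB) (rg_rank1 rgB) rho01 w2 Cv0 mv cv vb.
exists g, s2, phis, q, (C1 + C2 + C3); split; split => //.
- by rewrite !addr_ge0.
- by apply: s20 => x; apply: Ex_ge0 => w; rewrite sqr_ge0.
- move=> x; rewrite /phis addrAC subrr add0r (le_trans (q0b x))// ler_wpM2r//.
  by rewrite -addrA lerDl addr_ge0.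
- move=> w x; apply: (le_trans (xib w x)); rewrite ler_wpM2r ?mulr_ge0//.
  by rewrite -addrA addrCA lerDl addr_ge0.
- move=> x; apply: (le_trans (qb x)); rewrite ler_wpM2r ?exprn_ge0//.
  by rewrite lerDr addr_ge0.
Qed.

End Corrector.

(** * Markov chains driven by a regenerative map, and the splitting at the last regeneration *)

Section RegenerativeChain.
Context {R : realType} {dT dV : measure_display} {T : measurableType dT}
  {V : measurableType dV}.
Variables (P : probability T R) (tr : V -> R -> V) (x0 : V).
Variables (B : T -> V -> V) (Rk : set T) (rho K : R) (m : T -> R) (U W : V -> R).
Hypothesis rgB : regenerative P tr x0 B Rk rho K m U W.

Record translation : Prop := Translation {
  tr_D : forall x s t, tr (tr x s) t = tr x (s + t);
  tr_0 : forall x, tr x 0 = x;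
  tr_measurable : measurable_fun [set: V * measurableTypeR R] (fun p => tr p.1 p.2) }.

Hypothesis trT : translation.

(** The output of [corrector] once the drift has been removed by a translation: [phi] is a
    martingale along [B], and [q] compensates the fluctuations of its conditional variance around
    [s ^+ 2]. *)
Record harmonic (phi q : V -> R) (s Cx : R) : Prop := Harmonic {
  hm_C : 0 <= Cx;
  hm_m : measurable_fun [set: V] phi;
  hm_e : equivariant tr phi;
  hm_b : forall w x, `|phi (B w x) - phi x| <= Cx * (m w * U x);
  hm_0 : forall x, \int[P]_w (phi (B w x) - phi x) = 0;
  hm_mq : measurable_fun [set: V] q;
  hm_cq : class_fun tr q;
  hm_qb : forall x, `|q x| <= Cx * U x ^+ 2;
  hm_q : forall x, \int[P]_w q (B w x) =
    q x - \int[P]_w (phi (B w x) - phi x) ^+ 2 + s ^+ 2 }.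

(** Only the one-dimensional marginals are prescribed: the next law is obtained from a fresh
    independent sample [w']. This is all that the replacement argument requires of the process. *)
Record chain (x : V) (X : nat -> T -> V) : Prop := Chain {
  ch_m : forall k, measurable_fun [set: T] (X k);
  ch_0 : forall w, X 0%N w = x;
  ch_step : forall k (f : V -> \bar R), measurable_fun [set: V] f ->
    (forall y, 0 <= f y)%E ->
    (\int[P]_w f (X k.+1 w) = \int[P]_w \int[P]_w' f (B w' (X k w)))%E }.

Variables (phi q : V -> R) (s Cx : R) (x : V) (X : nat -> T -> V).
Hypotheses (hmB : harmonic phi q s Cx) (chX : chain x X).

Let mB := rg_mB rgB.

Lemma measurable_B2 dY (Y : measurableType dY) (g : Y -> V) (h : Y -> T) :
  measurable_fun [set: Y] g -> measurable_fun [set: Y] h ->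
  measurable_fun [set: Y] (fun w => B (h w) (g w)).
Proof. by move=> mg mh; exact: (measurableT_comp mB (measurable_fun_pair mg mh)). Qed.

Lemma measurable_tr2 dY (Y : measurableType dY) (g : Y -> V) (h : Y -> R) :
  measurable_fun [set: Y] g -> measurable_fun [set: Y] h ->
  measurable_fun [set: Y] (fun w => tr (g w) (h w)).
Proof.
move=> mg mh; have mh' : measurable_fun [set: Y] (h : Y -> measurableTypeR R) by [].
exact: (measurableT_comp (tr_measurable trT) (measurable_fun_pair mg mh')).
Qed.

Lemma measurable_X1 dY (Y : measurableType dY) (h : Y -> T) k :
  measurable_fun [set: Y] h -> measurable_fun [set: Y] (fun w => X k (h w)).
Proof. by move=> mh; exact: (measurableT_comp (ch_m chX k) mh). Qed.

Lemma measurable_transfer_X (f : V -> R) k : measurable_fun [set: V] f ->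
  measurable_fun [set: T * T] (fun ww => f (B ww.2 (X k ww.1))).
Proof.
move=> mf; apply: measurableT_comp => //; apply: measurable_B2 => //.
exact: measurable_X1.
Qed.

Section WithWeight.
Variables (cQ : R) (Q : V -> R).
Hypothesis wQ : weight P tr B Rk rho cQ Q.

Lemma transfer_nonneg_X (f : V -> R) k : measurable_fun [set: V] f ->
  (forall y, 0 <= f y) -> (forall y, intg P (fun w => f (B w y))) ->
  (\int[P]_w (f (X k.+1 w))%:E = \int[P]_w (transfer P B f (X k w))%:E)%E.
Proof.
move=> mf f0 fi; rewrite (ch_step chX k (f := fun y => (f y)%:E)).
- by apply: eq_integral => w _; rewrite Ex_EFin.
- exact/measurable_EFinP.
- by move=> y; rewrite lee_fin.
Qed.

Lemma intg_X k : intg P (fun w => Q (X k w)).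
Proof.
have mQ := weight_measurable wQ; have Q0 := weight_ge0 wQ.
have mQX j : measurable_fun [set: T] (fun w => Q (X j w)).
  by apply: measurableT_comp => //; exact: ch_m chX _.
elim: k => [|k IH].
  by under eq_fun do rewrite (ch_0 chX); exact: intg_cst.
apply: intg_ge0_lty => //.
rewrite transfer_nonneg_X//; last exact: weight_intg wQ.
have iB : intg P (fun w => transfer P B Q (X k w)).
  apply: (@intg_le _ _ _ _ _ (fun w => `|cQ| * Q (X k w))).
  - apply: measurableT_comp; last exact: ch_m chX _.
    have Qle : forall y, `|Q y| <= 1 * Q y by move=> y; rewrite mul1r ger0_norm.
    exact: (transfer_measurable mB wQ mQ Qle).
  - exact: intgZ.
  - move=> w; rewrite ger0_norm; last exact: Ex_ge0.
    by apply: (le_trans (weight_growth wQ _)); rewrite ler_wpM2r// ler_norm.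
by rewrite Ex_EFin// ltry.
Qed.

Lemma intg_comp_X (f : V -> R) (c : R) k : measurable_fun [set: V] f ->
  (forall y, `|f y| <= c * Q y) -> intg P (fun w => f (X k w)).
Proof.
move=> mf fc; apply: (@intg_le _ _ _ _ _ (fun w => c * Q (X k w))).
- by apply: measurableT_comp => //; exact: ch_m chX _.
- exact/intgZ/intg_X.
- by move=> w; exact: fc.
Qed.

Lemma intg_transfer_X (f : V -> R) (c : R) k : 0 <= c -> measurable_fun [set: V] f ->
  (forall y, `|f y| <= c * Q y) -> intg P (fun w => transfer P B f (X k w)).
Proof.
move=> c0 mf fc; apply: (@intg_comp_X _ (c * cQ)).
- exact: (transfer_measurable mB wQ mf fc).
- by move=> y; exact: (transfer_bound mB wQ y c0 mf fc).
Qed.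

(** The transition rule is given for nonnegative functions; adding [c * Q] brings a dominated
    function to that case. *)
Lemma step_X (f : V -> R) (c : R) k : 0 <= c -> measurable_fun [set: V] f ->
  (forall y, `|f y| <= c * Q y) ->
  \int[P]_w f (X k.+1 w) = \int[P]_w transfer P B f (X k w).
Proof.
move=> c0 mf fc; have mQ := weight_measurable wQ; have Q0 := weight_ge0 wQ.
have mcQ : measurable_fun [set: V] (fun y => c * Q y) by exact: measurable_funM.
have cQb y : `|c * Q y| <= c * Q y by rewrite ger0_norm// mulr_ge0.
have mg : measurable_fun [set: V] (fun y => f y + c * Q y) by exact: measurable_funD.
have g0 y : 0 <= f y + c * Q y by have := fc y; rewrite ler_norml => /andP[]; lra.
have iB (h : V -> R) y : measurable_fun [set: V] h -> (forall y, `|h y| <= c * Q y) ->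
    intg P (fun w => h (B w y)).
  by move=> mh hc; exact: (transfer_intg mB wQ y mh hc).
have E1 : \int[P]_w (f (X k.+1 w) + c * Q (X k.+1 w)) =
    \int[P]_w (transfer P B f (X k w) + transfer P B (fun y => c * Q y) (X k w)).
  rewrite /Rintegral (transfer_nonneg_X k mg g0); last first.
    by move=> y; exact: (intgD (iB f y mf fc) (iB _ y mcQ cQb)).
  congr fine; apply: eq_integral => w _; congr EFin.
  by rewrite /transfer (ExD (iB f _ mf fc) (iB _ _ mcQ cQb)).
have E2 : \int[P]_w (c * Q (X k.+1 w)) = \int[P]_w transfer P B (fun y => c * Q y) (X k w).
  rewrite /Rintegral (transfer_nonneg_X k mcQ)//.
    by move=> y; rewrite mulr_ge0.
  by move=> y; exact: (iB _ y mcQ cQb).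
move: E1; rewrite !ExD ?E2.
- by move/addIr.
- exact: intg_transfer_X mf fc.
- exact: intg_transfer_X mcQ cQb.
- exact: intg_comp_X mf fc.
- exact: intg_comp_X mcQ cQb.
Qed.

End WithWeight.

Lemma U_ge0 y : 0 <= U y.
Proof. exact: le_trans (rg_U1 rgB y). Qed.

(** A Foster-Lyapunov drift inequality: off [Rk] the third power contracts by [rho], and on [Rk] it
    restarts below the cube of [K * m]. *)
Lemma moment_U3 : exists2 C : R, 0 <= C &
  forall k, \int[P]_w U (X k w) ^+ 3 <= U x ^+ 3 + C.
Proof.
have /andP[r0 r1] := rg_rho rgB.
have w3 := weight_U rgB (isT : (3 <= 3)%N).
have mRk := rg_mRk rgB; have mN : measurable (~` Rk) by exact: measurableC.
have mU3 : measurable_fun [set: V] (fun y => U y ^+ 3) by exact: weight_measurable w3.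
pose A := K ^+ 3 * \int[P]_w m w ^+ 3.
have A0 : 0 <= A.
  rewrite /A mulr_ge0 ?exprn_ge0 ?(rg_K rgB)//; apply: Ex_ge0 => w.
  by rewrite exprn_ge0 ?(rg_m_ge0 rgB).
have drift y : transfer P B (fun y => U y ^+ 3) y <= rho * U y ^+ 3 + A.
  have iU := weight_intg w3 y.
  have i1 := intg_indicM mN iU.
  have i2 : intg P (fun w => K ^+ 3 * m w ^+ 3) by exact/intgZ/(rg_m3 rgB).
  apply: (@le_trans _ _ (\int[P]_w (\1_(~` Rk) w * U (B w y) ^+ 3 + K ^+ 3 * m w ^+ 3))).
    apply: Ex_le => //; first exact: intgD.
    move=> w; rewrite indicE; have [wR|wR] := pselect (Rk w).
      rewrite memNset//= mul0r add0r -exprMn; apply: lerXn2r.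
      - by rewrite nnegrE U_ge0.
      - by rewrite nnegrE mulr_ge0 ?(rg_K rgB) ?(rg_m_ge0 rgB).
      - exact: (rg_RU rgB).
    rewrite mem_set//= mul1r lerDl mulr_ge0 ?exprn_ge0 ?(rg_K rgB)//.
    exact: (rg_m_ge0 rgB).
  rewrite ExD// ExZ ?lerD2r; last exact: (rg_m3 rgB).
  exact: (weight_contract w3).
have U30 y : 0 <= U y ^+ 3 by rewrite exprn_ge0// U_ge0.
have U3b : forall y, `|U y ^+ 3| <= 1 * U y ^+ 3 by move=> y; rewrite mul1r ger0_norm.
exists (A / (1 - rho)); first by rewrite divr_ge0// subr_ge0 ltW.
elim=> [|k IH].
  under eq_Rintegral do rewrite (ch_0 chX).
  by rewrite Ex_cst lerDl divr_ge0// subr_ge0 ltW.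
rewrite (step_X w3 k ler01 mU3 U3b).
apply: (@le_trans _ _ (\int[P]_w (rho * U (X k w) ^+ 3 + A))).
  apply: Ex_le => //.
  - exact: (intg_transfer_X w3 k ler01 mU3 U3b).
  - by apply: intgD; [exact/intgZ/(intg_X w3)|exact: intg_cst].
rewrite ExD ?Ex_cst; [|exact/intgZ/(intg_X w3)|exact: intg_cst].
rewrite ExZ; last exact: (intg_X w3).
have E : A = (1 - rho) * (A / (1 - rho)) by field; rewrite gt_eqF// subr_gt0.
have := U30 x; rewrite {1}E; move: IH; set I := \int[P]_w _; set a := A / _ => IH Ux.
by nra.
Qed.

Lemma measurable_tr_fst (f : V -> R) (g : T -> R) (z : V) : measurable_fun [set: V] f ->
  measurable_fun [set: T] g -> measurable_fun [set: T] (fun w => f (tr z (g w))).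
Proof.
by move=> mf mg; apply: measurableT_comp => //; exact: measurable_tr2.
Qed.

(** The family of observables for which the rate is proved simultaneously. *)
Record near_phi (psi : V -> R) (M : R) : Prop := NearPhi {
  np_m : measurable_fun [set: V] psi;
  np_e : equivariant tr psi;
  np_b : forall y, `|psi y - phi y| <= M * W y;
  np_1 : 1 <= M }.

(** After a regeneration in the block [w], the state depends on the past through [phi (B w (X k))]
    alone. Its distance to [phi] involves the random factor [m w], whence the factor [m] in the
    integrability condition [rg_int]. *)
Lemma near_phi_B w : near_phi (fun y => phi (B w y)) ((1 + Cx) * m w).
Proof.
have C0 := hm_C hmB; have m1 := rg_m1 rgB w; have m0 := rg_m_ge0 rgB w.
split.
- apply: measurableT_comp; first exact: hm_m hmB.
  exact: measurableT_comp mB (pair2_measurable w).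
- by move=> y t; rewrite (rg_tr rgB) (hm_e hmB).
- move=> y; apply: (le_trans (hm_b hmB w y)).
  have UW := rg_UW rgB y; have U0 := U_ge0 y.
  rewrite -mulrA; apply: ler_pM => //; first by rewrite mulr_ge0.
  - by rewrite lerDr.
  - by rewrite ler_wpM2l.
- by rewrite mulr_ege1// lerDl.
Qed.

Definition Lam (psi : V -> R) k (f : V -> R) (z : V) : R :=
  \int[P]_w f (tr z (psi (X k w))).

(* The last time at which [B] has rank one splits [X k] into a state with a
   deterministic class and a scalar [psi (X i)] in the past. *)
Lemma last_regeneration (n : nat) (cQ theta CR : R) (Q : V -> R) (D : nat -> R) (f : V -> R) (d : R) :
  weight P tr B Rk rho cQ Q ->
  intg P (fun w => \1_Rk w * (Q (B w x0) * m w)) ->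
  \int[P]_w (\1_Rk w * (Q (B w x0) * m w)) <= CR ->
  0 <= theta -> theta * rho < 1 ->
  (forall k, 0 <= D k) -> (forall k, D k <= theta * D k.+1) ->
  0 <= d -> measurable_fun [set: V] f -> (forall y, `|f y| <= d * Q y) ->
  (forall psi M, near_phi psi M -> forall k, (k < n)%N -> forall z,
     `|Lam psi k f z| <= M * D k * Q z) ->
  let C' := theta * ((1 + Cx) * CR) / (1 - theta * rho) in
  d * Q x <= C' * D 0%N ->
  forall k, (k <= n)%N -> `|\int[P]_w f (X k w)| <= C' * D k.
Proof.
move=> wQ iR hCR th0 thr D0 Dth d0 mf fd hL C' hd k.
have /andP[r0 r1] := rg_rho rgB.
have mQ := weight_measurable wQ; have Q0 := weight_ge0 wQ; have cQ' := weight_class wQ.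
have mRk := rg_mRk rgB; have mN : measurable (~` Rk) by exact: measurableC.
have C0 := hm_C hmB.
have CR0 : 0 <= CR.
  apply: le_trans hCR; apply: Ex_ge0 => w.
  by rewrite mulr_ge0 ?indicE// mulr_ge0// (rg_m_ge0 rgB).
have C'0 : 0 <= C'.
  by rewrite divr_ge0 ?subr_ge0 ?(ltW thr)//; apply: mulr_ge0 => //; apply: mulr_ge0 => //; exact: addr_ge0.
(* [C'] is the fixed point of the recursion over one block: a regeneration contributes
   [(1 + Cx) * CR], its absence [rho * C'], and stepping back from [D k.+1] to [D k] costs
   [theta]. *)
have C'E : theta * ((1 + Cx) * CR + rho * C') = C'.
  by rewrite /C'; field; rewrite gt_eqF// subr_gt0.
elim: k f d D d0 mf fd D0 Dth hL hd => [|k IH] f d D d0 mf fd D0 Dth hL hd kn.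
  under eq_Rintegral do rewrite (ch_0 chX).
  by rewrite Ex_cst (le_trans (fd x)).
(* The last block is integrated out. The part [fN] without regeneration again satisfies all the
   hypotheses, with [d] and [D] multiplied by [rho]; hence the induction is over all [f], [d] and
   [D]. *)
pose fN y := \int[P]_w (\1_(~` Rk) w * f (B w y)).
pose fR y := \int[P]_w (\1_Rk w * f (B w y)).
have iB y : intg P (fun w => f (B w y)) by exact: (transfer_intg mB wQ y mf fd).
have iN y : intg P (fun w => \1_(~` Rk) w * f (B w y)) by exact: intg_indicM.
have iRf y : intg P (fun w => \1_Rk w * f (B w y)) by exact: intg_indicM.
have split_f y : transfer P B f y = fR y + fN y.
  rewrite /transfer /fR /fN -ExD//; apply: eq_Rintegral => w _.
  rewrite -mulrDl !indicE; have [wR|wR] := pselect (Rk w).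
    by rewrite mem_set// memNset//= addr0 mul1r.
  by rewrite memNset// mem_set//= add0r mul1r.
have mfB : measurable_fun [set: V * T] (fun p => f (B p.2 p.1)).
  exact: measurableT_comp mf mB.
have mInd (A : set T) : measurable A ->
    measurable_fun [set: V * T] (fun p => \1_A p.2 * f (B p.2 p.1)).
  move=> mA; apply: measurable_funM => //.
  by apply: measurableT_comp => //; exact: measurable_indic.
have mfN : measurable_fun [set: V] fN.
  exact: (measurable_Ex (P := P) (mInd _ mN)).
have mfR : measurable_fun [set: V] fR.
  exact: (measurable_Ex (P := P) (mInd _ mRk)).
have ind01 (A : set T) w : 0 <= (\1_A w : R) <= 1.
  by rewrite indicE; case: (_ \in _) => /=; rewrite ?lexx ?ler01.
have fNb y : `|fN y| <= rho * d * Q y.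
  have h := @Ex_norm_le _ _ _ P (fun w => \1_(~` Rk) w * f (B w y))
    (fun w => d * (\1_(~` Rk) w * Q (B w y))).
  have iNQ := intg_indicM mN (weight_intg wQ y).
  apply: (le_trans (h _ _ _)).
  - exact: intg_measurable (iN y).
  - exact: intgZ.
  - move=> w; have /andP[i0 _] := ind01 (~` Rk) w.
    by rewrite normrM ger0_norm// mulrCA ler_wpM2l.
  - by rewrite ExZ// (mulrC rho) -mulrA ler_wpM2l// (weight_contract wQ).
have step := step_X wQ k d0 mf fd.
have ifN : intg P (fun w => fN (X k w)) by exact: (intg_comp_X wQ k mfN fNb).
have ifT : intg P (fun w => transfer P B f (X k w)) by exact: (intg_transfer_X wQ k d0 mf fd).
have ifR : intg P (fun w => fR (X k w)).
  have -> : (fun w => (fR (X k w))%:E) = (fun w => (transfer P B f (X k w) - fN (X k w))%:E).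
    by apply/funext => w; rewrite split_f addrK.
  exact: intgB.
have -> : \int[P]_w f (X k.+1 w) = \int[P]_w fR (X k w) + \int[P]_w fN (X k w).
  by rewrite step -ExD//; apply: eq_Rintegral => w _; rewrite split_f.
have hN : `|\int[P]_w fN (X k w)| <= C' * (rho * D k).
  have D0' j : 0 <= rho * D j by exact: mulr_ge0.
  have Dth' j : rho * D j <= theta * (rho * D j.+1) by rewrite mulrCA ler_wpM2l.
  apply: (IH fN (rho * d) (fun j => rho * D j)) => //; last exact: ltnW.
  - exact: mulr_ge0.
  - move=> psi M hpsi j jn z.
    have [mpsi epsi _ M1] := hpsi.
    have mpX : measurable_fun [set: T] (fun w => psi (X j w)).
      by apply: measurableT_comp => //; exact: ch_m chX _.
    pose F (ww : T * T) := \1_(~` Rk) ww.2 * f (tr (B ww.2 z) (psi (X j ww.1))).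
    have mF : measurable_fun [set: T * T] F.
      apply: measurable_funM; first by apply: measurableT_comp => //; exact: measurable_indic.
      apply: measurableT_comp => //; apply: measurable_tr2.
        by apply: measurable_B2.
      exact: (measurableT_comp mpX measurable_fst).
    have Fb w w' : `|F (w, w')| <= 1 * (d * Q (B w' z)).
      rewrite /F /= mul1r normrM; have /andP[i0 i1] := ind01 (~` Rk) w'.
      rewrite ger0_norm//; apply: (@le_trans _ _ (1 * `|f (tr (B w' z) (psi (X j w)))|)).
        by rewrite ler_wpM2r.
      by rewrite mul1r (le_trans (fd _))// cQ'.
    have E := Ex_fubini mF (intg_cst P 1) (intgZ d (weight_intg wQ z)) Fb.
    have -> : Lam psi j fN z = \int[P]_w' (\1_(~` Rk) w' * Lam psi j f (B w' z)).
      transitivity (\int[P]_w \int[P]_w' F (w, w')).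
        apply: eq_Rintegral => w _; apply: eq_Rintegral => w' _.
        by rewrite /F /= (rg_tr rgB).
      rewrite E; apply: eq_Rintegral => w' _; rewrite /F /= ExZ//.
      apply: (@intg_bnd _ _ _ _ _ (d * Q (B w' z))).
        exact: (measurable_tr_fst _ mf mpX).
      by move=> w; rewrite (le_trans (fd _))// cQ'.
    have iNQ := intg_indicM mN (weight_intg wQ z).
    have M0 : 0 <= M by exact: le_trans ler01 M1.
    have mL : measurable_fun [set: T] (fun w' => \1_(~` Rk) w' * Lam psi j f (B w' z)).
      apply: measurable_funM; first exact: measurable_indic.
      apply: (@measurable_Ex _ _ _ T T P (fun p => f (tr (B p.1 z) (psi (X j p.2))))).
        apply: measurableT_comp => //; apply: measurable_tr2.
          by apply: measurable_B2.
        exact: (measurableT_comp mpX measurable_snd).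
      move=> w'; apply: (@intg_bnd _ _ _ _ _ (d * Q (B w' z))).
        rewrite /=; exact: (measurable_tr_fst (B w' z) mf mpX).
      by move=> w; rewrite (le_trans (fd _))// cQ'.
    have h := @Ex_norm_le _ _ _ P _ (fun w' => M * D j * (\1_(~` Rk) w' * Q (B w' z))) mL.
    apply: (le_trans (h _ _)).
    + exact: intgZ.
    + move=> w'; have /andP[i0 i1] := ind01 (~` Rk) w'.
      by rewrite normrM ger0_norm// mulrCA ler_wpM2l// hL.
    + rewrite ExZ// (_ : M * (rho * D j) * Q z = M * D j * (rho * Q z)); last by ring.
      by rewrite ler_wpM2l ?mulr_ge0// (weight_contract wQ).
  - by rewrite -mulrA (mulrCA C') ler_wpM2l.
have hR : `|\int[P]_w fR (X k w)| <= (1 + Cx) * CR * D k.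
  pose F (ww : T * T) := \1_Rk ww.2 * f (B ww.2 (X k ww.1)).
  have mF : measurable_fun [set: T * T] F.
    apply: measurable_funM; first by apply: measurableT_comp => //; exact: measurable_indic.
    exact: measurable_transfer_X.
  have Fb w w' : `|F (w, w')| <= 1 * (d * Q (B w' x0)).
    rewrite /F /= mul1r indicE; have [wR|wR] := pselect (Rk w').
      rewrite mem_set//= mul1r; have [t ->] := rg_rank1 rgB wR (X k w).
      by rewrite (le_trans (fd _))// cQ'.
    by rewrite memNset//= mul0r normr0 mulr_ge0.
  have E := Ex_fubini mF (intg_cst P 1) (intgZ d (weight_intg wQ x0)) Fb.
  have mG : measurable_fun [set: T] (fun w' => \int[P]_w F (w, w')).
    apply: (@measurable_Ex _ _ _ T T P (fun p => F (p.2, p.1))).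
      apply: (measurableT_comp mF (g := fun p : T * T => (p.2, p.1))).
      exact: measurable_fun_pair.
    move=> w'; apply: (@intg_bnd _ _ _ _ _ (1 * (d * Q (B w' x0)))) => //.
    exact: measurableT_comp mF (pair2_measurable w').
  have -> : \int[P]_w fR (X k w) = \int[P]_w' \int[P]_w F (w, w') by rewrite -E.
  have h := @Ex_norm_le _ _ _ P (fun w' => \int[P]_w F (w, w'))
    (fun w' => (1 + Cx) * D k * (\1_Rk w' * (Q (B w' x0) * m w'))) mG (intgZ _ iR).
  apply: (le_trans (h _)); last first.
    rewrite ExZ// [X in _ <= X](_ : _ = (1 + Cx) * D k * CR); last by ring.
    by rewrite ler_wpM2l// mulr_ge0// addr_ge0.
  move=> w'; rewrite /F /= !indicE; have [wR|wR] := pselect (Rk w'); last first.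
    rewrite memNset//= mul0r mulr0; under eq_Rintegral do rewrite mul0r.
    by rewrite Ex_cst normr0.
  rewrite mem_set//= mul1r; under eq_Rintegral do rewrite mul1r.
  (* The representative of the class of [B w' x0] on which [phi] vanishes: on [Rk] the state is [vh]
     translated by its own value of [phi]. *)
  pose vh := tr (B w' x0) (- phi (B w' x0)).
  have BE y : B w' y = tr vh (phi (B w' y)).
    have [t E1] := rg_rank1 rgB wR y.
    by rewrite E1 (hm_e hmB) /vh (tr_D trT) addrA addNr add0r.
  have -> : \int[P]_w f (B w' (X k w)) = Lam (fun y => phi (B w' y)) k f vh.
    by apply: eq_Rintegral => w _; rewrite [in LHS]BE.
  apply: (le_trans (hL _ _ (near_phi_B w') k kn vh)).
  rewrite /vh cQ' le_eqVlt; apply/orP; left; apply/eqP; ring.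
apply: (le_trans (ler_normD _ _)); apply: (le_trans (lerD hR hN)).
rewrite (_ : (1 + Cx) * CR * D k + _ = ((1 + Cx) * CR + rho * C') * D k); last by ring.
rewrite -[X in _ <= X * _]C'E (mulrC theta) -mulrA ler_wpM2l//.
by rewrite addr_ge0// mulr_ge0// addr_ge0.
Qed.

End RegenerativeChain.

(** * Lindeberg replacement *)

Section MeanTaylor.
Context {R : realType} {dT : measure_display} {T : measurableType dT}.
Variables (P : probability T R) (e0 e1 e2 e3 : R -> R) (D b : R).
Hypotheses (d0 : forall x : R, is_derive x 1 e0 (e1 x))
  (d1 : forall x : R, is_derive x 1 e1 (e2 x))
  (d2 : forall x : R, is_derive x 1 e2 (e3 x)) (e3D : forall x, `|e3 x| <= D)
  (e0b : forall x, `|e0 x| <= b) (e2b : forall x, `|e2 x| <= b).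

Lemma measurable_derivable (f df : R -> R) : (forall x : R, is_derive x 1 f (df x)) ->
  measurable_fun [set: R] f.
Proof.
move=> h; apply: continuous_measurable_fun => x.
by apply/differentiable_continuous/derivable1_diffP; have [] := h x.
Qed.

Variables (xi eta : T -> R) (t : R).
Hypotheses (mxi : measurable_fun [set: T] xi) (ieta : intg P eta).

Lemma mean_taylor2 : intg P xi -> intg P (fun w => xi w ^+ 2) ->
  intg P (fun w => `|xi w| ^+ 3) -> \int[P]_w xi w = 0 ->
  `|\int[P]_w e0 (t - xi w) - e0 t - (\int[P]_w xi w ^+ 2) / 2 * e2 t| <=
  D * \int[P]_w `|xi w| ^+ 3.
Proof.
move=> i1 i2 i3 mean0.
have me0 : measurable_fun [set: T] (fun w => e0 (t - xi w)).
  apply: (measurableT_comp (measurable_derivable d0)); exact: measurable_funB.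
have ie0 : intg P (fun w => e0 (t - xi w)) by exact: (intg_bnd _ me0 (fun w => e0b _)).
pose F w := e0 (t - xi w) - (e0 t - e1 t * xi w + e2 t / 2 * xi w ^+ 2).
have ia : intg P (fun w => e0 t - e1 t * xi w) by apply: intgB; [exact: intg_cst|exact: intgZ].
have ib : intg P (fun w => e2 t / 2 * xi w ^+ 2) by exact: intgZ.
have EF : \int[P]_w F w = \int[P]_w e0 (t - xi w) - e0 t - (\int[P]_w xi w ^+ 2) / 2 * e2 t.
  rewrite /F ExB//; last exact: intgD.
  rewrite [X in _ - X]ExD// ExZ// [X in _ - (X + _)]ExB//; [|exact: intg_cst|exact: intgZ].
  by rewrite Ex_cst ExZ// mean0; field.
rewrite -EF -ExZ//; apply: Ex_norm_le.
- by apply: measurable_funB => //; exact: intg_measurable (intgD ia ib).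
- exact: intgZ.
- move=> w; have := taylor2 d0 d1 d2 e3D t (- xi w); rewrite normrN; congr (`|_| <= _).
  by rewrite /F; field.
Qed.

Lemma mean_taylor0 : intg P (fun w => `|xi w| * `|eta w|) ->
  `|\int[P]_w (e2 (t - xi w) * eta w) - e2 t * \int[P]_w eta w| <=
  D * \int[P]_w (`|xi w| * `|eta w|).
Proof.
move=> i1.
have me2 : measurable_fun [set: T] (fun w => e2 (t - xi w)).
  apply: (measurableT_comp (measurable_derivable d2)); exact: measurable_funB.
have ie2 : intg P (fun w => e2 (t - xi w) * eta w) by exact: (intgMb me2 (fun w => e2b _)).
rewrite -[X in _ - X]ExZ// -ExB//; last exact: intgZ.
rewrite -ExZ//; apply: Ex_norm_le.
- exact: intg_measurable (intgB ie2 (intgZ (e2 t) ieta)).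
- exact: intgZ.
- move=> w; rewrite -mulrBl normrM mulrA ler_wpM2r//.
  by have := lipschitz_derive d2 e3D t (t - xi w); rewrite addrAC subrr add0r normrN.
Qed.

End MeanTaylor.

Section GaussianStep.
Context {R : realType} {dT dS : measure_display} {T : measurableType dT}
  {S : measurableType dS}.
Variables (P : probability T R) (Q : probability S R) (Y : T -> R) (v s D : R).
Hypotheses (mY : measurable_fun [set: T] Y) (v0 : 0 < v)
  (e3D : forall u, `|hexp P Y 3 v u| <= D).
Local Notation N := (normal_prob (0 : R) 1).

(** The variance of [xi] exceeds [s ^+ 2] by [qz] minus the mean of [eta], and this is exactly what
    the second order terms with [eta] and [qz] compensate. What remains is of third order, hence
    proportional to the bound [D] on the third derivative. *)
Lemma gaussian_step (xi eta : S -> R) (t qz : R) :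
  measurable_fun [set: S] xi -> intg Q eta ->
  intg Q xi -> intg Q (fun w => xi w ^+ 2) ->
  intg Q (fun w => `|xi w| ^+ 3) -> intg Q (fun w => `|xi w| * `|eta w|) ->
  \int[Q]_w xi w = 0 -> \int[Q]_w eta w = qz - \int[Q]_w xi w ^+ 2 + s ^+ 2 ->
  `|\int[Q]_w (hexp P Y 0 v (t - xi w) + 2^-1 * (hexp P Y 2 v (t - xi w) * eta w)) -
    (hexp P Y 0 (Num.sqrt (v ^+ 2 + s ^+ 2)) t +
     2^-1 * (hexp P Y 2 (Num.sqrt (v ^+ 2 + s ^+ 2)) t * qz))| <=
  D * (\int[Q]_w `|xi w| ^+ 3 + 2^-1 * \int[Q]_w (`|xi w| * `|eta w|) +
       `|s| ^+ 3 * \int[N]_z `|z| ^+ 3 + 2^-1 * (`|s| * `|qz| * \int[N]_z `|z|)).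
Proof.
move=> mxi ieta i1 i2 i3 i4 mean0 etaE.
have d0 u := is_derive_hexp P mY u (isT : (0 < 4)%N) v0.
have d1 u := is_derive_hexp P mY u (isT : (1 < 4)%N) v0.
have d2 u := is_derive_hexp P mY u (isT : (2 < 4)%N) v0.
pose b := hermB / v ^+ 0 + hermB / v ^+ 2 : R.
have hB0 : 0 <= hermB :> R by exact: ltW hermB_gt0.
have e0b u : `|hexp P Y 0 v u| <= b.
  by apply: (le_trans (hexp_bound P mY 0 u v0)); rewrite lerDl divr_ge0// exprn_ge0// ltW.
have e2b u : `|hexp P Y 2 v u| <= b.
  by apply: (le_trans (hexp_bound P mY 2 u v0)); rewrite lerDr divr_ge0// exprn_ge0// ltW.
have D0 : 0 <= D by exact: le_trans (normr_ge0 _) (e3D 0).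
rewrite !hexp_convolution//.
have mz : measurable_fun [set: measurableTypeR R] (fun z : R => s * z) by exact: measurable_funM.
have iz1 := intgZ s (intg_normal_id (R := R)).
have iz2 : intg N (fun z : R => (s * z) ^+ 2).
  by under eq_fun do rewrite exprMn; exact: intgZ intg_normal_sqr.
have iz3 : intg N (fun z : R => `|s * z| ^+ 3).
  by under eq_fun do rewrite normrM exprMn; exact/intgZ/intg_normal_pow.
have iz4 : intg N (fun z : R => `|s * z| * `|qz|).
  under eq_fun do rewrite normrM mulrAC; apply: intgZ.
  have := @intg_normal_pow R 1 isT; by under eq_fun do rewrite expr1.
have zmean : \int[N]_z (s * z) = 0 by rewrite ExZ ?normal_mean ?mulr0//; exact: intg_normal_id.
have zvar : \int[N]_z (s * z) ^+ 2 = s ^+ 2.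
  transitivity (\int[N]_z (s ^+ 2 * z ^+ 2)).
    by apply: eq_Rintegral => z _; rewrite exprMn.
  by rewrite ExZ ?normal_variance ?mulr1//; exact: intg_normal_sqr.
have A1 := mean_taylor2 d0 d1 d2 e3D e0b t mxi i1 i2 i3 mean0.
have A2 := mean_taylor0 d2 e3D e2b t mxi ieta i4.
have A3 := mean_taylor2 d0 d1 d2 e3D e0b t mz iz1 iz2 iz3 zmean.
have A4 := mean_taylor0 d2 e3D e2b t mz (intg_cst N qz) iz4.
have me0 : measurable_fun [set: S] (fun w => hexp P Y 0 v (t - xi w)).
  by apply: (measurableT_comp (measurable_derivable d0)); exact: measurable_funB.
have me2 : measurable_fun [set: S] (fun w => hexp P Y 2 v (t - xi w)).
  by apply: (measurableT_comp (measurable_derivable d2)); exact: measurable_funB.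
have me2z : measurable_fun [set: measurableTypeR R] (fun z : R => hexp P Y 2 v (t - s * z)).
  by apply: (measurableT_comp (measurable_derivable d2)); exact: measurable_funB.
have ie2 : intg Q (fun w => hexp P Y 2 v (t - xi w) * eta w).
  by exact: (intgMb me2 (fun w => e2b _)).
rewrite ExD; [|exact: (intg_bnd _ me0 (fun w => e0b _))|exact: intgZ].
rewrite [X in _ + X - _]ExZ//.
have E3 : \int[N]_z `|s * z| ^+ 3 = `|s| ^+ 3 * \int[N]_z `|z| ^+ 3.
  transitivity (\int[N]_z (`|s| ^+ 3 * `|z| ^+ 3)).
    by apply: eq_Rintegral => z _; rewrite normrM exprMn.
  by rewrite ExZ//; exact: intg_normal_pow.
have E4 : \int[N]_z (`|s * z| * `|qz|) = `|s| * `|qz| * \int[N]_z `|z|.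
  transitivity (\int[N]_z (`|s| * `|qz| * `|z|)).
    by apply: eq_Rintegral => z _; rewrite normrM mulrAC.
  rewrite ExZ//; have := @intg_normal_pow R 1 isT.
  by under eq_fun do rewrite expr1.
have E5 : \int[N]_z (hexp P Y 2 v (t - s * z) * qz) = qz * \int[N]_z hexp P Y 2 v (t - s * z).
  transitivity (\int[N]_z (qz * hexp P Y 2 v (t - s * z))).
    by apply: eq_Rintegral => z _; rewrite mulrC.
  by rewrite ExZ//; exact: (intg_bnd _ me2z (fun w => e2b _)).
move: A3 A4; rewrite zvar E3 E4 E5 Ex_cst => A3 A4.
move: A1 A2 A3 A4; rewrite etaE.
set a1 := \int[Q]_w hexp _ _ _ _ _; set a2 := \int[Q]_w (_ * eta w).
set a3 := \int[N]_w hexp _ _ 0 _ _; set a4 := \int[N]_z hexp _ _ 2 _ _.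
set V := \int[Q]_w xi w ^+ 2; set x3 := \int[Q]_w `|xi w| ^+ 3.
set xe := \int[Q]_w (`|xi w| * _); set c0 := hexp P Y 0 v t; set c2 := hexp P Y 2 v t.
set w1 := `|s| ^+ 3 * _; set w2 := `|s| * `|qz| * _.
rewrite !ler_norml => /andP[? ?] /andP[? ?] /andP[? ?] /andP[? ?].
by apply/andP; split; lra.
Qed.
End GaussianStep.

Section Defect.
Context {R : realType} {dT dV : measure_display} {T : measurableType dT}
  {V : measurableType dV}.
Variables (P : probability T R) (tr : V -> R -> V) (x0 : V).
Variables (B : T -> V -> V) (Rk : set T) (rho K : R) (m : T -> R) (U W : V -> R).
Hypotheses (rgB : regenerative P tr x0 B Rk rho K m U W) (trT : translation tr).
Variables (phi q : V -> R) (s Cx : R).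
Hypothesis hmB : harmonic P tr B m U phi q s Cx.

Let mB := rg_mB rgB.
Let Em := \int[P]_w m w ^+ 3.
Local Notation N := (normal_prob (0 : R) 1).

(* The Gaussian smoothing of a half line, corrected at second order by [q]. *)
Definition smooth (v u : R) (y : V) : R :=
  (v ^+ 0)^-1 * hermG 0 ((u - phi y) / v) +
  2^-1 * ((v ^+ 2)^-1 * hermG 2 ((u - phi y) / v) * q y).

(** The error of a single replacement: one step of the chain against an increase of the squared
    bandwidth by [s ^+ 2]. *)
Definition defect (v u : R) (z : V) : R :=
  transfer P B (smooth v u) z - smooth (Num.sqrt (v ^+ 2 + s ^+ 2)) u z.

Definition CL : R := Cx ^+ 3 * Em + 2^-1 * (Cx ^+ 2 * Em) +
  `|s| ^+ 3 * \int[N]_z `|z| ^+ 3 + 2^-1 * (`|s| * Cx * \int[N]_z `|z|).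

Let Em0 : 0 <= Em.
Proof. by apply: Ex_ge0 => w; rewrite exprn_ge0// (rg_m_ge0 rgB). Qed.

Let U0 y : 0 <= U y. Proof. exact: U_ge0 rgB y. Qed.

Lemma CL_ge0 : 0 <= CL.
Proof.
have C0 := hm_C hmB; have N3 : 0 <= \int[N]_z `|z| ^+ 3 by exact: Ex_ge0.
have N1 : 0 <= \int[N]_z `|z| by exact: Ex_ge0.
by rewrite /CL !addr_ge0// !mulr_ge0// ?exprn_ge0.
Qed.

Lemma measurable_smooth v u : measurable_fun [set: V] (smooth v u).
Proof.
have mh r : measurable_fun [set: V] (fun y => (v ^+ r)^-1 * hermG r ((u - phi y) / v)).
  apply: measurable_funM => //; apply: measurableT_comp; first exact: measurable_hermG.
  by apply: measurable_funM => //; apply: measurable_funB => //; exact: hm_m hmB.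
apply: measurable_funD; first exact: mh.
by apply: measurable_funM => //; apply: measurable_funM; [exact: mh|exact: hm_mq hmB].
Qed.

Lemma smooth_bound v u y : 0 < v ->
  `|smooth v u y| <= (hermB + hermB * Cx * (v ^+ 2)^-1) * U y ^+ 2.
Proof.
move=> v0; have C0 := hm_C hmB.
have hB0 : 0 <= hermB :> R by exact: ltW hermB_gt0.
have U1 : 1 <= U y ^+ 2 by rewrite exprn_ege1// (rg_U1 rgB).
have i0 : 0 <= (v ^+ 2)^-1 by rewrite invr_ge0 exprn_ge0// ltW.
rewrite [leRHS]mulrDl /smooth; apply: (le_trans (ler_normD _ _)); apply: lerD.
  rewrite expr0 invr1 mul1r; apply: (le_trans (hermG_bounded _ _)).
  by rewrite ler_peMr.
have h2 : `|(v ^+ 2)^-1 * hermG 2 ((u - phi y) / v)| <= (v ^+ 2)^-1 * hermB.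
  by rewrite normrM ger0_norm// ler_wpM2l// hermG_bounded.
rewrite normrM ger0_norm; last by rewrite invr_ge0.
rewrite (normrM _ (q y)).
apply: (@le_trans _ _ (1 * ((v ^+ 2)^-1 * hermB * (Cx * U y ^+ 2)))).
  apply: ler_pM; rewrite ?invr_ge0//; first by rewrite invf_le1// ler1n.
  by apply: ler_pM => //; exact: hm_qb hmB y.
by rewrite mul1r le_eqVlt; apply/orP; left; apply/eqP; ring.
Qed.

Let xi z w := phi (B w z) - phi z.

Let mxi z : measurable_fun [set: T] (xi z).
Proof. by apply: measurable_funB => //; apply: (measurable_B_comp mB); exact: hm_m hmB. Qed.

Let intg_xi i z : (i <= 3)%N -> intg P (fun w => `|xi z w| ^+ i).
Proof.
move=> i3; apply: (@intg_le _ _ _ _ _ (fun w => (Cx * U z) ^+ i * m w ^+ i)).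
- by apply: measurable_funX; exact: measurableT_comp.
- exact/intgZ/(rg_intg_m rgB).
- move=> w; rewrite normrX normr_id -exprMn; apply: lerXn2r; rewrite ?nnegrE//.
    by rewrite !mulr_ge0// ?(hm_C hmB)// (rg_m_ge0 rgB).
  by apply: (le_trans (hm_b hmB w z)); rewrite -mulrA [U z * _]mulrC.
Qed.

Let eta_bound w z : `|q (B w z)| <= Cx * U z ^+ 2 * m w ^+ 2.
Proof.
apply: (le_trans (hm_qb hmB _)); rewrite -mulrA ler_wpM2l ?(hm_C hmB)//.
rewrite -exprMn; apply: lerXn2r; rewrite ?nnegrE// ?mulr_ge0// ?(rg_m_ge0 rgB)//.
by rewrite mulrC (rg_BU rgB).
Qed.

Let meta z : measurable_fun [set: T] (fun w => q (B w z)).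
Proof. by apply: (measurable_B_comp mB); exact: hm_mq hmB. Qed.

Lemma smooth_average (S : measurableType dT) (Pr : probability S R) (Y : S -> R) v u z :
  measurable_fun [set: S] Y -> 0 < v ->
  \int[Pr]_w defect v u (tr z (Y w)) =
  \int[P]_w' (hexp Pr Y 0 v (u - phi z - xi z w') +
    2^-1 * (hexp Pr Y 2 v (u - phi z - xi z w') * q (B w' z))) -
  (hexp Pr Y 0 (Num.sqrt (v ^+ 2 + s ^+ 2)) (u - phi z) +
   2^-1 * (hexp Pr Y 2 (Num.sqrt (v ^+ 2 + s ^+ 2)) (u - phi z) * q z)).
Proof.
move=> mY v0; have w2 := weight_U rgB (isT : (2 <= 3)%N).
have C0 := hm_C hmB.
set v' := Num.sqrt _; have v'0 : 0 < v'.
  by rewrite sqrtr_gt0 ltr_wpDr ?sqr_ge0// exprn_gt0.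
pose F (ww : S * T) := smooth v u (B ww.2 (tr z (Y ww.1))).
have mtr : measurable_fun [set: S] (fun w => tr z (Y w)) by exact: (measurable_tr2 trT).
have mF : measurable_fun [set: S * T] F.
  apply: (measurableT_comp (measurable_smooth v u)).
  apply: (measurable_B2 rgB) => //; exact: (measurableT_comp mtr measurable_fst).
set c := (hermB + hermB * Cx * (v ^+ 2)^-1).
have c0 : 0 <= c.
  have hB0 : 0 <= hermB :> R by exact: ltW hermB_gt0.
  by rewrite /c addr_ge0// !mulr_ge0// invr_ge0 exprn_ge0// ltW.
have Fb w w' : `|F (w, w')| <= 1 * (c * U (B w' z) ^+ 2).
  rewrite mul1r; apply: (le_trans (smooth_bound _ _ v0)).
  by rewrite -/c (rg_tr rgB) (rg_cU rgB).
have E := Ex_fubini mF (intg_cst Pr 1) (intgZ c (weight_intg w2 z)) Fb.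
have mT : measurable_fun [set: V] (transfer P B (smooth v u)).
  by apply: (transfer_measurable mB w2 (measurable_smooth v u)) => y; exact: smooth_bound.
have itr : intg Pr (fun w => transfer P B (smooth v u) (tr z (Y w))).
  apply: (@intg_bnd _ _ _ _ _ (c * Em * U z ^+ 2)); first exact: measurableT_comp mT mtr.
  move=> w; apply: (le_trans (transfer_bound mB w2 _ c0 (measurable_smooth v u) (fun y => smooth_bound u y v0))).
  by rewrite (rg_cU rgB).
have av (vv : R) (y : V) : 0 < vv -> \int[Pr]_w smooth vv u (tr y (Y w)) =
    hexp Pr Y 0 vv (u - phi y) + 2^-1 * (hexp Pr Y 2 vv (u - phi y) * q y).
  move=> vv0.
  transitivity (\int[Pr]_w ((vv ^+ 0)^-1 * hermG 0 ((u - phi y - Y w) / vv) +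
      2^-1 * q y * ((vv ^+ 2)^-1 * hermG 2 ((u - phi y - Y w) / vv)))).
    apply: eq_Rintegral => w _; rewrite /smooth (hm_e hmB) (hm_cq hmB) opprD addrA.
    by congr (_ + _); ring.
  rewrite ExD; [|exact: intg_hexp|exact/intgZ/intg_hexp].
  by rewrite [X in _ + X]ExZ; [rewrite /hexp; ring|exact: intg_hexp].
have isv : intg Pr (fun w => smooth v' u (tr z (Y w))).
  apply: (@intg_bnd _ _ _ _ _ ((hermB + hermB * Cx * (v' ^+ 2)^-1) * U z ^+ 2)).
    exact: measurableT_comp (measurable_smooth _ _) mtr.
  by move=> w; apply: (le_trans (smooth_bound _ _ v'0)); rewrite (rg_cU rgB).
rewrite /defect ExB// -/v' (av v' z v'0); congr (_ - _).
transitivity (\int[Pr]_w \int[P]_w' F (w, w')) => //.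
rewrite E; apply: eq_Rintegral => w' _; rewrite -/(F _).
transitivity (\int[Pr]_w smooth v u (tr (B w' z) (Y w))).
  by apply: eq_Rintegral => w _; rewrite /F /= (rg_tr rgB).
rewrite (av v (B w' z) v0); have -> : u - phi z - xi z w' = u - phi (B w' z) by rewrite /xi; ring.
by [].
Qed.

(** When the past enters through a random height [Y], Fubini turns the kernel into the mollified law
    of [Y], and only the third derivative of the latter matters. For [Y] nearly normal this is much
    smaller than the uniform bound in [v ^- 3] of [defect_bound], the case [Y = 0]. *)
Lemma defect_average (S : measurableType dT) (Pr : probability S R) (Y : S -> R) v u z D :
  measurable_fun [set: S] Y -> 0 < v -> (forall t, `|hexp Pr Y 3 v t| <= D) ->
  `|\int[Pr]_w defect v u (tr z (Y w))| <= CL * D * U z ^+ 3.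
Proof.
move=> mY v0 hD; have C0 := hm_C hmB.
have U1 := rg_U1 rgB z; have D0 : 0 <= D by exact: le_trans (normr_ge0 _) (hD 0).
have Um i : (i <= 3)%N -> U z ^+ i <= U z ^+ 3 by move=> i3; exact: ler_weXn2l.
have im2 := rg_intg_m rgB (isT : (2 <= 3)%N).
have im3 := rg_m3 rgB.
rewrite smooth_average//.
have ixe : intg P (fun w => `|xi z w| * `|q (B w z)|).
  apply: (@intg_le _ _ _ _ _ (fun w => Cx ^+ 2 * U z ^+ 3 * m w ^+ 3)).
  - apply: measurable_funM; apply: measurableT_comp => //.
  - exact: intgZ.
  - move=> w; rewrite normrM !normr_id.
    apply: (@le_trans _ _ (Cx * (m w * U z) * (Cx * U z ^+ 2 * m w ^+ 2))).
      by apply: ler_pM => //; exact: hm_b hmB w z.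
    by rewrite le_eqVlt; apply/orP; left; apply/eqP; ring.
have i1 : intg P (xi z).
  apply: (@intg_le _ _ _ _ _ (fun w => `|xi z w| ^+ 1)) => //; exact: intg_xi.
have i2 : intg P (fun w => xi z w ^+ 2).
  apply: (@intg_le _ _ _ _ _ (fun w => `|xi z w| ^+ 2)) => //; first exact: measurable_funX.
    exact: intg_xi.
  by move=> w; rewrite normrX.
have ieta : intg P (fun w => q (B w z)).
  apply: (@intg_le _ _ _ _ _ (fun w => Cx * U z ^+ 2 * m w ^+ 2)) => //.
  exact: intgZ.
have h := gaussian_step mY v0 hD (u - phi z) (mxi z) ieta i1 i2 (intg_xi z (isT : (3 <= 3)%N)) ixe
  (hm_0 hmB z) (hm_q hmB z).
apply: (le_trans h); have -> : CL * D * U z ^+ 3 = D * (CL * U z ^+ 3) by ring.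
rewrite ler_wpM2l// /CL !mulrDl.
have N1 : 0 <= \int[N]_z `|z| by exact: Ex_ge0.
have N3 : 0 <= \int[N]_z `|z| ^+ 3 by exact: Ex_ge0.
have U31 : 1 <= U z ^+ 3 by rewrite exprn_ege1.
apply: lerD; [apply: lerD; [apply: lerD|]|].
- apply: (@le_trans _ _ (\int[P]_w (Cx ^+ 3 * U z ^+ 3 * m w ^+ 3))).
    apply: Ex_le => [||w]; [exact: intg_xi|exact: intgZ|].
    rewrite -!exprMn; apply: lerXn2r; rewrite ?nnegrE// ?mulr_ge0// ?(rg_m_ge0 rgB)//.
    by apply: (le_trans (hm_b hmB w z)); rewrite -mulrA [U z * _]mulrC.
  by rewrite ExZ// mulrAC.
- rewrite -!mulrA ler_wpM2l// ?invr_ge0//.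
  apply: (@le_trans _ _ (\int[P]_w (Cx ^+ 2 * U z ^+ 3 * m w ^+ 3))).
    apply: Ex_le => // [|w]; first exact: intgZ.
    apply: (@le_trans _ _ (Cx * (m w * U z) * (Cx * U z ^+ 2 * m w ^+ 2))).
      by apply: ler_pM => //; exact: hm_b hmB w z.
    by rewrite le_eqVlt; apply/orP; left; apply/eqP; ring.
  by rewrite ExZ// -/Em le_eqVlt; apply/orP; left; apply/eqP; ring.
- by rewrite ler_peMr// mulr_ge0// exprn_ge0.
- rewrite -!mulrA ler_wpM2l ?invr_ge0// ler_wpM2l// mulrA mulrAC ler_wpM2r//.
  apply: (le_trans (hm_qb hmB z)); rewrite ler_wpM2l//; exact: Um.
Qed.

Lemma measurable_defect v u : 0 < v -> measurable_fun [set: V] (defect v u).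
Proof.
move=> v0; have w2 := weight_U rgB (isT : (2 <= 3)%N).
apply: measurable_funB; last exact: measurable_smooth.
by apply: (transfer_measurable mB w2 (measurable_smooth v u)) => y; exact: smooth_bound.
Qed.

Lemma defect_bound v u z : 0 < v ->
  `|defect v u z| <= CL * (hermB / v ^+ 3) * U z ^+ 3.
Proof.
move=> v0.
have := @defect_average T P (fun=> 0) v u z (hermB / v ^+ 3)
  (measurable_cst _) v0 (fun t => hexp_bound P (measurable_cst _) 3 t v0).
suff -> : \int[P]_w defect v u (tr z 0) = defect v u z by [].
by rewrite (tr_0 trT) Ex_cst.
Qed.

End Defect.

(** * The Berry-Esseen induction *)

Section Kernel.
Context {R : realType}.
Local Notation sq := (@Num.sqrt R).

Lemma sqrt_nat_gt0 n : 0 < sq n.+1%:R.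
Proof. by rewrite sqrtr_gt0 ltr0n. Qed.

(** Separates the two singularities when [y + z] is constant along a sum. With [a], [b], [c] the
    square roots of [y], [z], [y + z], it reduces to [c ^+ 3 <= 3 * b * c ^+ 2 + a ^+ 3], a
    consequence of [c <= a + b]. *)
Lemma kernel_le (y z : R) : 0 < y -> 0 < z ->
  (sq y ^+ 3 * sq z)^-1 <= (3 / sq y ^+ 3 + (sq z * (y + z))^-1) / sq (y + z).
Proof.
move=> y0 z0; have S0 : 0 < y + z by rewrite addr_gt0.
set a := sq y; set b := sq z; set c := sq (y + z).
have a0 : 0 < a by rewrite sqrtr_gt0.
have b0 : 0 < b by rewrite sqrtr_gt0.
have c0 : 0 < c by rewrite sqrtr_gt0.
have a2 : a ^+ 2 = y by rewrite sqr_sqrtr// ltW.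
have b2 : b ^+ 2 = z by rewrite sqr_sqrtr// ltW.
have c2 : c ^+ 2 = y + z by rewrite sqr_sqrtr// ltW.
have ac : a <= c by rewrite ler_wsqrtr// lerDl ltW.
have bc : b <= c by rewrite ler_wsqrtr// lerDr ltW.
have cab : c <= a + b.
  rewrite -(@ler_pXn2r _ 2) ?nnegrE//; [|exact: ltW|by rewrite addr_ge0// ltW].
  have : 0 < a * b by rewrite mulr_gt0.
  rewrite c2 -a2 -b2 sqrrD; lra.
rewrite -c2 -subr_ge0.
have -> : (3 / a ^+ 3 + (b * c ^+ 2)^-1) / c - (a ^+ 3 * b)^-1 =
    (3 * b * c ^+ 2 + a ^+ 3 - c ^+ 3) / (a ^+ 3 * b * c ^+ 3).
  by field; rewrite !gt_eqF.
apply: divr_ge0; last by apply/ltW; rewrite !mulr_gt0// exprn_gt0.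
have h1 : c * c ^+ 2 <= (a + b) * c ^+ 2 by rewrite ler_wpM2r ?sqr_ge0.
have h2 : a * b * b <= c * b * c.
  by apply: ler_pM; [exact/ltW/mulr_gt0|exact: ltW|apply: ler_wpM2r => //; exact: ltW|].
have c2' : c ^+ 2 = a ^+ 2 + b ^+ 2 by rewrite c2 a2 b2.
rewrite subr_ge0 exprS; apply: (le_trans h1).
rewrite mulrDl {1}c2' mulrDr.
have -> : a * a ^+ 2 = a ^+ 3 by rewrite exprS.
have -> : a * b ^+ 2 = a * b * b by rewrite expr2 mulrA.
have : 0 <= b * c ^+ 2 by rewrite mulr_ge0 ?sqr_ge0// ltW.
move: h2; rewrite -(mulrA c) (mulrC c) -mulrA -expr2; lra.
Qed.

Lemma inv_sqrt_le (n : nat) : (sq n.+1%:R)^-1 <= 2 * (sq n.+1%:R - sq n%:R).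
Proof.
set a := sq n.+1%:R; set b := sq n%:R.
have a0 : 0 < a by rewrite sqrtr_gt0.
have b0 : 0 <= b by rewrite sqrtr_ge0.
have E : a ^+ 2 - b ^+ 2 = 1 by rewrite !sqr_sqrtr// -addn1 natrD addrAC subrr add0r.
have ba : b <= a by rewrite ler_wsqrtr// ler_nat.
rewrite -[X in X <= _]mul1r ler_pdivrMr//.
have : (a - b) * (a + b) = 1 by rewrite -E; ring.
have : 0 <= (a - b) * (a - b) by rewrite mulr_ge0 ?subr_ge0.
move: (a - b) => d; nra.
Qed.

Lemma sum_inv_sqrt (i n : nat) :
  \sum_(k < n) (sq (k + i).+1%:R)^-1 <= 2 * sq (n + i)%:R.
Proof.
elim: n => [|n IH]; first by rewrite big_ord0 mulr_ge0.
rewrite big_ord_recr/=; have := inv_sqrt_le (n + i); rewrite addSn.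
move: IH; set x := \sum_(_ < _) _; set y := (sq _)^-1; lra.
Qed.

Lemma inv_sqrt3_le (n : nat) : (0 < n)%N ->
  (sq n.+1%:R ^+ 3)^-1 <= 2 * ((sq n%:R)^-1 - (sq n.+1%:R)^-1).
Proof.
move=> n0; set a := sq n.+1%:R; set b := sq n%:R.
have a0 : 0 < a by rewrite sqrtr_gt0.
have b0 : 0 < b by rewrite sqrtr_gt0 ltr0n.
have E : a ^+ 2 - b ^+ 2 = 1 by rewrite !sqr_sqrtr// -addn1 natrD addrAC subrr add0r.
have ba : b <= a by rewrite ler_wsqrtr// ler_nat.
rewrite -subr_ge0.
have -> : 2 * (b^-1 - a^-1) - (a ^+ 3)^-1 = (2 * a ^+ 2 * (a - b) - b) / (a ^+ 3 * b).
  by field; rewrite !gt_eqF.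
apply: divr_ge0; last by apply/ltW; rewrite mulr_gt0// exprn_gt0.
have h := inv_sqrt_le n; rewrite -/a -/b in h.
have h1 : a <= 2 * a ^+ 2 * (a - b).
  have -> : 2 * a ^+ 2 * (a - b) = a ^+ 2 * (2 * (a - b)) by ring.
  apply: (@le_trans _ _ (a ^+ 2 * a^-1)).
    by rewrite expr2 -mulrA mulfV ?mulr1// gt_eqF.
  by rewrite ler_wpM2l// sqr_ge0.
by rewrite subr_ge0; exact: le_trans ba h1.
Qed.

Lemma sum_inv_sqrt3 (b n : nat) : (0 < b)%N ->
  \sum_(j < n) (sq (b + j).+1%:R ^+ 3)^-1 <= 2 / sq b%:R.
Proof.
move=> b0; have sb n' : 0 < sq (b + n')%:R by rewrite sqrtr_gt0 ltr0n addn_gt0 b0.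
suff : \sum_(j < n) (sq (b + j).+1%:R ^+ 3)^-1 <= 2 * ((sq b%:R)^-1 - (sq (b + n)%:R)^-1).
  have : 0 < (sq (b + n)%:R)^-1 by rewrite invr_gt0.
  move: (\sum_(_ < _) _) => x; lra.
elim: n => [|n IH]; first by rewrite big_ord0 addn0 subrr mulr0.
rewrite big_ord_recr/=; have := @inv_sqrt3_le (b + n); rewrite addn_gt0 b0 => /(_ isT).
rewrite addnS; move: IH; set x := \sum_(_ < _) _; set y := (sq _ ^+ 3)^-1; lra.
Qed.

(** Third derivatives at bandwidth [sqrt (b + j)] weighted by the rate for the remaining product.
    The gain [1 / sqrt b] is what closes the induction. *)
Lemma sum_kernel (b i n : nat) : (0 < b)%N -> (i < b)%N ->
  \sum_(j < n) (sq (b + j).+1%:R ^+ 3 * sq (n - j.+1 + i).+1%:R)^-1 <=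
  10 / (sq b%:R * sq (n + i).+1%:R).
Proof.
move=> b0 ib; set c := sq (b + n + i).+1%:R.
have c0 : 0 < c by exact: sqrt_nat_gt0.
have sb : 0 < sq b%:R by rewrite sqrtr_gt0 ltr0n.
have bc : sq b%:R <= c by rewrite ler_wsqrtr// ler_nat -addnA leqW// leq_addr.
have nc : sq (n + i).+1%:R <= c by rewrite ler_wsqrtr// ler_nat ltnS -addnA leq_addl.
have c2 : c ^+ 2 = (b + n + i).+1%:R by rewrite sqr_sqrtr.
apply: (@le_trans _ _ (\sum_(j < n) ((3 * (sq (b + j).+1%:R ^+ 3)^-1 +
    (sq (n - j.+1 + i).+1%:R)^-1 * (c ^+ 2)^-1) * c^-1))).
  apply: ler_sum => j _.
  have y0 : 0 < (b + j).+1%:R :> R by rewrite ltr0n.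
  have z0 : 0 < (n - j.+1 + i).+1%:R :> R by rewrite ltr0n.
  have := kernel_le y0 z0; rewrite -natrD.
  have -> : ((b + j).+1 + (n - j.+1 + i).+1 = (b + n + i).+1)%N.
    by have := ltn_ord j; lia.
  by rewrite -/c -c2 [(sq (n - j.+1 + i).+1%:R * _)^-1]invfM.
rewrite -mulr_suml big_split/= -mulr_sumr -mulr_suml.
have h1 := sum_inv_sqrt3 n b0.
have h2 : \sum_(j < n) (sq (n - j.+1 + i).+1%:R)^-1 <= 2 * c.
  rewrite (reindex_inj rev_ord_inj)/=.
  apply: (@le_trans _ _ (\sum_(k < n) (sq (k + i).+1%:R)^-1)).
    apply: ler_sum => k _; rewrite (_ : n - (n - k.+1).+1 = k)%N//.
    by have := ltn_ord k; lia.
  apply: (le_trans (sum_inv_sqrt i n)); rewrite ler_wpM2l// ler_wsqrtr// ler_nat.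
  by rewrite leqW// -addnA leq_addl.
have sn : 0 < sq (n + i).+1%:R by exact: sqrt_nat_gt0.
have h3 : (3 * (\sum_(j < n) (sq (b + j).+1%:R ^+ 3)^-1) +
    (\sum_(j < n) (sq (n - j.+1 + i).+1%:R)^-1) * (c ^+ 2)^-1) <= 10 / sq b%:R.
  have h4 : (\sum_(j < n) (sq (n - j.+1 + i).+1%:R)^-1) * (c ^+ 2)^-1 <= 2 / sq b%:R.
    apply: (@le_trans _ _ (2 * c * (c ^+ 2)^-1)).
      by rewrite ler_wpM2r// invr_ge0 sqr_ge0.
    rewrite (_ : 2 * c * (c ^+ 2)^-1 = 2 / c); last by field; rewrite gt_eqF.
    by rewrite ler_wpM2l// lef_pV2.
  have : 0 < (sq b%:R)^-1 by rewrite invr_gt0.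
  move: h1 h4; move: (\sum_(j < n) (sq (b + j).+1%:R ^+ 3)^-1) => x1.
  move: (_ * (c ^+ 2)^-1) => x2; lra.
apply: (@le_trans _ _ (10 / sq b%:R / c)).
  by rewrite ler_wpM2r// invr_ge0 ltW.
rewrite invfM mulrA ler_wpM2l//; last by rewrite lef_pV2.
Qed.

Lemma sqrt_ratio (eps p p' : R) (r : nat) : 0 <= eps -> 0 < p -> p' <= (1 + eps) * p ->
  0 < p' -> (r <= 3)%N -> (sq p ^+ r)^-1 <= (1 + eps) ^+ 2 * (sq p' ^+ r)^-1.
Proof.
move=> e0 p0 pp p'0 r3.
have sp : 0 < sq p ^+ r by rewrite exprn_gt0// sqrtr_gt0.
have sp' : 0 < sq p' ^+ r by rewrite exprn_gt0// sqrtr_gt0.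
rewrite -[_^-1]mul1r ler_pdivrMr// mulrAC ler_pdivlMr// mul1r.
have e1 : 0 <= 1 + eps by rewrite addr_ge0.
have e11 : 1 <= sq (1 + eps) by rewrite -[X in X <= _]sqrtr1 ler_wsqrtr// lerDl.
apply: (@le_trans _ _ ((sq (1 + eps) * sq p) ^+ r)).
  apply: lerXn2r; rewrite ?nnegrE ?mulr_ge0//.
  by rewrite -sqrtrM// ler_wsqrtr.
rewrite exprMn ler_wpM2r//.
apply: (@le_trans _ _ (sq (1 + eps) ^+ 4)).
  by apply: ler_weXn2l => //; rewrite ltnW.
by rewrite (exprM _ 2 2) sqr_sqrtr.
Qed.

End Kernel.

Lemma hexp_shift {R : realType} {dT : measure_display} {T : measurableType dT}
  (P : probability T R) (Y : T -> R) (c : R) r v u :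
  hexp P (fun w => Y w - c) r v u = hexp P Y r v (u + c).
Proof.
apply: eq_Rintegral => w _; rewrite (_ : u - (Y w - c) = u + c - Y w) //.
by ring.
Qed.

Section BerryEsseen.
Context {R : realType} {dT dV : measure_display} {T : measurableType dT}
  {V : measurableType dV}.
Variables (P : probability T R) (tr : V -> R -> V) (x0 : V).
Variables (B : T -> V -> V) (Rk : set T) (rho K : R) (m : T -> R) (U W : V -> R).
Hypotheses (rgB : regenerative P tr x0 B Rk rho K m U W) (trT : translation tr).
Variables (phi q : V -> R) (s Cx : R).
Hypothesis hmB : harmonic P tr B m U phi q s Cx.
Local Notation sq := (@Num.sqrt R).

Let mB := rg_mB rgB.

Section Telescope.
Variables (x : V) (X : nat -> T -> V).
Hypothesis chX : chain P B x X.

(** Blocks are replaced starting from the last one, so that the bandwidth is smallest when the past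
    is longest and its law smoothest. *)
Lemma smooth_telescope (v : nat -> R) (u : R) (n : nat) (c : nat -> R) :
  (forall j, 0 < v j) -> (forall j, v j.+1 = sq (v j ^+ 2 + s ^+ 2)) ->
  (forall j, (j < n)%N ->
    `|\int[P]_w defect P B phi q s (v j) u (X (n - j.+1)%N w)| <= c j) ->
  `|\int[P]_w smooth phi q (v 0%N) u (X n w) - smooth phi q (v n) u x| <=
  \sum_(j < n) c j.
Proof.
move=> v0 vS hc; have w2 := weight_U rgB (isT : (2 <= 3)%N).
have C0 := hm_C hmB; have hB0 : 0 <= hermB :> R by exact: ltW hermB_gt0.
have c20 j : 0 <= hermB + hermB * Cx * (v j ^+ 2)^-1.
  by rewrite addr_ge0// !mulr_ge0// invr_ge0 sqr_ge0.
have ms j := measurable_smooth hmB (v j) u.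
have bs j y := smooth_bound rgB hmB u y (v0 j).
have isX j k := intg_comp_X rgB chX w2 k (ms j) (bs j).
have itX j k := intg_transfer_X rgB chX w2 k (c20 j) (ms j) (bs j).
suff H i : (i <= n)%N -> \int[P]_w smooth phi q (v 0%N) u (X n w) =
    \int[P]_w smooth phi q (v i) u (X (n - i)%N w) +
    \sum_(j < i) \int[P]_w defect P B phi q s (v j) u (X (n - j.+1)%N w).
  rewrite (H n)// subnn; under eq_Rintegral do rewrite (ch_0 chX).
  rewrite Ex_cst addrAC subrr add0r (le_trans (ler_norm_sum _ _ _))//.
  by apply: ler_sum => j _; exact: hc.
elim: i => [|i IH] ni; first by rewrite big_ord0 subn0 addr0.
rewrite (IH (ltnW ni)) big_ord_recr/= addrA (addrAC _ (\sum_(_ < i) _)); congr (_ + _).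
rewrite -subSS subSn// (step_X rgB chX w2 (n - i.+1) (c20 i) (ms i) (bs i)).
rewrite -ExD//.
- by apply: eq_Rintegral => w _; rewrite /defect vS addrC subrK.
- rewrite /defect -vS; exact: (intgB (itX i (n - i.+1)%N) (isX i.+1 (n - i.+1)%N)).
Qed.

Lemma smooth_hexp v u n : 0 < v ->
  \int[P]_w smooth phi q v u (X n w) =
  hexp P (fun w => phi (X n w)) 0 v u +
  2^-1 * \int[P]_w ((v ^+ 2)^-1 * hermG 2 ((u - phi (X n w)) / v) * q (X n w)).
Proof.
move=> v0; have w2 := weight_U rgB (isT : (2 <= 3)%N).
have mX := ch_m chX n.
have mpX : measurable_fun [set: T] (fun w => phi (X n w)).
  exact: measurableT_comp (hm_m hmB) mX.
have iq := intg_comp_X rgB chX w2 n (hm_mq hmB) (hm_qb hmB).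
have iqh : intg P (fun w => (v ^+ 2)^-1 * hermG 2 ((u - phi (X n w)) / v) * q (X n w)).
  apply: (intgMb (measurable_hexp_fun mpX 2 v u) _ iq) => w.
  exact: (hexp_fun_bound (fun w => phi (X n w)) 2 u w v0).
rewrite /smooth ExD//; [|exact: (intg_hexp P mpX)|exact: intgZ].
by rewrite [X in _ + X]ExZ.
Qed.

End Telescope.

(** One constant for the three weights to come: [U ^+ 3] for the defects, [U ^+ 2] for the second
    order term and [W] for the change of observable, the last being at most [K * m] after a
    regeneration. *)
Lemma regeneration_constant : exists2 CR, 1 <= CR & forall Q : V -> R,
  measurable_fun [set: V] Q -> (forall y, 0 <= Q y) ->
  (forall w, Rk w -> Q (B w x0) <= U (B w x0) ^+ 3 + K * m w) ->
  intg P (fun w => \1_Rk w * (Q (B w x0) * m w)) /\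
  \int[P]_w (\1_Rk w * (Q (B w x0) * m w)) <= CR.
Proof.
have i1 := rg_int rgB; have i2 := rg_intg_m rgB (isT : (2 <= 3)%N).
have K0 := rg_K rgB; have m0 := rg_m_ge0 rgB.
have i3 : intg P (fun w => \1_Rk w * (U (B w x0) ^+ 3 * m w) + K * m w ^+ 2).
  exact: (intgD i1 (intgZ K i2)).
have p0 w : 0 <= \1_Rk w * (U (B w x0) ^+ 3 * m w).
  by rewrite indicE mulr_ge0// mulr_ge0// exprn_ge0// (U_ge0 rgB).
exists (1 + \int[P]_w (\1_Rk w * (U (B w x0) ^+ 3 * m w) + K * m w ^+ 2)).
  by rewrite lerDl; apply: Ex_ge0 => w; rewrite addr_ge0// mulr_ge0// sqr_ge0.
move=> Q mQ Q0 QU.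
have Qb w : `|\1_Rk w * (Q (B w x0) * m w)| <=
    \1_Rk w * (U (B w x0) ^+ 3 * m w) + K * m w ^+ 2.
  have km : 0 <= K * m w ^+ 2 by rewrite mulr_ge0// sqr_ge0.
  have := p0 w; rewrite indicE; have [wR|wR] := pselect (Rk w).
    rewrite mem_set//= !mul1r => _; rewrite ger0_norm; last exact: mulr_ge0.
    rewrite expr2 mulrA -mulrDl ler_wpM2r//; exact: QU.
  by rewrite memNset//= !mul0r normr0 add0r.
have mf : measurable_fun [set: T] (fun w => \1_Rk w * (Q (B w x0) * m w)).
  apply: measurable_funM; first exact: measurable_indic (rg_mRk rgB).
  by apply: measurable_funM; [exact: (measurable_B_comp mB)|exact: rg_mm rgB].
split; first exact: intg_le mf i3 Qb.
apply: (le_trans (ler_norm _)); apply: (le_trans (Ex_norm_le mf i3 Qb)).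
by rewrite lerDr.
Qed.

Hypothesis s0 : 0 < s.
Variables (b i : nat).
Hypotheses (b0 : (0 < b)%N) (ib : (i < b)%N).

(** The delay [i] makes consecutive values of the rate comparable up to [theta], close to [1]; the
    square covers the powers [r <= 3] of a square root, and [i < b] does the same for the Gaussian
    part. *)
Let eps : R := i.+1%:R^-1.
Let theta := (1 + eps) ^+ 2.

Let eps0 : 0 <= eps. Proof. by rewrite invr_ge0. Qed.

(** Each Gaussian increment adds [s ^+ 2] to the squared bandwidth; starting from [s ^+ 2 * b.+1]
    instead of zero keeps all derivatives bounded. *)
Definition bw (j : nat) : R := s * sq (b + j).+1%:R.

Let bw0 j : 0 < bw j. Proof. by rewrite mulr_gt0// sqrt_nat_gt0. Qed.

Let bwE j k : sq (bw j ^+ 2 + (s * sq k%:R) ^+ 2) = s * sq (b + j + k).+1%:R.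
Proof.
rewrite !exprMn !sqr_sqrtr// -mulrDr -natrD addSn sqrtrM ?sqr_ge0//.
by rewrite sqrtr_sqr gtr0_norm.
Qed.

Let bwS j : bw j.+1 = sq (bw j ^+ 2 + s ^+ 2).
Proof. by have := bwE j 1; rewrite sqrtr1 mulr1 addn1 -addnS => ->. Qed.

Variable K0 : R.
Hypothesis K00 : 0 <= K0.

(** The bound of [hexp_close] on the [r]-th derivative at bandwidth [bw j] after [k] blocks, granted
    [cdf_claim k] for an observable with [M = 1]. Taking [maxn k 1] keeps the comparison law
    nondegenerate at time [0]. *)
Definition rate (r j k : nat) : R := 10 * hermB *
  (K0 / sq (k + i).+1%:R / bw j ^+ r + ((s * sq (b + j + maxn k 1).+1%:R) ^+ r)^-1).

Lemma rate_ge0 r j k : 0 <= rate r j k.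
Proof.
have hB0 : 0 <= hermB :> R by exact: ltW hermB_gt0.
apply: mulr_ge0; first exact: mulr_ge0.
apply: addr_ge0; last by rewrite invr_ge0 exprn_ge0// mulr_ge0// ltW.
by rewrite !mulr_ge0 ?invr_ge0// exprn_ge0// ltW.
Qed.

Lemma rate_theta r j k : (r <= 3)%N -> rate r j k <= theta * rate r j k.+1.
Proof.
move=> r3; have hB0 : 0 <= hermB :> R by exact: ltW hermB_gt0.
have h p p' r' : (0 < p)%N -> (0 < p')%N -> (i.+1 <= p)%N -> (p' <= p.+1)%N -> (r' <= 3)%N ->
    (sq p%:R ^+ r')^-1 <= theta * (sq p'%:R ^+ r')^-1.
  move=> p0 p'0 ip pp r'3; apply: sqrt_ratio; rewrite ?ltr0n//.
  apply: (@le_trans _ _ p.+1%:R); first by rewrite ler_nat.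
  rewrite -addn1 natrD mulrDl mul1r lerD2l mulrC ler_pdivlMr ?ltr0n// mul1r.
  by rewrite ler_nat.
rewrite /rate mulrCA ler_wpM2l ?mulr_ge0// mulrDr; apply: lerD.
- rewrite mulrA ler_wpM2r ?invr_ge0 ?exprn_ge0//; first exact: ltW.
  rewrite mulrCA ler_wpM2l//.
  by have := h (k + i).+1 (k.+1 + i).+1 1%N isT isT; rewrite !expr1; apply => //; rewrite ltnS leq_addl.
- rewrite !exprMn !invfM mulrCA ler_wpM2l ?invr_ge0 ?exprn_ge0//; first exact: ltW.
  by apply: h => //; lia.
Qed.

Variables (x : V) (X : nat -> T -> V) (n : nat).
Hypothesis chX : chain P B x X.

Definition cdf_claim k := forall psi M, near_phi tr W phi psi M -> forall u,
  `|fine (P [set w | psi (X k w) <= u]) - Phi ((u - phi x) / (s * sq (maxn k 1)%:R))| <=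
  M * (K0 / sq (k + i).+1%:R).

Lemma hexp_rate psi M k r j u : cdf_claim k -> near_phi tr W phi psi M -> (r < 4)%N ->
  `|hexp P (fun w => psi (X k w)) r (bw j) u| <= M * rate r j k.
Proof.
move=> hk hpsi r4; have [mpsi _ _ M1] := hpsi.
have M0 : 0 <= M by exact: le_trans ler01 M1.
have hB0 : 0 <= hermB :> R by exact: ltW hermB_gt0.
have mpX : measurable_fun [set: T] (fun w => psi (X k w)).
  exact: measurableT_comp mpsi (ch_m chX k).
have mY : measurable_fun [set: T] (fun w => psi (X k w) - phi x).
  exact: measurable_funB.
have sk0 : 0 < s * sq (maxn k 1)%:R by rewrite mulr_gt0// sqrtr_gt0 ltr0n leq_max orbT.
have d0 : 0 <= M * (K0 / sq (k + i).+1%:R) by rewrite !mulr_ge0 ?invr_ge0.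
have cdf t : `|fine (P [set w | psi (X k w) - phi x <= t]) -
    Phi (t / (s * sq (maxn k 1)%:R))| <= M * (K0 / sq (k + i).+1%:R).
  have := hk _ _ hpsi (t + phi x); rewrite addrK.
  suff -> : [set w | psi (X k w) <= t + phi x] = [set w | psi (X k w) - phi x <= t] by [].
  by apply/seteqP; split => w /=; rewrite lerBlDr.
have := hexp_close mY sk0 d0 cdf (u - phi x) r4 (bw0 j).
rewrite hexp_shift subrK.
move=> h; apply: (le_trans h); rewrite bwE /rate [leRHS]mulrCA ler_wpM2l ?mulr_ge0// mulrDr.
apply: lerD; first by rewrite -!mulrA.
by rewrite ler_peMl// invr_ge0 exprn_ge0// mulr_ge0// ltW.
Qed.

Variable CR : R.
Hypotheses (CR1 : 1 <= CR) (hCR : forall Q : V -> R,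
  measurable_fun [set: V] Q -> (forall y, 0 <= Q y) ->
  (forall w, Rk w -> Q (B w x0) <= U (B w x0) ^+ 3 + K * m w) ->
  intg P (fun w => \1_Rk w * (Q (B w x0) * m w)) /\
  \int[P]_w (\1_Rk w * (Q (B w x0) * m w)) <= CR).
Hypotheses (thr : theta * rho < 1) (K1 : sq i.+1%:R * (U x ^+ 3 + W x) <= K0).

Definition BC : R := theta * ((1 + Cx) * CR) / (1 - theta * rho).

Let theta1 : 1 <= theta. Proof. by rewrite exprn_ege1// lerDl. Qed.

Let theta0 : 0 <= theta. Proof. exact: le_trans ler01 theta1. Qed.

Lemma BC_ge1 : 1 <= BC.
Proof.
have /andP[r0 _] := rg_rho rgB; have C0 := hm_C hmB.
rewrite /BC ler_pdivlMr ?subr_gt0// mul1r.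
apply: (@le_trans _ _ 1); first by rewrite lerBlDr lerDl mulr_ge0.
by rewrite mulr_ege1// mulr_ege1// lerDl.
Qed.

Lemma hermB_ge1 : 1 <= hermB :> R.
Proof. by rewrite /hermB unlock ler1n. Qed.

(** The chain may reach back to time [0] without any regeneration; [K0] dominates the weights of the
    starting point so that this contribution also fits into the rate. *)
Lemma rate_init r j y : (r <= 3)%N -> 0 <= y -> y <= U x ^+ 3 + W x ->
  hermB / bw j ^+ r * y <= rate r j 0.
Proof.
move=> r3 y0 yU; have hB0 : 0 <= hermB :> R by exact: ltW hermB_gt0.
have i0 : 0 <= (bw j ^+ r)^-1 by rewrite invr_ge0 exprn_ge0// ltW.
have yK : y <= K0 / sq i.+1%:R.
  by rewrite ler_pdivlMr ?sqrt_nat_gt0// (le_trans _ K1)// mulrC ler_wpM2l.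
have j0 : 0 <= ((s * sq (b + j + maxn 0 1).+1%:R) ^+ r)^-1.
  by rewrite invr_ge0 exprn_ge0// mulr_ge0// ltW.
rewrite /rate add0n -mulrA -[10 * hermB * _]mulrA mulrCA.
apply: (@le_trans _ _ (hermB * (10 * (K0 / sq i.+1%:R / bw j ^+ r)))); last first.
  by rewrite mulrCA ler_wpM2l// ler_wpM2l// lerDl.
rewrite mulrCA; apply: ler_wpM2l => //.
apply: (@le_trans _ _ (K0 / sq i.+1%:R / bw j ^+ r)).
  by rewrite mulrC ler_wpM2r.
have q0 : 0 <= K0 / sq i.+1%:R by rewrite divr_ge0.
by rewrite ler_peMl ?ler1n//; exact: mulr_ge0.
Qed.

Let UUW y : U y ^+ 2 <= U y ^+ 3. Proof. by apply: ler_weXn2l => //; exact: rg_U1 rgB y. Qed.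

Let W0 y : 0 <= W y. Proof. exact: le_trans ler01 (rg_W1 rgB y). Qed.

Let U0 y : 0 <= U y. Proof. exact: U_ge0 rgB y. Qed.

Lemma error_defect u :
  (forall k, (k < n)%N -> cdf_claim k) ->
  `|\int[P]_w smooth phi q (bw 0%N) u (X n w) - smooth phi q (bw n) u x| <=
  \sum_(j < n) BC * (CL P m s Cx * rate 3 j (n - j.+1)).
Proof.
move=> hk.
apply: (smooth_telescope chX bw0 bwS (c := fun j => BC * (CL P m s Cx * rate 3 j (n - j.+1)))).
move=> j jn.
have w3 := weight_U rgB (isT : (3 <= 3)%N).
have [iR hR] := hCR (weight_measurable w3) (weight_ge0 w3)
  (fun w wR => ltac:(rewrite lerDl mulr_ge0 ?(rg_K rgB) ?(rg_m_ge0 rgB)//)).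
have CL0 := CL_ge0 rgB hmB; have BC1 := BC_ge1.
have hB0 : 0 <= hermB :> R by exact: ltW hermB_gt0.
apply: (last_regeneration rgB trT hmB chX (n := (n - j.+1)%N) (D := fun k => CL P m s Cx * rate 3 j k)
  (f := defect P B phi q s (bw j) u) (d := CL P m s Cx * (hermB / bw j ^+ 3)) w3 iR hR theta0 thr) => //.
- by move=> k; rewrite mulr_ge0// rate_ge0.
- by move=> k; rewrite [leRHS]mulrCA ler_wpM2l// rate_theta.
- by rewrite mulr_ge0// divr_ge0// exprn_ge0// ltW.
- exact: (measurable_defect rgB hmB).
- by move=> y; exact: (defect_bound rgB trT hmB).
- move=> psi M hpsi k kj z; have [mpsi _ _ _] := hpsi.
  have kn : (k < n)%N by apply: (leq_trans kj); rewrite leq_subr.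
  have := defect_average rgB trT hmB (Pr := P) u z
    (measurableT_comp mpsi (ch_m chX k)) (bw0 j) (fun t => hexp_rate (r := 3) j t (hk k kn) hpsi isT).
  by rewrite /Lam (mulrCA M (CL P m s Cx)).
- rewrite -mulrA; apply: (@le_trans _ _ (CL P m s Cx * rate 3 j 0)).
    rewrite ler_wpM2l// rate_init// ?exprn_ge0// lerDl//.
  by rewrite ler_peMl// mulr_ge0// rate_ge0.
Qed.

Lemma error_second_order u : (forall k, (k < n)%N -> cdf_claim k) ->
  `|\int[P]_w ((bw 0 ^+ 2)^-1 * hermG 2 ((u - phi (X n w)) / bw 0) * q (X n w))| <=
  BC * (Cx * rate 2 0 n).
Proof.
move=> hk; have w2 := weight_U rgB (isT : (2 <= 3)%N).
have C0 := hm_C hmB; have BC1 := BC_ge1.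
have hB0 : 0 <= hermB :> R by exact: ltW hermB_gt0.
have [iR hR] := hCR (weight_measurable w2) (weight_ge0 w2)
  (fun w wR => ltac:(apply: (le_trans (UUW _)); rewrite lerDl mulr_ge0 ?(rg_K rgB) ?(rg_m_ge0 rgB)//)).
pose f y := (bw 0 ^+ 2)^-1 * hermG 2 ((u - phi y) / bw 0) * q y.
apply: (last_regeneration rgB trT hmB chX (n := n) (D := fun k => Cx * rate 2 0 k)
  (f := f) (d := Cx * (hermB / bw 0 ^+ 2)) w2 iR hR theta0 thr) => //.
- by move=> k; rewrite mulr_ge0// rate_ge0.
- by move=> k; rewrite [leRHS]mulrCA ler_wpM2l// rate_theta.
- by rewrite mulr_ge0// divr_ge0// exprn_ge0// ltW.
- apply: measurable_funM; last exact: hm_mq hmB.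
  exact: (measurable_hexp_fun (hm_m hmB)).
- move=> y; rewrite /f normrM.
  rewrite [leRHS](_ : _ = hermB / bw 0 ^+ 2 * (Cx * U y ^+ 2)); last by ring.
  apply: ler_pM => //; first exact: (hexp_fun_bound phi 2 u y (bw0 0)).
  exact: hm_qb hmB y.
- move=> psi M hpsi k kn z; have [mpsi epsi _ M1] := hpsi.
  have mpX := measurableT_comp mpsi (ch_m chX k).
  have -> : Lam P tr X psi k f z = q z * hexp P (fun w => psi (X k w)) 2 (bw 0) (u - phi z).
    rewrite -ExZ; last exact: (intg_hexp P mpX).
    apply: eq_Rintegral => w _; rewrite /f (hm_e hmB) (hm_cq hmB) opprD addrA; exact: mulrC.
  rewrite normrM [leRHS](_ : _ = Cx * U z ^+ 2 * (M * rate 2 0 k)); last by ring.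
  apply: ler_pM => //; first exact: hm_qb hmB z.
  exact: (hexp_rate _ _ (hk k kn)).
- rewrite -mulrA; apply: (@le_trans _ _ (Cx * rate 2 0 0)).
    rewrite ler_wpM2l// rate_init// ?exprn_ge0//.
    by apply: (le_trans (UUW x)); rewrite lerDl.
  by rewrite ler_peMl// mulr_ge0// rate_ge0.
Qed.

(** Replacing [phi] by [psi] moves the argument of the mollified law by at most [M * W], at the
    price of one derivative; the regeneration argument is then run with the weight [W]. *)
Lemma error_observable psi M u : (forall k, (k < n)%N -> cdf_claim k) ->
  near_phi tr W phi psi M ->
  `|hexp P (fun w => psi (X n w)) 0 (bw 0) u - hexp P (fun w => phi (X n w)) 0 (bw 0) u| <=
  BC * (M * rate 1 0 n).
Proof.
move=> hk hpsi; have w1 := weight_W rgB (isT : (1 <= 3)%N).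
have [mpsi epsi bpsi M1] := hpsi; have M0 : 0 <= M by exact: le_trans ler01 M1.
have BC1 := BC_ge1; have hB0 : 0 <= hermB :> R by exact: ltW hermB_gt0.
have U30 y : 0 <= U y ^+ 3 by rewrite exprn_ge0.
have [iR hR] := hCR (weight_measurable w1) (weight_ge0 w1)
  (fun w wR => ltac:(rewrite /= expr1; apply: (le_trans (rg_RW rgB x0 wR)); rewrite lerDr//)).
have mphi := hm_m hmB.
pose f y := (bw 0 ^+ 0)^-1 * hermG 0 ((u - psi y) / bw 0) -
  (bw 0 ^+ 0)^-1 * hermG 0 ((u - phi y) / bw 0).
have mX := ch_m chX n.
rewrite -ExB; last 2 first.
- exact: (intg_hexp P (measurableT_comp mpsi mX)).
- exact: (intg_hexp P (measurableT_comp mphi mX)).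
apply: (last_regeneration rgB trT hmB chX (n := n) (D := fun k => M * rate 1 0 k)
  (f := f) (d := M * (hermB / bw 0 ^+ 1)) w1 iR hR theta0 thr) => //.
- by move=> k; rewrite mulr_ge0// rate_ge0.
- by move=> k; rewrite [leRHS]mulrCA ler_wpM2l// rate_theta.
- by rewrite mulr_ge0// divr_ge0// exprn_ge0// ltW.
- by apply: measurable_funB; exact: measurable_hexp_fun.
- move=> y; rewrite /f !expr0 invr1 !mul1r; apply: (le_trans (Phi_lipschitz _ _)).
  rewrite -mulrBl (_ : u - psi y - (u - phi y) = phi y - psi y); last by ring.
  rewrite normrM [`|(bw 0)^-1|]gtr0_norm ?invr_gt0// distrC !expr1.
  rewrite [leRHS](_ : _ = M * W y * hermB / bw 0); last by ring.
  rewrite ler_wpM2r ?invr_ge0 ?(ltW (bw0 0))//; apply: (le_trans (bpsi y)).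
  by rewrite ler_peMr ?hermB_ge1// mulr_ge0.
- move=> psi' M' hpsi' k kn z; have [mpsi' epsi' _ M'1] := hpsi'.
  have mpX := measurableT_comp mpsi' (ch_m chX k).
  have -> : Lam P tr X psi' k f z = hexp P (fun w => psi' (X k w)) 0 (bw 0) (u - psi z) -
      hexp P (fun w => psi' (X k w)) 0 (bw 0) (u - phi z).
    rewrite -ExB; [|exact: (intg_hexp P mpX)..].
    by apply: eq_Rintegral => w _; rewrite /f (hm_e hmB) epsi !opprD !addrA.
  have d0 t := is_derive_hexp P mpX t (isT : (0 < 4)%N) (bw0 0).
  have := lipschitz_derive d0 (fun t => hexp_rate (r := 1) 0 t (hk k kn) hpsi' isT)
    (u - phi z) (u - psi z).
  move=> h; apply: (le_trans h).
  rewrite (_ : u - psi z - (u - phi z) = phi z - psi z); last by ring.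
  rewrite distrC (_ : M' * (M * rate 1 0 k) * W z ^+ 1 = M' * rate 1 0 k * (M * W z)); last by ring.
  by rewrite ler_wpM2l// mulr_ge0 ?rate_ge0// (le_trans ler01).
- rewrite -mulrA; apply: (@le_trans _ _ (M * rate 1 0 0)).
    rewrite ler_wpM2l// rate_init// ?exprn_ge0//.
    by rewrite expr1 lerDr.
  by rewrite ler_peMl// mulr_ge0// rate_ge0.
Qed.

Hypothesis n0 : (0 < n)%N.
Let L := sq (n + i).+1%:R.
Let I := sq i.+2%:R.

Let L0 : 0 < L. Proof. exact: sqrt_nat_gt0. Qed.

Let sqb0 : 0 < sq b%:R. Proof. by rewrite sqrtr_gt0 ltr0n. Qed.

Let sqn0 : 0 < sq n%:R. Proof. by rewrite sqrtr_gt0 ltr0n. Qed.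

Lemma inv_sqrt_rate : (sq n%:R)^-1 <= I / L.
Proof.
rewrite ler_pdivlMr// mulrC ler_pdivrMr// -sqrtrM//.
by rewrite ler_wsqrtr// -natrM ler_nat mulSn -addnS leq_add2l leq_pmulr.
Qed.

Lemma rate_last r : (0 < r)%N ->
  rate r 0 n <= 10 * hermB / s ^+ r * (K0 / (sq b%:R * L) + I / L).
Proof.
move=> r0; have hB0 : 0 <= hermB :> R by exact: ltW hermB_gt0.
have sr : 0 < s ^+ r by rewrite exprn_gt0.
rewrite /rate -/L -[leRHS]mulrA; apply: ler_wpM2l; first exact: mulr_ge0.
have inv_le p p' : (0 < p)%N -> (p <= p')%N -> (sq p'%:R ^+ r)^-1 <= (sq p%:R)^-1.
  move=> p0 pp'; have p1 : 1 <= sq p%:R by rewrite -[X in X <= _]sqrtr1 ler_wsqrtr// ler1n.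
  have pp : sq p%:R <= sq p'%:R by rewrite ler_wsqrtr// ler_nat.
  have sp : 0 < sq p%:R by exact: lt_le_trans ltr01 p1.
  rewrite lef_pV2 ?posrE//; last by rewrite exprn_gt0// (lt_le_trans sp).
  apply: (le_trans pp); apply: ler_eXnr => //; exact: le_trans pp.
rewrite mulrDr; apply: lerD.
- rewrite /bw exprMn (invfM (s ^+ r)) (invfM (sq b%:R)).
  rewrite (_ : _ / _ * _ = (s ^+ r)^-1 * (K0 * L^-1 * (sq (b + 0).+1%:R ^+ r)^-1)); last by ring.
  rewrite ler_wpM2l ?invr_ge0 ?(ltW sr)// -mulrA ler_wpM2l// [leLHS]mulrC.
  by rewrite ler_wpM2r ?invr_ge0 ?(ltW L0)// inv_le// addn0.
- rewrite exprMn invfM ler_wpM2l ?invr_ge0 ?(ltW sr)//.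
  apply: le_trans inv_sqrt_rate; apply: inv_le => //.
  by rewrite (leq_trans _ (leqnSn _))// (leq_trans (leq_maxl n 1))// leq_addl.
Qed.

Lemma sum_rate : \sum_(j < n) rate 3 j (n - j.+1) <=
  10 * hermB / s ^+ 3 * (10 * (K0 / (sq b%:R * L)) + I / L).
Proof.
have hB0 : 0 <= hermB :> R by exact: ltW hermB_gt0.
have sr : 0 < s ^+ 3 by rewrite exprn_gt0.
apply: (@le_trans _ _ (\sum_(j < n) (10 * hermB / s ^+ 3 *
    (K0 * (sq (b + j).+1%:R ^+ 3 * sq (n - j.+1 + i).+1%:R)^-1 + (sq n%:R ^+ 3)^-1)))).
  apply: ler_sum => j _; rewrite /rate -[leRHS]mulrA.
  apply: ler_wpM2l; first exact: mulr_ge0.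
  rewrite mulrDr; apply: lerD.
    by rewrite /bw exprMn !invfM le_eqVlt; apply/orP; left; apply/eqP; ring.
  rewrite exprMn invfM ler_wpM2l ?invr_ge0 ?(ltW sr)//.
  rewrite lef_pV2 ?posrE ?exprn_gt0 ?sqrt_nat_gt0//.
  apply: lerXn2r; rewrite ?nnegrE// ler_wsqrtr// ler_nat.
  rewrite -addSn; apply: (@leq_trans (j.+1 + (n - j.+1))); first by rewrite subnKC.
  by apply: leq_add; [rewrite ltnS leq_addl|exact: leq_maxl].
rewrite -mulr_sumr; apply: ler_wpM2l; first by rewrite divr_ge0 ?mulr_ge0// ltW.
rewrite big_split/= -mulr_sumr sumr_const card_ord; apply: lerD.
  rewrite [leRHS]mulrCA; apply: ler_wpM2l => //; exact: sum_kernel.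
rewrite -[leLHS]mulr_natr; apply: le_trans inv_sqrt_rate.
rewrite -[X in _ * X <= _](sqr_sqrtr (ler0n R n)).
by rewrite le_eqVlt; apply/orP; left; apply/eqP; field; rewrite gt_eqF.
Qed.

(** The four sources of error: the defects, the second order term at the end, the change of
    observable, and the second order term at the start. These constants depend on [i] through [BC]
    but not on [b], which can therefore be chosen after them. *)
Let k1 := BC * CL P m s Cx * (10 * hermB / s ^+ 3).
Let k2 := BC * Cx * (10 * hermB / s ^+ 2).
Let k3 := BC * (10 * hermB / s).
Let k4 := hermB * Cx / s ^+ 2.

Hypotheses (Hb : 4 * (10 * k1 + k2 + k3) <= sq b%:R)
  (HK : 4 * I * (k1 + k2 + k3 + k4 + 3 * sq b.+1%:R) * (U x ^+ 3 + W x) <= K0).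

Lemma smooth_last u :
  `|smooth phi q (bw n) u x - Phi ((u - phi x) / bw n)| <= k4 * U x ^+ 2 * (I / L).
Proof.
have hB0 : 0 <= hermB :> R by exact: ltW hermB_gt0.
have C0 := hm_C hmB.
rewrite /smooth expr0 invr1 mul1r addrAC subrr add0r.
set h := (_ * hermG 2 _); have hb : `|h| <= hermB / s ^+ 2 * (I / L).
  rewrite /h normrM ger0_norm ?invr_ge0 ?sqr_ge0//.
  apply: (@le_trans _ _ ((bw n ^+ 2)^-1 * hermB)).
    by rewrite ler_wpM2l ?invr_ge0 ?sqr_ge0// hermG_bounded.
  rewrite /bw exprMn invfM [leLHS](_ : _ = hermB / s ^+ 2 * (sq (b + n).+1%:R ^+ 2)^-1); last by ring.
  rewrite ler_wpM2l ?divr_ge0 ?sqr_ge0//.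
  apply: le_trans inv_sqrt_rate; rewrite lef_pV2 ?posrE ?exprn_gt0 ?sqrt_nat_gt0//.
  apply: (@le_trans _ _ (sq (b + n).+1%:R)); first by rewrite ler_wsqrtr// ler_nat (leq_trans _ (leqnSn _))// leq_addl.
  apply: ler_eXnr => //; rewrite -[X in X <= _]sqrtr1 ler_wsqrtr// ler1n//.
apply: (@le_trans _ _ (`|h| * `|q x|)).
  rewrite normrM normrM ger0_norm ?invr_ge0// ler_piMl ?mulr_ge0//.
  by rewrite invf_le1// ler1n.
apply: (@le_trans _ _ (hermB / s ^+ 2 * (I / L) * (Cx * U x ^+ 2))).
  by apply: ler_pM => //; exact: hm_qb hmB x.
by rewrite /k4 le_eqVlt; apply/orP; left; apply/eqP; ring.
Qed.

Lemma cdf_step : (forall k, (k < n)%N -> cdf_claim k) -> cdf_claim n.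
Proof.
move=> hk psi M hpsi u; have [mpsi epsi bpsi M1] := hpsi.
have M0 : 0 <= M by exact: le_trans ler01 M1.
have hB0 : 0 <= hermB :> R by exact: ltW hermB_gt0.
have C0 := hm_C hmB; have BC1 := BC_ge1; have BC0 : 0 <= BC by exact: le_trans ler01 BC1.
have CL0 := CL_ge0 rgB hmB.
have isr r : 0 <= 10 * hermB / s ^+ r.
  by rewrite divr_ge0 ?mulr_ge0 ?exprn_ge0 ?(ltW s0).
have k10 : 0 <= k1 by apply: mulr_ge0 (isr 3%N); exact: mulr_ge0.
have k20 : 0 <= k2 by apply: mulr_ge0 (isr 2%N); exact: mulr_ge0.
have k30 : 0 <= k3 by rewrite mulr_ge0//; have := isr 1%N; rewrite expr1.
have k40 : 0 <= k4 by rewrite divr_ge0 ?mulr_ge0 ?exprn_ge0 ?(ltW s0).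
pose a1 := K0 / (sq b%:R * L); pose a2 := I / L.
have a10 : 0 <= a1 by rewrite divr_ge0// mulr_ge0 ?ltW.
have a20 : 0 <= a2 by rewrite divr_ge0 ?(ltW L0)// sqrtr_ge0.
pose eps1 := M * ((10 * k1 + k2 + k3) * a1 + (k1 + k2 + k3 + k4 * U x ^+ 2) * a2).
have main t : `|hexp P (fun w => psi (X n w)) 0 (bw 0) t - Phi ((t - phi x) / bw n)| <= eps1.
  have e1 := error_defect t hk.
  have e2 := error_second_order t hk.
  have e3 := error_observable t hk hpsi.
  have e4 := smooth_last t.
  rewrite (smooth_hexp chX t n (bw0 0)) in e1.
  have f1 : \sum_(j < n) BC * (CL P m s Cx * rate 3 j (n - j.+1)) <= k1 * (10 * a1 + a2).
    have -> : \sum_(j < n) BC * (CL P m s Cx * rate 3 j (n - j.+1)) =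
        BC * CL P m s Cx * \sum_(j < n) rate 3 j (n - j.+1).
      by rewrite mulr_sumr; apply: eq_bigr => j _; rewrite mulrA.
    rewrite /k1 -[leRHS]mulrA; apply: ler_wpM2l; [exact: mulr_ge0|exact: sum_rate].
  have f2 : BC * (Cx * rate 2 0 n) <= k2 * (a1 + a2).
    rewrite mulrA /k2 -[leRHS]mulrA; apply: ler_wpM2l; [exact: mulr_ge0|exact: rate_last].
  have f3 : BC * (M * rate 1 0 n) <= M * (k3 * (a1 + a2)).
    rewrite [leLHS]mulrCA; apply: ler_wpM2l => //.
    rewrite /k3 -[leRHS]mulrA; apply: ler_wpM2l => //.
    by have := @rate_last 1 isT; rewrite expr1.
  have g2 : 0 <= k2 * (a1 + a2) by rewrite mulr_ge0// addr_ge0.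
  have g3 : 0 <= k1 * (10 * a1 + a2) by rewrite mulr_ge0// addr_ge0// mulr_ge0.
  have g4 : 0 <= k4 * U x ^+ 2 * a2 by rewrite mulr_ge0// mulr_ge0// sqr_ge0.
  have g1 : k1 * (10 * a1 + a2) + k2 * (a1 + a2) + k4 * U x ^+ 2 * a2 <=
      M * (k1 * (10 * a1 + a2) + k2 * (a1 + a2) + k4 * U x ^+ 2 * a2).
    by rewrite ler_peMl// addr_ge0// addr_ge0.
  have -> : eps1 = M * (k1 * (10 * a1 + a2) + k2 * (a1 + a2) + k4 * U x ^+ 2 * a2) +
      M * (k3 * (a1 + a2)) by rewrite /eps1; ring.
  rewrite -/a2 in e4.
  move: e1 e2 e3 e4 f1 f2 f3 g1 g2.
  set A := hexp _ _ _ _ _; set B' := hexp _ _ _ _ _; set Cq := \int[P]_w _.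
  set S := smooth _ _ _ _ _; set F := Phi _; set Sg := \sum_(_ < _) _.
  set r2 := BC * (Cx * _); set r3 := BC * (M * _).
  rewrite !ler_norml => /andP[? ?] /andP[? ?] /andP[? ?] /andP[? ?] ? ? ? ? ?.
  by apply/andP; split; lra.
have mY : measurable_fun [set: T] (fun w => psi (X n w) - phi x).
  by apply: measurable_funB => //; exact: measurableT_comp mpsi (ch_m chX n).
have sn0 : 0 < s * sq n%:R by rewrite mulr_gt0.
have bwn : sq (bw 0 ^+ 2 + (s * sq n%:R) ^+ 2) = bw n by rewrite bwE addn0.
have main' t : `|hexp P (fun w => psi (X n w) - phi x) 0 (bw 0) t -
    Phi (t / sq (bw 0 ^+ 2 + (s * sq n%:R) ^+ 2))| <= eps1.
  by have := main (t + phi x); rewrite addrK bwn hexp_shift.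
have := desmoothing mY (bw0 0) sn0 main' (u - phi x).
have -> : [set w | psi (X n w) - phi x <= u - phi x] = [set w | psi (X n w) <= u].
  by apply/seteqP; split => w /=; rewrite lerD2r.
rewrite (_ : maxn n 1 = n); last by apply/maxn_idPl.
move=> h; apply: (le_trans h); rewrite -/L.
have -> : bw 0 / (s * sq n%:R) = sq b.+1%:R * (sq n%:R)^-1.
  by rewrite /bw addn0 invfM mulrACA mulfV ?mul1r// gt_eqF.
have h1 : sq b.+1%:R * (sq n%:R)^-1 <= M * (sq b.+1%:R * a2).
  apply: (@le_trans _ _ (sq b.+1%:R * a2)); first by rewrite ler_wpM2l// inv_sqrt_rate.
  by rewrite ler_peMl// mulr_ge0.
(* Here [Hb] keeps the inherited errors below a quarter of the target, and [HK] does the same for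
   the others in [h3]; the factor [2] of [desmoothing] makes each of them one half. *)
have h2 : (10 * k1 + k2 + k3) * a1 <= K0 / L / 4.
  rewrite (_ : K0 / L / 4 = sq b%:R / 4 * a1); last first.
    by rewrite /a1; field; rewrite !gt_eqF.
  by rewrite ler_wpM2r//; move: Hb; lra.
have h3 : (k1 + k2 + k3 + k4 * U x ^+ 2 + 3 * sq b.+1%:R) * a2 <= K0 / L / 4.
  have UW1 : 1 <= U x ^+ 3 + W x.
    by rewrite (le_trans (rg_W1 rgB x))// lerDr exprn_ge0.
  have UW2 : U x ^+ 2 <= U x ^+ 3 + W x by rewrite (le_trans (UUW x))// lerDl.
  rewrite (_ : K0 / L / 4 = (K0 / 4) / L); last by rewrite mulrAC.
  rewrite /a2 mulrA ler_wpM2r ?invr_ge0 ?(ltW L0)// ler_pdivlMr//.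
  apply: le_trans HK.
  rewrite (_ : 4 * I * _ * _ =
    (k1 + k2 + k3 + k4 + 3 * sq b.+1%:R) * (U x ^+ 3 + W x) * I * 4); last by ring.
  rewrite ler_wpM2r// ler_wpM2r ?sqrtr_ge0//.
  have b1 : 0 <= k1 + k2 + k3 + 3 * sq b.+1%:R by rewrite !addr_ge0// mulr_ge0.
  have h31 : k4 * U x ^+ 2 <= k4 * (U x ^+ 3 + W x) by rewrite ler_wpM2l.
  have h32 := ler_wpM2l b1 UW1.
  move: h31 h32; lra.
have -> : 2 * eps1 + 6 * (sq b.+1%:R * (sq n%:R)^-1) =
    2 * (M * ((10 * k1 + k2 + k3) * a1)) +
    2 * (M * ((k1 + k2 + k3 + k4 * U x ^+ 2) * a2)) + 6 * (sq b.+1%:R * (sq n%:R)^-1).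
  by rewrite /eps1; ring.
have := ler_wpM2l M0 h2; have := ler_wpM2l M0 h3.
move: h1; rewrite !(mulrDl, mulrDr); lra.
Qed.

End BerryEsseen.

Section BerryEsseenTheorem.
Context {R : realType} {dT dV : measure_display} {T : measurableType dT}
  {V : measurableType dV}.
Variables (P : probability T R) (tr : V -> R -> V) (x0 : V).
Variables (B : T -> V -> V) (Rk : set T) (rho K : R) (m : T -> R) (U W : V -> R).
Hypotheses (rgB : regenerative P tr x0 B Rk rho K m U W) (trT : translation tr).
Variables (phi q : V -> R) (s Cx : R).
Hypothesis hmB : harmonic P tr B m U phi q s Cx.
Local Notation sq := (@Num.sqrt R).

Lemma nat_above (y : R) : exists n : nat, y <= n%:R.
Proof.
exists (Num.bound `|y|); apply: (le_trans (ler_norm y)).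
exact: ltW (archi_boundP (normr_ge0 y)).
Qed.

Theorem chain_berry_esseen : 0 < s -> exists2 C : R, 0 <= C &
  forall x X, chain P B x X -> forall psi M, near_phi tr W phi psi M -> forall k u,
  `|fine (P [set w | psi (X k w) <= u]) - Phi ((u - phi x) / (s * sq (maxn k 1)%:R))| <=
  M * (C * (U x ^+ 3 + W x) / sq k.+1%:R).
Proof.
move=> s0; have /andP[r0 r1] := rg_rho rgB.
have [CR CR1 hCR] := regeneration_constant rgB.
(* The order of the choices matters: [i] depends on [rho], then [b] on constants involving [i], and
   finally [K0] on [b] and on the weights of [x]. *)
have [i hi] : exists i : nat, (1 + (i.+1%:R^-1 : R)) ^+ 2 * rho < 1.
  have r10 : 0 < 1 - rho by rewrite subr_gt0.
  have [i hi] := nat_above (3 / (1 - rho)); exists i.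
  have e0 : 0 < i.+1%:R^-1 :> R by rewrite invr_gt0.
  have e1 : i.+1%:R^-1 <= 1 :> R by rewrite invf_le1// ler1n.
  have e3 : 3 * i.+1%:R^-1 <= 1 - rho.
    rewrite ler_pdivrMr ?ltr0n//; rewrite ler_pdivrMr// in hi.
    by rewrite mulrC (le_trans hi)// ler_wpM2r ?(ltW r10)// ler_nat.
  move: e0 e1 e3; set e := _^-1 => e0 e1 e3.
  have e2 : (1 + e) ^+ 2 <= 2 - rho by nra.
  apply: le_lt_trans (ler_wpM2r r0 e2) _.
  have : 0 < (1 - rho) * (1 - rho) by rewrite mulr_gt0.
  by lra.
pose c1 : R := BC rho Cx i CR * CL P m s Cx * (10 * hermB / s ^+ 3).
pose c2 : R := BC rho Cx i CR * Cx * (10 * hermB / s ^+ 2).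
pose c3 : R := BC rho Cx i CR * (10 * hermB / s).
pose c4 : R := hermB * Cx / s ^+ 2.
have [b' hb'] := nat_above ((4 * (10 * c1 + c2 + c3)) ^+ 2).
pose b := maxn i.+1 b'.
have Hb : 4 * (10 * c1 + c2 + c3) <= sq b%:R.
  apply: (le_trans (ler_norm _)); rewrite -sqrtr_sqr ler_wsqrtr// (le_trans hb')//.
  by rewrite ler_nat leq_maxr.
have ib : (i < b)%N by rewrite leq_maxl.
have b0 : (0 < b)%N by rewrite (leq_trans _ ib).
pose C := sq i.+1%:R + `|4 * sq i.+2%:R * (c1 + c2 + c3 + c4 + 3 * sq b.+1%:R)|.
have C0 : 0 <= C by rewrite addr_ge0.
exists C => // x X chX psi M hpsi k u.
have [_ _ _ M1] := hpsi; have M0 : 0 <= M by exact: le_trans ler01 M1.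
have W1 := rg_W1 rgB x; have U30 : 0 <= U x ^+ 3 by rewrite exprn_ge0// (U_ge0 rgB).
have UW1 : 1 <= U x ^+ 3 + W x by rewrite (le_trans W1)// lerDr.
have UW0 : 0 <= U x ^+ 3 + W x by exact: le_trans ler01 UW1.
pose K0 := C * (U x ^+ 3 + W x).
have K00 : 0 <= K0 by exact: mulr_ge0.
have K1 : sq i.+1%:R * (U x ^+ 3 + W x) <= K0 by rewrite ler_wpM2r// lerDl.
have HK : 4 * sq i.+2%:R * (c1 + c2 + c3 + c4 + 3 * sq b.+1%:R) * (U x ^+ 3 + W x) <= K0.
  by rewrite ler_wpM2r// (le_trans (ler_norm _))// lerDr.
have H n : cdf_claim P tr W phi s i K0 x X n.
  (* At time [0] the claim is trivial: by the choice of [K0] its right-hand side is at least [1]. *)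
  elim/ltn_ind: n => n IH; case: (posnP n) => [n0|n0].
    rewrite n0 => psi' M' [mpsi' _ _ M'1] u'.
    apply: (@le_trans _ _ 1).
      have mA : measurable [set w | psi' (X 0%N w) <= u'].
        exact: measurable_le_set (measurableT_comp mpsi' (ch_m chX 0%N)).
      exact: Phi_dist_le1 (fine_prob01 P mA).
    rewrite mulr_ege1// ler_pdivlMr ?sqrt_nat_gt0// mul1r add0n.
    by rewrite (le_trans _ K1)// ler_peMr.
  exact: (cdf_step rgB trT hmB s0 b0 ib K00 chX CR1 hCR hi K1 n0 Hb HK IH).
apply: (le_trans (H k psi M hpsi u)); rewrite ler_wpM2l// ler_wpM2l//.
by rewrite lef_pV2 ?posrE ?sqrt_nat_gt0// ler_wsqrtr// ler_nat ltnS leq_addr.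
Qed.

End BerryEsseenTheorem.

Section CrudeCLT.
Context {R : realType} {dT dV : measure_display} {T : measurableType dT}
  {V : measurableType dV}.
Variables (P : probability T R) (tr : V -> R -> V) (x0 : V).
Variables (B : T -> V -> V) (Rk : set T) (rho K : R) (m : T -> R) (U W : V -> R).
Hypotheses (rgB : regenerative P tr x0 B Rk rho K m U W) (trT : translation tr).
Variables (phi q : V -> R) (s Cx : R).
Hypothesis hmB : harmonic P tr B m U phi q s Cx.
Variables (x : V) (X : nat -> T -> V).
Hypothesis chX : chain P B x X.
Local Notation sq := (@Num.sqrt R).

(** The same telescoping with uniform bounds on the kernel, hence without induction and without
    positivity of [s]. For [v] of order [sqrt n] the error is of order [1 / sqrt n]: a limit theorem
    for the law smoothed at its own scale, enough to determine [g] and [s]. *)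
Lemma crude_clt : exists2 C : R, 0 <= C & forall n u v, 0 < v ->
  `|hexp P (fun w => phi (X n w)) 0 v u - Phi ((u - phi x) / sq (v ^+ 2 + s ^+ 2 * n%:R))| <=
  C * (n%:R / v ^+ 3 + (v ^+ 2)^-1).
Proof.
have [C3 C30 hC3] := moment_U3 rgB chX.
have CL0 := CL_ge0 rgB hmB; have Cx0 := hm_C hmB.
have hB0 : 0 <= hermB :> R by exact: ltW hermB_gt0.
have U1 y : 1 <= U y by exact: rg_U1 rgB y.
have U23 y : U y ^+ 2 <= U y ^+ 3 by apply: ler_weXn2l.
have w3 := weight_U rgB (isT : (3 <= 3)%N).
have U30 y : 0 <= U y ^+ 3 by rewrite exprn_ge0// (U_ge0 rgB).
pose E3 := U x ^+ 3 + C3.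
have E30 : 0 <= E3 by rewrite addr_ge0.
pose C := CL P m s Cx * hermB * E3 + hermB * Cx * E3 + hermB * Cx * E3.
have C0 : 0 <= C by rewrite /C !addr_ge0// !mulr_ge0.
exists C => // n u v v0.
pose vv j := sq (v ^+ 2 + s ^+ 2 * j%:R).
have vvp j : 0 < v ^+ 2 + s ^+ 2 * j%:R by rewrite ltr_wpDr ?exprn_gt0// mulr_ge0// sqr_ge0.
have vv0 j : 0 < vv j by rewrite sqrtr_gt0.
have vle j : v <= vv j.
  by rewrite -[X in X <= _](gtr0_norm v0) -sqrtr_sqr ler_wsqrtr// lerDl mulr_ge0// sqr_ge0.
have vvS j : vv j.+1 = sq (vv j ^+ 2 + s ^+ 2).
  by rewrite [vv j ^+ 2]sqr_sqrtr ?(ltW (vvp j))// /vv -[j.+1]addn1 natrD mulrDr mulr1 addrA.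
have vvz : vv 0%N = v by rewrite /vv mulr0 addr0 sqrtr_sqr gtr0_norm.
have vinv r j : (vv j ^+ r)^-1 <= (v ^+ r)^-1.
  rewrite lef_pV2 ?posrE ?exprn_gt0//; apply: lerXn2r; rewrite ?nnegrE//; exact: ltW.
have i30 : 0 <= (v ^+ 3)^-1 by rewrite invr_ge0 exprn_ge0// ltW.
have i20 : 0 <= (v ^+ 2)^-1 by rewrite invr_ge0 sqr_ge0.
pose c := CL P m s Cx * hermB * E3 / v ^+ 3.
have e1 : `|\int[P]_w smooth phi q (vv 0%N) u (X n w) - smooth phi q (vv n) u x| <=
    \sum_(j < n) c.
  apply: (smooth_telescope rgB hmB chX vv0 vvS (c := fun=> c)) => j jn.
  have iU := intg_X rgB chX w3 (n - j.+1).
  apply: (@le_trans _ _ (\int[P]_w (CL P m s Cx * (hermB / vv j ^+ 3) * U (X (n - j.+1)%N w) ^+ 3))).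
    apply: Ex_norm_le; last by move=> w; exact: (defect_bound rgB trT hmB).
      by apply: (measurableT_comp (measurable_defect rgB hmB _ (vv0 j))); exact: ch_m chX _.
    exact: intgZ.
  rewrite ExZ// /c -!mulrA; apply: ler_wpM2l => //; apply: ler_wpM2l => //.
  rewrite mulrC; apply: ler_pM; [exact: Ex_ge0| |exact: hC3|exact: vinv].
  by rewrite invr_ge0 exprn_ge0// ltW.
rewrite sumr_const card_ord vvz (smooth_hexp rgB hmB chX u n v0) in e1.
have hb t v' : 0 < v' -> v <= v' -> `|(v' ^+ 2)^-1 * hermG 2 t| <= (v ^+ 2)^-1 * hermB.
  move=> v'0 vv'; rewrite normrM ger0_norm ?invr_ge0 ?sqr_ge0//.
  apply: ler_pM; rewrite ?invr_ge0 ?sqr_ge0 ?hermG_bounded//.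
  rewrite lef_pV2 ?posrE ?exprn_gt0//; apply: lerXn2r; rewrite ?nnegrE//; exact: ltW.
have e2 : `|\int[P]_w ((v ^+ 2)^-1 * hermG 2 ((u - phi (X n w)) / v) * q (X n w))| <=
    hermB * Cx * E3 / v ^+ 2.
  have iU := intg_X rgB chX w3 n.
  apply: (@le_trans _ _ (\int[P]_w ((v ^+ 2)^-1 * hermB * Cx * U (X n w) ^+ 3))).
    apply: Ex_norm_le; last 2 first.
    + exact: intgZ.
    + move=> w; rewrite normrM -mulrA; apply: ler_pM => //; first exact: hb.
      by apply: (le_trans (hm_qb hmB _)); rewrite ler_wpM2l.
    apply: measurable_funM; last exact: measurableT_comp (hm_mq hmB) (ch_m chX n).
    exact: (measurable_hexp_fun (measurableT_comp (hm_m hmB) (ch_m chX n))).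
  rewrite ExZ// [leRHS](_ : _ = (v ^+ 2)^-1 * hermB * Cx * E3); last by ring.
  by rewrite ler_wpM2l ?hC3// mulr_ge0// mulr_ge0.
have e3 : `|smooth phi q (vv n) u x - Phi ((u - phi x) / vv n)| <= hermB * Cx * E3 / v ^+ 2.
  rewrite /smooth expr0 invr1 mul1r addrAC subrr add0r.
  rewrite normrM ger0_norm ?invr_ge0// normrM.
  apply: (@le_trans _ _ (1 * ((v ^+ 2)^-1 * hermB * (Cx * E3)))).
    apply: ler_pM; rewrite ?invr_ge0 ?mulr_ge0//; first by rewrite invf_le1// ler1n.
    apply: ler_pM => //; first exact: hb.
    apply: (le_trans (hm_qb hmB x)); rewrite ler_wpM2l// (le_trans (U23 x))//.
    by rewrite lerDl.
  by rewrite mul1r le_eqVlt; apply/orP; left; apply/eqP; ring.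
rewrite -/(vv n).
have -> : C * (n%:R / v ^+ 3 + (v ^+ 2)^-1) = c *+ n + hermB * Cx * E3 / v ^+ 2 +
    hermB * Cx * E3 / v ^+ 2 + CL P m s Cx * hermB * E3 / v ^+ 2 +
    (hermB * Cx * E3 + hermB * Cx * E3) * (n%:R / v ^+ 3).
  by rewrite -[c *+ n]mulr_natr /C /c; ring.
have p1 : 0 <= CL P m s Cx * hermB * E3 / v ^+ 2 by rewrite !mulr_ge0.
have p2 : 0 <= (hermB * Cx * E3 + hermB * Cx * E3) * (n%:R / v ^+ 3).
  by rewrite mulr_ge0 ?addr_ge0 ?mulr_ge0.
have p3 : 0 <= hermB * Cx * E3 / v ^+ 2 by rewrite !mulr_ge0.
move: e1 e2 e3 p1 p2 p3; move: (c *+ n) (hermB * Cx * E3 / v ^+ 2) => c' a.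
move: (CL P m s Cx * hermB * E3 / v ^+ 2) ((_ + _) * (_ / _)) => a1 a2.
set A := hexp _ _ _ _ _; set Q := \int[P]_w _; set S := smooth _ _ _ _ _; set F := Phi _.
rewrite !ler_norml => /andP[? ?] /andP[? ?] /andP[? ?] ? ? ?.
by apply/andP; split; lra.
Qed.

End CrudeCLT.

(** * Random topical operators *)

(* [cst] denotes the constant vector from here on, no longer the constant function. *)
Import Defs.

Section IndependentPairs.
Context {R : realType} {dT d1 d2 : measure_display} {T : measurableType dT}
  {S1 : measurableType d1} {S2 : measurableType d2}.
Variables (P : probability T R) (Y : T -> S1) (Z Z' : T -> S2).
Hypotheses (mY : measurable_fun [set: T] Y) (mZ : measurable_fun [set: T] Z)
  (mZ' : measurable_fun [set: T] Z').
Local Open Scope ereal_scope.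

(** The hypothesis contains both the independence of [Y] and [Z] and the equality of the laws of [Z]
    and [Z'], so that a late operator can be replaced by an independent sample of the first one. *)
Lemma independent_integral (F : S1 * S2 -> \bar R) :
  (forall A B, measurable A -> measurable B ->
     P (Y @^-1` A `&` Z @^-1` B) = P (Y @^-1` A) * P (Z' @^-1` B)) ->
  measurable_fun [set: S1 * S2] F -> (forall p, 0 <= F p) ->
  \int[P]_w F (Y w, Z w) = \int[P]_w \int[P]_w' F (Y w, Z' w').
Proof.
move=> indep mF F0.
have mYZ : measurable_fun [set: T] (fun w => (Y w, Z w)) by exact: measurable_fun_pair.
pose Yf : {mfun T >-> S1} := HB.pack Y (isMeasurableFun.Build _ _ _ _ _ mY).
pose Zf : {mfun T >-> S2} := HB.pack Z' (isMeasurableFun.Build _ _ _ _ _ mZ').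
pose YZf : {mfun T >-> (S1 * S2)%type} :=
  HB.pack (fun w => (Y w, Z w)) (isMeasurableFun.Build _ _ _ _ _ mYZ).
pose m1 := distribution P Yf; pose m2 := distribution P Zf.
have E X : measurable X -> (m1 \x m2) X = distribution P YZf X.
  apply: product_measure_unique => A B mA mB.
  by rewrite /m1 /m2 /distribution /pushforward/= -(indep A B mA mB).
transitivity (\int[distribution P YZf]_p F p).
  by rewrite ge0_integral_pushforward.
transitivity (\int[m1 \x m2]_p F p).
  by apply: eq_measure_integral => X mX _; exact/esym/E.
rewrite fubini_tonelli1//; rewrite /m1 ge0_integral_pushforward//; last 2 first.
- exact: measurable_fun_fubini_tonelli_F.
- by move=> y _; apply: integral_ge0.
apply: eq_integral => w _; rewrite /= /fubini_F /m2 ge0_integral_pushforward//.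
exact: (measurableT_comp mF (pair1_measurable (Y w))).
Qed.

End IndependentPairs.

(** * Measurability on the spaces of vectors and of operators *)

Section OperatorSpace.
Context {R : realType} {d : nat}.
Local Notation vec := 'rV[R]_d.

Definition mvec := g_sigma_algebraType (@vec_gen R d).
Definition mop := g_sigma_algebraType (@op_gen R d).

HB.instance Definition _ := Measurable.on mvec.
HB.instance Definition _ := Measurable.on mop.

Lemma measurable_coord i : measurable_fun [set: mvec] (fun v : mvec => v ord0 i : R).
Proof.
move=> _ B mB; rewrite setTI; apply: sub_sigma_algebra.
by exists i, B.
Qed.

Lemma measurable_to_mvec dS (S : measurableType dS) (f : S -> mvec) :
  (forall i, measurable_fun [set: S] (fun w => f w ord0 i : R)) -> measurable_fun [set: S] f.
Proof.
move=> h; apply: (@measurability _ _ S mvec setT f (@vec_gen R d)) => // _ [_ [i [B [mB ->]] <-]].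
exact: (h i measurableT B mB).
Qed.

Lemma measurable_eval (x : vec) i : measurable_fun [set: mop] (fun f : mop => f x ord0 i : R).
Proof.
move=> _ B mB; rewrite setTI; apply: sub_sigma_algebra.
by exists x, i, B.
Qed.

Lemma measurable_to_mop dS (S : measurableType dS) (g : S -> mop) :
  (forall x i, measurable_fun [set: S] (fun w => g w x ord0 i : R)) -> measurable_fun [set: S] g.
Proof.
move=> h; apply: (@measurability _ _ S mop setT g (@op_gen R d)) => // _ [_ [x [i [B [mB ->]]] <-]].
exact: (h x i measurableT B mB).
Qed.

Definition ratvec (q : 'rV[rat]_d) : vec := map_mx ratr q.

Lemma ratvec_above (x : vec) (e : R) : 0 < e ->
  exists q, vle x (ratvec q) /\ vle (ratvec q) (x + cst e).
Proof.
move=> e0.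
have H i : exists r : rat, x ord0 i <= ratr r <= x ord0 i + e.
  have [|r] := @rat_in_itvoo R (x ord0 i) (x ord0 i + e); first by rewrite ltrDl.
  by rewrite in_itv/= => /andP[? ?]; exists r; rewrite !ltW.
have [q hq] := choice H.
exists (\row_i q i); split=> i; rewrite !mxE; have /andP[h1 h2] := hq i => //.
Qed.

Lemma topical_op_le (A : vec -> vec) (x y : vec) (c : R) : topical_op A ->
  (forall i, x ord0 i <= y ord0 i + c) -> forall i, A x ord0 i <= A y ord0 i + c.
Proof.
move=> [mono homog] xy i.
have := mono x (y + cst c); rewrite homog => /(_ _ i); rewrite !mxE; apply.
by move=> j; rewrite !mxE.
Qed.

(* Evaluation of an operator at a point is not measurable on the space of all
   operators; this regularization is, and it agrees with it on topical operators. *)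
Definition ev (x : vec) (f : vec -> vec) (i : 'I_d) : \bar R :=
  ereal_inf [set (f (ratvec q) ord0 i)%:E | q in [set q | vle x (ratvec q)]].

Lemma ev_topical (x : vec) f i : topical_op f -> ev x f i = (f x ord0 i)%:E.
Proof.
move=> tf; apply/eqP; rewrite eq_le; apply/andP; split; last first.
  apply: le_ereal_inf_tmp => _ [q xq <-]; rewrite lee_fin.
  by have [mono _] := tf; exact: mono.
apply/lee_addgt0Pr => e e0; have [q [xq qx]] := ratvec_above x e0.
apply: (@le_trans _ _ (f (ratvec q) ord0 i)%:E).
  by apply: ereal_inf_lbound; exists q.
rewrite -EFinD lee_fin; apply: topical_op_le => // j.
by have := qx j; rewrite !mxE.
Qed.

Lemma measurable_ev i : measurable_fun [set: mvec * mop]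
  (fun p : mvec * mop => ev p.1 p.2 i).
Proof.
apply: (measurability _ (ErealGenInftyO.measurableE R)) => _ [_ [r ->] <-].
have -> : setT `&` (fun p : mvec * mop => ev p.1 p.2 i) @^-1` `]-oo, r%:E[%classic =
    \bigcup_(q : 'rV[rat]_d) ([set p : mvec * mop | vle p.1 (ratvec q)] `&`
      [set p : mvec * mop | p.2 (ratvec q) ord0 i < r]).
  rewrite setTI; apply/seteqP; split => p.
    rewrite /= in_itv/= => /ereal_inf_lt [_ [q pq <-]]; rewrite lte_fin => h.
    by exists q.
  move=> [q _ [/= pq h]]; rewrite /= in_itv/=.
  apply: (@le_lt_trans _ _ (p.2 (ratvec q) ord0 i)%:E); last by rewrite lte_fin.
  by apply: ereal_inf_lbound; exists q.
apply: countable_bigcupT_measurable; first exact: countableP.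
move=> q; apply: measurableI.
  have -> : [set p : mvec * mop | vle p.1 (ratvec q)] =
      \bigcap_(j in [set: 'I_d]) [set p : mvec * mop | p.1 ord0 j <= ratvec q ord0 j].
    by apply/seteqP; split => p h j; [move=> _|]; exact: h.
  apply: fin_bigcap_measurable; first exact: finite_finset.
  move=> j _; apply: measurable_le_set.
  exact: (measurableT_comp (measurable_coord j) measurable_fst).
have mg : measurable_fun [set: mvec * mop] (fun p : mvec * mop => p.2 (ratvec q) ord0 i).
  exact: (measurableT_comp (measurable_eval (ratvec q) i) measurable_snd).
by have := measurable_fun_ltr mg (measurable_cst r); move/(_ measurableT [set true] I); rewrite setTI.
Qed.

Lemma measurable_topical dS (S : measurableType dS) (A : S -> mop) (X : S -> mvec) :
  (forall w, topical_op (A w)) -> measurable_fun [set: S] A -> measurable_fun [set: S] X ->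
  measurable_fun [set: S] (fun w => A w (X w) : mvec).
Proof.
move=> tA mA mX; apply: measurable_to_mvec => i; apply/measurable_EFinP.
have -> : EFin \o (fun w => A w (X w) ord0 i) = fun w => ev (X w) (A w) i.
  by apply/funext => w; rewrite /= ev_topical.
exact: (measurableT_comp (measurable_ev i) (measurable_fun_pair mX mA)).
Qed.

Lemma topical_const_op (phi : vec -> R) : topical_fun phi ->
  topical_op (fun x => const_mx (phi x) : vec).
Proof.
move=> [mono homog]; split=> [x y xy i|x a]; first by rewrite !mxE mono.
by apply/rowP => i; rewrite !mxE homog.
Qed.

(** A topical function is a topical operator with values on the diagonal, so the regularized
    evaluation applies to it. *)
Lemma measurable_topical_fun (phi : vec -> R) : (0 < d)%N -> topical_fun phi ->
  measurable_fun [set: mvec] (phi : mvec -> R).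
Proof.
move=> d0 tphi.
have := measurable_topical (A := fun _ : mvec => (fun x => const_mx (phi x)) : mop)
  (X := id) (fun _ => topical_const_op tphi) (measurable_cst _) (@measurable_id _ _ _).
move=> h; have := measurableT_comp (measurable_coord (Ordinal d0)) h.
by apply: eq_measurable_fun => x _; rewrite /= mxE.
Qed.

End OperatorSpace.

(** * The Markov property of the products *)

Section OperatorProcess.
Context {R : realType} {d : nat} {dT : measure_display} {T : measurableType dT}.
Local Notation vec := 'rV[R]_d.
Local Notation mvec := (@mvec R d).
Local Notation mop := (@mop R d).
Variables (P : probability T R) (A : nat -> T -> vec -> vec).
Hypotheses (topA : forall n w, topical_op (A n w)) (iidA : iid_ops P A).

Lemma measurable_A n : measurable_fun [set: T] (A n : T -> mop).
Proof. by have [mA _] := iidA; apply: measurable_to_mop => x i; exact: mA. Qed.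

Lemma indep_init_cst (y : vec) : indep_init P A (fun=> y).
Proof.
move=> E s F mE mF; have [yE|yE] := pselect (E y).
  have -> : (fun=> y) @^-1` E = [set: T] by apply/seteqP; split.
  by rewrite setTI probability_setT mul1e.
have -> : (fun=> y) @^-1` E = set0 :> set T by apply/seteqP; split.
by rewrite set0I measure0 mul0e.
Qed.

Lemma iotaE m : [set` iota 0 m] = [set k | (k < m)%N].
Proof. by apply/seteqP; split=> k /=; rewrite mem_iota. Qed.

Section Past.
Variable X0 : T -> vec.
Hypotheses (mX0 : measurable_fun [set: T] (X0 : T -> mvec)) (indX0 : indep_init P A X0).

Definition past (n : nat) : set (set T) := [set S | exists E F,
  [/\ vec_meas E, forall k, op_meas (F k) &
   S = X0 @^-1` E `&` \bigcap_(k in [set` iota 0 n]) (A k @^-1` F k)]].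

Lemma past_setI n : setI_closed (past n).
Proof.
move=> _ _ [E [F [mE mF ->]]] [E' [F' [mE' mF' ->]]].
exists (E `&` E'), (fun k => F k `&` F' k); split.
- exact: (@measurableI _ mvec _ _ mE mE').
- by move=> k; exact: (@measurableI _ mop _ _ (mF k) (mF' k)).
- apply/seteqP; split => w /=.
    by move=> [[a b] [a' b']]; split=> // k kn; split; [exact: b|exact: b'].
  by move=> [[a a'] b]; split; split=> // k kn; have [] := b k kn.
Qed.

Lemma measurable_preA n (F : set (vec -> vec)) : op_meas F -> measurable (A n @^-1` F).
Proof. by move=> mF; rewrite -[X in measurable X]setTI; exact: (measurable_A n measurableT mF). Qed.

Lemma past_measurable n : past n `<=` measurable.
Proof.
move=> _ [E [F [mE mF ->]]]; apply: measurableI.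
  by rewrite -[X in measurable X]setTI; exact: (mX0 measurableT mE).
apply: fin_bigcap_measurable; first exact: finite_seq.
by move=> k _; exact: measurable_preA.
Qed.

(** As functions of [S], both sides are finite measures; they agree on [past n], which is stable
    under intersection, hence on the sigma-algebra it generates. *)
Lemma past_independent n S F : <<s past n >> S -> op_meas F ->
  P (S `&` A n @^-1` F) = (P S * P (A 0%N @^-1` F))%E.
Proof.
move=> pS mF; have [_ [idA prodA]] := iidA.
have mAF := measurable_preA n mF.
have c0 : 0 <= fine (P (A 0%N @^-1` F)) by exact: fine_ge0.
pose c : {nonneg R} := NngNum c0.
have cE : (c%:num)%:E = P (A 0%N @^-1` F).
  by rewrite /= fineK// fin_num_measure//; exact: measurable_preA.
have msE X : mscale c P X = (P (A 0%N @^-1` F) * P X)%E by rewrite -cE.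
suff : mrestr P mAF S = mscale c P S by rewrite msE /mrestr muleC.
have past_T : past n [set: T].
  exists setT, (fun=> setT); split; [exact: (@measurableT _ mvec)|move=> k; exact: (@measurableT _ mop)|].
  by apply/seteqP; split.
apply: (@g_sigma_algebra_measure_unique _ R T (past n) _ (fun=> setT)) => //.
- exact: past_measurable.
- by apply/seteqP; split => // w _; exists 0%N.
- exact: past_setI.
- move=> _ [E [G [mE mG ->]]]; apply: etrans (esym (msE _)).
  rewrite /= /mrestr.
  pose H k := if (k < n)%N then G k else F.
  have mH k : op_meas (H k) by rewrite /H; case: ifP.
  have E1 : X0 @^-1` E `&` \bigcap_(k in [set` iota 0 n]) (A k @^-1` G k) `&` A n @^-1` F =
      X0 @^-1` E `&` \bigcap_(k in [set` iota 0 n.+1]) (A k @^-1` H k).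
    rewrite !iotaE -setIA; congr (_ `&` _); apply/seteqP; split => w /=.
      move=> [h hn] k; rewrite /= ltnS leq_eqVlt => /orP[/eqP ->|kn].
        by rewrite /H ltnn.
      by rewrite /H kn; exact: h.
    move=> h; split=> [k /= kn|].
      by have := h k; rewrite /= /H kn; apply; rewrite ltnS ltnW.
    by have := h n; rewrite /= ltnSn /H ltnn; apply.
  rewrite E1 indX0// indX0// !prodA ?iota_uniq// -[n.+1]addn1 iotaD big_cat/= add0n big_seq1.
  rewrite [P (A n @^-1` _)](_ : _ = P (A 0%N @^-1` F)); last by rewrite /H ltnn idA.
  have -> : (\prod_(k <- iota 0 n) P (A k @^-1` H k) = \prod_(k <- iota 0 n) P (A k @^-1` G k))%E.
    by rewrite !big_seq; apply: eq_bigr => k; rewrite mem_iota add0n /= /H => ->.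
  by rewrite muleA muleC.
- move=> k; have : (P ([set: T] `&` A n @^-1` F) < +oo)%E; last by [].
  by rewrite setTI; apply: le_lt_trans (ltry 1); exact: probability_le1.
Qed.

(** The sample space with a coarser sigma-algebra: measurability from [pastT n] expresses dependence
    on [X0] and the first [n] operators only. *)
Definition pastT n := g_sigma_algebraType (past n).

HB.instance Definition _ n := Measurable.on (pastT n).

Lemma measurable_past_X0 n : measurable_fun [set: pastT n] (X0 : pastT n -> mvec).
Proof.
move=> _ E mE; rewrite setTI; apply: sub_sigma_algebra.
exists E, (fun=> setT); split=> //; first by move=> k; exact: (@measurableT _ mop).
by apply/seteqP; split => w //= [].
Qed.

Lemma measurable_past_A n k : (k < n)%N ->
  measurable_fun [set: pastT n] (A k : pastT n -> mop).
Proof.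
move=> kn _ F mF; rewrite setTI; apply: sub_sigma_algebra.
exists setT, (fun j => if j == k then F else setT); split.
- exact: (@measurableT _ mvec).
- by move=> j; case: ifP => // _; exact: (@measurableT _ mop).
- apply/seteqP; split => w /=.
    by move=> Fw; split=> // j _; case: eqP => // ->.
  by rewrite iotaE => -[_ /(_ k)]; rewrite /= kn eqxx; apply.
Qed.

Lemma measurable_past_prodop n k : (k <= n)%N ->
  measurable_fun [set: pastT n] (fun w : pastT n => prodop A k w (X0 w) : mvec).
Proof.
elim: k => [|k IH] kn /=; first exact: measurable_past_X0.
apply: measurable_topical => //; first exact: measurable_past_A.
by apply: IH; exact: ltnW.
Qed.

Lemma measurable_prodop_X0 n : measurable_fun [set: T] (fun w => prodop A n w (X0 w) : mvec).
Proof.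
elim: n => [//|n IH] /=; apply: measurable_topical => //; exact: measurable_A.
Qed.

Definition evv (x : vec) (f : vec -> vec) : vec := \row_i fine (ev x f i).

Lemma evv_topical (x : vec) f : topical_op f -> evv x f = f x.
Proof. by move=> tf; apply/rowP => i; rewrite mxE ev_topical. Qed.

Lemma measurable_evv : measurable_fun [set: mvec * mop] (fun p : mvec * mop => evv p.1 p.2 : mvec).
Proof.
apply: measurable_to_mvec => i.
have -> : (fun p : mvec * mop => evv p.1 p.2 ord0 i) = fun p : mvec * mop => fine (ev p.1 p.2 i).
  by apply/funext => p; rewrite mxE.
exact: (measurableT_comp (@fine_measurable R setT measurableT) (measurable_ev i)).
Qed.

(** The initial vector is kept beside the current state because [phi (X0 w)] is subtracted in the
    first estimate. *)
Lemma one_step n (F : mvec * mvec -> \bar R) : measurable_fun [set: mvec * mvec] F ->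
  (forall p, 0 <= F p)%E ->
  (\int[P]_w F (X0 w, prodop A n.+1 w (X0 w)) =
   \int[P]_w \int[P]_w' F (X0 w, A 0%N w' (prodop A n w (X0 w))))%E.
Proof.
move=> mF F0.
pose Y w : mvec * mvec := (X0 w, prodop A n w (X0 w)).
have mY : measurable_fun [set: T] Y.
  by apply: measurable_fun_pair => //; exact: measurable_prodop_X0.
have mYp : measurable_fun [set: pastT n] (Y : pastT n -> mvec * mvec).
  by apply: measurable_fun_pair; [exact: measurable_past_X0|exact: measurable_past_prodop].
pose G (p : (mvec * mvec) * mop) := F (p.1.1, evv p.1.2 p.2).
have mG : measurable_fun [set: (mvec * mvec) * mop] G.
  apply: (measurableT_comp mF); apply: measurable_fun_pair.
    exact: (measurableT_comp measurable_fst measurable_fst).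
  have m1 : measurable_fun [set: (mvec * mvec) * mop] (fun p : (mvec * mvec) * mop => p.1.2).
    exact: (measurableT_comp measurable_snd measurable_fst).
  have m2 : measurable_fun [set: (mvec * mvec) * mop] (fun p : (mvec * mvec) * mop => p.2).
    exact: measurable_snd.
  have mp := measurable_fun_pair m1 m2.
  exact: (measurableT_comp measurable_evv mp).
transitivity (\int[P]_w G (Y w, A n w))%E.
  by apply: eq_integral => w _; rewrite /G /= evv_topical.
rewrite (independent_integral mY (measurable_A n) (measurable_A 0)) //.
  apply: eq_integral => w _; apply: eq_integral => w' _.
  by rewrite /G /= evv_topical.
  move=> C D mC mD; apply: past_independent => //.
  by have := mYp measurableT C mC; rewrite setTI.
by move=> p; exact: F0.
Qed.

End Past.

Lemma measurable_mvec_cst (y : vec) : measurable_fun [set: T] (fun=> y : mvec).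
Proof. exact: measurable_cst. Qed.

Lemma process_law (X0 : T -> vec) n k (F : mvec * mvec -> \bar R) :
  measurable_fun [set: T] (X0 : T -> mvec) -> indep_init P A X0 ->
  measurable_fun [set: mvec * mvec] F -> (forall p, 0 <= F p)%E ->
  (\int[P]_w F (X0 w, prodop A (n + k) w (X0 w)) =
   \int[P]_w \int[P]_w' F (X0 w, prodop A k w' (prodop A n w (X0 w))))%E.
Proof.
move=> mX0 iX0 mF F0; elim: k F mF F0 => [|k IH] F mF F0.
  rewrite addn0; apply: eq_integral => w _ /=.
  rewrite -[LHS]mule1 -(probability_setT P).
  by apply/esym; exact: (integral_cst P measurableT).
pose G (p : mvec * mvec) := (\int[P]_w' F (p.1, A 0%N w' p.2))%E.
have mFA : measurable_fun [set: (mvec * mvec) * T] (fun p => F (p.1.1, A 0%N p.2 p.1.2)).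
  apply: (measurableT_comp mF); apply: measurable_fun_pair.
    exact: (measurableT_comp measurable_fst measurable_fst).
  apply: (measurable_topical (A := fun p : (mvec * mvec) * T => A 0%N p.2 : mop)
    (X := fun p : (mvec * mvec) * T => p.1.2)) => //.
    exact: (measurableT_comp (measurable_A 0) measurable_snd).
  exact: (measurableT_comp measurable_snd measurable_fst).
have mG : measurable_fun [set: mvec * mvec] G.
  apply: (@measurable_fun_fubini_tonelli_F _ _ _ _ _ P
    (fun p : (mvec * mvec) * T => F (p.1.1, A 0%N p.2 p.1.2)) mFA) => p.
  exact: F0.
have G0 p : (0 <= G p)%E by exact: integral_ge0.
rewrite addnS (one_step mX0 iX0)//.
have -> : (\int[P]_w \int[P]_w' F (X0 w, A 0%N w' (prodop A (n + k) w (X0 w))) =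
    \int[P]_w G (X0 w, prodop A (n + k) w (X0 w)))%E by [].
rewrite (IH G mG G0); apply: eq_integral => w _ /=.
pose y := prodop A n w (X0 w); rewrite -/y.
have mFx : measurable_fun [set: mvec * mvec] (fun p => F (X0 w, p.2)).
  by apply: (measurableT_comp mF); apply: measurable_fun_pair.
have h := one_step (X0 := fun=> y) (measurable_mvec_cst y) (indep_init_cst y) k mFx (fun p => F0 _).
exact: esym h.
Qed.

Lemma measurable_prodop n : measurable_fun [set: mvec * T]
  (fun p => prodop A n p.2 p.1 : mvec).
Proof.
elim: n => [|n IH] /=; first exact: measurable_fst.
apply: (measurable_topical (A := fun p : mvec * T => A n p.2 : mop)) => //.
exact: (measurableT_comp (measurable_A n) measurable_snd).
Qed.

Lemma topical_prodop n w : topical_op (prodop A n w).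
Proof.
elim: n => [|n [mono homog]]; first by split.
have [mA hA] := topA n w; split=> [x y xy|x a] /=; first exact/mA/mono.
by rewrite homog hA.
Qed.

(** Rank one is tested by comparing the images of rational vectors and of [0], coordinate against
    coordinate; isotony and homogeneity extend the identities to all vectors. *)
Lemma measurable_rank_one n : measurable [set w | rank_one (prodop A n w)].
Proof.
pose D q i j w := prodop A n w (ratvec q) ord0 i - prodop A n w 0 ord0 i -
  (prodop A n w (ratvec q) ord0 j - prodop A n w 0 ord0 j).
have -> : [set w | rank_one (prodop A n w)] =
    \bigcap_(q in [set: 'rV[rat]_d]) \bigcap_(p in [set: 'I_d * 'I_d]) [set w | D q p.1 p.2 w = 0].
  apply/seteqP; split => w.
    move=> rk q _ [i j] _ /=; have [a E] := rk (ratvec q) 0.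
    by rewrite /D E !mxE; ring.
  move=> h; have tp := topical_prodop n w.
  suff H x i j : prodop A n w x ord0 i - prodop A n w 0 ord0 i =
      prodop A n w x ord0 j - prodop A n w 0 ord0 j.
    suff H0 x : exists a, prodop A n w x = prodop A n w 0 + cst a.
      move=> x y; have [a ->] := H0 x; have [b ->] := H0 y.
      by exists (a - b); apply/rowP => i; rewrite !mxE; ring.
    have [i0 _|d0] := pickP (@predT 'I_d); last first.
      by exists 0; apply/rowP => i; have := d0 i.
    exists (prodop A n w x ord0 i0 - prodop A n w 0 ord0 i0).
    by apply/rowP => i; rewrite !mxE; have := H x i i0; lra.
  have Hle e k l : 0 < e -> prodop A n w x ord0 k - prodop A n w 0 ord0 k -
      (prodop A n w x ord0 l - prodop A n w 0 ord0 l) <= e.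
    move=> e0; have [q [xq qx]] := ratvec_above x e0.
    have := h q I (k, l) I; rewrite /D /=.
    have := proj1 tp _ _ xq k.
    have : prodop A n w (ratvec q) ord0 l <= prodop A n w x ord0 l + e.
      by apply: topical_op_le => // m; have := qx m; rewrite !mxE.
    lra.
  apply/eqP; rewrite eq_le; apply/andP; split; apply/ler_addgt0Pr => e e0.
    by have := Hle e i j e0; lra.
  by have := Hle e j i e0; lra.
have mc x i : measurable_fun [set: T] (fun w => prodop A n w x ord0 i).
  apply: (measurableT_comp (measurable_coord i)).
  exact: (measurableT_comp (measurable_prodop n) (pair1_measurable (x : mvec))).
rewrite -[X in measurable X]setCK setC_bigcap; apply: measurableC.
apply: countable_bigcupT_measurable => [|q]; first exact: countableP.
apply: measurableC.
apply: fin_bigcap_measurable => [|p _]; first exact: finite_finset.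
have mD : measurable_fun [set: T] (D q p.1 p.2).
  by apply: measurable_funB; apply: measurable_funB; exact: mc.
have := mD measurableT [set 0] (measurable_set1 0); rewrite setTI.
by congr (measurable _); apply/seteqP; split => w.
Qed.

End OperatorProcess.

Section Recentering.
Context {R : realType} {dT dV : measure_display} {T : measurableType dT}
  {V : measurableType dV}.
Variables (P : probability T R) (tr : V -> R -> V) (x0 : V).
Variables (B : T -> V -> V) (Rk : set T) (rho K : R) (m : T -> R) (U W : V -> R).
Hypotheses (rgB : regenerative P tr x0 B Rk rho K m U W) (trT : translation tr).
Local Notation sq := (@Num.sqrt R).

Lemma recenter_regenerative (g : R) :
  regenerative P tr x0 (fun w x => tr (B w x) (- g)) Rk rho K m U W.
Proof.
have [mB Btr mRk rk1 mm m1 m3 rho01 mN K0 mU mW cU cW U1 UW BU BW RU RW ri] := rgB.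
split=> //.
- exact: (measurable_tr2 trT mB (measurable_cst (- g))).
- by move=> w x s; rewrite Btr !(tr_D trT) addrC.
- move=> w wR x; have [s E] := rk1 w wR x; exists s.
  by rewrite E !(tr_D trT) addrC.
- by move=> w x; rewrite cU.
- by move=> w x; rewrite cW.
- by move=> w x wR; rewrite cU; exact: RU.
- by move=> w x wR; rewrite cW; exact: RW.
- by under eq_fun do rewrite cU.
Qed.

Lemma recenter_chain (g : R) (x : V) (X : nat -> T -> V) : chain P B x X ->
  chain P (fun w x => tr (B w x) (- g)) x (fun k w => tr (X k w) (- (k%:R * g))).
Proof.
move=> [mX X0 XS]; split.
- by move=> k; exact: (measurable_tr2 trT (mX k) (measurable_cst _)).
- by move=> w; rewrite X0 mul0r oppr0 (tr_0 trT).
- move=> k f mf f0.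
  rewrite (XS k (fun y => f (tr y (- (k.+1%:R * g)))))//.
    apply: eq_integral => w _; apply: eq_integral => w' _.
    rewrite (rg_tr rgB) (tr_D trT); congr (f (tr _ _)).
    by rewrite -addn1 natrD; ring.
  apply: (measurableT_comp mf); exact: (measurable_tr2 trT (@measurable_id _ _ _) (measurable_cst _)).
Qed.

(** The crude estimate holds without any assumption on [s]: it comes first, to identify [g] and [s]
    and thereby prove [0 < s], after which the sharp estimate becomes available. *)
Theorem regenerative_limit (phi : V -> R) (Cphi : R) : 0 <= Cphi ->
  measurable_fun [set: V] phi -> equivariant tr phi ->
  (forall w x, `|phi (B w x) - phi x| <= Cphi * (m w * U x)) ->
  exists (g s : R) (phis : V -> R) (C : R),
  [/\ 0 <= C, 0 <= s, measurable_fun [set: V] phis, equivariant tr phis &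
      forall x, `|phis x - phi x| <= C * U x] /\
  [/\ forall x X, chain P B x X -> exists2 C', 0 <= C' & forall n u v, 0 < v ->
      `|hexp P (fun w => phis (X n w)) 0 v u -
        Phi ((u - n%:R * g - phis x) / sq (v ^+ 2 + s ^+ 2 * n%:R))| <=
      C' * (n%:R / v ^+ 3 + (v ^+ 2)^-1) &
   0 < s -> exists2 C', 0 <= C' & forall x X, chain P B x X ->
     forall psi M, near_phi tr W phi psi M -> forall k u,
      `|fine (P [set w | psi (X k w) <= u]) -
        Phi ((u - k%:R * g - phis x) / (s * sq (maxn k 1)%:R))| <=
      M * (C' * (U x ^+ 3 + W x) / sq k.+1%:R)].
Proof.
move=> Cp0 mphi ephi phiB.
have [g [s2 [phis [q [C [[C0 s20 mphis ephis phisC] [phisB phis0 [mq cq] qb qE]]]]]]] :=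
  corrector rgB Cp0 mphi ephi phiB.
pose s := sq s2; have sE : s ^+ 2 = s2 by rewrite sqr_sqrtr.
pose B' w x := tr (B w x) (- g).
have rgB' : regenerative P tr x0 B' Rk rho K m U W := recenter_regenerative g.
have B'E w x : phis (B' w x) - phis x = phis (B w x) - phis x - g.
  by rewrite /B' ephis; ring.
have hm : harmonic P tr B' m U phis q s C.
  split=> //.
  - by move=> w x; rewrite B'E.
  - by move=> x; rewrite -[RHS](phis0 x); apply: eq_Rintegral => w _; rewrite B'E.
  - move=> x; rewrite sE.
    transitivity (\int[P]_w q (B w x)).
      by apply: eq_Rintegral => w _; rewrite /B' cq.
    by rewrite qE; congr (_ - _ + _); apply: eq_Rintegral => w _; rewrite B'E.
exists g, s, phis, C; split; first by split=> //; exact: sqrtr_ge0.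
split=> [x X chX|s0].
  have [C' C'0 h] := crude_clt rgB' trT hm (recenter_chain g chX).
  exists C' => // n u v v0; have := h n (u - n%:R * g) v v0.
  have -> : hexp P (fun w => phis (tr (X n w) (- (n%:R * g)))) 0 v (u - n%:R * g) =
      hexp P (fun w => phis (X n w)) 0 v u.
    have -> : (fun w => phis (tr (X n w) (- (n%:R * g)))) = (fun w => phis (X n w) - n%:R * g).
      by apply/funext => w; rewrite ephis.
    by rewrite hexp_shift subrK.
  by [].
have [C' C'0 h] := chain_berry_esseen rgB' trT hm s0.
exists (C' * (1 + C)); first by rewrite mulr_ge0// addr_ge0.
move=> x X chX psi M [mpsi epsi bpsi M1] k u.
have np : near_phi tr W phis psi (M * (1 + C)).
  split=> //; last by rewrite mulr_ege1// lerDl.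
  move=> y; have W0 : 0 <= W y by exact: le_trans ler01 (rg_W1 rgB y).
  rewrite (_ : psi y - phis y = (psi y - phi y) - (phis y - phi y)); last by ring.
  apply: (le_trans (ler_normB _ _)); apply: (@le_trans _ _ (M * W y + C * W y)).
    apply: lerD; first exact: bpsi.
    by apply: (le_trans (phisC y)); rewrite ler_wpM2l// (rg_UW rgB).
  rewrite -mulrDl ler_wpM2r// mulrDr mulr1 lerD2l ler_peMl//.
have := h x _ (recenter_chain g chX) psi _ np k (u - k%:R * g).
have -> : [set w | psi (tr (X k w) (- (k%:R * g))) <= u - k%:R * g] = [set w | psi (X k w) <= u].
  by apply/seteqP; split => w /=; rewrite epsi lerD2r.
move=> h'; apply: (le_trans h'); rewrite le_eqVlt; apply/orP; left; apply/eqP; ring.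
Qed.

End Recentering.

(** * Blocks of operators *)

Section PowerMoments.
Context {R : realType} {dT : measure_display} {T : measurableType dT}.
Variable P : probability T R.
Implicit Types f g : T -> R.

Lemma intg_pow_le f (i k : nat) : (i <= k)%N -> measurable_fun [set: T] f ->
  (forall w, 0 <= f w) -> intg P (fun w => f w ^+ k) -> intg P (fun w => f w ^+ i).
Proof.
move=> ik mf f0 fk; apply: (@intg_le _ _ _ _ _ (fun w => 1 + f w ^+ k)).
- exact: measurable_funX.
- by apply: intgD => //; exact: intg_cst.
- move=> w; rewrite ger0_norm ?exprn_ge0//; have [f1|f1] := leP (f w) 1.
    by rewrite (le_trans (exprn_ile1 _ (f0 w) f1))// lerDl exprn_ge0.
  by apply: (@le_trans _ _ (f w ^+ k)); [exact: ler_weXn2l (ltW f1) _ _ ik|rewrite lerDr].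
Qed.

Lemma intg_powD f g (k : nat) : measurable_fun [set: T] f -> measurable_fun [set: T] g ->
  (forall w, 0 <= f w) -> (forall w, 0 <= g w) ->
  intg P (fun w => f w ^+ k) -> intg P (fun w => g w ^+ k) ->
  intg P (fun w => (f w + g w) ^+ k).
Proof.
move=> mf mg f0 g0 fk gk.
apply: (@intg_le _ _ _ _ _ (fun w => 2 ^+ k * (f w ^+ k + g w ^+ k))).
- by apply: measurable_funX; exact: measurable_funD.
- by apply: intgZ; exact: intgD.
- move=> w; rewrite ger0_norm ?exprn_ge0 ?addr_ge0//.
  have fk0 : 0 <= f w ^+ k by exact: exprn_ge0.
  have gk0 : 0 <= g w ^+ k by exact: exprn_ge0.
  have h (a b : R) : 0 <= a -> a <= b -> (a + b) ^+ k <= 2 ^+ k * b ^+ k.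
    move=> a0 ab; rewrite -exprMn; apply: lerXn2r; rewrite ?nnegrE ?addr_ge0 ?mulr_ge0//.
    - exact: le_trans ab.
    - exact: le_trans ab.
    - by rewrite mulr_natl mulr2n lerD2r.
  have [fg|/ltW gf] := leP (f w) (g w).
    by apply: (le_trans (h _ _ (f0 w) fg)); rewrite ler_wpM2l ?exprn_ge0// lerDr.
  by rewrite addrC; apply: (le_trans (h _ _ (g0 w) gf)); rewrite ler_wpM2l ?exprn_ge0// lerDl.
Qed.

Lemma intg_pow_sum (M : nat -> T -> R) (n k : nat) :
  (forall i, measurable_fun [set: T] (M i)) -> (forall i w, 0 <= M i w) ->
  (forall i, intg P (fun w => M i w ^+ k)) ->
  intg P (fun w => (\sum_(i < n) M i w) ^+ k).
Proof.
move=> mM M0 iM; elim: n => [|n IH].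
  by under eq_fun do rewrite big_ord0; exact: intg_cst.
under eq_fun do rewrite big_ord_recr/=.
apply: intg_powD => //; first by apply: measurable_sum.
by move=> w; apply: sumr_ge0.
Qed.

End PowerMoments.

Section Blocks.
Context {R : realType} {d : nat} {dT : measure_display} {T : measurableType dT}.
Local Notation vec := 'rV[R]_d.
Local Notation mvec := (@mvec R d).
Local Notation mop := (@mop R d).
Variables (P : probability T R) (A : nat -> T -> vec -> vec) (phi : vec -> R).
Hypotheses (d0 : (0 < d)%N) (topA : forall n w, topical_op (A n w)) (iidA : iid_ops P A)
  (tphi : topical_fun phi).

Definition vtr (x : mvec) (s : R) : mvec := ((x : vec) + cst s : vec).

Lemma vtr_translation : translation vtr.
Proof.
split.
- by move=> x s t; apply/rowP => i; rewrite !mxE addrA.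
- by move=> x; apply/rowP => i; rewrite !mxE addr0.
- apply: measurable_to_mvec => i.
  have -> : (fun w : mvec * measurableTypeR R => vtr w.1 w.2 ord0 i) =
      fun w => w.1 ord0 i + w.2.
    by apply/funext => w; rewrite !mxE.
  apply: measurable_funD; last exact: measurable_snd.
  exact: (measurableT_comp (measurable_coord i) measurable_fst).
Qed.

(* [M] dominates the increments of the potentials [Th1 <= Th2] along the operators,
   and, outside a null set, those of [phi] up to a multiple of [Th1]. *)
Record profile (Th1 Th2 : vec -> R) (M : nat -> T -> R) (G : nat -> set T) (c : R) : Prop :=
  Profile {
  pf_m1 : measurable_fun [set: mvec] (Th1 : mvec -> R);
  pf_m2 : measurable_fun [set: mvec] (Th2 : mvec -> R);
  pf_c1 : class_fun vtr Th1;
  pf_c2 : class_fun vtr Th2;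
  pf_ge0 : forall x, 0 <= Th1 x;
  pf_le : forall x, Th1 x <= Th2 x;
  pf_0 : Th2 0 = 0;
  pf_mM : forall i, measurable_fun [set: T] (M i);
  pf_M0 : forall i w, 0 <= M i w;
  pf_A1 : forall i w x, Th1 (A i w x) <= Th1 x + M i w;
  pf_A2 : forall i w x, Th2 (A i w x) <= Th2 x + M i w;
  pf_mG : forall i, measurable (G i);
  pf_G1 : forall i, P (G i) = 1%E;
  pf_c : 0 <= c;
  pf_phi : forall i w, G i w -> forall x, `|phi (A i w x) - phi x| <= M i w + c * Th1 x;
  pf_int : forall i, intg P (fun w => M i w ^+ 3);
  pf_alt : (forall x, Th1 x = 0) \/ (forall i, intg P (fun w => M i w ^+ 4)) }.

Variables (Th1 Th2 : vec -> R) (M : nat -> T -> R) (G : nat -> set T) (c : R).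
Hypothesis pf : profile Th1 Th2 M G c.

Definition sumM (n : nat) (w : T) : R := \sum_(i < n) M i w.

Definition goodset (n : nat) : set T := \bigcap_(i in [set k | (k < n)%N]) G i.

Lemma sumM_ge0 n w : 0 <= sumM n w.
Proof. by apply: sumr_ge0 => i _; exact: pf_M0 pf _ _. Qed.

Lemma measurable_sumM n : measurable_fun [set: T] (sumM n).
Proof. by apply: measurable_sum => i; exact: pf_mM pf _. Qed.

Lemma prodop_Th1 n w x : Th1 (prodop A n w x) <= Th1 x + sumM n w.
Proof.
elim: n => [|n IH]; first by rewrite /sumM big_ord0 addr0.
rewrite /sumM big_ord_recr/= addrA; apply: (le_trans (pf_A1 pf n w _)).
by rewrite lerD2r.
Qed.

Lemma prodop_Th2 n w x : Th2 (prodop A n w x) <= Th2 x + sumM n w.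
Proof.
elim: n => [|n IH]; first by rewrite /sumM big_ord0 addr0.
rewrite /sumM big_ord_recr/= addrA; apply: (le_trans (pf_A2 pf n w _)).
by rewrite lerD2r.
Qed.

Lemma prodop_phi n w x : goodset n w ->
  `|phi (prodop A n w x) - phi x| <= sumM n w + n%:R * c * (Th1 x + sumM n w).
Proof.
move=> Gw; have c0 := pf_c pf.
suff H k : (k <= n)%N ->
    `|phi (prodop A k w x) - phi x| <= sumM k w + k%:R * (c * (Th1 x + sumM n w)).
  by rewrite -mulrA; exact: H.
elim: k => [|k IH] kn; first by rewrite subrr normr0 mul0r addr0 sumM_ge0.
rewrite /= -(subrK (phi (prodop A k w x)) (phi (A k w _))) -addrA.
apply: (le_trans (ler_normD _ _)).
rewrite /sumM big_ord_recr/= -/(sumM k w) -addn1 natrD mulrDl mul1r.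
have h1 := pf_phi pf (Gw k kn) (prodop A k w x).
have h2 := IH (ltnW kn).
have h3 : c * Th1 (prodop A k w x) <= c * (Th1 x + sumM n w).
  rewrite ler_wpM2l// (le_trans (prodop_Th1 k w x))// lerD2l.
  rewrite /sumM -(subnK (ltnW kn)) addnC big_split_ord/= lerDl.
  by apply: sumr_ge0 => j _; exact: pf_M0 pf _ _.
move: h1 h2 h3; rewrite -/(sumM n w); lra.
Qed.

Lemma measurable_goodset n : measurable (goodset n).
Proof.
have -> : goodset n = \bigcap_(i in [set` iota 0 n]) G i by rewrite iotaE.
by apply: fin_bigcap_measurable => [|i _]; [exact: finite_seq|exact: pf_mG pf _].
Qed.

Lemma goodset_prob n : P (goodset n) = 1%E.
Proof.
elim: n => [|n IH].
  rewrite (_ : goodset 0 = setT) ?probability_setT//.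
  by apply/seteqP; split=> w // _ k.
have mG := pf_mG pf n; have mg := measurable_goodset n.
have -> : goodset n.+1 = goodset n `\` ~` G n.
  apply/seteqP; split=> w.
    by move=> h; split=> [k kn|/= nG]; [apply: h; rewrite /= ltnS ltnW|exact: nG (h n (ltnSn n))].
  move=> [h /contrapT hn] k; rewrite /= ltnS leq_eqVlt => /orP[/eqP ->//|]; exact: h.
have N0 : P (~` G n) = 0%E by rewrite probability_setC// (pf_G1 pf) subee.
have N1 : P (goodset n `&` ~` G n) = 0%E.
  apply/eqP; rewrite eq_le measure_ge0 andbT -N0; apply: le_measure; rewrite ?inE//.
    by apply: measurableI => //; exact: measurableC.
  exact: measurableC.
have mGC : measurable (~` G n) by exact: measurableC.
transitivity (P (goodset n) - P (goodset n `&` ~` G n))%E; last by rewrite IH N1 sube0.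
by apply: measureD => //; apply: le_lt_trans (ltry 1); exact: probability_le1.
Qed.

Lemma goodsetC_prob n : P (~` goodset n) = 0%E.
Proof. by rewrite probability_setC ?goodset_prob ?subee//; exact: measurable_goodset. Qed.

Variable N : nat.

(** Replaced by the identity off an almost sure event, so that the bounds on increments hold for
    every [w], as [regenerative] demands. *)
Definition block (w : T) (x : mvec) : mvec := if w \in goodset N then prodop A N w x else x.

Definition rankset : set T := [set w | rank_one (prodop A N w)] `&` goodset N.

Lemma measurable_rankset : measurable rankset.
Proof. by apply: measurableI; [exact: (measurable_rank_one topA iidA)|exact: measurable_goodset]. Qed.

Hypothesis N_rank : (0 < P [set w | rank_one (prodop A N w)])%E.

Lemma rankset_gt0 : (0 < P rankset)%E.
Proof.
have mg := measurable_goodset N.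
have mR : measurable [set w | rank_one (prodop A N w)] by exact: (measurable_rank_one topA iidA).
have N0 := goodsetC_prob N.
rewrite (lt_le_trans N_rank)//.
apply: (@le_trans _ _ (P (rankset `|` ~` goodset N))).
  apply: le_measure; rewrite ?inE//.
    by apply: measurableU; [exact: measurable_rankset|exact: measurableC].
  by move=> w rw; have [gw|gw] := pselect (goodset N w); [left; split|right].
have mRk := measurable_rankset; have mgC : measurable (~` goodset N) by exact: measurableC.
by apply: (le_trans (measureU2 _ mRk mgC)); rewrite [X in (_ + X <= _)%E]N0 adde0.
Qed.

Lemma measurable_block : measurable_fun [set: mvec * T] (fun p => block p.2 p.1).
Proof.
apply: (measurable_fun_ifT (f := fun p : mvec * T => p.2 \in goodset N)).
- have mi : measurable_fun [set: T] (fun w => w \in goodset N).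
    apply: (measurable_fun_bool true).
    have -> : (fun w => w \in goodset N) @^-1` [set true] = goodset N.
      by apply/seteqP; split => w; [exact: set_mem|exact: mem_set].
    by rewrite setTI; exact: measurable_goodset.
  exact: (measurableT_comp mi measurable_snd).
- exact: (measurable_prodop topA iidA).
- exact: measurable_fst.
Qed.

(** The step from [N * k] to [N * k.+1] uses fresh operators, distributed as the first [N] ones;
    [block] differs from the product of the latter on a null set only. *)
Lemma block_chain (x : vec) : chain P block x (fun k w => prodop A (N * k) w x : mvec).
Proof.
have mp k : measurable_fun [set: T] (fun w => prodop A k w x : mvec).
  exact: (measurableT_comp (measurable_prodop topA iidA k) (pair1_measurable (x : mvec))).
split=> [k|w|k f mf f0]; [exact: mp|by rewrite muln0|].
have mF : measurable_fun [set: mvec * mvec] (fun p : mvec * mvec => f p.2).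
  exact: (measurableT_comp mf measurable_snd).
have := process_law topA iidA (N * k) N (measurable_mvec_cst x) (indep_init_cst P A x) mF (fun p => f0 _).
rewrite addnC -mulnS => ->; apply: eq_integral => w _ /=.
set y := prodop A (N * k) w x.
apply: ge0_ae_eq_integral => //.
- exact: (measurableT_comp mf (measurableT_comp (measurable_prodop topA iidA N) (pair1_measurable (y : mvec)))).
- exact: (measurableT_comp mf (measurableT_comp measurable_block (pair1_measurable (y : mvec)))).
- exists (~` goodset N); split.
  + exact/measurableC/measurable_goodset.
  + exact: goodsetC_prob.
  + move=> w' /= h; apply: contra_not h => gw _; rewrite /block ifT//; exact/mem_set.
Qed.

(** Adding [K] to a potential turns its additive growth by [sumM N w] into growth by this factor,
    which is close to [1] when [K] is large. *)
Definition bm (K : R) (w : T) : R := 1 + sumM N w / K.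

Lemma block_weight (Th : vec -> R) (K : R) w x : 1 <= K -> (forall x, 0 <= Th x) ->
  (forall n w x, Th (prodop A n w x) <= Th x + sumM n w) ->
  Th x + sumM N w + K <= bm K w * (Th x + K) /\ Th (block w x) + K <= bm K w * (Th x + K).
Proof.
move=> K1 Th0 hTh; have K0 : 0 < K by exact: lt_le_trans ltr01 K1.
have S0 := sumM_ge0 N w.
have h : Th x + sumM N w + K <= bm K w * (Th x + K).
  rewrite /bm; have -> : (1 + sumM N w / K) * (Th x + K) =
      Th x + sumM N w + K + sumM N w * Th x / K by field; rewrite gt_eqF.
  by rewrite lerDl divr_ge0 ?mulr_ge0// ltW.
split=> //; apply: le_trans h; rewrite lerD2r /block; case: ifP => _; first exact: hTh.
by rewrite lerDl.
Qed.

Lemma block_regenerative : exists (K rho : R), 1 <= K /\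
  regenerative P vtr 0 block rankset rho K (bm K) (fun x => Th1 x + K) (fun x => Th2 x + K).
Proof.
have S0 := sumM_ge0 N; have mS := measurable_sumM N.
have iM := pf_int pf; have mM := pf_mM pf; have M0 := pf_M0 pf.
have iS3 : intg P (fun w => sumM N w ^+ 3) by exact: intg_pow_sum.
have iS i : (i <= 3)%N -> intg P (fun w => sumM N w ^+ i).
  by move=> i3; exact: (intg_pow_le i3 mS S0 iS3).
have mRk := measurable_rankset; have mN : measurable (~` rankset) by exact: measurableC.
pose p := fine (P rankset).
have p01 := fine_prob01 P mRk.
have p0 : 0 < p by rewrite -lte_fin -Ex_finP// rankset_gt0.
have pN : \int[P]_w \1_(~` rankset) w = 1 - p.
  rewrite Ex_indic// probability_setC// /p [in LHS](Ex_finP P mRk).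
  by rewrite -EFinB.
pose Q w := 3 * sumM N w + 3 * sumM N w ^+ 2 + sumM N w ^+ 3.
have iS1 : intg P (sumM N) by have := iS 1%N isT; under eq_fun do rewrite expr1.
have iQ : intg P Q by apply: intgD => //; apply: intgD; apply: intgZ => //; exact: iS.
have Q0 w : 0 <= Q w by rewrite !addr_ge0 ?mulr_ge0 ?exprn_ge0.
pose E := \int[P]_w Q w; have E0 : 0 <= E by exact: Ex_ge0.
(* Off [rankset] the third moment of [bm K] is at most [1 - p + E / K]; this choice gives
   [E / K <= p / 2], whence [rho = 1 - p / 2]. *)
pose K := 1 + 2 * E / p.
have K1 : 1 <= K by rewrite lerDl divr_ge0 ?mulr_ge0// ltW.
have K0 : 0 < K by exact: lt_le_trans ltr01 K1.
have bm1 w : 1 <= bm K w by rewrite lerDl divr_ge0// ltW.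
have mbm : measurable_fun [set: T] (bm K).
  by apply: measurable_funD => //; exact: measurable_funM.
have bmQ w : bm K w ^+ 3 <= 1 + Q w / K.
  have t0 : 0 <= sumM N w / K by rewrite divr_ge0// ltW.
  have K1' : K^-1 <= 1 by rewrite invf_le1.
  have i0 : 0 <= K^-1 by rewrite invr_ge0 ltW.
  have h2 : (K^-1) ^+ 2 <= K^-1 by rewrite expr2 ler_piMl.
  have h3 : (K^-1) ^+ 3 <= K^-1 by rewrite exprS ler_piMr// exprn_ile1.
  have -> : bm K w ^+ 3 = 1 + (3 * sumM N w * K^-1 + 3 * sumM N w ^+ 2 * (K^-1) ^+ 2 +
      sumM N w ^+ 3 * (K^-1) ^+ 3) by rewrite /bm; ring.
  have -> : Q w / K = 3 * sumM N w * K^-1 + 3 * sumM N w ^+ 2 * K^-1 +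
      sumM N w ^+ 3 * K^-1 by rewrite /Q; ring.
  rewrite lerD2l; apply: lerD; first apply: lerD => //.
    by rewrite ler_wpM2l// mulr_ge0// exprn_ge0.
  by rewrite ler_wpM2l// exprn_ge0.
have Th10 : Th1 0 = 0.
  by apply/eqP; rewrite eq_le (pf_ge0 pf) -{1}(pf_0 pf) (pf_le pf).
have Th20 x : 0 <= Th2 x by exact: le_trans (pf_ge0 pf x) (pf_le pf x).
have BU w x := block_weight w x K1 (pf_ge0 pf) prodop_Th1.
have BW w x := block_weight w x K1 Th20 prodop_Th2.
have KE w : sumM N w + K = K * bm K w by rewrite /bm; field; rewrite gt_eqF.
have rank_shift w : rankset w -> forall x, exists s, block w x = vtr (block w 0) s.
  move=> [rk gw] x; rewrite /block !ifT ?inE//; exact: rk.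
have RTh (Th : vec -> R) w x : class_fun vtr Th -> Th 0 = 0 ->
    (forall n w x, Th (prodop A n w x) <= Th x + sumM n w) -> rankset w ->
    Th (block w x) + K <= K * bm K w.
  move=> cTh Th0 hTh wR; have [s ->] := rank_shift w wR x.
  rewrite cTh -KE lerD2r; have [_ gw] := wR; rewrite /block ifT ?inE//.
  by have := hTh N w 0; rewrite Th0 add0r.
exists K, (1 - p / 2); split=> //.
have ibm3 : intg P (fun w => bm K w ^+ 3).
  apply: (@intg_le _ _ _ _ _ (fun w => 1 + K^-1 * Q w)).
  - exact: measurable_funX.
  - by apply: intgD; [exact: intg_cst|exact: intgZ].
  - move=> w; rewrite ger0_norm ?exprn_ge0 ?(le_trans ler01)// mulrC; exact: bmQ.
have mTh1K : measurable_fun [set: mvec] (fun x : mvec => Th1 x + K).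
  by apply: measurable_funD => //; exact: pf_m1 pf.
split=> //.
- exact: measurable_block.
- move=> w x s; rewrite /block; case: ifP => // _.
  by have [_ ->] := topical_prodop topA N w.
- by have /andP[_ p1] := p01; apply/andP; split; rewrite -/p in p1; lra.
- have iN : intg P (fun w => \1_(~` rankset) w * (1 + K^-1 * Q w)).
    by apply: intg_indicM => //; apply: intgD; [exact: intg_cst|exact: intgZ].
  have i1 : intg P (fun w => \1_(~` rankset) w + K^-1 * Q w).
    apply: intgD; last exact: intgZ.
    apply: (@intg_bnd _ _ _ _ _ 1) => [|w]; first exact: measurable_indic.
    by rewrite indicE; case: (_ \in _); rewrite ?normr1 ?normr0.
  apply: (@le_trans _ _ (\int[P]_w (\1_(~` rankset) w + K^-1 * Q w))).
    apply: Ex_le => //; first exact: intg_indicM.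
    move=> w; rewrite indicE; have := bmQ w; have q0 := Q0 w.
    have : 0 <= Q w / K by rewrite divr_ge0// ltW.
    by case: (_ \in _) => /= h1 h2; rewrite ?mul1r ?mul0r ?add0r mulrC.
  rewrite ExD; last 2 first.
  + apply: (@intg_bnd _ _ _ _ _ 1) => [|w]; first exact: measurable_indic.
    by rewrite indicE; case: (_ \in _); rewrite ?normr1 ?normr0.
  + exact: intgZ.
  rewrite pN ExZ// -/E.
  suff : K^-1 * E <= p / 2 by lra.
  rewrite mulrC ler_pdivrMr// /K mulrDr mulr1.
  have -> : p / 2 * (2 * E / p) = E by field; rewrite gt_eqF.
  by rewrite lerDr divr_ge0// ltW.
- exact: ltW.
- by apply: measurable_funD => //; exact: pf_m2 pf.
- by move=> x s; rewrite (pf_c1 pf).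
- by move=> x s; rewrite (pf_c2 pf).
- by move=> x; rewrite (le_trans K1)// lerDr (pf_ge0 pf).
- by move=> x; rewrite lerD2r (pf_le pf).
- by move=> w x; have [] := BU w x.
- by move=> w x; have [] := BW w x.
- by move=> w x wR; apply: RTh => //; [exact: pf_c1 pf|exact: prodop_Th1].
- by move=> w x wR; apply: RTh => //; [exact: pf_c2 pf|exact: pf_0 pf|exact: prodop_Th2].
- have mU3 : measurable_fun [set: T] (fun w => (Th1 (block w 0) + K) ^+ 3 * bm K w).
    apply: measurable_funM => //; apply: measurable_funX.
    exact: (measurableT_comp mTh1K (measurableT_comp measurable_block (pair1_measurable (0 : mvec)))).
  apply: intg_indicM => //.
  (* The two moment assumptions part here. In general the cube of the weight after a regeneration
     times [bm] is of order [bm K w ^+ 4]; when [Th1] vanishes the weight is the constant [K] and a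
     single power of [bm] remains. *)
  have [T0|iM4] := pf_alt pf.
    have i1 := intg_pow_le (isT : (1 <= 3)%N) mbm (fun w => le_trans ler01 (bm1 w)) ibm3.
    have -> : (fun w => ((Th1 (block w 0) + K) ^+ 3 * bm K w)%:E) =
        (fun w => (K ^+ 3 * bm K w ^+ 1)%:E).
      by apply/funext => w; rewrite T0 add0r expr1.
    exact: intgZ.
  have iS4 : intg P (fun w => sumM N w ^+ 4) by exact: intg_pow_sum.
  have ibm4 : intg P (fun w => bm K w ^+ 4).
    apply: intg_powD => //.
    + exact: measurable_funM.
    + by move=> w; rewrite divr_ge0// ltW.
    + exact: intg_cst.
    + by under eq_fun do rewrite expr_div_n mulrC; exact: intgZ.
  apply: (@intg_le _ _ _ _ _ (fun w => K ^+ 3 * bm K w ^+ 4)) => //; first exact: intgZ.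
  move=> w; have [_ h] := BU w 0; rewrite Th10 add0r in h.
  have b0 : 0 <= bm K w by exact: le_trans ler01 (bm1 w).
  have u0 : 0 <= Th1 (block w 0) + K by rewrite addr_ge0 ?(pf_ge0 pf)// ltW.
  rewrite ger0_norm ?mulr_ge0 ?exprn_ge0//.
  have -> : K ^+ 3 * bm K w ^+ 4 = (K * bm K w) ^+ 3 * bm K w by ring.
  rewrite ler_wpM2r//; apply: lerXn2r; rewrite ?nnegrE//.
    by rewrite mulr_ge0// ltW.
  by rewrite mulrC.
Qed.

Lemma block_phi K w x : 1 <= K ->
  `|phi (block w x) - phi x| <= (1 + N%:R * c) * (bm K w * (Th1 x + K)).
Proof.
move=> K1; have K0 : 0 < K by exact: lt_le_trans ltr01 K1.
have S0 := sumM_ge0 N w; have c0 := pf_c pf; have T0 := pf_ge0 pf x.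
have [h _] := block_weight w x K1 (pf_ge0 pf) prodop_Th1.
have Nc : 0 <= N%:R * c by rewrite mulr_ge0.
have mU0 : 0 <= bm K w * (Th1 x + K) by apply: le_trans h; rewrite !addr_ge0// ltW.
rewrite /block; case: (boolP (w \in goodset N)) => [/set_mem gw|_]; last first.
  by rewrite subrr normr0 mulr_ge0// addr_ge0.
apply: (le_trans (prodop_phi x gw)).
rewrite mulrDl mul1r; apply: lerD.
  by apply: le_trans h; rewrite -addrA addrC -addrA lerDl addr_ge0// ltW.
by rewrite ler_wpM2l// (le_trans _ h)// lerDl ltW.
Qed.

End Blocks.

(** * Identification of the limit *)

Section NormalSmoothing.
Context {R : realType}.
Local Notation sq := (@Num.sqrt R).

Lemma normal_pdf_reflect (m s c z : R) : s != 0 ->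
  normal_pdf m s (c - z) = normal_pdf (c - m) s z.
Proof.
move=> s0; rewrite !normal_pdfE// /normal_fun; 
by rewrite (_ : c - z - m = - (z - (c - m))) ?sqrrN//; ring.
Qed.

Lemma Ex_Phi_normal (sigma c : R) : 0 < sigma ->
  \int[normal_prob 0 sigma]_z Phi (c - z) = Phi (c / sq (1 + sigma ^+ 2)).
Proof.
move=> s0; set t := sq _.
have t0 : 0 < t by rewrite sqrtr_gt0 ltr_pwDl// sqr_ge0.
have tE : t = sq (sigma ^+ 2 + 1 ^+ 2) by rewrite expr1n addrC.
have mid : measurable_fun [set: measurableTypeR R] (fun z : measurableTypeR R => z : R) by [].
rewrite -(@hexp0_of_hexp1 _ _ _ (normal_prob 0 sigma) id 1 t)//.
  by apply: eq_Rintegral => z _; rewrite /= expr0 invr1 mul1r mulr1.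
move=> u; rewrite /hexp Ex_normal; last exact: intg_hexp.
have st0 : 0 < sigma / t by rewrite divr_gt0.
transitivity (\int[lebesgue_measure]_z (t^-1 * gpdf (u / t) *
    normal_pdf (u - 1 * u / t ^+ 2) (sigma / t) z)).
  apply: eq_Rintegral => z _; have := gpdf_mul 1 u (u - z) s0.
  rewrite /= -tE normal_pdf_reflect ?gt_eqF// => <-.
  rewrite expr1 invr1 !mul1r mulr1 normal_pdf_gpdf// opprB addrCA subrr addr0.
  ring.
rewrite RintegralZl//; last exact: integrable_normal_pdf.
by rewrite /Rintegral integral_normal_pdf/= mulr1.
Qed.

Lemma Phi_lt (x y : R) : x < y -> Phi x < Phi y.
Proof.
move=> xy; rewrite -subr_gt0; have [c _ ->] := MVT_any x y (@is_derive_Phi R).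
by rewrite mulr_gt0 ?gpdf_gt0// subr_gt0.
Qed.

Lemma Phi_inj : injective (@Phi R).
Proof.
move=> x y E; apply/eqP; rewrite eq_le !leNgt.
by apply/andP; split; apply/negP => /Phi_lt; rewrite E ltxx.
Qed.

(** The derivative of [Phi (x * t)] in [x] is [t * gpdf (x * t)], bounded for [1 <= x] by the
    maximum of [y * gpdf y], uniformly in [t]. *)
Lemma Phi_scale_close (t lam : R) : 1 <= lam -> `|Phi (lam * t) - Phi t| <= hermB * (lam - 1).
Proof.
move=> l1.
have [c] : exists2 c, 1 <= c & Phi (lam * t) - Phi t = t * gpdf (c * t) * (lam - 1).
  have dP (x : R) : is_derive x 1 (fun x => Phi (x * t)) (t * gpdf (x * t)).
    have h1 : is_derive x 1 (fun x : R => x * t) t.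
      have -> : (fun x : R => x * t) = t \*: (@id R) by apply/funext => y; rewrite /= mulrC.
      by apply: is_derive_eq; rewrite /GRing.scale/= mulr1.
    have := @is_derive1_comp R (@Phi R) (fun x => x * t) x _ _ (is_derive_Phi _) h1.
    by rewrite mulrC.
  have [->|l1'] := eqVneq lam 1.
    by exists 1 => //; rewrite mul1r !subrr mulr0.
  have l1'' : 1 < lam by rewrite lt_neqAle eq_sym l1' l1.
  have cP : {within `[1, lam], continuous (fun x => Phi (x * t))}.
    apply: continuous_subspaceT => x.
    by apply/differentiable_continuous/derivable1_diffP; have [] := dP x.
  have [c ci E] := MVT l1'' (fun x _ => dP x) cP.
  exists c; first by move: ci; rewrite in_itv/= => /andP[/ltW].
  by move: E; rewrite mul1r.
move=> c1 ->; have c0 : 0 < c by exact: lt_le_trans ltr01 c1.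
rewrite normrM [X in _ * X]ger0_norm ?subr_ge0// ler_wpM2r ?subr_ge0//.
apply: le_trans (hermG_bounded 2 (c * t)); rewrite /= mulNr normrN.
by rewrite -mulrA [leRHS]normrM (ger0_norm (ltW c0)) ler_peMl.
Qed.

End NormalSmoothing.

Section TightClass.
Context {R : realType} {dT dV : measure_display} {T : measurableType dT}
  {V : measurableType dV}.
Variables (P : probability T R) (tr : V -> R -> V) (x0 : V).
Variables (B : T -> V -> V) (Rk : set T) (rho K : R) (m : T -> R) (U W : V -> R).
Hypothesis rgB : regenerative P tr x0 B Rk rho K m U W.
Variables (x : V) (X : nat -> T -> V).
Hypothesis chX : chain P B x X.

Let mB := rg_mB rgB.

Lemma weight_one : weight P tr B Rk rho 1 (fun=> 1).
Proof.
have mN : measurable (~` Rk) by exact/measurableC/(rg_mRk rgB).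
split=> //.
- by move=> y; exact: intg_cst.
- by move=> y; rewrite Ex_cst mulr1.
- move=> y; rewrite mulr1; apply: le_trans (rg_mN rgB).
  apply: Ex_le; [by apply: intg_indicM => //; exact: intg_cst|exact: intg_indicM (rg_m3 rgB)|].
  move=> w; rewrite indicE; case: (_ \in _); rewrite ?mul0r// !mul1r.
  by rewrite exprn_ege1// (rg_m1 rgB).
Qed.

Lemma iter_transfer (f : V -> R) j : measurable_fun [set: V] f -> class_fun tr f ->
  (forall y, 0 <= f y <= 1) ->
  let F := iter j (transfer P B) f in
  [/\ measurable_fun [set: V] F, class_fun tr F, forall y, 0 <= F y <= 1 &
      forall y z, `|F y - F z| <= rho ^+ j] /\
  forall k, \int[P]_w f (X (k + j) w) = \int[P]_w F (X k w).
Proof.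
move=> mf cf f01; have w1 := weight_one.
elim: j => [|j [[mF cF F01 oF] EF]] /=.
  split; last by move=> k; rewrite addn0.
  split=> // y z; rewrite expr0; have /andP[? ?] := f01 y; have /andP[? ?] := f01 z.
  by rewrite ler_norml; apply/andP; split; lra.
set F := iter j _ _ in mF cF F01 oF EF *.
have Fb y : `|F y| <= 1 * 1 by rewrite mul1r ger0_norm; have /andP[] := F01 y.
have iF y : intg P (fun w => F (B w y)) := transfer_intg mB w1 y mF Fb.
split; last first.
  by move=> k; rewrite -addSnnS EF (step_X rgB chX w1 k ler01 mF Fb).
split.
- exact: (transfer_measurable mB w1 mF Fb).
- exact: (transfer_class P (rg_tr rgB) cF).
- move=> y; apply/andP; split; first by apply: Ex_ge0 => w; have /andP[] := F01 (B w y).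
  rewrite -[X in _ <= X](Ex_cst P 1); apply: Ex_le => //; first exact: intg_cst.
  by move=> w; have /andP[] := F01 (B w y).
- move=> y z; have r0 : 0 <= rho by have /andP[] := rg_rho rgB.
  have D0 : 0 <= rho ^+ j / 2 by rewrite divr_ge0// exprn_ge0.
  have h := transfer_contract mB (rg_mRk rgB) (rg_rank1 rgB) w1 mF cF Fb D0.
  apply: (le_trans (h _ y z)).
    by move=> y' z'; apply: (le_trans (oF y' z')); rewrite le_eqVlt; apply/orP; left; apply/eqP; field.
  by rewrite exprS le_eqVlt; apply/orP; left; apply/eqP; field.
Qed.

(** No moment of [h] is required: on class functions with values in [[0, 1]] the laws at time [n]
    and at a fixed earlier time [k] differ by at most [rho ^+ k], and at time [k] dominated
    convergence applies. *)
Lemma tight_class (h : V -> R) (e : R) : measurable_fun [set: V] h -> class_fun tr h ->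
  0 < e -> exists n0 : nat, forall n t, (n0 <= n)%N -> n0%:R + 1 <= t ->
  \int[P]_w Num.min 1 (`|h (X n w)| / t) <= e.
Proof.
move=> mh ch e0; have /andP[r0 r1] := rg_rho rgB.
pose f (t : R) y := Num.min 1 (`|h y| / t).
have mf t : measurable_fun [set: V] (f t).
  apply: measurable_minr => //; apply: measurable_funM => //.
  exact: measurableT_comp.
have f01 t y : 0 < t -> 0 <= f t y <= 1.
  move=> t0; rewrite /f le_min ler01/= divr_ge0 ?(ltW t0)//=.
  by rewrite ge_min lexx.
have cf t : class_fun tr (f t) by move=> y s; rewrite /f ch.
have [k hk] : exists k, rho ^+ k <= e / 2.
  have : (fun n => rho ^+ n) @ \oo --> (0 : R) by apply: cvg_expr; rewrite ger0_norm.
  move=> /cvgrPdist_le/(_ (e / 2)); rewrite divr_gt0// => /(_ isT)[k _ /(_ k (leqnn k))].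
  by rewrite sub0r normrN ger0_norm ?exprn_ge0// => ?; exists k.
have mX := ch_m chX k.
have dct : \int[P]_w f n.+1%:R (X k w) @[n --> \oo] --> (0 : R).
  rewrite -[X in _ --> X](Ex_cst P 0).
  apply: (@Ex_dct _ _ _ P _ _ (fun=> 1)) => //.
  - by move=> n; exact: measurableT_comp (mf _) mX.
  - exact: intg_cst.
  - by move=> n w; have /andP[? ?] := f01 n.+1%:R (X k w) (ltr0Sn _ _); rewrite ger0_norm.
  - move=> w; apply/cvgrPdist_le => e' e'0.
    have [n1 hn1] := nat_above (`|h (X k w)| / e').
    exists n1 => // n /= n1n; rewrite sub0r normrN.
    have /andP[? _] := f01 n.+1%:R (X k w) (ltr0Sn _ _); rewrite ger0_norm// /f ge_min.
    apply/orP; right; rewrite ler_pdivrMr ?ltr0n// mulrC -ler_pdivrMr//.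
    by rewrite (le_trans hn1)// ler_nat leqW.
have [n1 _ hn1] : \forall n \near \oo, `|0 - \int[P]_w f n.+1%:R (X k w)| <= e / 2.
  by move: dct => /cvgrPdist_le; apply; rewrite divr_gt0.
exists (maxn k n1) => n t kn tn.
have kn' : (k <= n)%N by rewrite (leq_trans (leq_maxl _ _) kn).
have t0 : 0 < t by apply: lt_le_trans tn; rewrite ltr_wpDl.
have [_ EF] := iter_transfer k (mf t) (cf t) (fun y => f01 t y t0).
have [[mF cF F01 oF] _] := iter_transfer k (mf t) (cf t) (fun y => f01 t y t0).
have E1 := EF (n - k)%N; rewrite subnK// in E1; have E2 := EF 0%N; rewrite add0n in E2.
move: mF cF F01 oF E1 E2; set F := iter k _ _ => mF cF F01 oF E1 E2.
have iFX j : intg P (fun w => F (X j w)).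
  apply: (@intg_bnd _ _ _ _ _ 1) => [|w]; first exact: measurableT_comp mF (ch_m chX j).
  by have /andP[? ?] := F01 (X j w); rewrite ger0_norm.
have E3 : \int[P]_w F (X 0%N w) = F x.
  by under eq_Rintegral do rewrite (ch_0 chX); rewrite Ex_cst.
have E4 : \int[P]_w f t (X n w) <= \int[P]_w f t (X k w) + rho ^+ k.
  rewrite E1 E2 E3 -[X in _ <= X](Ex_cst P); apply: Ex_le => //; first exact: intg_cst.
  move=> w; have := oF (X (n - k)%N w) x; rewrite ler_norml => /andP[_]; lra.
apply: (le_trans E4).
have E5 : \int[P]_w f t (X k w) <= \int[P]_w f n1.+1%:R (X k w).
  have ib t' : 0 < t' -> intg P (fun w => f t' (X k w)).
    move=> t'0; apply: (@intg_bnd _ _ _ _ _ 1) => [|w].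
      exact: measurableT_comp (mf _) mX.
    by have /andP[? ?] := f01 t' (X k w) t'0; rewrite ger0_norm.
  apply: Ex_le; [exact: ib|by apply: ib; rewrite ltr0n|].
  move=> w; rewrite /f le_min ge_min lexx/= ge_min; apply/orP; right.
  apply: ler_wpM2l => //; rewrite lef_pV2 ?posrE ?ltr0n//.
  by apply: le_trans tn; rewrite -addn1 natrD lerD2r ler_nat leq_maxr.
have := hn1 n1 (leqnn _); rewrite sub0r normrN => /(le_trans (ler_norm _)); lra.
Qed.

End TightClass.

Section Identification.
Context {R : realType}.
Local Notation sq := (@Num.sqrt R).

(** If [del] were positive, the shifted argument would go to minus infinity and [b n 0], tending to
    [Phi 0], would be caught below [a n (- 1)], whose limit is smaller; the negative case is
    symmetric. Then injectivity of [Phi] compares the limits at [c = 1]. *)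
Lemma identify_scales (a b : nat -> R -> R) (e : nat -> R) (kap kap' del : R) : 0 < kap ->
  (forall c eps, 0 < eps -> exists n1 : nat, forall n, (n1 <= n)%N -> `|a n c - Phi (c * kap)| <= eps) ->
  (forall c eps, 0 < eps -> exists n1 : nat, forall n, (n1 <= n)%N -> `|b n c - Phi (c * kap')| <= eps) ->
  (forall eps, 0 < eps -> exists n1 : nat, forall n, (n1 <= n)%N -> e n <= eps) ->
  (forall n c, (0 < n)%N -> `|b n c - a n (c - sq n%:R * del)| <= e n) ->
  (forall n, {homo a n : c c' / c <= c'}) ->
  del = 0 /\ kap = kap'.
Proof.
move=> k0 Ha Hb He Hab mono.
have H c c' eps : 0 < eps -> exists n1 : nat, forall n, (n1 <= n)%N ->
    [/\ (0 < n)%N, `|a n c - Phi (c * kap)| <= eps, `|b n c' - Phi (c' * kap')| <= eps & e n <= eps].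
  move=> e0; have [n1 h1] := Ha c eps e0; have [n2 h2] := Hb c' eps e0.
  have [n3 h3] := He eps e0; exists (maxn 1 (maxn n1 (maxn n2 n3))) => n.
  by rewrite !geq_max => /and4P[n0 m1 m2 m3]; split; [|exact: h1|exact: h2|exact: h3].
have big d' (C : R) : 0 < d' -> exists n2 : nat, forall n, (n2 <= n)%N -> C <= sq n%:R * d'.
  move=> d'0; have [n2 h2] := nat_above ((C / d') ^+ 2); exists n2 => n n2n.
  rewrite -ler_pdivrMr//; apply: (le_trans (ler_norm _)).
  by rewrite -sqrtr_sqr ler_wsqrtr// (le_trans h2)// ler_nat.
have del0 : del = 0.
  apply/eqP; rewrite eq_le !leNgt; apply/andP; split; apply/negP => dl.
    have gap : 0 < (Phi 0 - Phi (- kap)) / 4 by rewrite divr_gt0// subr_gt0 Phi_lt// oppr_lt0.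
    have [n1 h1] := H (- 1) 0 _ gap; have [n2 h2] := big del 1 dl.
    have := h1 (maxn n1 n2) (leq_maxl _ _); move: (h2 (maxn n1 n2) (leq_maxr _ _)).
    set n := maxn n1 n2 => nd [n0]; rewrite mul0r mulN1r => ha hb he.
    have hab := Hab n 0 n0.
    have := mono n (0 - sq n%:R * del) (- 1); rewrite sub0r lerN2 => /(_ nd).
    by move: ha hb he hab gap; rewrite sub0r !ler_norml => /andP[? ?] /andP[? ?] ? /andP[? ?]; lra.
  have gap : 0 < (Phi kap - Phi 0) / 4 by rewrite divr_gt0// subr_gt0 Phi_lt.
  have dl' : 0 < - del by rewrite oppr_gt0.
  have [n1 h1] := H 1 0 _ gap; have [n2 h2] := big (- del) 1 dl'.
  have := h1 (maxn n1 n2) (leq_maxl _ _); move: (h2 (maxn n1 n2) (leq_maxr _ _)).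
  set n := maxn n1 n2; rewrite mulrN => nd [n0]; rewrite mul0r mul1r => ha hb he.
  have hab := Hab n 0 n0.
  have := mono n 1 (0 - sq n%:R * del); rewrite sub0r => /(_ nd).
  by move: ha hb he hab gap; rewrite sub0r !ler_norml => /andP[? ?] /andP[? ?] ? /andP[? ?]; lra.
split=> //; apply: Phi_inj; apply/eqP; rewrite -subr_eq0 -normr_le0.
apply/ler_addgt0Pr => e' e'0; rewrite add0r.
have e3 : 0 < e' / 3 by rewrite divr_gt0.
have [n1 h1] := H 1 1 _ e3; have [n0] := h1 n1 (leqnn _).
have := Hab n1 1 n0; rewrite del0 mulr0 subr0 !mul1r.
by rewrite !ler_norml => /andP[? ?] /andP[? ?] /andP[? ?] ?; apply/andP; split; lra.
Qed.

End Identification.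

Section ProfileRate.
Context {R : realType} {d : nat} {dT : measure_display} {T : measurableType dT}.
Local Notation vec := 'rV[R]_d.
Local Notation mvec := (@mvec R d).
Local Notation sq := (@Num.sqrt R).
Variables (P : probability T R) (A : nat -> T -> vec -> vec) (phi : vec -> R)
  (l gamma sigma : R).
Hypotheses (d0 : (0 < d)%N) (topA : forall n w, topical_op (A n w)) (iidA : iid_ops P A)
  (tphi : topical_fun phi) (cltA : clt P A gamma l sigma) (sigma0 : 0 < sigma).

Lemma good_init_cst (y : vec) : good_init P A l (fun=> y).
Proof.
split; [by move=> i; exact: measurable_cst|split; first exact: indep_init_cst].
have -> : moment P (fun=> supnorm y) l = (supnorm y `^ l)%:E; last by rewrite ltry.
rewrite /moment -[RHS]mule1 -(probability_setT P).
exact: (integral_cst P measurableT).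
Qed.

Let i0 := Ordinal d0.

(** Among the continuous bounded test functions, [Phi (c - v)] in one coordinate is chosen because
    its expectation is a mollified distribution function, the quantity that [crude_clt] estimates,
    and its normal integral is again a value of [Phi]. *)
Lemma clt_coordinate (c eps : R) : 0 < eps -> exists n1 : nat, forall n, (n1 <= n)%N ->
  `|\int[P]_w Phi (c - (prodop A n w 0 ord0 i0 - n%:R * gamma) / sq n%:R) -
    Phi (c * (sq (1 + sigma ^+ 2))^-1)| <= eps.
Proof.
move=> e0; pose f (v : vec) := Phi (c - v ord0 i0).
have cf : continuous f.
  have cP : continuous (fun x : R => Phi (c - x)).
    move=> x; apply: (@continuous_comp R R R (fun x => c - x) (@Phi R)); last exact: (@hermG_continuous R 0 isT).
    by apply: cvgB; [exact: cvg_cst|exact: cvg_id].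
  move=> v; apply: (@continuous_comp _ R R (fun v : vec => v ord0 i0 : R) (fun x => Phi (c - x))); last exact: cP.
  exact: coord_continuous.
have fb : exists M : R, forall v, `|f v| <= M.
  by exists 1 => v; rewrite ger0_norm ?Phi_ge0// Phi_le1.
have := cltA (good_init_cst 0) cf fb.
have mPhi : measurable_fun [set: R] (@Phi R) := @measurable_hermG R 0.
have mPc : measurable_fun [set: measurableTypeR R] (fun z : R => Phi (c - z)).
  by apply: (measurableT_comp mPhi); exact: measurable_funB.
have -> : (\int[normal_prob 0 sigma]_z (f (cst z))%:E)%E =
    (Phi (c * (sq (1 + sigma ^+ 2))^-1))%:E.
  rewrite -Ex_Phi_normal// -Ex_EFin; last first.
    by apply: (@intg_bnd _ _ _ _ _ 1) => // z; rewrite ger0_norm ?Phi_ge0// Phi_le1.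
  by apply: eq_integral => z _; rewrite /f /cst mxE.
have -> : (fun n : nat => (\int[P]_w
    (f ((sq n%:R)^-1 *: (prodop A n w 0 - cst (n%:R * gamma))))%:E)%E) =
  (fun n : nat => (\int[P]_w Phi (c - (prodop A n w 0 ord0 i0 - n%:R * gamma) / sq n%:R))%:E).
  apply/funext => n; rewrite -Ex_EFin.
    by apply: eq_integral => w _; rewrite /f !mxE mulrC.
  apply: (@intg_bnd _ _ _ _ _ 1) => [|w]; last by rewrite ger0_norm ?Phi_ge0// Phi_le1.
  apply: (measurableT_comp mPhi); apply: measurable_funB => //; apply: measurable_funM => //.
  apply: measurable_funB => //; apply: (measurableT_comp (measurable_coord i0)).
  exact: (measurableT_comp (measurable_prodop topA iidA n) (pair1_measurable (0 : mvec))).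
move=> /fine_cvg /cvgrPdist_le/(_ eps e0)[n1 _ h]; exists n1 => n n1n.
by have := h n n1n; rewrite distrC.
Qed.

Lemma inv_sqrt_small (D eps : R) : 0 < eps -> exists n1 : nat, forall n, (n1 <= n)%N ->
  (0 < n)%N /\ D / sq n%:R <= eps.
Proof.
move=> e0; have [n2 h2] := nat_above ((D / eps) ^+ 2); exists (maxn 1 n2) => n.
rewrite geq_max => /andP[n0 n2n]; split=> //.
rewrite ler_pdivrMr ?sqrtr_gt0 ?ltr0n// mulrC -ler_pdivrMr//.
apply: (le_trans (ler_norm _)).
by rewrite -sqrtr_sqr ler_wsqrtr// (le_trans h2)// ler_nat.
Qed.

Variables (Th1 Th2 : vec -> R) (M : nat -> T -> R) (G : nat -> set T) (c0 : R).
Hypothesis pf : profile P A phi Th1 Th2 M G c0.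
Variable N : nat.
Hypotheses (N0 : (0 < N)%N) (N_rank : (0 < P [set w | rank_one (prodop A N w)])%E).

Theorem profile_rate : exists (phis : vec -> R) (C : R),
  [/\ 0 <= C, measurable_fun [set: mvec] (phis : mvec -> R), equivariant vtr phis,
      forall x, `|phis x - phi x| <= C * (Th1 x + 1) &
  forall x psi Mp, measurable_fun [set: mvec] (psi : mvec -> R) -> equivariant vtr psi ->
    (forall y, `|psi y - phi y| <= Mp * (Th2 y + 1)) -> 1 <= Mp ->
    forall k u, (0 < k)%N ->
    `|fine (P [set w | psi (prodop A (N * k) w x) <= u]) -
      Phi ((u - (N * k)%:R * gamma - phis x) / (sigma * sq (N * k)%:R))| <=
    Mp * (C * ((Th1 x + 1) ^+ 3 + (Th2 x + 1)) / sq k%:R)].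
Proof.
have [K [rho [K1 rgB]]] := block_regenerative topA iidA pf N_rank.
have trT := @vtr_translation R d.
have T1 := pf_ge0 pf; have T2 x : 0 <= Th2 x := le_trans (T1 x) (pf_le pf x).
have mphi := measurable_topical_fun d0 tphi.
have ephi : equivariant vtr phi by move=> x t; exact: (proj2 tphi).
have Cp0 : 0 <= 1 + N%:R * c0 by rewrite addr_ge0// mulr_ge0// (pf_c pf).
have K0 : 0 <= K by exact: le_trans ler01 K1.
have [g [s [phis [C [[C00 s0 mphis ephis phisC] [crude BE]]]]]] :=
  regenerative_limit rgB trT Cp0 mphi ephi (fun w x => block_phi pf N w x K1).
pose X n w := prodop A (N * n) w 0.
have chX : chain P (block A G N) 0 X := block_chain topA iidA pf N 0.
have mX n : measurable_fun [set: T] (X n : T -> mvec) := ch_m chX n.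
have mPhi : measurable_fun [set: R] (@Phi R) := @measurable_hermG R 0.
have NR : 0 < N%:R :> R by rewrite ltr0n.
have N1 : 1 <= N%:R :> R by rewrite ler1n.
(* This is both the normalization at time [N * n] and the bandwidth in the crude estimate, which
   makes [a n c] a value of [hexp]. *)
pose tau n : R := sq (N * n)%:R.
have tau2 n : tau n ^+ 2 = N%:R * n%:R by rewrite sqr_sqrtr// natrM.
have tau0 n : (0 < n)%N -> 0 < tau n by move=> n0; rewrite sqrtr_gt0 ltr0n muln_gt0 N0.
have tauE n : tau n = sq N%:R * sq n%:R by rewrite /tau natrM sqrtrM.
have taun n : sq n%:R <= tau n by rewrite ler_wsqrtr// ler_nat leq_pmull.
have sN : 0 < sq N%:R by rewrite sqrtr_gt0.
pose a n c := \int[P]_w Phi (c - (phis (X n w) - n%:R * g) / tau n).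
pose b n c := \int[P]_w Phi (c - (X n w ord0 i0 - (N * n)%:R * gamma) / tau n).
(* The assumed limit concerns a coordinate, the constructed one [phis]; their difference is a class
   function, negligible after division by [tau n]. *)
pose h (y : mvec) := y ord0 i0 - phis y.
pose e n := \int[P]_w Num.min 1 (`|h (X n w)| / tau n).
pose kap := sq N%:R / sq (N%:R + s ^+ 2).
pose kap' := (sq (1 + sigma ^+ 2))^-1.
pose del := (g - N%:R * gamma) / sq N%:R.
have Ns0 : 0 < N%:R + s ^+ 2 by rewrite ltr_pwDl// sqr_ge0.
have sNs : 0 < sq (N%:R + s ^+ 2) by rewrite sqrtr_gt0.
have iPhi (Z : T -> R) : measurable_fun [set: T] Z -> intg P (fun w => Phi (Z w)).
  move=> mZ; apply: (@intg_bnd _ _ _ _ _ 1) => [|w]; first exact: measurableT_comp.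
  by rewrite ger0_norm ?Phi_ge0// Phi_le1.
have mZa n c : measurable_fun [set: T] (fun w => c - (phis (X n w) - n%:R * g) / tau n).
  apply: measurable_funB => //; apply: measurable_funM => //; apply: measurable_funB => //.
  exact: measurableT_comp mphis (mX n).
have mZb n c : measurable_fun [set: T] (fun w => c - (X n w ord0 i0 - (N * n)%:R * gamma) / tau n).
  apply: measurable_funB => //; apply: measurable_funM => //; apply: measurable_funB => //.
  exact: measurableT_comp (measurable_coord i0) (mX n).
have mh : measurable_fun [set: mvec] h.
  by apply: measurable_funB => //; exact: measurable_coord.
have ch : class_fun vtr h by move=> y t; rewrite /h ephis /vtr !mxE; ring.
have [del0 kapE] : del = 0 /\ kap = kap'.
  apply: (@identify_scales _ a b e kap kap' del).
  - by rewrite divr_gt0.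
  - move=> c eps eps0; have [C' C'0 hC'] := crude 0 X chX.
    have [n1 h1] := inv_sqrt_small (2 * C' + `|phis 0|) eps0.
    exists n1 => n n1n; have [n0 h2] := h1 n n1n; apply: le_trans h2.
    have t0 := tau0 n n0; have sn : 0 < sq n%:R by rewrite sqrtr_gt0 ltr0n.
    have nn : n%:R = sq n%:R ^+ 2 :> R by rewrite sqr_sqrtr.
    have aE : a n c = hexp P (fun w => phis (X n w)) 0 (tau n) (c * tau n + n%:R * g).
      apply: eq_Rintegral => w _; rewrite /= expr0 invr1 mul1r; congr Phi.
      by field; rewrite gt_eqF.
    have h3 := hC' n (c * tau n + n%:R * g) (tau n) t0; rewrite -aE addrK in h3.
    have E1 : sq (tau n ^+ 2 + s ^+ 2 * n%:R) = sq (N%:R + s ^+ 2) * sq n%:R.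
      by rewrite tau2 -mulrDl sqrtrM// ltW.
    have E2 : (c * tau n - phis 0) / sq (tau n ^+ 2 + s ^+ 2 * n%:R) =
        c * kap - phis 0 / (sq (N%:R + s ^+ 2) * sq n%:R).
      by rewrite E1 /kap tauE; field; rewrite !gt_eqF.
    rewrite E2 in h3.
    have h4 := Phi_lipschitz (c * kap) (c * kap - phis 0 / (sq (N%:R + s ^+ 2) * sq n%:R)).
    have h5 : n%:R / tau n ^+ 3 + (tau n ^+ 2)^-1 <= 2 / sq n%:R.
      have t1 : 1 <= tau n by apply: le_trans (taun n); rewrite -[X in X <= _]sqrtr1 ler_wsqrtr// ler1n.
      have ti : (tau n)^-1 <= (sq n%:R)^-1 by rewrite lef_pV2.
      have t3 : n%:R / tau n ^+ 3 <= (tau n)^-1.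
        rewrite exprSr tau2 invfM mulrA ler_piMl ?invr_ge0 ?(ltW t0)//.
        by rewrite invfM mulrCA mulfV ?mulr1 ?invf_le1// gt_eqF// ltr0n.
      have t2 : (tau n ^+ 2)^-1 <= (tau n)^-1.
        by rewrite lef_pV2 ?posrE ?exprn_gt0// expr2 ler_peMl// ltW.
      by move: ti t2 t3; lra.
    have h6 : `|c * kap - phis 0 / (sq (N%:R + s ^+ 2) * sq n%:R) - c * kap| <= `|phis 0| / sq n%:R.
      rewrite addrAC subrr add0r normrN normrM ler_wpM2l// ger0_norm ?invr_ge0 ?mulr_ge0//.
      rewrite lef_pV2 ?posrE ?mulr_gt0// ler_peMl//.
      rewrite -[X in X <= _]sqrtr1 ler_wsqrtr// (le_trans N1)// lerDl sqr_ge0//.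
    have h7 := ler_wpM2l C'0 h5.
    have -> : (2 * C' + `|phis 0|) / sq n%:R = C' * (2 / sq n%:R) + `|phis 0| / sq n%:R by ring.
    apply: (le_trans (ler_distD (Phi (c * kap - phis 0 / (sq (N%:R + s ^+ 2) * sq n%:R))) _ _)).
    apply: lerD; first exact: le_trans h3 h7.
    exact: le_trans h4 h6.
  - move=> c eps eps0; have [n1 h1] := clt_coordinate c eps0.
    exists n1 => n n1n; apply: (h1 (N * n)%N).
    by rewrite (leq_trans n1n)// leq_pmull.
  - move=> eps eps0; have [n0 hn0] := tight_class rgB chX mh ch eps0.
    have [n2 h2] := nat_above ((n0%:R + 1 : R) ^+ 2).
    exists (maxn n0 n2) => n; rewrite geq_max => /andP[n0n n2n]; apply: hn0 => //.
    apply: le_trans (taun n); rewrite -[X in X <= _]ger0_norm ?addr_ge0//.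
    by rewrite -sqrtr_sqr ler_wsqrtr// (le_trans h2)// ler_nat.
  - move=> n c n0; have t0 := tau0 n n0; rewrite /a /b -ExB; [|exact: iPhi..].
    have sn : 0 < sq n%:R by rewrite sqrtr_gt0 ltr0n.
    have nn : n%:R = sq n%:R ^+ 2 :> R by rewrite sqr_sqrtr.
    have NN : N%:R = sq N%:R ^+ 2 :> R by rewrite sqr_sqrtr.
    apply: Ex_norm_le.
    + by apply: measurable_funB; exact: (measurableT_comp mPhi).
    + apply: (@intg_bnd _ _ _ _ _ 1) => [|w].
        apply: measurable_minr => //; apply: measurable_funM => //.
        by apply: measurableT_comp => //; exact: (measurableT_comp mh (mX n)).
      have p0 : 0 <= Num.min 1 (`|h (X n w)| / tau n).
        by rewrite le_min ler01 divr_ge0// ltW.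
      by rewrite ger0_norm// ge_min lexx.
    + move=> w; rewrite le_min; apply/andP; split.
        by apply: Phi_dist_le1; rewrite Phi_ge0 Phi_le1.
      apply: (le_trans (Phi_lipschitz _ _)).
      have E (y p nv Nv rn rN gam : R) : nv = rn ^+ 2 -> Nv = rN ^+ 2 -> rn != 0 -> rN != 0 ->
          c - (y - Nv * nv * gam) / (rN * rn) - (c - rn * ((g - Nv * gam) / rN) -
            (p - nv * g) / (rN * rn)) = - ((y - p) / (rN * rn)).
        by move=> -> -> rn0 rN0; field; rewrite rn0 rN0.
      rewrite natrM tauE (E _ _ _ _ _ _ _ nn NN) ?gt_eqF// -tauE normrN normrM.
      by rewrite [`|(tau n)^-1|]ger0_norm// invr_ge0 ltW.
  - move=> n c c' cc; apply: Ex_le; [exact: iPhi..|].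
    by move=> w; apply: Phi_mono; rewrite lerD2r.
have gE : g = N%:R * gamma.
  by move/eqP: del0; rewrite /del mulf_eq0 invr_eq0 (gt_eqF sN) orbF subr_eq0 => /eqP.
have sE : s = sigma * sq N%:R.
  have sg1 : 0 < 1 + sigma ^+ 2 by rewrite ltr_pwDl// sqr_ge0.
  have E : N%:R * (1 + sigma ^+ 2) = N%:R + s ^+ 2.
    have := congr1 (fun z => z ^+ 2) kapE; rewrite /kap /kap' expr_div_n exprVn.
    rewrite !sqr_sqrtr ?(ltW NR) ?(ltW Ns0) ?(ltW sg1)// => E.
    have E' : N%:R = (N%:R + s ^+ 2) / (1 + sigma ^+ 2).
      by rewrite -E mulrC divfK// gt_eqF.
    by rewrite {1}E' divfK// gt_eqF.
  have E2 : s ^+ 2 = (sigma * sq N%:R) ^+ 2.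
    by rewrite exprMn sqr_sqrtr ?(ltW NR)//; move: E; lra.
  by apply/eqP; rewrite -(@eqrXn2 _ 2 s)//; [rewrite E2|rewrite mulr_ge0// ltW].
have sp : 0 < s by rewrite sE mulr_gt0.
have [C' C'0 hBE] := BE sp.
have C1 : 0 <= C * K by rewrite mulr_ge0.
exists phis, (C * K + C' * K ^+ 3); split=> //.
- by rewrite addr_ge0// mulr_ge0// exprn_ge0.
- move=> x; apply: (le_trans (phisC x)); apply: (@le_trans _ _ (C * K * (Th1 x + 1))).
    rewrite -mulrA ler_wpM2l// mulrDr mulr1 lerD2r ler_peMl//.
  by rewrite ler_wpM2r ?addr_ge0// lerDl mulr_ge0// exprn_ge0.
- move=> x psi Mp mpsi epsi bpsi Mp1 k u k0.
  have Mp0 : 0 <= Mp by exact: le_trans ler01 Mp1.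
  have np : near_phi vtr (fun x => Th2 x + K) phi psi Mp.
    split=> // y; apply: (le_trans (bpsi y)); rewrite ler_wpM2l//.
    by rewrite lerD2l.
  have := hBE x _ (block_chain topA iidA pf N x) psi Mp np k u.
  have -> : maxn k 1 = k by apply/maxn_idPl.
  rewrite gE sE -mulrA -sqrtrM ?(ltW NR)// -natrM (mulrA k%:R) -natrM (mulnC k).
  move=> h'; apply: (le_trans h'); rewrite ler_wpM2l//.
  have sk : 0 < sq k%:R by rewrite sqrtr_gt0 ltr0n.
  have KK3 : K <= K ^+ 3 by rewrite -[X in X <= _]expr1; apply: ler_weXn2l.
  have T13 : (Th1 x + K) ^+ 3 <= K ^+ 3 * (Th1 x + 1) ^+ 3.
    rewrite -exprMn; apply: lerXn2r; rewrite ?nnegrE ?mulr_ge0 ?addr_ge0//.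
    by rewrite mulrDr mulr1 lerD2r ler_peMl.
  have T23 : Th2 x + K <= K ^+ 3 * (Th2 x + 1).
    rewrite mulrDr mulr1; apply: lerD => //.
    by rewrite ler_peMl// (le_trans K1).
  have S0 : 0 <= (Th1 x + 1) ^+ 3 + (Th2 x + 1).
    by rewrite addr_ge0 ?exprn_ge0 ?addr_ge0.
  apply: ler_pM; rewrite ?invr_ge0//.
  + by rewrite mulr_ge0// addr_ge0 ?exprn_ge0 ?addr_ge0.
  + apply: (@le_trans _ _ (C' * K ^+ 3 * ((Th1 x + 1) ^+ 3 + (Th2 x + 1)))).
      by rewrite -mulrA ler_wpM2l// mulrDr lerD.
    by rewrite ler_wpM2r// lerDr.
  + by rewrite lef_pV2 ?posrE ?sqrt_nat_gt0// ler_wsqrtr// ler_nat.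
Qed.

End ProfileRate.

(** * Arbitrary times and random initial conditions *)

Section AllTimes.
Context {R : realType} {d : nat} {dT : measure_display} {T : measurableType dT}.
Local Notation vec := 'rV[R]_d.
Local Notation mvec := (@mvec R d).
Local Notation sq := (@Num.sqrt R).
Variables (P : probability T R) (A : nat -> T -> vec -> vec) (phi : vec -> R)
  (l gamma sigma : R).
Hypotheses (d0 : (0 < d)%N) (topA : forall n w, topical_op (A n w)) (iidA : iid_ops P A)
  (tphi : topical_fun phi) (cltA : clt P A gamma l sigma) (sigma0 : 0 < sigma).
Variables (Th1 Th2 : vec -> R) (M : nat -> T -> R) (G : nat -> set T) (c0 : R).
Hypothesis pf : profile P A phi Th1 Th2 M G c0.
Hypothesis mlA : memory_loss P A.

(** Composing on the left with one more topical operator preserves rank one, so the block length can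
    be taken positive. *)
Lemma memory_loss_pos : exists2 N, (0 < N)%N & (0 < P [set w | rank_one (prodop A N w)])%E.
Proof.
have [N hN] := mlA; exists N.+1 => //; apply: (lt_le_trans hN).
apply: le_measure; rewrite ?inE.
- exact: measurable_rank_one topA iidA N.
- exact: measurable_rank_one topA iidA N.+1.
- move=> w rk x y; have [a E] := rk x y; exists a.
  by rewrite /= E (proj2 (topA N w)).
Qed.

Lemma cube_add (a b : R) : 0 <= a -> 0 <= b -> (a + b) ^+ 3 <= 8 * (a ^+ 3 + b ^+ 3).
Proof.
move=> a0 b0; have h (x y : R) : 0 <= x -> x <= y -> (x + y) ^+ 3 <= 8 * y ^+ 3.
  move=> x0 xy; have y0 := le_trans x0 xy.
  have -> : 8 * y ^+ 3 = (y + y) ^+ 3 by ring.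
  by apply: lerXn2r; rewrite ?nnegrE ?addr_ge0// lerD2r.
have a3 : 0 <= a ^+ 3 by exact: exprn_ge0.
have b3 : 0 <= b ^+ 3 by exact: exprn_ge0.
have [ab|/ltW ba] := leP a b; first by have := h a b a0 ab; lra.
by have := h b a b0 ba; rewrite addrC; lra.
Qed.

Lemma cdf_process (X0 : T -> vec) (psi eta : mvec -> R) n k t :
  measurable_fun [set: T] (X0 : T -> mvec) -> indep_init P A X0 ->
  measurable_fun [set: mvec] psi -> measurable_fun [set: mvec] eta ->
  fine (P [set w | psi (prodop A (n + k) w (X0 w)) <= t + eta (X0 w)]) =
  \int[P]_w fine (P [set w' | psi (prodop A k w' (prodop A n w (X0 w))) <= t + eta (X0 w)]).
Proof.
move=> mX0 iX0 mpsi meta.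
pose E := [set p : mvec * mvec | psi p.2 - eta p.1 <= t].
have mE : measurable E.
  apply: measurable_le_set; apply: measurable_funB.
    exact: (measurableT_comp mpsi measurable_snd).
  exact: (measurableT_comp meta measurable_fst).
have mF : measurable_fun [set: mvec * mvec] (fun p => (\1_E p)%:E : \bar R).
  by apply/measurable_EFinP; exact: measurable_indic.
have F0 p : (0 <= (\1_E p)%:E :> \bar R)%E by rewrite lee_fin indicE.
have := process_law topA iidA n k mX0 iX0 mF F0.
have mx j : measurable_fun [set: T] (fun w => prodop A j w (X0 w) : mvec).
  exact: (measurable_prodop_X0 topA iidA mX0).
have mS (Z : T -> mvec * mvec) : measurable_fun [set: T] Z -> measurable (Z @^-1` E).
  by move=> mZ; rewrite -[X in measurable X]setTI; exact: mZ.
have mZ1 : measurable_fun [set: T] (fun w => (X0 w : mvec, prodop A (n + k) w (X0 w) : mvec)).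
  exact: measurable_fun_pair.
have mZ2 (x y : vec) : measurable_fun [set: T] (fun w' => (x : mvec, prodop A k w' y : mvec)).
  apply: measurable_fun_pair => //.
  exact: (measurableT_comp (measurable_prodop topA iidA k) (pair1_measurable (y : mvec))).
have ib (Z : T -> mvec * mvec) : measurable_fun [set: T] Z ->
    intg P (fun w => \1_E (Z w) : R).
  move=> mZ; apply: (@intg_bnd _ _ _ _ _ 1) => [|w].
    by apply: (measurableT_comp _ mZ); exact: measurable_indic.
  by rewrite indicE; case: (_ \in _); rewrite ?normr1 ?normr0.
have int_ind (Z : T -> mvec * mvec) : measurable_fun [set: T] Z ->
    \int[P]_w \1_E (Z w) = fine (P (Z @^-1` E)).
  move=> mZ; rewrite -Ex_indic; last exact: mS.
  apply: eq_Rintegral => w _; rewrite !indicE.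
  by have [h|h] := pselect (E (Z w)); [rewrite !mem_set|rewrite !memNset].
have setE (Z : T -> mvec * mvec) (x : T -> mvec) (y : T -> mvec) :
    (forall w, Z w = (x w, y w)) -> Z @^-1` E = [set w | psi (y w) <= t + eta (x w)].
  by move=> ZE; apply/seteqP; split=> w; rewrite /= /E ZE /= lerBlDr.
have mZ3 : measurable_fun [set: T * T]
    (fun p : T * T => (X0 p.1 : mvec, prodop A k p.2 (prodop A n p.1 (X0 p.1)) : mvec)).
  apply: measurable_fun_pair; first exact: (measurableT_comp mX0 measurable_fst).
  have mp : measurable_fun [set: T * T] (fun p : T * T => (prodop A n p.1 (X0 p.1) : mvec, p.2)).
    apply: measurable_fun_pair; last exact: measurable_snd.
    exact: (measurableT_comp (mx n) measurable_fst).
  exact: (measurableT_comp (measurable_prodop topA iidA k) mp).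
have mI : measurable_fun [set: T]
    (fun w => \int[P]_w' (\1_E (X0 w, prodop A k w' (prodop A n w (X0 w))) : R)).
  apply: (@measurable_Ex _ _ _ T T P
    (fun p => \1_E (X0 p.1, prodop A k p.2 (prodop A n p.1 (X0 p.1))))).
    by apply: (measurableT_comp _ mZ3); exact: measurable_indic.
  by move=> w; exact: (ib _ (mZ2 (X0 w) (prodop A n w (X0 w)))).
have iI : intg P (fun w => \int[P]_w' (\1_E (X0 w, prodop A k w' (prodop A n w (X0 w))) : R)).
  apply: (@intg_bnd _ _ _ _ _ 1) => // w; apply: Ex_bnd.
    exact: intg_measurable (ib _ (mZ2 _ _)).
  by move=> w'; rewrite indicE; case: (_ \in _); rewrite ?normr1 ?normr0.
rewrite (Ex_EFin (ib _ mZ1)) (int_ind _ mZ1).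
under [X in _ = X]eq_integral do rewrite (Ex_EFin (ib _ (mZ2 _ _))).
rewrite (Ex_EFin iI) (setE _ (fun w => X0 w) (fun w => prodop A (n + k) w (X0 w)))//.
move=> [->]; apply: eq_Rintegral => w _; rewrite (int_ind _ (mZ2 _ _)).
by rewrite (setE _ (fun=> X0 w) (fun w' => prodop A k w' (prodop A n w (X0 w)))).
Qed.

(** A time [n = r + N * k] is treated as [k] blocks started from the random point reached after [r]
    operators. The potentials of that point exceed those of [x] by at most [sumM M N w], which has a
    third moment. *)
Theorem det_rate : exists2 C : R, 0 <= C & forall x psi Mp,
  measurable_fun [set: mvec] (psi : mvec -> R) -> equivariant vtr psi ->
  (forall y, `|psi y - phi y| <= Mp * (Th2 y + 1)) -> 1 <= Mp ->
  forall n t, (0 < n)%N ->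
  `|fine (P [set w | psi (prodop A n w x) <= t]) -
    Phi ((t - n%:R * gamma - phi x) / (sigma * sq n%:R))| <=
  C * Mp * ((Th1 x + 1) ^+ 3 + Th2 x + 1) / sq n%:R.
Proof.
have [N N0 N_rank] := memory_loss_pos.
have [phis [C [C0 mphis ephis phisC rate]]] :=
  profile_rate d0 topA iidA tphi cltA sigma0 pf N0 N_rank.
have T1 := pf_ge0 pf; have T2 x : 0 <= Th2 x := le_trans (T1 x) (pf_le pf x).
have S0 := sumM_ge0 pf N; have mS := measurable_sumM pf N.
have iM := pf_int pf; have mM := pf_mM pf; have M0 := pf_M0 pf; have c00 := pf_c pf.
have iS3 : intg P (fun w => sumM M N w ^+ 3) by exact: intg_pow_sum.
have iS : intg P (sumM M N).
  by have := intg_pow_le (isT : (1 <= 3)%N) mS S0 iS3; under eq_fun do rewrite expr1.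
have NR : 0 < N%:R :> R by rewrite ltr0n.
have N1 : 1 <= N%:R :> R by rewrite ler1n.
have hB0 : 0 <= hermB :> R by exact: ltW hermB_gt0.
pose E3 := \int[P]_w sumM M N w ^+ 3; pose E1 := \int[P]_w sumM M N w.
have E30 : 0 <= E3 by apply: Ex_ge0 => w; exact: exprn_ge0.
have E10 : 0 <= E1 by exact: Ex_ge0.
pose D1 := (C + 1 + N%:R * c0) / sigma.
have D10 : 0 <= D1 by rewrite divr_ge0 ?(ltW sigma0)// !addr_ge0// mulr_ge0.
pose D2 := N%:R * `|gamma| / sigma.
have D20 : 0 <= D2 by rewrite divr_ge0 ?(ltW sigma0)// mulr_ge0.
pose Cf := 8 * C * (1 + E3) + C * (1 + E1) + D1 * (1 + E1) + D2 + hermB.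
have CE : 0 <= C * (1 + E1) by rewrite mulr_ge0// addr_ge0.
have Cf0 : 0 <= Cf.
  apply: addr_ge0 hB0; apply: addr_ge0 D20; apply: addr_ge0; last by rewrite mulr_ge0// addr_ge0.
  by apply: addr_ge0 CE; rewrite !mulr_ge0// addr_ge0.
exists (sq N%:R + Cf * sq (2 * N)%:R); first by rewrite addr_ge0// mulr_ge0.
move=> x psi Mp mpsi epsi bpsi Mp1 n t n0.
have Mp0 : 0 <= Mp by exact: le_trans ler01 Mp1.
have sn : 0 < sq n%:R by rewrite sqrtr_gt0 ltr0n.
set H := (Th1 x + 1) ^+ 3 + Th2 x + 1.
have T1c : 0 <= (Th1 x + 1) ^+ 3 by rewrite exprn_ge0// addr_ge0.
have H1 : 1 <= H by rewrite /H lerDr addr_ge0.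
have H0 : 0 <= H by exact: le_trans ler01 H1.
have MH1 : 1 <= Mp * H by rewrite mulr_ege1.
have MH0 : 0 <= Mp * H by exact: mulr_ge0.
pose y0 := (t - n%:R * gamma - phi x) / (sigma * sq n%:R).
have mxn j z : measurable_fun [set: T] (fun w => prodop A j w z : mvec).
  exact: (measurableT_comp (measurable_prodop topA iidA j) (pair1_measurable (z : mvec))).
have mev j z u : measurable [set w | psi (prodop A j w z) <= u].
  by apply: measurable_le_set; exact: (measurableT_comp mpsi (mxn j z)).
(* Before one full block the bound is trivial, thanks to the summand [sq N%:R] of the constant. *)
rewrite -/y0; have [nN|Nn] := ltnP n N.
  apply: (@le_trans _ _ 1).
    exact: Phi_dist_le1 (fine_prob01 P (mev n x t)).
  rewrite ler_pdivlMr// mul1r -mulrA; apply: (@le_trans _ _ (sq N%:R * (Mp * H))).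
    apply: (@le_trans _ _ (sq N%:R)); last by rewrite ler_peMr.
    by rewrite ler_wsqrtr// ler_nat ltnW.
  by rewrite ler_wpM2r// lerDl mulr_ge0.
pose k := (n %/ N)%N; pose r := (n %% N)%N.
have nE : n = (r + N * k)%N by rewrite addnC mulnC -divn_eq.
have k0 : (0 < k)%N by rewrite divn_gt0.
have rN : (r < N)%N by rewrite ltn_mod.
have sk : 0 < sq k%:R by rewrite sqrtr_gt0 ltr0n.
have sNk : 0 < sq (N * k)%:R by rewrite sqrtr_gt0 ltr0n muln_gt0 N0.
have kn : (sq k%:R)^-1 <= sq (2 * N)%:R / sq n%:R.
  rewrite ler_pdivlMr// mulrC ler_pdivrMr// -sqrtrM// ler_wsqrtr// -natrM ler_nat.
  rewrite nE -mulnA mul2n -addnn leq_add2r (leq_trans (ltnW rN))//.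
  by rewrite leq_pmulr.
have kNk : sq k%:R <= sq (N * k)%:R by rewrite ler_wsqrtr// ler_nat leq_pmull.
have phix : measurable_fun [set: mvec] (fun=> 0 : R) by exact: measurable_cst.
have := cdf_process (eta := fun=> 0) r (N * k) t (measurable_mvec_cst (T := T) x)
  (indep_init_cst P A x) mpsi phix.
rewrite -nE addr0.
move=> ->; set gI := fun w => fine (P [set w' | psi (prodop A (N * k) w' (prodop A r w x)) <= t]).
have mgood := measurable_goodset pf r.
have mgc : measurable (~` goodset G r) by exact: measurableC.
have S_r w : 0 <= sumM M r w <= sumM M N w.
  rewrite (sumM_ge0 pf r w)/= /sumM -(subnK (ltnW rN)) addnC big_split_ord/= lerDl.
  by apply: sumr_ge0.
pose z0 := (t - n%:R * gamma - phi x) / (sigma * sq (N * k)%:R).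
pose alpha := 8 * Mp * C; pose beta := Mp * C + D1.
pose delta := Mp * C * (8 * (Th1 x + 1) ^+ 3 + Th2 x + 1) + D1 * (Th1 x + 1) + D2 + hermB.
(* Normalizing by [N * k] instead of [n] is harmless: [lam - 1] is at most [lam ^+ 2 - 1], that is
   [r / (N * k)], hence at most [1 / k]. *)
have scale : `|Phi z0 - Phi y0| <= hermB * (sq k%:R)^-1.
  pose lam := sq n%:R / sq (N * k)%:R.
  have lam1 : 1 <= lam.
    by rewrite ler_pdivlMr// mul1r ler_wsqrtr// ler_nat [leqRHS]nE leq_addl.
  have -> : z0 = lam * y0.
    by rewrite /z0 /y0 /lam; field; rewrite !gt_eqF.
  apply: (le_trans (Phi_scale_close y0 lam1)); rewrite ler_wpM2l//.
  have lam2 : lam ^+ 2 = n%:R / (N * k)%:R by rewrite expr_div_n !sqr_sqrtr.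
  have Nk0 : 0 < (N * k)%:R :> R by rewrite ltr0n muln_gt0 N0.
  have l2 : lam <= lam ^+ 2 by rewrite expr2 ler_peMl// (le_trans ler01).
  have l3 : lam ^+ 2 - 1 <= k%:R^-1.
    rewrite lam2 {1}nE natrD mulrDl divff ?gt_eqF// addrK.
    rewrite ler_pdivrMr// natrM mulrC mulfK ?pnatr_eq0 -?lt0n// ler_nat; exact: ltnW.
  have l4 : k%:R^-1 <= (sq k%:R)^-1.
    rewrite lef_pV2 ?posrE ?ltr0n//.
    have k1 : 1 <= sq k%:R by rewrite -[X in X <= _]sqrtr1 ler_wsqrtr// ler1n.
    have kk : k%:R = sq k%:R ^+ 2 :> R by rewrite sqr_sqrtr.
    by rewrite [leRHS]kk expr2 ler_peMl// ltW.
  by apply: le_trans l4; apply: le_trans l3; rewrite lerD2r.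
have pw w : `|gI w - Phi y0| <=
    (sq k%:R)^-1 * (alpha * sumM M N w ^+ 3 + beta * sumM M N w + delta) + \1_(~` goodset G r) w.
  have Sw := S0 w; have q0 : 0 <= (sq k%:R)^-1 by rewrite invr_ge0.
  have Sw3 : 0 <= sumM M N w ^+ 3 by exact: exprn_ge0.
  have al0 : 0 <= alpha by rewrite !mulr_ge0.
  have be0 : 0 <= beta by rewrite addr_ge0// mulr_ge0.
  have de0 : 0 <= delta.
    rewrite /delta; apply: addr_ge0 hB0; apply: addr_ge0 D20; apply: addr_ge0.
      rewrite mulr_ge0 ?(mulr_ge0 Mp0 C0)//; apply: addr_ge0 => //; apply: addr_ge0 => //.
      exact: mulr_ge0.
    by rewrite mulr_ge0// addr_ge0.
  have [gw|gw] := pselect (goodset G r w); last first.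
    have p0 : 0 <= (sq k%:R)^-1 * (alpha * sumM M N w ^+ 3 + beta * sumM M N w + delta).
      apply: mulr_ge0 q0 _; apply: addr_ge0 de0; apply: addr_ge0; first exact: mulr_ge0 al0 Sw3.
      exact: mulr_ge0 be0 Sw.
    rewrite indicE mem_set//=.
    apply: (le_trans (Phi_dist_le1 y0 (fine_prob01 P (mev (N * k)%N (prodop A r w x) t)))).
    by rewrite lerDr.
  rewrite indicE memNset/=; last by move=> /(_ gw).
  rewrite addr0; set xr := prodop A r w x.
  have /andP[Sr0 SrN] := S_r w.
  have t1 : Th1 xr <= Th1 x + sumM M N w by apply: (le_trans (prodop_Th1 pf r w x)); rewrite lerD2l.
  have t2 : Th2 xr <= Th2 x + sumM M N w by apply: (le_trans (prodop_Th2 pf r w x)); rewrite lerD2l.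
  have e1 := rate xr psi Mp mpsi epsi bpsi Mp1 k t k0; rewrite -/(gI w) in e1.
  have e2 : `|Phi ((t - (N * k)%:R * gamma - phis xr) / (sigma * sq (N * k)%:R)) - Phi z0| <=
      (D1 * (Th1 x + sumM M N w + 1) + D2) / sq k%:R.
    apply: (le_trans (Phi_lipschitz _ _)); rewrite /z0 -mulrBl.
    have -> : t - (N * k)%:R * gamma - phis xr - (t - n%:R * gamma - phi x) =
        r%:R * gamma - (phis xr - phi xr) - (phi xr - phi x).
      by rewrite {1}nE natrD; ring.
    rewrite normrM [`|(_ * _)^-1|]ger0_norm ?invr_ge0 ?mulr_ge0 ?(ltW sigma0)//.
    have b1 : `|r%:R * gamma| <= N%:R * `|gamma|.
      by rewrite normrM normr_nat ler_wpM2r// ler_nat ltnW.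
    have b2 : `|phis xr - phi xr| <= C * (Th1 x + sumM M N w + 1).
      by apply: (le_trans (phisC xr)); rewrite ler_wpM2l// lerD2r.
    have b3 : `|phi xr - phi x| <= sumM M N w + N%:R * c0 * (Th1 x + sumM M N w).
      apply: (le_trans (prodop_phi pf x gw)); apply: lerD => //.
      apply: ler_pM; rewrite ?mulr_ge0 ?addr_ge0// ?lerD2l//.
      by rewrite ler_wpM2r// ler_nat ltnW.
    have b4 : `|r%:R * gamma - (phis xr - phi xr) - (phi xr - phi x)| <=
        N%:R * `|gamma| + (C + 1 + N%:R * c0) * (Th1 x + sumM M N w + 1).
      apply: (le_trans (ler_normB _ _)); apply: (le_trans (lerD (ler_normB _ _) (lexx _))).
      have b5 : 0 <= N%:R * c0 by rewrite mulr_ge0.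
      apply: (le_trans (lerD (lerD b1 b2) b3)).
      rewrite -[C + 1 + _]addrA mulrDl -addrA lerD2l lerD2l mulrDl mul1r; apply: lerD.
        by rewrite addrAC lerDr addr_ge0.
      by apply: ler_wpM2l b5 _ _ _; rewrite lerDl.
    apply: (@le_trans _ _ ((N%:R * `|gamma| + (C + 1 + N%:R * c0) * (Th1 x + sumM M N w + 1)) /
        (sigma * sq k%:R))).
      apply: ler_pM => //; first by rewrite invr_ge0 mulr_ge0 ?(ltW sigma0).
      by rewrite lef_pV2 ?posrE ?mulr_gt0// ler_wpM2l// ltW.
    by rewrite /D1 /D2 le_eqVlt; apply/orP; left; apply/eqP; field; rewrite !gt_eqF.
  have e3 : C * ((Th1 xr + 1) ^+ 3 + (Th2 xr + 1)) <=
      C * (8 * ((Th1 x + 1) ^+ 3 + sumM M N w ^+ 3) + (Th2 x + sumM M N w + 1)).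
    rewrite ler_wpM2l//; apply: lerD; last by rewrite lerD2r.
    have Tx1 : 0 <= Th1 x + 1 by rewrite addr_ge0.
    apply: le_trans (cube_add Tx1 Sw).
    by apply: lerXn2r; rewrite ?nnegrE ?addr_ge0// addrAC lerD2r.
  apply: (le_trans (ler_distD (Phi ((t - (N * k)%:R * gamma - phis xr) / (sigma * sq (N * k)%:R))) _ _)).
  apply: (le_trans (lerD e1 (ler_distD (Phi z0) _ _))).
  apply: (le_trans (lerD (lexx _) (lerD e2 scale))).
  have e4 := ler_wpM2r q0 (ler_wpM2l Mp0 e3).
  rewrite -(mulrA Mp) in e4; apply: (le_trans (lerD e4 (lexx _))).
  by rewrite le_eqVlt; apply/orP; left; apply/eqP; rewrite /alpha /beta /delta; ring.
have ig : intg P gI.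
  have mgI : measurable_fun [set: T] gI.
    have mF : measurable_fun [set: T * T]
        (fun p : T * T => \1_[set z : mvec | psi z <= t] (prodop A (N * k) p.2 (prodop A r p.1 x)) : R).
      have ms : measurable [set z : mvec | psi z <= t] by exact: measurable_le_set.
      have mp : measurable_fun [set: T * T] (fun p : T * T => (prodop A r p.1 x : mvec, p.2)).
        apply: measurable_fun_pair; last exact: measurable_snd.
        exact: (measurableT_comp (mxn r x) measurable_fst).
      have mq := measurableT_comp (measurable_prodop topA iidA (N * k)) mp.
      by apply: (measurableT_comp _ mq); exact: measurable_indic.
    have ->: gI = fun w => \int[P]_w' \1_[set z : mvec | psi z <= t] (prodop A (N * k) w' (prodop A r w x)).
      apply/funext => w; rewrite /gI -Ex_indic//; apply: eq_Rintegral => w' _; rewrite !indicE.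
    apply: (measurable_Ex mF) => w; apply: (@intg_bnd _ _ _ _ _ 1) => [|w'].
      exact: (measurableT_comp mF (pair1_measurable w)).
    by rewrite indicE; case: (_ \in _); rewrite ?normr1 ?normr0.
  apply: (@intg_bnd _ _ _ _ _ 1) => // w.
  by have /andP[g0 g1] := fine_prob01 P (mev (N * k)%N (prodop A r w x) t); rewrite ger0_norm.
have iind : intg P (fun w => \1_(~` goodset G r) w : R).
  apply: (@intg_bnd _ _ _ _ _ 1) => [|w]; first exact: measurable_indic.
  by rewrite indicE; case: (_ \in _); rewrite ?normr1 ?normr0.
have i1 : intg P (fun w => alpha * sumM M N w ^+ 3 + beta * sumM M N w).
  by apply: intgD; exact: intgZ.
have i2 : intg P (fun w => alpha * sumM M N w ^+ 3 + beta * sumM M N w + delta).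
  by apply: intgD => //; exact: intg_cst.
rewrite -[X in _ - X](Ex_cst P) -ExB//; last exact: intg_cst.
have := @Ex_norm_le _ _ _ P (fun w => gI w - Phi y0) _ _ _ pw.
move=> h; apply: (le_trans (h _ _)).
- have iB : intg P (fun w => gI w - Phi y0) by apply: intgB ig _; exact: intg_cst.
  exact: intg_measurable iB.
- by apply: intgD => //; exact: intgZ.
rewrite ExD//; last exact: intgZ.
rewrite ExZ// [X in _ * X]ExD//; last exact: intg_cst.
rewrite [X in _ * (X + _)]ExD; [|exact: intgZ..].
rewrite !ExZ// Ex_cst Ex_indic// (goodsetC_prob pf r)/= addr0 -/E3 -/E1.
have K1 : alpha * E3 + beta * E1 + delta <= Cf * (Mp * H).
  have T11 : Th1 x + 1 <= (Th1 x + 1) ^+ 3.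
    by rewrite -[X in X <= _]expr1; apply: ler_weXn2l => //; rewrite lerDr.
  have HT : (Th1 x + 1) ^+ 3 <= H by rewrite /H -addrA lerDl addr_ge0.
  have HT2 : Th2 x + 1 <= H by rewrite /H -addrA lerDr.
  have h1 : 8 * ((Th1 x + 1) ^+ 3 + E3) <= 8 * (1 + E3) * H.
    by rewrite -mulrA ler_wpM2l// mulrDl mul1r lerD// ler_peMr.
  have h2 : Th2 x + 1 + E1 <= (1 + E1) * H by rewrite mulrDl mul1r lerD// ler_peMr.
  have h3 : Th1 x + 1 + E1 <= (1 + E1) * H.
    by rewrite mulrDl mul1r lerD ?(le_trans T11)// ler_peMr.
  have HM : H <= Mp * H by rewrite ler_peMl.
  have g1 : Mp * C * (8 * ((Th1 x + 1) ^+ 3 + E3) + (Th2 x + 1 + E1)) <=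
      Mp * C * ((8 * (1 + E3) + (1 + E1)) * H).
    by apply: ler_wpM2l; [exact: mulr_ge0|rewrite [leRHS]mulrDl; exact: lerD].
  have g2 : D1 * (Th1 x + 1 + E1) <= D1 * (1 + E1) * (Mp * H).
    by rewrite -mulrA ler_wpM2l// (le_trans h3)// ler_wpM2l// addr_ge0.
  have g3 : D2 <= D2 * (Mp * H) by rewrite ler_peMr.
  have g4 : hermB <= hermB * (Mp * H) by rewrite ler_peMr.
  rewrite (_ : alpha * E3 + beta * E1 + delta = Mp * C * (8 * ((Th1 x + 1) ^+ 3 + E3) +
    (Th2 x + 1 + E1)) + D1 * (Th1 x + 1 + E1) + D2 + hermB); last first.
    by rewrite /alpha /beta /delta; ring.
  rewrite (_ : Cf * (Mp * H) = Mp * C * ((8 * (1 + E3) + (1 + E1)) * H) +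
    D1 * (1 + E1) * (Mp * H) + D2 * (Mp * H) + hermB * (Mp * H)); last by rewrite /Cf; ring.
  exact: lerD (lerD (lerD g1 g2) g3) g4.
apply: (@le_trans _ _ ((sq k%:R)^-1 * (Cf * (Mp * H)))).
  by rewrite ler_wpM2l// invr_ge0.
apply: (@le_trans _ _ (sq (2 * N)%:R / sq n%:R * (Cf * (Mp * H)))).
  by rewrite ler_wpM2r// mulr_ge0.
rewrite (_ : _ / _ * _ = Cf * sq (2 * N)%:R * Mp * H / sq n%:R); last by ring.
rewrite ler_wpM2r ?invr_ge0 ?(ltW sn)// ler_wpM2r// ler_wpM2r// lerDr//.
Qed.

End AllTimes.

Section RandomStart.
Context {R : realType} {d : nat} {dT : measure_display} {T : measurableType dT}.
Local Notation vec := 'rV[R]_d.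
Local Notation mvec := (@mvec R d).
Local Notation sq := (@Num.sqrt R).
Variables (P : probability T R) (A : nat -> T -> vec -> vec) (phi : vec -> R)
  (l gamma sigma : R).
Hypotheses (d0 : (0 < d)%N) (topA : forall n w, topical_op (A n w)) (iidA : iid_ops P A)
  (tphi : topical_fun phi) (cltA : clt P A gamma l sigma) (sigma0 : 0 < sigma).
Variables (Th1 Th2 : vec -> R) (M : nat -> T -> R) (G : nat -> set T) (c0 : R).
Hypothesis pf : profile P A phi Th1 Th2 M G c0.
Hypothesis mlA : memory_loss P A.

(** [eta] is the initial value to be subtracted, [phi] in the first estimate and [0] in the second;
    [h] collects all that has to be integrated over the initial law. *)
Theorem random_rate : exists2 C : R, 0 <= C & forall (X0 : T -> vec) psi eta Mp h,
  measurable_fun [set: T] (X0 : T -> mvec) -> indep_init P A X0 ->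
  measurable_fun [set: mvec] (psi : mvec -> R) -> equivariant vtr psi ->
  (forall y, `|psi y - phi y| <= Mp * (Th2 y + 1)) -> 1 <= Mp ->
  measurable_fun [set: mvec] (eta : mvec -> R) -> intg P h ->
  (forall w, Mp * ((Th1 (X0 w) + 1) ^+ 3 + Th2 (X0 w) + 1) +
     `|eta (X0 w) - phi (X0 w)| <= h w) ->
  forall n v, (0 < n)%N ->
  `|fine (P [set w | psi (prodop A n w (X0 w)) <= v + n%:R * gamma + eta (X0 w)]) -
    Phi (v / (sigma * sq n%:R))| <= C * \int[P]_w h w / sq n%:R.
Proof.
have [C C0 rate] := det_rate d0 topA iidA tphi cltA sigma0 pf mlA.
have si0 : 0 <= sigma^-1 by rewrite invr_ge0 ltW.
exists (C + sigma^-1) => [|X0 psi eta Mp h mX0 iX0 mpsi epsi bpsi Mp1 meta ih hh n v n0].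
  exact: addr_ge0.
have sn : 0 < sq n%:R by rewrite sqrtr_gt0 ltr0n.
have T1 := pf_ge0 pf; have T2 x : 0 <= Th2 x := le_trans (T1 x) (pf_le pf x).
have Mp0 : 0 <= Mp by exact: le_trans ler01 Mp1.
have := cdf_process topA iidA 0 n (v + n%:R * gamma) mX0 iX0 mpsi meta.
rewrite add0n => -> /=.
pose gI w := fine (P [set w' | psi (prodop A n w' (X0 w)) <= v + n%:R * gamma + eta (X0 w)]).
have mxn z : measurable_fun [set: T] (fun w => prodop A n w z : mvec).
  exact: (measurableT_comp (measurable_prodop topA iidA n) (pair1_measurable (z : mvec))).
have mev z u : measurable [set w | psi (prodop A n w z) <= u].
  by apply: measurable_le_set; exact: (measurableT_comp mpsi (mxn z)).
have pw w : `|gI w - Phi (v / (sigma * sq n%:R))| <= (C + sigma^-1) / sq n%:R * h w.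
  have e1 := rate (X0 w) psi Mp mpsi epsi bpsi Mp1 n (v + n%:R * gamma + eta (X0 w)) n0.
  have E : v + n%:R * gamma + eta (X0 w) - n%:R * gamma - phi (X0 w) =
    v + (eta (X0 w) - phi (X0 w)) by ring.
  rewrite E -/(gI w) in e1.
  have e2 : `|Phi ((v + (eta (X0 w) - phi (X0 w))) / (sigma * sq n%:R)) -
      Phi (v / (sigma * sq n%:R))| <= sigma^-1 * `|eta (X0 w) - phi (X0 w)| / sq n%:R.
    apply: (le_trans (Phi_lipschitz _ _)).
    rewrite -mulrBl addrAC subrr add0r normrM [`|(_ * _)^-1|]ger0_norm; last first.
      by rewrite invr_ge0 mulr_ge0// ltW.
    by rewrite invfM mulrA [_ * sigma^-1]mulrC.
  apply: (le_trans (ler_distD _ _ _)); apply: (le_trans (lerD e1 e2)).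
  rewrite -mulrDl [leRHS]mulrAC ler_wpM2r ?invr_ge0 ?(ltW sn)//.
  have Hh := hh w; set H := (_ + Th2 _ + 1) in Hh *.
  have H0 : 0 <= H by rewrite /H !addr_ge0// exprn_ge0// addr_ge0.
  have MH : 0 <= Mp * H by exact: mulr_ge0.
  have := normr_ge0 (eta (X0 w) - phi (X0 w)); rewrite -mulrA mulrDl => e0.
  by apply: lerD; apply: ler_wpM2l => //; move: Hh MH e0; lra.
have ig : intg P gI.
  have mgI : measurable_fun [set: T] gI.
    pose E := [set z : mvec * mvec | psi z.2 - eta z.1 <= v + n%:R * gamma].
    have mE : measurable E.
      apply: measurable_le_set; apply: measurable_funB.
        exact: (measurableT_comp mpsi measurable_snd).
      exact: (measurableT_comp meta measurable_fst).
    have mF : measurable_fun [set: T * T]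
        (fun p : T * T => \1_E (X0 p.1 : mvec, prodop A n p.2 (X0 p.1) : mvec) : R).
      have mX1 := measurableT_comp mX0 (@measurable_fst _ _ T T).
      have mp : measurable_fun [set: T * T] (fun p : T * T => (X0 p.1 : mvec, p.2)).
        by apply: measurable_fun_pair; last exact: measurable_snd.
      have mq := measurableT_comp (measurable_prodop topA iidA n) mp.
      by apply: (measurableT_comp _ (measurable_fun_pair mX1 mq)); exact: measurable_indic.
    have ->: gI = fun w => \int[P]_w' \1_E (X0 w, prodop A n w' (X0 w)).
      apply/funext => w; rewrite /gI -Ex_indic//; apply: eq_Rintegral => w' _; rewrite !indicE.
      congr ((_ : bool)%:R); apply/idP/idP; rewrite !inE /E/=; lra.
    apply: (measurable_Ex mF) => w; apply: (@intg_bnd _ _ _ _ _ 1) => [|w'].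
      exact: (measurableT_comp mF (pair1_measurable w)).
    by rewrite indicE; case: (_ \in _); rewrite ?normr1 ?normr0.
  apply: (@intg_bnd _ _ _ _ _ 1) => // w.
  by have /andP[g0 g1] := fine_prob01 P (mev (X0 w) (v + n%:R * gamma + eta (X0 w))); rewrite ger0_norm.
rewrite -[X in _ - X](Ex_cst P) -ExB//; last exact: intg_cst.
have iB : intg P (fun w => gI w - Phi (v / (sigma * sq n%:R))) by apply: intgB ig _; exact: intg_cst.
apply: (le_trans (@Ex_norm_le _ _ _ P _ _ (intg_measurable iB) (intgZ _ ih) pw)).
by rewrite ExZ// mulrAC.
Qed.

End RandomStart.

(** * Coordinate functionals *)

Section Coordinates.
Context {R : realType} {d : nat}.
Local Notation vec := 'rV[R]_d.
Local Notation mvec := (@mvec R d).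
Local Notation mop := (@mop R d).
Hypothesis d0 : (0 < d)%N.

Lemma topical_fun_le (f : vec -> R) (x y : vec) (c : R) : topical_fun f ->
  (forall i, x ord0 i <= y ord0 i + c) -> f x <= f y + c.
Proof.
by move=> [mono homog] xy; rewrite -homog; apply: mono => i; rewrite !mxE.
Qed.

Lemma supnorm_ge (x : vec) i : `|x ord0 i| <= supnorm x.
Proof. exact: le_bigmax. Qed.

Lemma supnorm_ge0 (x : vec) : 0 <= supnorm x.
Proof. exact: le_trans (normr_ge0 _) (supnorm_ge x (Ordinal d0)). Qed.

Lemma topical_fun_supnorm (f : vec -> R) (x : vec) : topical_fun f ->
  `|f x| <= `|f 0| + supnorm x.
Proof.
move=> tf; have h1 : f x <= f 0 + supnorm x.
  apply: topical_fun_le => // i; rewrite mxE add0r.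
  exact: le_trans (ler_norm _) (supnorm_ge x i).
have h2 : f 0 <= f x + supnorm x.
  apply: topical_fun_le => // i; rewrite mxE.
  by have := ler_norm (- x ord0 i); rewrite normrN; have := supnorm_ge x i; lra.
have h3 := ler_norm (f 0); have h4 := ler_norm (- f 0); rewrite normrN in h4.
by rewrite ler_norml; apply/andP; split; lra.
Qed.

Definition maxv (x : vec) : R := \big[Num.max/x ord0 (Ordinal d0)]_i x ord0 i.

Lemma maxv_ge (x : vec) i : x ord0 i <= maxv x.
Proof. exact: le_bigmax. Qed.

Lemma maxv_le (x : vec) c : (forall i, x ord0 i <= c) -> maxv x <= c.
Proof. by move=> h; apply: bigmax_le. Qed.

Lemma topical_maxv : topical_fun maxv.
Proof.
split=> [x y xy|x a]; first by apply: maxv_le => i; exact: le_trans (xy i) (maxv_ge y i).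
apply/eqP; rewrite eq_le; apply/andP; split.
  by apply: maxv_le => i; rewrite !mxE lerD2r; exact: maxv_ge.
rewrite -lerBrDr; apply: maxv_le => i; rewrite lerBrDr.
by have := maxv_ge (x + cst a) i; rewrite !mxE.
Qed.

Lemma maxv_scale (x : vec) a : 0 < a -> maxv (a *: x) = a * maxv x.
Proof.
move=> a0; apply/eqP; rewrite eq_le; apply/andP; split.
  by apply: maxv_le => i; rewrite mxE ler_pM2l//; exact: maxv_ge.
rewrite mulrC -ler_pdivlMr//; apply: maxv_le => i; rewrite ler_pdivlMr// mulrC.
by have := maxv_ge (a *: x) i; rewrite mxE.
Qed.

Lemma measurable_maxv : measurable_fun [set: mvec] (maxv : mvec -> R).
Proof. exact: measurable_topical_fun topical_maxv. Qed.

Lemma measurable_maxvN : measurable_fun [set: mvec] (fun x : mvec => maxv (- (x : vec)) : R).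
Proof.
have mN : measurable_fun [set: mvec] (fun x : mvec => - (x : vec) : mvec).
  apply: measurable_to_mvec => i; under eq_fun do rewrite mxE.
  exact: measurable_funN (measurable_coord i).
exact: (measurableT_comp measurable_maxv mN).
Qed.

Lemma supnorm_maxv (x : vec) : supnorm x = Num.max (maxv x) (maxv (- x)).
Proof.
apply/eqP; rewrite eq_le; apply/andP; split.
  have h i : `|x ord0 i| <= Num.max (maxv x) (maxv (- x)).
    have := maxv_ge x i; have := maxv_ge (- x) i; rewrite mxE => h1 h2.
    by rewrite ler_norml lerNl !le_max h1 h2 orbT.
  by apply: bigmax_le => //; exact: le_trans (normr_ge0 _) (h (Ordinal d0)).
rewrite ge_max; apply/andP; split; apply: maxv_le => i.
  exact: le_trans (ler_norm _) (supnorm_ge x i).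
by rewrite mxE; apply: le_trans (supnorm_ge x i); rewrite -normrN ler_norm.
Qed.

Lemma measurable_supnorm : measurable_fun [set: mvec] (fun x : mvec => supnorm (x : vec) : R).
Proof.
under eq_fun do rewrite supnorm_maxv.
exact: measurable_maxr measurable_maxv measurable_maxvN.
Qed.

(** The largest coordinate minus the smallest one, the natural norm on the quotient by constant
    vectors. *)
Definition osc (x : vec) : R := maxv x + maxv (- x).

Lemma measurable_osc : measurable_fun [set: mvec] (osc : mvec -> R).
Proof. exact: measurable_funD measurable_maxv measurable_maxvN. Qed.

Lemma osc_class : class_fun (@vtr R d) osc.
Proof.
move=> x s; have [_ homog] := topical_maxv.
rewrite /osc /vtr (_ : - (_ + _) = - (x : vec) + cst (- s)); last first.
  by apply/rowP => i; rewrite !mxE opprD.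
by rewrite !homog; ring.
Qed.

Lemma osc_ge0 (x : vec) : 0 <= osc x.
Proof.
have := maxv_ge x (Ordinal d0); have := maxv_ge (- x) (Ordinal d0).
by rewrite /osc mxE; lra.
Qed.

Lemma osc0 : osc 0 = 0.
Proof.
apply/eqP; rewrite eq_le osc_ge0 andbT /osc oppr0 -[leRHS]addr0.
by apply: lerD; apply: maxv_le => i; rewrite mxE.
Qed.

Lemma osc_supnorm (x : vec) : osc x <= 2 * supnorm x.
Proof. by rewrite supnorm_maxv /osc mulr2n mulrDl mul1r lerD// le_max lexx ?orbT. Qed.

Lemma topical_op_bounds (f : vec -> vec) (x : vec) i : topical_op f ->
  - supnorm (f 0) - maxv (- x) <= f x ord0 i <= supnorm (f 0) + maxv x.
Proof.
move=> tf; have := supnorm_ge (f 0) i; rewrite ler_norml => /andP[h1 h2].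
have h3 := @topical_op_le _ _ f x 0 (maxv x) tf.
have h4 := @topical_op_le _ _ f 0 x (maxv (- x)) tf.
have {}h3 : f x ord0 i <= f 0 ord0 i + maxv x.
  by apply: h3 => j; rewrite mxE add0r; exact: maxv_ge.
have {}h4 : f 0 ord0 i <= f x ord0 i + maxv (- x).
  by apply: h4 => j; have := maxv_ge (- x) j; rewrite !mxE; lra.
by apply/andP; split; lra.
Qed.

Lemma osc_topical (f : vec -> vec) (x : vec) : topical_op f ->
  osc (f x) <= osc x + 2 * supnorm (f 0).
Proof.
move=> tf; have h i := topical_op_bounds x i tf.
have h1 : maxv (f x) <= supnorm (f 0) + maxv x.
  by apply: maxv_le => i; have /andP[] := h i.
have h2 : maxv (- f x) <= supnorm (f 0) + maxv (- x).
  by apply: maxv_le => i; rewrite mxE; have /andP[] := h i; lra.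
by rewrite /osc; lra.
Qed.

Lemma topical_fun_step (phi : vec -> R) (f : vec -> vec) (x : vec) :
  topical_fun phi -> topical_op f -> `|phi (f x) - phi x| <= supnorm (f 0) + osc x.
Proof.
move=> tphi tf.
have h1 : phi (f x) <= phi x + (supnorm (f 0) + osc x).
  apply: topical_fun_le => // i; have /andP[_ hi] := topical_op_bounds x i tf.
  by have := maxv_ge (- x) i; rewrite /osc mxE; lra.
have h2 : phi x <= phi (f x) + (supnorm (f 0) + osc x).
  apply: topical_fun_le => // i; have /andP[hi _] := topical_op_bounds x i tf.
  by have := maxv_ge x i; rewrite /osc; lra.
by rewrite ler_norml; apply/andP; split; lra.
Qed.

(* A topical function whose sublevel sets are the orthants [{y | y <= c + r}], [r] real. *)
Definition orthant (c y : vec) : R := maxv (y - c) - maxv (- c).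

Lemma topical_orthant c : topical_fun (orthant c).
Proof.
have [mono homog] := topical_maxv; split=> [x y xy|x a]; rewrite /orthant.
  by rewrite lerD2r; apply: mono => i; rewrite !mxE lerD2r.
by rewrite addrAC homog addrAC.
Qed.

Lemma orthant_le c y s : (orthant c y <= s - maxv (- c)) <-> (forall i, y ord0 i - s <= c ord0 i).
Proof.
rewrite /orthant lerD2r; split=> [h i|h].
  by have := le_trans (maxv_ge (y - c) i) h; rewrite !mxE; lra.
by apply: maxv_le => i; rewrite !mxE; have := h i; lra.
Qed.

(** Subtracting [maxv (- c)] makes [orthant c] vanish at [0], and a topical function at [y] differs
    from its value at [0] by a number between the extreme coordinates of [y]. The bound is thus
    uniform in [c], as a supremum over all orthants requires. *)
Lemma orthant_close (phi : vec -> R) c y : topical_fun phi ->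
  `|orthant c y - phi y| <= osc y + `|phi 0|.
Proof.
move=> tphi.
have h1 : orthant c y <= maxv y.
  rewrite /orthant lerBlDr; apply: maxv_le => i; rewrite !mxE.
  by have := maxv_ge y i; have := maxv_ge (- c) i; rewrite mxE; lra.
have h2 : - maxv (- y) <= orthant c y.
  rewrite /orthant lerBrDr -lerBrDl; apply: maxv_le => i.
  by have := maxv_ge (y - c) i; have := maxv_ge (- y) i; rewrite !mxE; lra.
have h3 : phi y <= phi 0 + maxv y.
  by apply: topical_fun_le => // i; rewrite mxE add0r maxv_ge.
have h4 : phi 0 <= phi y + maxv (- y).
  by apply: topical_fun_le => // i; have := maxv_ge (- y) i; rewrite !mxE; lra.
have h5 := ler_norm (phi 0); have h6 := ler_norm (- phi 0); rewrite normrN in h6.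
by rewrite /osc ler_norml; apply/andP; split; lra.
Qed.

Lemma vmin_maxv (u : vec) : vmin u = - maxv (- u).
Proof.
rewrite /vmin; set b := (X in fine X).
have bu i : (b <= (u ord0 i)%:E)%E by exact: bigmin_le.
have ub : ((- maxv (- u))%:E <= b)%E.
  apply: le_bigmin => [|i _]; first exact: leey.
  by rewrite lee_fin lerNl; have := maxv_ge (- u) i; rewrite mxE.
have bf : b \is a fin_num.
  rewrite fin_numElt (lt_le_trans _ ub) ?ltNyr//=; exact: le_lt_trans (bu (Ordinal d0)) (ltry _).
apply/eqP; rewrite eq_le; apply/andP; split; last by rewrite -lee_fin fineK.
by rewrite lerNr; apply: maxv_le => i; rewrite mxE lerN2 -lee_fin fineK.
Qed.

End Coordinates.

(** * Measurable functionals of the size of an operator *)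

Section SizeFunctionals.
Context {R : realType} {d : nat} {dT : measure_display} {T : measurableType dT}.
Local Notation vec := 'rV[R]_d.
Local Notation mvec := (@mvec R d).
Local Notation mop := (@mop R d).
Variables (P : probability T R) (phi : vec -> R).
Hypotheses (d0 : (0 < d)%N) (tphi : topical_fun phi).

Lemma pow_le_powR (t l : R) (k : nat) : 0 <= t -> k%:R <= l -> t ^+ k <= 1 + t `^ l.
Proof.
move=> t0 kl; have p0 : 0 <= t `^ l by exact: powR_ge0.
have [t1|t1] := leP t 1; first by have := exprn_ile1 k t0 t1; lra.
by have := ler_powR (ltW t1) kl; rewrite powR_mulrn//; lra.
Qed.

Lemma intg_powR (f : T -> R) (l : R) : measurable_fun [set: T] f ->
  (moment P f l < +oo)%E -> intg P (fun w => f w `^ l).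
Proof.
move=> mf mo; apply: intg_ge0_lty mo => [|w]; last exact: powR_ge0.
exact: (measurableT_comp (measurable_powR l) mf).
Qed.

Lemma intg_moment (f : T -> R) (l : R) (k : nat) : measurable_fun [set: T] f ->
  (forall w, 0 <= f w) -> k%:R <= l -> (moment P f l < +oo)%E -> intg P (fun w => f w ^+ k).
Proof.
move=> mf f0 kl mo; have ip := intg_powR mf mo.
apply: (@intg_le _ _ _ _ _ (fun w => 1 + f w `^ l)).
- exact: measurable_funX.
- by apply: intgD => //; exact: intg_cst.
- by move=> w; rewrite ger0_norm ?exprn_ge0//; exact: pow_le_powR.
Qed.

(* The supremum defining [supdiff], over rational vectors only, hence measurable in [f]. *)
Definition ratdiff (f : vec -> vec) : \bar R :=
  esups (fun n => let q := ratvec (odflt 0 (unpickle n)) in (`|phi (f q) - phi q|)%:E) 0.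

Lemma measurable_ratdiff : measurable_fun [set: mop] (ratdiff : mop -> \bar R).
Proof.
apply: (measurable_fun_esups (f := fun n (f : mop) =>
  let q := ratvec (odflt 0 (unpickle n)) in (`|phi (f q) - phi q|)%:E)) => n /=.
apply/measurable_EFinP; set q := ratvec _.
have me : measurable_fun [set: mop] (fun f : mop => f q : mvec).
  by apply: measurable_to_mvec => i; exact: measurable_eval.
apply: measurableT_comp => //; apply: measurable_funB => //.
exact: (measurableT_comp (measurable_topical_fun d0 tphi) me).
Qed.

Lemma ratdiff_ge0 f : (0 <= ratdiff f)%E.
Proof.
apply: (@le_trans _ _ (`|phi (f (ratvec 0)) - phi (ratvec 0)|)%:E); first by rewrite lee_fin.
by apply: ereal_sup_ubound; exists (pickle (0 : 'rV[rat]_d)) => //=; rewrite pickleK.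
Qed.

Lemma ratdiff_ge f x : topical_op f -> ((`|phi (f x) - phi x|)%:E <= ratdiff f)%E.
Proof.
move=> [mono homog]; have [mphi hphi] := tphi; apply/lee_addgt0Pr => e e0.
have [q [xq qx]] := ratvec_above x e0.
apply: (@le_trans _ _ ((`|phi (f (ratvec q)) - phi (ratvec q)|)%:E + e%:E)); last first.
  apply: leeD => //; apply: ereal_sup_ubound; exists (pickle q) => //=; by rewrite pickleK.
have a1 : phi x <= phi (ratvec q) by exact: mphi.
have a2 : phi (ratvec q) <= phi x + e by rewrite -hphi; exact: mphi.
have a3 : phi (f x) <= phi (f (ratvec q)) by apply: mphi; exact: mono.
have a4 : phi (f (ratvec q)) <= phi (f x) + e.
  by rewrite -hphi; apply: mphi; rewrite -homog; exact: mono.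
have b1 := ler_norm (phi (f (ratvec q)) - phi (ratvec q)).
have b2 := ler_norm (- (phi (f (ratvec q)) - phi (ratvec q))); rewrite normrN in b2.
by rewrite -EFinD lee_fin ler_norml; apply/andP; split; lra.
Qed.

Variable A : nat -> T -> vec -> vec.
Hypotheses (topA : forall n w, topical_op (A n w)) (iidA : iid_ops P A).

Lemma ratdiff_supdiff w : ratdiff (A 0 w) = supdiff phi A w.
Proof.
apply/eqP; rewrite eq_le; apply/andP; split.
  by apply: ge_ereal_sup => _ [n _ <-]; apply: ereal_sup_ubound; exists (ratvec (odflt 0 (unpickle n))).
by apply: ge_ereal_sup => _ [x _ <-]; exact: ratdiff_ge.
Qed.

Lemma iid_integral n (h : mop -> \bar R) : measurable_fun [set: mop] h -> (forall f, 0 <= h f)%E ->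
  (\int[P]_w h (A n w) = \int[P]_w h (A 0 w))%E.
Proof.
move=> mh h0; have mA k : measurable_fun [set: T] (A k : T -> mop) := measurable_A iidA k.
have E k : (\int[P]_w h (A k w) = \int[pushforward P (A k : T -> mop)]_f h f)%E.
  by rewrite ge0_integral_pushforward.
rewrite !E; apply: eq_measure_integral => F mF _.
by have [_ [idA _]] := iidA; exact: idA.
Qed.

Lemma iid_intg n (h : mop -> R) : measurable_fun [set: mop] h -> (forall f, 0 <= h f) ->
  intg P (fun w => h (A 0 w)) -> intg P (fun w => h (A n w)).
Proof.
move=> mh h0 ih; have mA : measurable_fun [set: T] (A n : T -> mop) := measurable_A iidA n.
apply: intg_ge0_lty => //; first exact: (measurableT_comp mh mA).
rewrite (iid_integral n (h := fun f => (h f)%:E)); first by rewrite (Ex_EFin ih) ltry.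
- exact/measurable_EFinP.
- by move=> f; rewrite lee_fin.
Qed.

Section FiniteSupdiff.
Variable l : R.
Hypotheses (l3 : 3 <= l) (sdl : supdiff_moment_finite P phi A l).

Lemma ratdiff_moment : (moment P (fun w => fine (ratdiff (A 0 w))) l < +oo)%E.
Proof.
have [msd fsd] := sdl; apply: le_lt_trans fsd; apply: ge0_le_integral => //.
- by move=> w _; rewrite lee_fin powR_ge0.
- apply/measurable_EFinP; apply: (measurableT_comp (measurable_powR l)).
  under eq_fun do rewrite ratdiff_supdiff; exact: measurableT_comp.
- exact: (measurableT_comp (measurable_poweR l) msd).
move=> w _; rewrite ratdiff_supdiff; have := ratdiff_ge0 (A 0 w); rewrite ratdiff_supdiff.
have l0 : l != 0 by rewrite gt_eqF// (lt_le_trans _ l3).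
by case: (supdiff phi A w) => [r| |]//= _; rewrite (negbTE l0) leey.
Qed.

(** The moment assumption speaks of the first operator; written with rational vectors, finiteness is
    an event of the cylinder sigma-algebra and passes to every [n] by equality of laws. *)
Lemma ratdiff_finite n : P [set w | (ratdiff (A n w) < +oo)%E] = 1%E.
Proof.
have [msd fsd] := sdl; have [_ [idA _]] := iidA.
have mF : op_meas [set f : vec -> vec | (ratdiff f < +oo)%E].
  have := emeasurable_fun_infty_o measurableT measurable_ratdiff +oo%E.
  by rewrite setTI.
have -> : P [set w | (ratdiff (A n w) < +oo)%E] = P [set w | (ratdiff (A 0 w) < +oo)%E].
  exact: (idA n _ mF).
have isd : P.-integrable setT (fun w => (supdiff phi A w) `^ l)%E.
  apply/integrableP; split; first exact: (measurableT_comp (measurable_poweR l) msd).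
  by under eq_integral do rewrite gee0_abs ?poweR_ge0//.
have l0 : l != 0 by rewrite gt_eqF// (lt_le_trans _ l3).
have [N [mN N0 sub]] := integrable_ae measurableT isd.
have NC : P (~` N) = 1%E by rewrite probability_setC// N0 sube0.
have mG : measurable [set w | (ratdiff (A 0 w) < +oo)%E].
  have := measurable_A iidA 0 measurableT mF; rewrite setTI; exact.
apply/eqP; rewrite eq_le probability_le1//= -NC; apply: le_measure; rewrite ?inE//.
  exact: measurableC.
move=> w Nw /=; rewrite ltNge leye_eq; apply/negP => /eqP E; apply: Nw; apply: sub => /(_ I).
by rewrite -ratdiff_supdiff E poweRyr.
Qed.

End FiniteSupdiff.

End SizeFunctionals.

(** * The potentials provided by each of the two moment assumptions *)

Section Profiles.
Context {R : realType} {d : nat} {dT : measure_display} {T : measurableType dT}.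
Local Notation vec := 'rV[R]_d.
Local Notation mvec := (@mvec R d).
Local Notation mop := (@mop R d).
Local Notation sq := (@Num.sqrt R).
Variables (P : probability T R) (A : nat -> T -> vec -> vec) (phi : vec -> R) (l : R).
Hypotheses (d0 : (0 < d)%N) (topA : forall n w, topical_op (A n w)) (iidA : iid_ops P A)
  (tphi : topical_fun phi).

Let mA n : measurable_fun [set: T] (A n : T -> mop) := measurable_A iidA n.

Let measurable_size : measurable_fun [set: mop] (fun f : mop => supnorm (f 0) : R).
Proof.
have me : measurable_fun [set: mop] (fun f : mop => f 0 : mvec).
  by apply: measurable_to_mvec => i; exact: measurable_eval.
exact: (measurableT_comp (measurable_supnorm d0) me).
Qed.

Lemma intg_size (k : nat) : k%:R <= l ->
  (moment P (fun w => supnorm (A 0%N w 0%R)) l < +oo)%E ->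
  intg P (fun w => (2 * supnorm (A 0%N w 0)) ^+ k).
Proof.
move=> kl mo; under eq_fun do rewrite exprMn; apply: intgZ; apply: intg_moment kl mo.
  exact: (measurableT_comp measurable_size (mA 0)).
by move=> w; exact: supnorm_ge0.
Qed.

(** The increments of [phi] are dominated independently of the state, so the first potential is
    zero. The flag [b] adds the oscillation as second potential, which the orthants call for, and
    with it a moment of the image of [0]. *)
Lemma profile_supdiff (b : bool) : 3 <= l -> supdiff_moment_finite P phi A l ->
  (b -> (moment P (fun w => supnorm (A 0%N w 0%R)) l < +oo)%E) ->
  profile P A phi (fun=> 0) (fun x => b%:R * osc d0 x)
    (fun i w => fine (ratdiff phi (A i w)) + b%:R * (2 * supnorm (A i w 0)))
    (fun i => [set w | (ratdiff phi (A i w) < +oo)%E]) 0.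
Proof.
move=> l3 sdl mb; have b0 : 0 <= b%:R :> R by exact: ler0n.
have mr := measurable_ratdiff d0 tphi; have r0 := @ratdiff_ge0 R d phi.
have s0 := @supnorm_ge0 R d d0.
have f0 f : 0 <= fine (ratdiff phi f) by exact: fine_ge0.
have mfr : measurable_fun [set: mop] (fun f : mop => fine (ratdiff phi f)).
  exact: measurableT_comp.
have mbs : measurable_fun [set: mop] (fun f : mop => b%:R * (2 * supnorm (f 0)) : R).
  by apply: measurable_funM => //; exact: measurable_funM.
have m0 f : 0 <= fine (ratdiff phi f) + b%:R * (2 * supnorm (f 0)).
  by rewrite addr_ge0// !mulr_ge0.
have mm : measurable_fun [set: mop]
    (fun f : mop => fine (ratdiff phi f) + b%:R * (2 * supnorm (f 0))).
  exact: measurable_funD.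
split => //.
- by apply: measurable_funM => //; exact: measurable_osc.
- by move=> x s; congr (_ * _); exact: osc_class.
- by move=> x; rewrite mulr_ge0 ?osc_ge0.
- by rewrite osc0 mulr0.
- by move=> i; exact: (measurableT_comp mm (mA i)).
- by move=> i w x; rewrite add0r.
- move=> i w x; have := ler_wpM2l b0 (osc_topical d0 x (topA i w)).
  by rewrite mulrDr; have := f0 (A i w); lra.
- move=> i; have := emeasurable_fun_infty_o measurableT (measurableT_comp mr (mA i)) +oo%E.
  by rewrite setTI.
- by move=> i; exact: ratdiff_finite l3 sdl i.
- move=> i w /= rf x; rewrite mulr0 addr0.
  have bs : 0 <= b%:R * (2 * supnorm (A i w 0)) by rewrite !mulr_ge0.
  have rfin : ratdiff phi (A i w) \is a fin_num by rewrite ge0_fin_numE.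
  apply: (@le_trans _ _ (fine (ratdiff phi (A i w)))); last by rewrite lerDl.
  by rewrite -lee_fin fineK//; exact: ratdiff_ge.
- move=> i; apply: (iid_intg iidA i (h := fun f : mop =>
    (fine (ratdiff phi f) + b%:R * (2 * supnorm (f 0))) ^+ 3)).
  + exact: measurable_funX.
  + by move=> f; exact: exprn_ge0.
  apply: (intg_powD (g := fun w => b%:R * (2 * supnorm (A 0%N w 0)))).
  + exact: (measurableT_comp mfr (mA 0)).
  + exact: (measurableT_comp mbs (mA 0)).
  + by [].
  + by move=> w; rewrite !mulr_ge0.
  + apply: (intg_moment _ _ l3) => //; first exact: (measurableT_comp mfr (mA 0)).
    exact: ratdiff_moment l3 sdl.
  case: b mb {b0 mbs m0 mm} => mb.
    by under eq_fun do rewrite mul1r; exact: intg_size l3 (mb isT).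
  by under eq_fun do rewrite mul0r expr0n; exact: intg_cst.
- by left.
Qed.

(** Here the increments of [phi] grow with the oscillation of the state, which therefore serves as
    both potentials; [6 < l] covers the fourth moment requested by [pf_alt]. *)
Lemma profile_norm : 6 < l -> (moment P (fun w => supnorm (A 0%N w 0%R)) l < +oo)%E ->
  profile P A phi (osc d0) (osc d0) (fun i w => 2 * supnorm (A i w 0)) (fun=> setT) 1.
Proof.
move=> l6 mo; have s0 := @supnorm_ge0 R d d0.
have ms : measurable_fun [set: mop] (fun f : mop => 2 * supnorm (f 0) : R).
  exact: measurable_funM.
have ik (k : nat) i : (k <= 6)%N -> intg P (fun w => (2 * supnorm (A i w 0)) ^+ k).
  move=> k6; apply: (iid_intg iidA i (h := fun f : mop => (2 * supnorm (f 0)) ^+ k)).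
  - exact: measurable_funX.
  - by move=> f; rewrite exprn_ge0// mulr_ge0.
  apply: intg_size mo; apply: le_trans (ltW l6); by rewrite ler_nat.
split => //.
- exact: measurable_osc.
- exact: measurable_osc.
- exact: osc_class.
- exact: osc_class.
- by move=> x; exact: osc_ge0.
- exact: osc0.
- by move=> i; exact: (measurableT_comp ms (mA i)).
- by move=> i w; rewrite mulr_ge0.
- by move=> i w x; exact: osc_topical.
- by move=> i w x; exact: osc_topical.
- by move=> i; exact: probability_setT.
- move=> i w _ x; rewrite mul1r; apply: (le_trans (topical_fun_step d0 x tphi (topA i w))).
  by have := s0 (A i w 0); lra.
- by move=> i; exact: ik.
- by right=> i; exact: ik.
Qed.

Variables gamma sigma : R.
Hypotheses (cltA : clt P A gamma l sigma) (sigma0 : 0 < sigma) (mlA : memory_loss P A)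
  (l3 : 3 <= l).

Lemma moment_rate (Th1 Th2 : vec -> R) M G c0 : profile P A phi Th1 Th2 M G c0 ->
  (forall x, Th2 x <= 2 * supnorm x) ->
  exists2 C : R, 0 <= C & forall (X0 : T -> vec) psi eta Mp Me,
  good_init P A l X0 ->
  measurable_fun [set: mvec] (psi : mvec -> R) -> equivariant (@vtr R d) psi ->
  (forall y, `|psi y - phi y| <= Mp * (Th2 y + 1)) -> 1 <= Mp ->
  measurable_fun [set: mvec] (eta : mvec -> R) ->
  (forall y, `|eta y - phi y| <= Me * (1 + supnorm y)) -> 0 <= Me ->
  forall n v, (0 < n)%N ->
  `|fine (P [set w | psi (prodop A n w (X0 w)) <= v + n%:R * gamma + eta (X0 w)]) -
    Phi (v / (sigma * sq n%:R))| <=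
  C * (Mp + Me) * (1 + fine (moment P (fun w => supnorm (X0 w)) l)) / sq n%:R.
Proof.
move=> pf Th2s; have [C C0 rate] := random_rate d0 topA iidA tphi cltA sigma0 pf mlA.
exists (C * 77) => [|X0 psi eta Mp Me [mX0 [iX0 fX0]] mpsi epsi bpsi Mp1 meta beta Me0 n v n0].
  exact: mulr_ge0.
have {}mX0 : measurable_fun [set: T] (X0 : T -> mvec) by exact: measurable_to_mvec.
have T1 := pf_ge0 pf; have T12 := pf_le pf.
have Mp0 : 0 <= Mp by exact: le_trans ler01 Mp1.
(* The cube of [2 * s w + 1] takes [72] times [1 + s w] to the power [l], by [cube_add]; the rest of
   [77] leaves room for the linear terms. *)
pose s w := supnorm (X0 w); pose h w := 77 * (Mp + Me) * (1 + s w `^ l).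
have s0 w : 0 <= s w by exact: supnorm_ge0.
have ms : measurable_fun [set: T] s by exact: (measurableT_comp (measurable_supnorm d0) mX0).
have isl : intg P (fun w => s w `^ l) by exact: intg_powR.
have ih : intg P h by apply: intgZ; apply: intgD => //; exact: intg_cst.
have hh w : Mp * ((Th1 (X0 w) + 1) ^+ 3 + Th2 (X0 w) + 1) +
    `|eta (X0 w) - phi (X0 w)| <= h w.
  have b1 : s w <= 1 + s w `^ l.
    have l1 : 1%:R <= l by apply: le_trans l3; rewrite ler_nat.
    by have := pow_le_powR (s0 w) l1; rewrite expr1.
  have b3 : s w ^+ 3 <= 1 + s w `^ l by exact: pow_le_powR (s0 w) l3.
  set p := s w `^ l in b1 b3; have p0 : 0 <= p by exact: powR_ge0.
  have t3 : (Th1 (X0 w) + 1) ^+ 3 <= 72 * (1 + p).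
    apply: (@le_trans _ _ ((2 * s w + 1) ^+ 3)).
      apply: lerXn2r; rewrite ?nnegrE ?addr_ge0 ?mulr_ge0// lerD2r.
      exact: le_trans (T12 _) (Th2s _).
    apply: (le_trans (cube_add (mulr_ge0 (ler0n _ 2) (s0 w)) ler01)).
    by rewrite exprMn expr1n; lra.
  have t2 := Th2s (X0 w); rewrite -/(s w) in t2.
  have H : (Th1 (X0 w) + 1) ^+ 3 + Th2 (X0 w) + 1 <= 77 * (1 + p) by lra.
  have E : `|eta (X0 w) - phi (X0 w)| <= Me * (77 * (1 + p)).
    by apply: (le_trans (beta _)); rewrite ler_wpM2l// -/(s w); lra.
  rewrite /h -/p [77 * _]mulrC -mulrA mulrDl; apply: lerD E.
  by rewrite ler_wpM2l.
apply: (le_trans (rate _ _ _ _ _ mX0 iX0 mpsi epsi bpsi Mp1 meta ih hh n v n0)).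
have -> : \int[P]_w h w = 77 * (Mp + Me) * (1 + fine (moment P (fun w => supnorm (X0 w)) l)).
  rewrite /h ExZ; last by apply: intgD => //; exact: intg_cst.
  by rewrite ExD//; [rewrite Ex_cst|exact: intg_cst].
by rewrite !mulrA.
Qed.

End Profiles.

Unset Implicit Arguments.

Theorem theorem2p2 (R : realType) (d : nat) (dT : measure_display)
  (T : measurableType dT) (P : probability T R)
  (A : nat -> T -> 'rV[R]_d -> 'rV[R]_d) (phi : 'rV[R]_d -> R)
  (l gamma sigma : R) :
  (0 < d)%N ->
  (forall n w, topical_op (A n w)) ->
  iid_ops P A ->
  memory_loss P A ->
  topical_fun phi ->
  ((3 <= l /\ supdiff_moment_finite P phi A l)
   \/ (6 < l /\ (moment P (fun w => supnorm (A 0%N w 0%R)) l < +oo)%E)) ->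
  lyapunov P A gamma ->
  clt P A gamma l sigma ->
  0 < sigma ->
  exists C : R, 0 <= C /\
    forall X0 : T -> 'rV[R]_d, good_init P A l X0 ->
    forall n : nat, (0 < n)%N ->
      (forall u : R,
        (`| P [set w | (phi (prodop A n w (X0 w)) - n%:R * gamma - phi (X0 w)
                        <= sigma * u * Num.sqrt n%:R)%R]
            - normal_prob 0 1 [set z | (z <= u)%R] |
         <= C%:E * (1 + moment P (fun w => supnorm (X0 w)) l)
              * ((Num.sqrt n%:R)^-1)%:E)%E) /\
      (forall u : 'rV[R]_d,
        (`| P [set w | forall i, ((prodop A n w (X0 w)) ord0 i - n%:R * gamma
                        <= sigma * u ord0 i * Num.sqrt n%:R)%R]
            - normal_prob 0 1 [set z | (z <= vmin u)%R] |
         <= C%:E * (1 + moment P (fun w => supnorm (X0 w)) l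
                      + moment P (fun w => supnorm (A 0%N w 0%R)) l)
              * ((n%:R `^ (l / (2 * (l + 1))))^-1)%:E)%E).
Proof.
move=> d0 topA iidA mlA tphi cond _ cltA sigma0.
have l3 : 3 <= l by case: cond => -[]; lra.
(* Since the exponent of the second estimate is at most one half, a bound in [1 / sqrt n] suffices
   there too. *)
have el : l / (2 * (l + 1)) <= 2^-1.
  have l1 : 0 < 2 * (l + 1) by rewrite mulr_gt0 ?ltr_wpDl//; lra.
  by rewrite ler_pdivrMr//; lra.
pose mA := moment P (fun w => supnorm (A 0%N w 0%R)) l.
have m0 (f : T -> R) : (0 <= moment P f l)%E.
  by apply: integral_ge0 => w _; rewrite lee_fin powR_ge0.
have os (x : 'rV[R]_d) : osc d0 x <= 2 * supnorm x := osc_supnorm d0 x.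
have s0 (x : 'rV[R]_d) : 0 <= supnorm x := @supnorm_ge0 R d d0 x.
have mphi := measurable_topical_fun d0 tphi.
have ephi : equivariant (@vtr R d) phi by move=> x a; exact: (proj2 tphi).
have normalE (u : R) : normal_prob 0 1 [set z | (z <= u)%R] = (Phi u)%:E.
  by rewrite -Phi_EFin; congr (normal_prob _ _ _); apply/seteqP; split=> z /=; rewrite in_itv.
have [C1 C10 rate1] : exists2 C : R, 0 <= C & forall X0, good_init P A l X0 ->
    forall n v, (0 < n)%N ->
    `|fine (P [set w | phi (prodop A n w (X0 w)) <= v + n%:R * gamma + phi (X0 w)]) -
      Phi (v / (sigma * Num.sqrt n%:R))| <=
    C * (1 + fine (moment P (fun w => supnorm (X0 w)) l)) / Num.sqrt n%:R.
  have [Th1 [Th2 [M [G [c [pf T2]]]]]] : exists Th1 Th2 M G c,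
      profile P A phi Th1 Th2 M G c /\ forall x, Th2 x <= 2 * supnorm x.
    case: cond => -[hl hm].
      have nb : false -> (mA < +oo)%E by [].
      have pf := profile_supdiff d0 topA iidA tphi hl hm nb.
      do 5 eexists; split; first exact: pf.
      by move=> x /=; rewrite mul0r mulr_ge0.
    do 5 eexists; split; first exact: profile_norm d0 topA iidA tphi hl hm.
    exact: os.
  have [C C0 rate] := moment_rate d0 topA iidA tphi cltA sigma0 mlA l3 pf T2.
  exists C => // X0 gX0 n v n0.
  have T20 y : 0 <= Th2 y := le_trans (pf_ge0 pf y) (pf_le pf y).
  have := rate X0 phi phi 1 0 gX0 mphi ephi; rewrite addr0 mulr1; apply => // y.
    by rewrite subrr normr0 mul1r addr_ge0.
  by rewrite subrr normr0 mul0r.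
have [C2 C20 rate2] : exists2 C : R, 0 <= C & (mA < +oo)%E ->
    forall X0, good_init P A l X0 -> forall n v c, (0 < n)%N ->
    `|fine (P [set w | orthant d0 c (prodop A n w (X0 w)) <= v + n%:R * gamma]) -
      Phi (v / (sigma * Num.sqrt n%:R))| <=
    C * (1 + fine (moment P (fun w => supnorm (X0 w)) l)) / Num.sqrt n%:R.
  have [mAf|] := ltP mA +oo%E; last by move=> h; exists 0.
  have [Th1 [M [G [c [pf]]]]] : exists Th1 M G c,
      profile P A phi Th1 (osc d0) M G c /\ true.
    case: cond => -[hl hm].
      have pf := profile_supdiff d0 topA iidA tphi hl hm (fun _ : true => mAf).
      have E : (fun x : 'rV[R]_d => true%:R * osc d0 x) = osc d0 by apply/funext => x; rewrite mul1r.
      by rewrite E in pf; do 4 eexists; split; first exact: pf.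
    by do 4 eexists; split; first exact: profile_norm d0 topA iidA tphi hl hm.
  move=> _; have [C C0 rate] := moment_rate d0 topA iidA tphi cltA sigma0 mlA l3 pf os.
  have a0 := normr_ge0 (phi 0).
  exists (C * ((1 + `|phi 0|) + (1 + `|phi 0|))) => [|_ X0 gX0 n v c1 n0].
    by rewrite mulr_ge0// !addr_ge0.
  have to := topical_orthant d0 c1.
  rewrite -[v + n%:R * gamma]addr0.
  apply: (rate X0 (orthant d0 c1) (fun=> 0) (1 + `|phi 0|) (1 + `|phi 0|) gX0) => //.
  - exact: measurable_topical_fun.
  - by move=> x a; exact: (proj2 to).
  - move=> y; apply: (le_trans (orthant_close d0 c1 y tphi)).
    have := mulr_ge0 a0 (osc_ge0 d0 y); lra.
  - by rewrite lerDl.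
  - move=> y; rewrite sub0r normrN; apply: (le_trans (topical_fun_supnorm y tphi)).
    have := mulr_ge0 a0 (s0 y); lra.
have C0 : 0 < C1 + C2 + 1 by rewrite ltr_wpDl// addr_ge0.
exists (C1 + C2 + 1); split; first exact: ltW.
move=> X0 gX0 n n0; have [mX0 [_ fX0]] := gX0.
have {}mX0 : measurable_fun [set: T] (X0 : T -> @mvec R d) by exact: measurable_to_mvec.
have mXn := measurable_prodop_X0 topA iidA mX0 n.
set mX := moment P (fun w => supnorm (X0 w)) l in fX0 *.
have mXE : mX = (fine mX)%:E by rewrite fineK// ge0_fin_numE//; exact: m0.
have fX : 0 <= fine mX by apply: fine_ge0; exact: m0.
have sn : 0 < Num.sqrt n%:R :> R by rewrite sqrtr_gt0 ltr0n.
have ss : sigma * Num.sqrt n%:R != 0 by rewrite mulf_neq0 ?gt_eqF.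
split=> u.
  set E := [set w | _].
  have EE : E = [set w | phi (prodop A n w (X0 w)) <=
      sigma * u * Num.sqrt n%:R + n%:R * gamma + phi (X0 w)].
    by apply/seteqP; split=> w; rewrite /E/=; lra.
  have mE : measurable E.
    apply: measurable_le_set; apply: measurable_funB; last exact: (measurableT_comp mphi mX0).
    by apply: measurable_funB => //; exact: (measurableT_comp mphi mXn).
  rewrite (Ex_finP _ mE) normalE mXE -!EFinD -!EFinM/= lee_fin.
  have := rate1 X0 gX0 n (sigma * u * Num.sqrt n%:R) n0; rewrite -EE.
  rewrite (_ : _ / _ = u); last by field; rewrite !gt_eqF.
  move=> h; apply: (le_trans h); rewrite ler_wpM2r ?invr_ge0 ?(ltW sn)//.
  by rewrite ler_wpM2r ?addr_ge0//; lra.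
set c := (sigma * Num.sqrt n%:R) *: u; set E := [set w | _].
(* The minimum of the coordinates of [u] enters through the level of the orthant function: the
   orthant is its sublevel set at [n * gamma - maxv (- c)]. *)
have cE : maxv d0 (- c) = - (sigma * Num.sqrt n%:R * vmin u).
  by rewrite (vmin_maxv d0) /c -scalerN maxv_scale ?mulr_gt0// mulrN opprK.
have EE : E = [set w | orthant d0 c (prodop A n w (X0 w)) <=
    sigma * Num.sqrt n%:R * vmin u + n%:R * gamma].
  have cu i : c ord0 i = sigma * u ord0 i * Num.sqrt n%:R by rewrite mxE mulrAC.
  have se : sigma * Num.sqrt n%:R * vmin u + n%:R * gamma = n%:R * gamma - maxv d0 (- c).
    by rewrite cE opprK addrC.
  apply/seteqP; split=> w; rewrite /E/= se.
    by move=> h; apply/orthant_le => i; rewrite cu.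
  by move=> /orthant_le h i; rewrite -cu.
have mE : measurable E.
  rewrite EE; apply: measurable_le_set.
  exact: (measurableT_comp (measurable_topical_fun d0 (topical_orthant d0 c)) mXn).
have pn : 0 < n%:R `^ (l / (2 * (l + 1))) :> R by rewrite powR_gt0// ltr0n.
(* If this moment is infinite, so is the right-hand side; the summand [1] in the constant makes it
   strictly positive for this purpose. *)
have [mAf|] := ltP mA +oo%E; last first.
  rewrite leye_eq => /eqP mAoo; rewrite -/mA mAoo mXE -EFinD addey// gt0_muley ?lte_fin//.
  by rewrite gt0_mulye ?lte_fin ?invr_gt0// leey.
have mAE : mA = (fine mA)%:E by rewrite fineK// ge0_fin_numE//; exact: m0.
have fA : 0 <= fine mA by apply: fine_ge0; exact: m0.
rewrite -/mA (Ex_finP _ mE) normalE mXE mAE -!EFinD -!EFinM/= lee_fin.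
have := rate2 mAf X0 gX0 n (sigma * Num.sqrt n%:R * vmin u) c n0; rewrite -EE.
rewrite [_ * vmin u]mulrC mulfK// => h; apply: (le_trans h).
have C12 : C2 <= C1 + C2 + 1 by rewrite -addrA addrCA lerDl addr_ge0.
have pq : (Num.sqrt n%:R)^-1 <= (n%:R `^ (l / (2 * (l + 1))))^-1.
  by rewrite lef_pV2 ?posrE// -powR12_sqrt//; apply: ler_powR; rewrite ?ler1n.
have x0 : 0 <= 1 + fine mX := addr_ge0 ler01 fX.
have sn' : 0 <= (Num.sqrt n%:R)^-1 :> R by rewrite invr_ge0 ltW.
have xa : 1 + fine mX <= 1 + fine mX + fine mA by rewrite lerDl.
exact: ler_pM (mulr_ge0 C20 x0) sn' (ler_pM C20 x0 C12 xa) pq.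
Qed.
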